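(* In the setting and with the notation of the context, let $u\in V$ be the solution of $B(u,v)=F(v)$ for all $v\in V$, and let $u_{X\mathfrak{P}}\in V_{X\mathfrak{P}}$ and $\widehat u_{X\mathfrak{P}}\in\widehat V_{X\mathfrak{P}}$ be the Galerkin approximations satisfying $$B(u_{X\mathfrak{P}},v)=F(v)\ \ \text{for all } v\in V_{X\mathfrak{P}},\qquad B(\widehat u_{X\mathfrak{P}},\widehat v)=F(\widehat v)\ \ \text{for all } \widehat v\in\widehat V_{X\mathfrak{P}}.$$ Then there exists a constant $C_{\rm thm}\ge 1$, which depends only on the shape regularity of $\mathcal{T}$ and $\widehat{\mathcal{T}}$, the (local) mesh-refinement rule, and the mean field $a_0$, such that the error estimate $\mu_{X\mathfrak{P}}$ satisfies $$\frac{\lambda}{K}\,\mu_{X\mathfrak{P}}^2\le \|\widehat u_{X\mathfrak{P}}-u_{X\mathfrak{P}}\|_B^2\le \Lambda\, C_{\rm thm}\,\mu_{X\mathfrak{P}}^2 .$$ Furthermore, if the saturation assumption $$\|u-\widehat u_{X\mathfrak{P}}\|_B\le\beta\,\|u-u_{X\mathfrak{P}}\|_B$$ holds with a constant $\beta\in[0,1)$, then (with the same $C_{\rm thm}$) $$\frac{\lambda}{K}\,\mu_{X\mathfrak{P}}^2\le \|u-u_{X\mathfrak{P}}\|_B^2\le \frac{\Lambda\, C_{\rm thm}}{1-\beta^2}\,\mu_{X\mathfrak{P}}^2 .$$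
   Context: **Parametric problem.** $D\subset\mathbb{R}^2$ is a bounded Lipschitz domain with polygonal boundary. $\Gamma=\prod_{m=1}^\infty\Gamma_m$ with $\Gamma_m=[-1,1]$; $\pi=\prod_{m=1}^\infty\pi_m$ is the product of symmetric Borel probability measures $\pi_m$ on $\Gamma_m$. $a_m\in L^\infty(D)$ for $m\in\mathbb{N}_0$; there are constants $0<a_0^{\min}\le a_0(x)\le a_0^{\max}<\infty$ for a.e. $x\in D$, and $\tau:=\frac{1}{a_0^{\min}}\sum_{m=1}^\infty\|a_m\|_{L^\infty(D)}<1$. The function $a_0$ is called the mean field. $V:=L^2_\pi(\Gamma;H^1_0(D))$ (Bochner space). For $v,w\in V$, $$B_0(v,w):=\int_\Gamma\int_D a_0(x)\nabla v(x,\mathbf{y})\cdot\nabla w(x,\mathbf{y})\,dx\,d\pi(\mathbf{y}),$$ $$B(v,w):=B_0(v,w)+\sum_{m=1}^\infty\int_\Gamma\int_D y_m a_m(x)\nabla v(x,\mathbf{y})\cdot\nabla w(x,\mathbf{y})\,dx\,d\pi(\mathbf{y}),$$ where $\nabla$ acts in $x$. Both are symmetric, continuous, elliptic bilinear forms on $V$; write $\|v\|_B:=B(v,v)^{1/2}$, $\|v\|_0:=B_0(v,v)^{1/2}$. With $\lambda:=\frac{a_0^{\min}}{a_0^{\max}(1+\tau)}$ and $\Lambda:=\frac{a_0^{\max}}{a_0^{\min}(1-\tau)}$ one has $\lambda\|v\|_B^2\le\|v\|_0^2\le\Lambda\|v\|_B^2$ for all $v\in V$. For $f\in H^{-1}(D)$,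 $F(v):=\int_\Gamma\int_D f(x)v(x,\mathbf{y})\,dx\,d\pi(\mathbf{y})$ (duality pairing in $x$). **Parametric polynomials.** For each $m$, $(P_n^m)_{n\in\mathbb{N}_0}$ are the polynomials ($\deg P_n^m=n$, $P_0^m\equiv1$, positive leading coefficients) orthonormal in $L^2_{\pi_m}(\Gamma_m)$ (each $\pi_m$ is assumed not to be supported on finitely many points, so that this sequence exists). $\mathfrak{I}:=\{\nu\in\mathbb{N}_0^{\mathbb{N}}:\#\operatorname{supp}(\nu)<\infty\}$ with $\operatorname{supp}(\nu)=\{m:\nu_m\ne0\}$; $P_\nu(\mathbf{y}):=\prod_{m\in\operatorname{supp}(\nu)}P^m_{\nu_m}(y_m)$. The family $(P_\nu)_{\nu\in\mathfrak{I}}$ is an orthonormal basis of $L^2_\pi(\Gamma)$. **Discrete spaces.** $\mathcal{T}$ is a conforming triangulation of $D$ into compact triangles, $\mathcal{N}_{\mathcal{T}}$ its set of interior vertices, and $X:=\mathcal{S}^1_0(\mathcal{T}):=\{v\in H^1_0(D): v|_T\text{ is affine for all }T\in\mathcal{T}\}$. $\widehat{\mathcal{T}}$ is a conforming triangulation obtained by a uniform refinement of $\mathcal{T}$, $\mathcal{N}_{\widehat{\mathcal{T}}}$ its set of interior vertices, $\widehat X:=\mathcal{S}^1_0(\widehat{\mathcal{T}})=X\oplus Y$ with $Y:=\{v\in\widehat X: v(\xi)=0\ \forall\xi\in\mathcal{N}_{\mathcal{T}}\}$. Write $\mathcal{N}_{\widehat{\mathcal{T}}}\setminus\mathcal{N}_{\mathcal{T}}=\{\xi_1,\dots,\xi_n\}$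 and let $\varphi_j\in\widehat X$ be the hat function with $\varphi_j(\xi_j)=1$ and $\varphi_j(\xi)=0$ for all $\xi\in\mathcal{N}_{\widehat{\mathcal{T}}}\setminus\{\xi_j\}$; $\{\varphi_1,\dots,\varphi_n\}$ is a basis of $Y$. $K\ge1$ is a constant such that $\#\{j:\operatorname{interior}(\operatorname{supp}(\varphi_j)\cap T)\ne\emptyset\}\le K$ for all $T\in\mathcal{T}$. $\mathfrak{P}\subset\mathfrak{I}$ is a finite index set containing the zero index $\mathbf{0}$. Let $M_{\mathfrak{P}}:=0$ if $\mathfrak{P}=\{\mathbf{0}\}$ and $M_{\mathfrak{P}}:=\max\{\max(\operatorname{supp}(\nu)):\nu\in\mathfrak{P}\setminus\{\mathbf{0}\}\}$ otherwise. With a fixed $\overline M\in\mathbb{N}$ and the Kronecker index $\varepsilon^{(m)}=(\delta_{mk})_{k\in\mathbb{N}}$, the detail index set is $$\mathfrak{Q}:=\{\mu\in\mathfrak{I}\setminus\mathfrak{P}:\mu=\nu\pm\varepsilon^{(m)}\text{ for some }\nu\in\mathfrak{P}\text{ and some }m=1,\dots,M_{\mathfrak{P}}+\overline M\}.$$ For a finite-dimensional space $Z\subset H^1_0(D)$ and an index set $\mathfrak{R}$, identify $Z\otimes\operatorname{span}\{P_\nu:\nu\in\mathfrak{R}\}$ with a subspace of $V$. Set $V_{X\mathfrak{P}}:=X\otimes\operatorname{span}\{P_\nu:\nu\in\mathfrak{P}\}$, $V_{Y\mathfrak{P}}:=Y\otimes\operatorname{span}\{P_\nu:\nu\in\mathfrak{P}\}$,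 $V_{X\mathfrak{Q}}:=X\otimes\operatorname{span}\{P_\nu:\nu\in\mathfrak{Q}\}$, and $\widehat V_{X\mathfrak{P}}:=V_{X\mathfrak{P}}\oplus V_{Y\mathfrak{P}}\oplus V_{X\mathfrak{Q}}$. **Error estimate.** For each $\nu\in\mathfrak{Q}$, $e^{(\nu)}_{X\mathfrak{Q}}\in X\otimes\operatorname{span}\{P_\nu\}$ is the unique solution of $B_0(e^{(\nu)}_{X\mathfrak{Q}},v_XP_\nu)=F(v_XP_\nu)-B(u_{X\mathfrak{P}},v_XP_\nu)$ for all $v_X\in X$. The estimate $\mu_{X\mathfrak{P}}\ge0$ is defined by $$\mu_{X\mathfrak{P}}^2:=\sum_{\nu\in\mathfrak{P}}\sum_{j=1}^n\frac{|F(\varphi_jP_\nu)-B(u_{X\mathfrak{P}},\varphi_jP_\nu)|^2}{\|a_0^{1/2}\nabla\varphi_j\|_{L^2(D)}^2}+\sum_{\nu\in\mathfrak{Q}}\|e^{(\nu)}_{X\mathfrak{Q}}\|_0^2 .$$ **Dependence of constants.** Shape regularity of a triangulation is measured by the maximum over its elements of the ratio of diameter to inradius. The (local) mesh-refinement rule is the fixed rule prescribing the finitely many patterns (up to affine transformation) by which an element of $\mathcal{T}$ is subdivided into elements of $\widehat{\mathcal{T}}$. ''Depends only on'' these quantities means in particular independence of the mesh size and number of elements, of $\mathfrak{P}$, $\mathfrak{Q}$, of $f$, and of the $a_m$, $m\ge1$. *)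

(* Defs.v *)
From HB Require Import structures.
From mathcomp Require Import all_boot all_order all_algebra.
From mathcomp Require Import finmap.
From mathcomp Require Import all_classical all_reals all_analysis.

Set Implicit Arguments.
Unset Strict Implicit.
Unset Printing Implicit Defensive.

Import Order.TTheory GRing.Theory Num.Theory.
Import numFieldNormedType.Exports.

Local Open Scope classical_set_scope.
Local Open Scope ring_scope.

Definition edot (R : realType) (p q : R * R) : R := p.1 * q.1 + p.2 * q.2.

(* The library norm on R * R is the max norm; lengths are Euclidean here. *)
Definition enorm (R : realType) (p : R * R) : R := Num.sqrt (edot p p).

Definition hull (R : realType) (S : {fset (R * R)}) : set (R * R) :=
  [set p | exists w : R * R -> R,
    [/\ forall x, x \in S -> 0 <= w x, \sum_(x <- S) w x = 1 &
        p = \sum_(x <- S) w x *: x]].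

Definition boundary (R : realType) (A : set (R * R)) : set (R * R) :=
  closure A `\` interior A.

(* D is locally the strict epigraph of a Lipschitz function in the orthonormal
   frame (e, e') at x; this forces gamma 0 = 0 when x lies on the boundary of
   the open set D. *)
Definition lipschitz_boundary (R : realType) (D : set (R * R)) : Prop :=
  forall x, boundary D x ->
    exists (e : R * R) (r h L : R) (gamma : R -> R),
      let e' := (- e.2, e.1) in
      [/\ enorm e = 1, 0 < r, 0 < h, L.-lipschitz gamma &
          forall s t, `|s| < r -> `|t| < h ->
            (D (x + s *: e + t *: e') <-> gamma s < t)].

Definition polygonal_boundary (R : realType) (D : set (R * R)) : Prop :=
  exists E : {fset {fset (R * R)}},
    (forall S, S \in E -> #|` S| = 2%N) /\
    boundary D = \bigcup_(S in [set` E]) hull S.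

Definition polygonal_domain (R : realType) (D : set (R * R)) : Prop :=
  [/\ open D, D !=set0, connected D, bounded_set D &
      lipschitz_boundary D /\ polygonal_boundary D].

(* A triangle is the set of its three vertices; its point set is the hull. *)
Definition is_triangle (R : realType) (T : {fset (R * R)}) : Prop :=
  #|` T| = 3%N /\ interior (hull T) !=set0.

(* Two elements meet in the hull of their common vertices: nothing, a common
   vertex, or a common edge. *)
Definition triangulation (R : realType) (A : set (R * R))
    (M : {fset {fset (R * R)}}) : Prop :=
  [/\ forall T, T \in M -> is_triangle T,
      \bigcup_(T in [set` M]) hull T = A &
      forall S T, S \in M -> T \in M ->
        hull S `&` hull T = hull (S `&` T)%fset].

Definition interior_vertices (R : realType) (D : set (R * R))
    (M : {fset {fset (R * R)}}) : set (R * R) :=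
  [set x | D x /\ exists2 T, T \in M & x \in T].

Definition diam (R : realType) (A : set (R * R)) : R :=
  sup [set r | exists p q, [/\ A p, A q & r = enorm (p - q)]].

Definition inradius (R : realType) (A : set (R * R)) : R :=
  sup [set r | 0 <= r /\ exists c, [set x | enorm (x - c) <= r] `<=` A].

Definition shape_regularity (R : realType) (M : {fset {fset (R * R)}}) : R :=
  \big[Num.max/0]_(T <- M) (diam (hull T) / inradius (hull T)).

Definition affine_map (R : realType) (c u v : R * R) (x : R * R) : R * R :=
  c + x.1 *: u + x.2 *: v.

Definition ref_triangle (R : realType) : {fset (R * R)} :=
  [fset (0, 0); (1, 0); (0, 1)]%fset.

(* A refinement rule is a finite list of patterns, each of which properly
   subdivides the reference triangle. *)
Definition refinement_rule (R : realType)
    (rule : seq {fset {fset (R * R)}}) : Prop :=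
  forall p, p \in rule ->
    triangulation (hull (ref_triangle R)) p /\ ref_triangle R \notin p.

(* Every element of M is subdivided by an affine copy of a pattern. *)
Definition uniform_refinement (R : realType)
    (rule : seq {fset {fset (R * R)}}) (M M' : {fset {fset (R * R)}}) : Prop :=
  (forall T', T' \in M' -> exists2 T, T \in M & hull T' `<=` hull T) /\
  (forall T, T \in M ->
     exists2 p, p \in rule &
     exists c u v, let G := affine_map c u v in
       T = [fset G x | x in ref_triangle R]%fset /\
       forall T', (T' \in M' /\ hull T' `<=` hull T) <->
         (exists2 t : {fset (R * R)}, t \in p & T' = [fset G x | x in t]%fset)).

(* Functions on D are represented by functions on the plane whose values off D
   are irrelevant. *)

Definition leb2 (R : realType) := (@lebesgue_measure R \x @lebesgue_measure R)%E.

Definition Linfty (R : realType) (D : set (R * R)) (a : R * R -> R) : Prop :=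
  (a \_ D : R * R -> R) \in Lfun (@leb2 R) +oo%E.

Definition Linfty_norm (R : realType) (D : set (R * R)) (a : R * R -> R)
    : \bar R :=
  'N[@leb2 R]_+oo%E[EFin \o (a \_ D)].

Definition L2 (R : realType) (D : set (R * R)) (v : R * R -> R) : Prop :=
  (v \_ D : R * R -> R) \in Lfun (@leb2 R) 2%:E.

Definition L2norm (R : realType) (D : set (R * R)) (g : R * R -> R * R) : R :=
  Num.sqrt (\int[@leb2 R]_(x in D) edot (g x) (g x)).

Definition partial1 (R : realType) (phi : R * R -> R) (x : R * R) : R :=
  'D_((1, 0) : R * R) phi x.
Definition partial2 (R : realType) (phi : R * R -> R) (x : R * R) : R :=
  'D_((0, 1) : R * R) phi x.

Fixpoint Ck (R : realType) (k : nat) (phi : R * R -> R) : Prop :=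
  match k with
  | 0 => continuous phi
  | k'.+1 => [/\ forall x, derivable phi x ((1, 0) : R * R),
                 forall x, derivable phi x ((0, 1) : R * R),
                 Ck k' (partial1 phi) & Ck k' (partial2 phi)]
  end.

Definition test_function (R : realType) (D : set (R * R)) (phi : R * R -> R)
    : Prop :=
  (forall k, Ck k phi) /\
  exists K : set (R * R), [/\ compact K, K `<=` D & forall x, ~ K x -> phi x = 0].

Definition weak_gradient (R : realType) (D : set (R * R)) (v : R * R -> R)
    (g : R * R -> R * R) : Prop :=
  [/\ L2 D (fun x => (g x).1), L2 D (fun x => (g x).2) &
      forall phi, test_function D phi ->
        \int[@leb2 R]_(x in D) (v x * partial1 phi x) =
          - (\int[@leb2 R]_(x in D) ((g x).1 * phi x)) /\
        \int[@leb2 R]_(x in D) (v x * partial2 phi x) =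
          - (\int[@leb2 R]_(x in D) ((g x).2 * phi x))].

Definition H1 (R : realType) (D : set (R * R)) (v : R * R -> R) : Prop :=
  L2 D v /\ exists g, weak_gradient D v g.

(* A representative of the weak gradient, unique up to a null set on H1 D. *)
Definition grad (R : realType) (D : set (R * R)) (v : R * R -> R)
    : R * R -> R * R :=
  xget (fun=> 0) [set g | weak_gradient D v g].

Definition H1norm (R : realType) (D : set (R * R)) (v : R * R -> R) : R :=
  Num.sqrt (\int[@leb2 R]_(x in D) (v x ^+ 2 + edot (grad D v x) (grad D v x))).

Definition H10 (R : realType) (D : set (R * R)) (v : R * R -> R) : Prop :=
  H1 D v /\
  forall eps : R, 0 < eps ->
    exists2 phi, test_function D phi & H1norm D (v \- phi) < eps.

(* Elements of H^{-1}(D), as functionals on representatives. *)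
Definition Hm1 (R : realType) (D : set (R * R)) (f : (R * R -> R) -> R) : Prop :=
  (forall (c : R) v w, H10 D v -> H10 D w ->
     f (fun x => c * v x + w x) = c * f v + f w) /\
  (exists C : R, forall v, H10 D v -> `|f v| <= C * H1norm D v).

Definition S10 (R : realType) (D : set (R * R)) (M : {fset {fset (R * R)}})
    : set (R * R -> R) :=
  [set v | H10 D v /\
    forall T, T \in M -> exists (c : R) (b : R * R),
      forall x, hull T x -> v x = c + edot b x].

(* The space Y of the splitting S10 D M' = S10 D M (+) Y. *)
Definition detail_space (R : realType) (D : set (R * R))
    (M M' : {fset {fset (R * R)}}) : set (R * R -> R) :=
  [set v | S10 D M' v /\ forall x, interior_vertices D M x -> v x = 0].

Definition hat_functions (R : realType) (D : set (R * R))
    (M M' : {fset {fset (R * R)}}) (n : nat) (xi : 'I_n -> R * R)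
    (phi : 'I_n -> R * R -> R) : Prop :=
  [/\ injective xi,
      range xi = interior_vertices D M' `\` interior_vertices D M,
      forall j, S10 D M' (phi j) &
      forall j, phi j (xi j) = 1 /\
        forall x, interior_vertices D M' x -> x <> xi j -> phi j x = 0].

Definition fsupp (R : realType) (D : set (R * R)) (v : R * R -> R)
    : set (R * R) := closure [set x | D x /\ v x <> 0].

Definition overlap_bound (R : realType) (D : set (R * R))
    (M : {fset {fset (R * R)}}) (n : nat) (phi : 'I_n -> R * R -> R) (K : R)
    : Prop :=
  forall T, T \in M ->
    #|[set j : 'I_n | `[< interior (fsupp D (phi j) `&` hull T) !=set0 >]]%SET|%:R
      <= K.

(* Coordinates are numbered from 0: y m stands for y_{m+1}, and likewise for
   the coefficients a m, the measures pi_ m and the polynomials P m. *)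

Definition cylinders (R : realType) : set (set (nat -> R)) :=
  [set A | exists (m : nat) (B : set (measurableTypeR R)),
    measurable B /\ A = [set y | B (y m)]].

(* The sequence space with its product sigma-algebra; Gamma is a subset. *)
Definition param (R : realType) := g_sigma_algebraType (@cylinders R).

Definition Gamma (R : realType) : set (param R) :=
  [set y | forall m : nat, -1 <= y m <= 1].

Definition product_measure (R : realType)
    (pi_ : nat -> probability (measurableTypeR R) R)
    (pi : probability (param R) R) : Prop :=
  forall (n : nat) (A : nat -> set R),
    (forall m, measurable (A m : set (measurableTypeR R))) ->
    pi [set y | forall m, (m < n)%N -> A m (y m)] =
      (\prod_(m < n) pi_ m (A m))%E.

Definition admissible_marginal (R : realType)
    (mu : probability (measurableTypeR R) R) : Prop :=
  [/\ mu `[-1, 1]%classic = 1%E,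
      forall A : set (measurableTypeR R), measurable A ->
        mu [set x | A (- x)] = mu A &
      forall S : set (measurableTypeR R), finite_set S -> mu S <> 1%E].

(* V = L^2_pi(Gamma; H10 D): strongly measurable, i.e. pointwise limits of
   simple functions in the norm of H10 D, and square integrable.  Every class of
   the Bochner space has such a representative. *)

Definition simple_H10 (R : realType) (D : set (R * R))
    (s : param R -> R * R -> R) : Prop :=
  exists (n : nat) (A : 'I_n -> set (param R)) (h : 'I_n -> R * R -> R),
    [/\ forall i, measurable (A i), forall i, H10 D (h i) &
        forall y x, s y x = \sum_(i < n) \1_(A i) y * h i x].

Definition strongly_measurable (R : realType) (D : set (R * R))
    (v : param R -> R * R -> R) : Prop :=
  exists s : nat -> param R -> R * R -> R,
    (forall k, simple_H10 D (s k)) /\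
    forall y, Gamma y -> (fun k => H1norm D (v y \- s k y)) @ \oo --> (0 : R).

Definition V (R : realType) (D : set (R * R)) (pi : probability (param R) R)
    : set (param R -> R * R -> R) :=
  [set v | [/\ forall y, Gamma y -> H10 D (v y), strongly_measurable D v &
     (\int[pi]_(y in @Gamma R) (H1norm D (v y) ^+ 2)%:E < +oo)%E]].

Definition B0 (R : realType) (D : set (R * R)) (pi : probability (param R) R)
    (a0 : R * R -> R) (v w : param R -> R * R -> R) : R :=
  \int[pi]_(y in @Gamma R)
    \int[@leb2 R]_(x in D) (a0 x * edot (grad D (v y) x) (grad D (w y) x)).

Definition B (R : realType) (D : set (R * R)) (pi : probability (param R) R)
    (a0 : R * R -> R) (a : nat -> R * R -> R) (v w : param R -> R * R -> R) : R :=
  B0 D pi a0 v w +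
  limn (series (fun m : nat =>
    \int[pi]_(y in @Gamma R)
      \int[@leb2 R]_(x in D)
        (y m * a m x * edot (grad D (v y) x) (grad D (w y) x)))).

Definition norm0 (R : realType) (D : set (R * R)) (pi : probability (param R) R)
    (a0 : R * R -> R) (v : param R -> R * R -> R) : R :=
  Num.sqrt (B0 D pi a0 v v).

Definition normB (R : realType) (D : set (R * R)) (pi : probability (param R) R)
    (a0 : R * R -> R) (a : nat -> R * R -> R) (v : param R -> R * R -> R) : R :=
  Num.sqrt (B D pi a0 a v v).

Definition F (R : realType) (pi : probability (param R) R)
    (f : (R * R -> R) -> R) (v : param R -> R * R -> R) : R :=
  \int[pi]_(y in @Gamma R) f (v y).

Definition orthonormal_polynomials (R : realType)
    (mu : probability (measurableTypeR R) R) (p : nat -> {poly R}) : Prop :=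
  [/\ forall n, size (p n) = n.+1, p 0%N = 1, forall n, 0 < lead_coef (p n) &
      forall n k, \int[mu]_(t in `[-1, 1]) ((p n).[t] * (p k).[t]) = (n == k)%:R].

Definition midx := {fsfun nat -> nat with 0%N}.

Definition midx0 : midx := [fsfun].

Definition Ppoly (R : realType) (P : nat -> nat -> {poly R}) (nu : midx)
    (y : param R) : R :=
  \prod_(m <- finsupp nu) (P m (nu m)).[y m].

Definition elem_tensor (R : realType) (P : nat -> nat -> {poly R})
    (z : R * R -> R) (nu : midx) : param R -> R * R -> R :=
  fun y x => z x * Ppoly P nu y.

(* The subspace Z (x) span {P_nu : nu \in I} of V; elements of V are equal when
   they agree almost everywhere. *)
Definition tensor (R : realType) (D : set (R * R))
    (pi : probability (param R) R) (P : nat -> nat -> {poly R})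
    (Z : set (R * R -> R)) (I : {fset midx}) : set (param R -> R * R -> R) :=
  [set v | V D pi v /\
    exists z : midx -> R * R -> R, (forall nu, nu \in I -> Z (z nu)) /\
      {ae pi, forall y, Gamma y -> {ae @leb2 R, forall x, D x ->
        v y x = \sum_(nu <- I) elem_tensor P (z nu) nu y x}}].

(* The largest active coordinate, in the numbering from 1. *)
Definition maxactive (I : {fset midx}) : nat :=
  (\max_(nu <- I) \max_(m <- finsupp nu) m.+1)%N.

Definition kronecker (m k : nat) : int := (k == m)%:Z.

Definition detail_indices (I : {fset midx}) (Mbar : nat) : {fset midx} :=
  fset_set [set mu : midx | mu \notin I /\
    exists nu m, [/\ nu \in I, (m < maxactive I + Mbar)%N &
      (forall k, (mu k)%:Z = (nu k)%:Z + kronecker m k) \/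
      (forall k, (mu k)%:Z = (nu k)%:Z - kronecker m k)]].

Definition enriched_space (R : realType) (D : set (R * R))
    (pi : probability (param R) R) (P : nat -> nat -> {poly R})
    (M M' : {fset {fset (R * R)}}) (I J : {fset midx})
    : set (param R -> R * R -> R) :=
  [set v | exists v1 v2 v3,
    [/\ tensor D pi P (S10 D M) I v1, tensor D pi P (detail_space D M M') I v2,
        tensor D pi P (S10 D M) J v3 &
        v = (fun y x => v1 y x + v2 y x + v3 y x)]].

Definition galerkin (R : realType) (D : set (R * R))
    (pi : probability (param R) R) (a0 : R * R -> R) (a : nat -> R * R -> R)
    (f : (R * R -> R) -> R) (W : set (param R -> R * R -> R))
    (u : param R -> R * R -> R) : Prop :=
  W u /\ forall v, W v -> B D pi a0 a u v = F pi f v.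

Definition index_estimators (R : realType) (D : set (R * R))
    (pi : probability (param R) R) (a0 : R * R -> R) (a : nat -> R * R -> R)
    (f : (R * R -> R) -> R) (P : nat -> nat -> {poly R})
    (X : set (R * R -> R)) (J : {fset midx})
    (uXP : param R -> R * R -> R) (e : midx -> param R -> R * R -> R) : Prop :=
  forall nu, nu \in J ->
    tensor D pi P X [fset nu]%fset (e nu) /\
    forall z, X z ->
      B0 D pi a0 (e nu) (elem_tensor P z nu) =
      F pi f (elem_tensor P z nu) - B D pi a0 a uXP (elem_tensor P z nu).

Definition error_estimate (R : realType) (D : set (R * R))
    (pi : probability (param R) R) (a0 : R * R -> R) (a : nat -> R * R -> R)
    (f : (R * R -> R) -> R) (P : nat -> nat -> {poly R}) (I J : {fset midx})
    (n : nat) (phi : 'I_n -> R * R -> R)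
    (uXP : param R -> R * R -> R) (e : midx -> param R -> R * R -> R) : R :=
  Num.sqrt
    (\sum_(nu <- I) \sum_(j < n)
        `|F pi f (elem_tensor P (phi j) nu)
          - B D pi a0 a uXP (elem_tensor P (phi j) nu)| ^+ 2
        / L2norm D (fun x => Num.sqrt (a0 x) *: grad D (phi j) x) ^+ 2
     + \sum_(nu <- J) norm0 D pi a0 (e nu) ^+ 2).

(* Main.v *)
Require Import Defs.
From mathcomp Require Import all_boot all_order all_algebra.
From mathcomp Require Import finmap.
From mathcomp Require Import all_classical all_reals all_analysis.
From mathcomp Require Import measurable_realfun ess_sup_inf.
From mathcomp Require Import ring lra.

Import Order.TTheory GRing.Theory Num.Theory.
Import numFieldNormedType.Exports.

Set Implicit Arguments.
Unset Strict Implicit.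
Unset Printing Implicit Defensive.

Local Open Scope classical_set_scope.
Local Open Scope ring_scope.

(** Write [r v = F v - B uXP v] for the residual and [d = uhat - uXP]. The
    Galerkin equations give [B d v = r v] on the enriched space, while [r] is
    zero on the coarse space and [r (z (x) P_nu) = B0 (e nu) (z (x) P_nu)] for
    [nu] in the detail index set. Since the series of [B] is a perturbation of
    relative size [tau] of [B0] ([B_bounds]), the forms [B] and [B0] are
    equivalent, and it remains to compare [mu ^+ 2] with the energy of [d]. For
    [B0] the functions [z (x) P_nu] with different [nu] are orthogonal
    ([vform_ptensor_sum]), because the coordinates are independent and the
    polynomials are orthonormal ([Ppoly_orthonormal]); so everything reduces to
    the domain [D], one multi-index at a time.

    Lower bound ([estimate_le]). The combination [w] of the hat functions with
    the coefficients [r (phi_j P_nu) / |phi_j|^2], plus the sum of the [e nu],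
    satisfies [B d w = r w = mu ^+ 2]. Its energy is at most [K * mu ^+ 2], since
    at most [K] hat functions are active on an element ([overlap_energy]), and
    the Cauchy-Schwarz inequality gives the claim.

    Upper bound ([error_le]). The component of [d] at a multi-index of the coarse
    set is [x + y] with [x] coarse and [y = \sum_j y (xi_j) phi_j] a detail
    ([detail_expansion]). Only [y] contributes to [B d d = r d], and with the
    weights [|phi_j|] the sum is controlled by [mu] times the square root of
    [\sum_j y (xi_j)^2 |phi_j|^2]. This last sum is at most a constant times the
    energy of [x + y] ([detail_estimate]): on a coarse element, [y (xi_j)] is the
    interpolation error of [x + y] and hence at most the diameter times the
    largest slope of [x + y] on the pieces of the element, while the slope of a
    hat function is at most the inverse of the width of a piece. Shape regularity
    compares diameters, widths and areas, and the refinement rule, having finitely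
    many patterns, bounds the number of pieces and the ratio of their sizes
    ([refinement_constants]). The bounds on the mean field used in this constant
    are those of [a0] itself ([detail_constant]).

    The interpolation argument also needs the values at boundary vertices, and
    these are zero: a finite element function that belongs to [H10] vanishes
    pointwise on the boundary ([trace_zero]). This is where the Lipschitz boundary
    enters, through a cone inside the domain and the opposite cone outside of it
    ([boundary_cone]). The gradient in the energy is the weak one; it is the slope
    of the affine piece almost everywhere ([S10_pieces]), by the uniqueness of weak
    gradients, which rests on the fundamental lemma of the calculus of variations
    ([fundamental_lemma]).

    Under the saturation assumption, the orthogonality of [u - uhat] to [d] gives
    [|u - uXP|^2 = |u - uhat|^2 + |d|^2] ([galerkin_pythagoras]), so that [|d|^2]
    lies between [1 - beta ^+ 2] times [|u - uXP|^2] and [|u - uXP|^2]. *)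

(** * Symmetric bilinear forms on subspaces *)

Definition subspace (R : realType) (U : lmodType R) (S : set U) : Prop :=
  S 0 /\ forall (c : R) u v, S u -> S v -> S (c *: u + v).

Definition linear_on (R : realType) (U : lmodType R) (S : set U) (f : U -> R)
    : Prop :=
  forall (c : R) u v, S u -> S v -> f (c *: u + v) = c * f u + f v.

Definition sym_bilinear_on (R : realType) (U : lmodType R) (S : set U)
    (q : U -> U -> R) : Prop :=
  (forall u v, S u -> S v -> q u v = q v u) /\
  (forall u, S u -> linear_on S (q u)).

Definition psd_on (R : realType) (U : lmodType R) (S : set U)
    (q : U -> U -> R) : Prop := forall u, S u -> 0 <= q u u.

Section Forms.
Context (R : realType) (U : lmodType R) (S : set U).
Hypothesis hS : subspace S.

Lemma subspace0 : S 0. Proof. exact: hS.1. Qed.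

Lemma subspaceZ (c : R) u : S u -> S (c *: u).
Proof. by move=> Su; rewrite -[c *: u]addr0; apply: hS.2 => //; exact: hS.1. Qed.

Lemma subspaceD u v : S u -> S v -> S (u + v).
Proof. by move=> Su Sv; rewrite -[u]scale1r; apply: hS.2. Qed.

Lemma subspaceN u : S u -> S (- u).
Proof. by move=> Su; rewrite -scaleN1r; apply: subspaceZ. Qed.

Lemma subspaceB u v : S u -> S v -> S (u - v).
Proof. by move=> Su Sv; apply: subspaceD => //; apply: subspaceN. Qed.

Lemma subspace_sum (I : eqType) (r : seq I) (c : I -> R) (u : I -> U) :
  (forall i, i \in r -> S (u i)) -> S (\sum_(i <- r) c i *: u i).
Proof.
move=> h; rewrite big_seq; elim/big_ind: _ => [||i ir].
- exact: subspace0.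
- exact: subspaceD.
- exact/subspaceZ/h.
Qed.

Context (f : U -> R).
Hypothesis hf : linear_on S f.

Lemma linear_on0 : f 0 = 0.
Proof.
have := hf 1 hS.1 hS.1; rewrite scaler0 addr0 mul1r => /eqP.
by rewrite -subr_eq subrr => /eqP.
Qed.

Lemma linear_onZ (c : R) u : S u -> f (c *: u) = c * f u.
Proof.
by move=> Su; rewrite -[c *: u]addr0 hf ?linear_on0 ?addr0 //; exact: hS.1.
Qed.

Lemma linear_onD u v : S u -> S v -> f (u + v) = f u + f v.
Proof. by move=> Su Sv; rewrite -[u in LHS]scale1r hf // mul1r. Qed.

Lemma linear_onB u v : S u -> S v -> f (u - v) = f u - f v.
Proof.
move=> Su Sv; rewrite linear_onD //; last exact: subspaceN.
by rewrite -scaleN1r linear_onZ // mulN1r.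
Qed.

Lemma linear_on_sum (I : eqType) (r : seq I) (c : I -> R) (u : I -> U) :
  (forall i, i \in r -> S (u i)) ->
  f (\sum_(i <- r) c i *: u i) = \sum_(i <- r) c i * f (u i).
Proof.
elim: r => [|i r IH] h; first by rewrite !big_nil linear_on0.
rewrite !big_cons hf; last 2 first.
- by apply: h; rewrite mem_head.
- by apply: subspace_sum => j jr; apply: h; rewrite in_cons jr orbT.
by rewrite IH // => j jr; apply: h; rewrite in_cons jr orbT.
Qed.
End Forms.

Section PSD.
Context (R : realType) (U : lmodType R) (S : set U).
Hypothesis hS : subspace S.
Context (q : U -> U -> R).
Hypothesis hq : sym_bilinear_on S q.

Lemma form_sqD u v : S u -> S v -> q (u + v) (u + v) = q u u + 2 * q u v + q v v.
Proof.
move=> Su Sv; have Suv := subspaceD hS Su Sv.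
rewrite (linear_onD (hq.2 _ Suv)) // (hq.1 _ _ Suv Su) (hq.1 _ _ Suv Sv).
rewrite !(linear_onD (hq.2 _ _)) // (hq.1 _ _ Sv Su); ring.
Qed.

Lemma form_sqZ (c : R) u : S u -> q (c *: u) (c *: u) = c ^+ 2 * q u u.
Proof.
move=> Su; have Scu := subspaceZ hS c Su.
rewrite (linear_onZ hS (hq.2 _ Scu)) // (hq.1 _ _ Scu Su).
rewrite (linear_onZ hS (hq.2 _ Su)) //; ring.
Qed.

Hypothesis q0 : psd_on S q.

(** The discriminant of the nonnegative quadratic t |-> q (t u + v) (t u + v)
    cannot be positive; if [q v v = 0], the quadratic in the other variable
    forces [q u v = 0] already. *)
Lemma form_cauchy_schwarz u v : S u -> S v -> q u v ^+ 2 <= q u u * q v v.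
Proof.
move=> Su Sv.
have H c d : 0 <= c ^+ 2 * q u u + 2 * (c * d * q u v) + d ^+ 2 * q v v.
  have Sc := subspaceZ hS c Su; have Sd := subspaceZ hS d Sv.
  have := q0 (subspaceD hS Sc Sd); rewrite form_sqD // !form_sqZ //.
  rewrite (linear_onZ hS (hq.2 _ Sc)) // (hq.1 _ _ Sc Sv).
  rewrite (linear_onZ hS (hq.2 _ Sv)) // (hq.1 _ _ Sv Su).
  by move=> h; apply: le_trans h _; lra.
have [vv0|vv0] := eqVneq (q v v) 0.
  rewrite vv0 mulr0; have [->|b0] := eqVneq (q u v) 0; first by rewrite expr0n.
  have := H 1 (- (q u u + 1) / q u v); have := q0 Su; rewrite vv0 mulr0.
  rewrite expr1n !mul1r divfK // => a0 h; exfalso; lra.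
have vv : 0 < q v v by rewrite lt0r vv0 q0.
have := H (q v v) (- q u v); set a := q u u; set b := q u v.
rewrite -/a -/b => h.
have : 0 <= q v v * (a * q v v - b ^+ 2).
  by apply: le_trans h _; rewrite le_eqVlt; apply/orP; left; apply/eqP; ring.
by rewrite pmulr_rge0 // subr_ge0.
Qed.

Lemma form_null u v : S u -> S v -> q u u = 0 -> q u v = 0.
Proof.
move=> Su Sv uu; have := form_cauchy_schwarz Su Sv.
by rewrite uu mul0r le_eqVlt ltNge sqr_ge0 orbF sqrf_eq0 => /eqP.
Qed.

Lemma form_sqrtD u v : S u -> S v ->
  Num.sqrt (q (u + v) (u + v)) <= Num.sqrt (q u u) + Num.sqrt (q v v).
Proof.
move=> Su Sv.
have su := sqrtr_ge0 (q u u); have sv := sqrtr_ge0 (q v v).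
rewrite -(@ler_pXn2r _ 2) // ?nnegrE ?addr_ge0 ?sqrtr_ge0 //.
rewrite sqr_sqrtr ?q0 //; last exact: subspaceD.
rewrite form_sqD // sqrrD !sqr_sqrtr ?q0 // lerD2r lerD2l.
suff : q u v <= Num.sqrt (q u u) * Num.sqrt (q v v) by rewrite -mulr_natl; lra.
apply: le_trans (ler_norm _) _.
rewrite -sqrtrM ?q0 // -sqrtr_sqr ler_wsqrtr //.
exact: form_cauchy_schwarz.
Qed.

Lemma form_sqrtZ (c : R) u : S u ->
  Num.sqrt (q (c *: u) (c *: u)) = `|c| * Num.sqrt (q u u).
Proof. by move=> Su; rewrite form_sqZ // sqrtrM ?sqr_ge0 // sqrtr_sqr. Qed.
End PSD.

(** * Square-integrable functions *)

Section SquareIntegrable.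
Context d (T : measurableType d) (R : realType)
  (mu : {measure set T -> \bar R}).
Implicit Types (D : set T) (f g a : T -> R).

Definition sqint D f : Prop :=
  measurable_fun D f /\ mu.-integrable D (EFin \o (fun x => f x ^+ 2)).

Definition ess_bounded D a : Prop :=
  measurable_fun D a /\ exists M : R, {ae mu, forall x, D x -> `|a x| <= M}.

Lemma aeS (P Q : T -> Prop) : (forall x, P x -> Q x) ->
  {ae mu, forall x, P x} -> {ae mu, forall x, Q x}.
Proof. by move=> PQ; apply: filterS. Qed.

Lemma aeS2 (P P' Q : T -> Prop) : (forall x, P x -> P' x -> Q x) ->
  {ae mu, forall x, P x} -> {ae mu, forall x, P' x} -> {ae mu, forall x, Q x}.
Proof. by move=> PQ; apply: filterS2. Qed.

Lemma ae_le_integrable D f g : measurable D -> measurable_fun D f ->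
  {ae mu, forall x, D x -> `|f x| <= `|g x|} ->
  mu.-integrable D (EFin \o g) -> mu.-integrable D (EFin \o f).
Proof.
move=> mD mf fg /integrableP[mg ig]; apply/integrableP; split.
  exact/measurable_EFinP.
apply: le_lt_trans ig; apply: ae_ge0_le_integral => //.
- by apply: measurableT_comp => //; exact/measurable_EFinP.
- exact: measurableT_comp.
Qed.

Lemma ae_eq_Rintegral D f g : measurable D -> measurable_fun D f ->
  measurable_fun D g -> {ae mu, forall x, D x -> f x = g x} ->
  \int[mu]_(x in D) f x = \int[mu]_(x in D) g x.
Proof.
move=> mD mf mg fg; rewrite /Rintegral; congr fine.
apply: ae_eq_integral => //; try exact/measurable_EFinP.
by apply: filterS fg => x /= h Dx; rewrite h.
Qed.

Lemma integrable_lin D (c : R) f g : measurable D ->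
  mu.-integrable D (EFin \o f) -> mu.-integrable D (EFin \o g) ->
  mu.-integrable D (EFin \o (fun x => c * f x + g x)).
Proof.
move=> mD hf hg; have := integrableD mD (integrableZl mD c hf) hg.
by apply: eq_integrable => // x _; rewrite /= EFinD EFinM.
Qed.

Lemma Rintegral_lin D (c : R) f g : measurable D ->
  mu.-integrable D (EFin \o f) -> mu.-integrable D (EFin \o g) ->
  \int[mu]_(x in D) (c * f x + g x) =
  c * \int[mu]_(x in D) f x + \int[mu]_(x in D) g x.
Proof.
move=> mD hf hg; rewrite -RintegralZl // -RintegralD //.
by have := integrableZl mD c hf; apply: eq_integrable => // x _; rewrite /= EFinM.
Qed.

Lemma sqint_mul D a f g : measurable D -> ess_bounded D a -> sqint D f ->
  sqint D g -> mu.-integrable D (EFin \o (fun x => a x * (f x * g x))).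
Proof.
move=> mD [ma [M aM]] [mf f2] [mg g2].
apply: (@ae_le_integrable _ _ (fun x => `|M| * (f x ^+ 2 + g x ^+ 2))) => //.
- by apply: measurable_funM => //; exact: measurable_funM.
- apply: filterS aM => x aM Dx; rewrite !normrM normr_id.
  apply: ler_pM; rewrite ?mulr_ge0 //.
    by apply: le_trans (aM Dx) _; rewrite ler_norm.
  rewrite -normrM [leRHS]ger0_norm ?addr_ge0 ?sqr_ge0 // ler_norml.
  have h1 := sqr_ge0 (f x + g x); have h2 := sqr_ge0 (f x - g x).
  have h3 := sqr_ge0 (f x); have h4 := sqr_ge0 (g x).
  by apply/andP; split; nra.
- under [X in _.-integrable _ X]eq_fun do rewrite /= EFinM EFinD.
  by apply: integrableZl => //; apply: integrableD.
Qed.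

Lemma ess_bounded_cst D c : measurable D -> ess_bounded D (fun=> c).
Proof.
by move=> mD; split => //; exists `|c|; apply: aeW => x _.
Qed.

Lemma sqint_mul1 D f g : measurable D -> sqint D f -> sqint D g ->
  mu.-integrable D (EFin \o (fun x => f x * g x)).
Proof.
move=> mD hf hg; have := sqint_mul mD (ess_bounded_cst 1 mD) hf hg.
by under eq_fun do rewrite /= mul1r.
Qed.

Lemma sqint_lin D c f g : measurable D -> sqint D f -> sqint D g ->
  sqint D (fun x => c * f x + g x).
Proof.
move=> mD hf hg; split.
  apply: measurable_funD; last exact: hg.1.
  by apply: measurable_funM => //; exact: hf.1.
have fg := sqint_mul1 mD hf hg.
have E : EFin \o (fun x => (c * f x + g x) ^+ 2) =
  (fun x => (c ^+ 2)%:E * (f x ^+ 2)%:E + (2 * c)%:E * (f x * g x)%:E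
    + (g x ^+ 2)%:E)%E.
  by apply/funext => x /=; rewrite -!EFinM -!EFinD; congr EFin; ring.
rewrite E; apply: integrableD => //; last exact: hg.2.
have i1 := integrableZl mD (c ^+ 2) hf.2.
have i2 := integrableZl mD (2 * c) fg.
exact: integrableD i1 i2.
Qed.

Lemma sqint_sub D E f : measurable D -> measurable E -> E `<=` D ->
  sqint D f -> sqint E f.
Proof.
move=> mD mE ED [mf f2]; split; first exact: measurable_funS mf.
exact: integrableS f2.
Qed.

Lemma sqint_Lfun D f : measurable D ->
  ((f \_ D : T -> R) \in Lfun mu 2%:E) <-> sqint D f.
Proof.
move=> mD.
have E : (fun x => ((f \_ D) x ^+ 2)%:E) = (EFin \o (fun x => f x ^+ 2)) \_ D.
  apply/funext => x; rewrite !patchE; case: ifP => //= _.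
  by rewrite expr0n.
split=> [h|[mf f2]].
  split; last by apply/integrable_mkcond => //; rewrite -E;
    exact: Lfun2_integrable_sqr.
  move: h; rewrite inE => /andP[]; rewrite inE => h _.
  by have /(measurable_restrict _ mD measurableT) := h; rewrite setTI.
move/integrable_mkcond : f2 => /(_ mD); rewrite -E => f2.
have mfD : measurable_fun setT (f \_ D).
  by apply/(measurable_restrict _ mD measurableT); rewrite setTI.
rewrite inE; apply/andP; split; rewrite inE //= /finite_norm.
rewrite unlock; apply: poweR_lty.
move/integrableP : f2 => [_]; congr (_ < _)%E; apply: eq_integral => x _ /=.
by rewrite normrX powR_mulrn.
Qed.

Lemma sqint0 D : measurable D -> sqint D (fun=> 0).
Proof.
move=> mD; split => //.
by under eq_fun do rewrite /= expr0n; exact: integrable0.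
Qed.

(** Bounding |h| by [eta + h^2 / eta] replaces a Cauchy-Schwarz argument on a
    set of finite measure. *)
Lemma int_norm_le D f (eta : R) : measurable D -> mu D \is a fin_num ->
  0 < eta -> sqint D f ->
  \int[mu]_(x in D) `|f x| <=
    eta * fine (mu D) + eta^-1 * \int[mu]_(x in D) (f x ^+ 2).
Proof.
move=> mD fD eta0 hf.
have i1 : mu.-integrable D (EFin \o (fun=> eta)).
  apply: measurable_bounded_integrable => //; first by rewrite ltey_eq fD.
  by exists `|eta|; split => // x xM y _; exact: ltW.
have i2 : mu.-integrable D (EFin \o (fun x => eta^-1 * f x ^+ 2)).
  under [X in _.-integrable _ X]eq_fun do rewrite /= EFinM.
  by apply: integrableZl => //; exact: hf.2.
have i3 : mu.-integrable D (EFin \o (fun x => eta + eta^-1 * f x ^+ 2)).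
  under [X in _.-integrable _ X]eq_fun do rewrite /= EFinD.
  exact: integrableD.
have H x : `|f x| <= eta + eta^-1 * f x ^+ 2.
  rewrite -(ler_pM2l eta0) mulrDr mulrA divff ?gt_eqF // mul1r.
  have := sqr_ge0 (eta - `|f x|); rewrite sqrrB -normrX.
  rewrite (ger0_norm (sqr_ge0 (f x))); have := mulr_ge0 (ltW eta0) (normr_ge0 (f x)); lra.
rewrite -RintegralZl //; last exact: hf.2.
rewrite -[eta * _]Rintegral_cst // -RintegralD //.
apply: le_Rintegral => //.
apply: (@ae_le_integrable _ _ (fun x => eta + eta^-1 * f x ^+ 2)) => //.
  by apply: measurableT_comp => //; exact: hf.1.
by apply: aeW => x _; rewrite normr_id (le_trans (H x)) // ler_norm.
Qed.
End SquareIntegrable.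

(** * The plane: squares, open sets and null lines *)

(** The plane with the product of the Borel structures that carry Lebesgue
    measure. *)
Notation plane R := (measurableTypeR R * measurableTypeR R)%type.

Definition osq (R : realType) (c : R * R) (r : R) : set (R * R) :=
  `]c.1 - r, c.1 + r[%classic `*` `]c.2 - r, c.2 + r[%classic.

Definition csq (R : realType) (c : R * R) (r : R) : set (R * R) :=
  `[c.1 - r, c.1 + r]%classic `*` `[c.2 - r, c.2 + r]%classic.

Section Plane.
Context (R : realType).
Implicit Types (c p : R * R) (r : R) (U : set (R * R)).
Notation mu2 := (@leb2 R).

Lemma osqE c r p : osq c r p <-> `|p.1 - c.1| < r /\ `|p.2 - c.2| < r.
Proof. by rewrite /osq /setX /= !in_itv /= !ltr_distl. Qed.

Lemma csqE c r p : csq c r p <-> `|p.1 - c.1| <= r /\ `|p.2 - c.2| <= r.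
Proof. by rewrite /csq /setX /= !in_itv /= !ler_distl. Qed.

Lemma osq_csq c r : osq c r `<=` csq c r.
Proof. by move=> p /osqE[/ltW ? /ltW ?]; apply/csqE. Qed.

Lemma osq_ball c r : osq c r = ball c r.
Proof.
apply/seteqP; split=> p.
  by move=> /osqE[h1 h2]; split; rewrite /ball /= distrC.
by move=> [h1 h2]; apply/osqE; rewrite distrC [X in _ /\ X < _]distrC.
Qed.

Lemma open_osq c r : open (osq c r).
Proof. by rewrite osq_ball; exact: ball_open. Qed.

Lemma open_sub_osq U p : open U -> U p -> exists2 r, 0 < r & osq p r `<=` U.
Proof.
move=> oU Up; have /nbhs_ballP[r r0 rU] : nbhs p U by exact: open_nbhs_nbhs.
by exists r => //; rewrite osq_ball.
Qed.

Lemma interior_osq U p : interior U p <-> exists2 r, 0 < r & osq p r `<=` U.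
Proof.
split; first by move=> /nbhs_ballP[r r0 rU]; exists r => //; rewrite osq_ball.
by move=> [r r0]; rewrite osq_ball => rU; apply/nbhs_ballP; exists r.
Qed.

Lemma measurable_osq c r : measurable (osq c r : set (plane R)).
Proof. by apply: measurableX; exact: measurable_itv. Qed.

Lemma measurable_csq c r : measurable (csq c r : set (plane R)).
Proof. by apply: measurableX; exact: measurable_itv. Qed.

Lemma leb2_osq c r : 0 <= r -> mu2 (osq c r) = ((2 * r) ^+ 2)%:E.
Proof.
move=> r0; rewrite /leb2 product_measure1E ?measurable_itv //.
change (lebesgue_measure (`](c.1 - r)%R, (c.1 + r)%R[%classic : set R) * lebesgue_measure (`](c.2 - r)%R, (c.2 + r)%R[%classic : set R) = ((2 * r)%R ^+ 2)%:E)%E.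
rewrite !lebesgue_measure_itv /= !lte_fin.
have [->|rn0] := eqVneq r 0; first by rewrite !subr0 !addr0 !ltxx mule0 mulr0 expr0n.
have {}r0 : 0 < r by rewrite lt0r rn0.
rewrite !ifT; [|lra|lra]; rewrite -!EFinB -EFinM; congr EFin; ring.
Qed.

Lemma leb2_csq c r : 0 <= r -> mu2 (csq c r) = ((2 * r) ^+ 2)%:E.
Proof.
move=> r0; rewrite /leb2 product_measure1E ?measurable_itv //.
change (lebesgue_measure (`[(c.1 - r)%R, (c.1 + r)%R]%classic : set R) * lebesgue_measure (`[(c.2 - r)%R, (c.2 + r)%R]%classic : set R) = ((2 * r)%R ^+ 2)%:E)%E.
rewrite !lebesgue_measure_itv /= !lte_fin.
have [->|rn0] := eqVneq r 0; first by rewrite !subr0 !addr0 !ltxx mule0 mulr0 expr0n.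
have {}r0 : 0 < r by rewrite lt0r rn0.
rewrite !ifT; [|lra|lra]; rewrite -!EFinB -EFinM; congr EFin; ring.
Qed.

(** A family of closed squares with rational data: negative radii stand for
    squares that do not fit into the open set. *)
Lemma open_bigcup_osq U : open U ->
  exists (c : nat -> R * R) (r : nat -> R),
  U = \bigcup_k osq (c k) (r k) /\ forall k : nat, csq (c k) (r k) `<=` U.
Proof.
move=> oU.
pose cr (q : rat * rat * rat) : (R * R) * R := ((ratr q.1.1, ratr q.1.2), ratr q.2).
pose good (q : rat * rat * rat) := `[< csq (cr q).1 (cr q).2 `<=` U >].
pose g (k : nat) : (R * R) * R :=
  if choice.unpickle k is Some q then (if good q then cr q else (0, -1)) else (0, -1).
exists (fun k => (g k).1), (fun k => (g k).2).
have gU k : csq (g k).1 (g k).2 `<=` U.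
  have e1 : csq (0 : R * R) (-1) `<=` U.
    by move=> p /csqE[h _]; have := le_trans (normr_ge0 _) h; rewrite lerNr oppr0 ler10.
  rewrite /g; case: choice.unpickle => [q|] //; case: ifP => // /asboolP; exact.
split => //; apply/seteqP; split=> p; last by move=> [k _ /osq_csq/gU].
move=> Up; have [r r0 rU] := open_sub_osq oU Up.
have r4 : 0 < r / 4 by rewrite divr_gt0.
have [q1 /andP[a1 b1]] : exists q : rat, ratr q \in `]p.1 - r/4, p.1 + r/4[.
  by apply: rat_in_itvoo; lra.
have [q2 /andP[a2 b2]] : exists q : rat, ratr q \in `]p.2 - r/4, p.2 + r/4[.
  by apply: rat_in_itvoo; lra.
have [q3 /andP[a3 b3]] : exists q : rat, ratr q \in `]r/4, r/2[.
  by apply: rat_in_itvoo; lra.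
rewrite !bnd_simp in a1 b1 a2 b2 a3 b3.
exists (choice.pickle (q1, q2, q3)) => //; rewrite /g choice.pickleK ifT.
  apply/osqE => /=; rewrite !ltr_distl; split; apply/andP; split; lra.
apply/asboolP => x /csqE /=; rewrite !ler_distl => -[/andP[? ?] /andP[? ?]].
by apply: rU; apply/osqE; rewrite !ltr_distl; split; apply/andP; split; lra.
Qed.

Lemma measurable_open2 U : open U -> measurable (U : set (plane R)).
Proof.
move=> /open_bigcup_osq[c [r [-> _]]]; apply: bigcup_measurable => k _.
exact: measurable_osq.
Qed.

Lemma measurable_closed2 U : closed U -> measurable (U : set (plane R)).
Proof.
by move=> /closed_openC/measurable_open2/measurableC; rewrite setCK.
Qed.

Lemma measurable_continuous2 (f : R * R -> R) :
  continuous f -> measurable_fun (setT : set (plane R)) f.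
Proof.
move=> cf; apply: (measurability _ (RGenOInfty.measurableE R)).
move=> /= _ [_ [a ->]] <-; rewrite setTI; apply: measurable_open2.
by move/continuousP : cf; apply; rewrite set_itvoy; exact: open_gt.
Qed.

Lemma affine_root (a b y : R) : b != 0 -> a + b * y = 0 <-> y = - a / b.
Proof.
move=> b0; split=> [h|->]; first by apply: (mulIf b0); rewrite divfK //; lra.
by rewrite mulrC divfK // subrr.
Qed.

(** Lines are null: almost every vertical section is a point or empty. *)
Lemma leb2_line (k b1 b2 : R) : (b1, b2) != 0 :> R * R ->
  mu2 [set p | k + b1 * p.1 + b2 * p.2 = 0] = 0.
Proof.
move=> b0; have [b20|b20] := eqVneq b2 0; last first.
  rewrite /leb2 /product_measure1 /=; apply: integral0_eq => x _ /=.
  rewrite (_ : xsection _ _ = [set (- (k + b1 * x) / b2)]) ?lebesgue_measure_set1 //.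
  by apply/seteqP; split=> y; rewrite /xsection /= inE /= => /(affine_root _ _ b20).
have b10 : b1 != 0 by apply: contraNneq b0 => b10; rewrite b10 b20.
rewrite (_ : [set p | _] = [set - k / b1] `*` setT).
  by rewrite /leb2 product_measure1E // [X in (X * _)%E]lebesgue_measure_set1 mul0e.
apply/seteqP; split=> -[x y] /=; rewrite b20 mul0r addr0.
  by move=> /(affine_root _ _ b10).
by move=> [/(affine_root _ _ b10)].
Qed.
End Plane.

(** * Continuously differentiable functions on the plane *)

Definition C1 (R : realType) (h : R * R -> R) : Prop :=
  [/\ continuous h,
      forall x, derivable h x ((1, 0) : R * R),
      forall x, derivable h x ((0, 1) : R * R),
      continuous (partial1 h) & continuous (partial2 h)].

Section C1Plane.
Context (R : realType).
Implicit Types (h g : R * R -> R) (D K : set (R * R)).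
Notation mu1 := (@lebesgue_measure R).
Notation mu2 := (@leb2 R).

Lemma test_function_C1 D h : test_function D h -> C1 h.
Proof.
by move=> [hC _]; have c0 := hC 0%N; have [d1 d2 c1 c2] := hC 1%N; split.
Qed.

Lemma slice1 h (s t : R) : derivable h (s, t) ((1, 0) : R * R) ->
  is_derive s (1 : R) (fun s => h (s, t)) (partial1 h (s, t)).
Proof.
move=> dh.
have E : (fun k : R => k^-1 *: (h (k *: ((1, 0) : R * R) + (s, t)) - h (s, t)))
    = (fun k : R => k^-1 *: (h (k *: (1 : R) + s, t) - h (s, t))).
  apply/funext => k; congr (_ *: (h _ - _)).
  by apply: injective_projections; rewrite /= ?scaler0 ?add0r.
split; first by rewrite /derivable /= -E.
by rewrite /partial1 /derive /= -E.
Qed.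

Lemma slice2 h (s t : R) : derivable h (s, t) ((0, 1) : R * R) ->
  is_derive t (1 : R) (fun t => h (s, t)) (partial2 h (s, t)).
Proof.
move=> dh.
have E : (fun k : R => k^-1 *: (h (k *: ((0, 1) : R * R) + (s, t)) - h (s, t)))
    = (fun k : R => k^-1 *: (h (s, k *: (1 : R) + t) - h (s, t))).
  apply/funext => k; congr (_ *: (h _ - _)).
  by apply: injective_projections; rewrite /= ?scaler0 ?add0r.
split; first by rewrite /derivable /= -E.
by rewrite /partial2 /derive /= -E.
Qed.

Lemma continuous_slice1 h (t : R) : continuous h -> continuous (fun s => h (s, t)).
Proof.
move=> ch s; apply: (@continuous_comp _ _ _ (fun s : R => (s, t)) h); last exact: ch.
exact: (cvg_pair cvg_id (cvg_cst t)).
Qed.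

Lemma continuous_slice2 h (s : R) : continuous h -> continuous (fun t => h (s, t)).
Proof.
move=> ch t; apply: (@continuous_comp _ _ _ (fun t : R => (s, t)) h); last exact: ch.
exact: (cvg_pair (cvg_cst s) cvg_id).
Qed.

Lemma FTC1D (F f : R -> R) (a b : R) : (forall x, is_derive x (1 : R) F (f x)) ->
  continuous f -> a <= b ->
  (\int[mu1]_(x in `[a, b]) (f x)%:E)%E = (F b - F a)%:E.
Proof.
move=> dF cf; rewrite le_eqVlt => /orP[/eqP ->|ab].
  by rewrite set_itv1 integral_set1 subrr.
have cF x : {for x, continuous F}.
  by apply: differentiable_continuous; apply/derivable1_diffP; have [] := dF x.
rewrite (@continuous_FTC2 _ f F) //.
- exact: continuous_subspaceT.
- split; first by move=> x _; have [] := dF x.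
  + exact: cvg_at_right_filter (cF a).
  + exact: cvg_at_left_filter (cF b).
- by move=> x _; rewrite derive1E; have [_ ->] := dF x.
Qed.

Lemma increment_le (F f : R -> R) (a b x y : R) :
  (forall x, is_derive x (1 : R) F (f x)) ->
  continuous f -> a <= x <= b -> a <= y <= b ->
  (`|F y - F x|%:E <= \int[mu1]_(x in `[a, b]) `|f x|%:E)%E.
Proof.
move=> dF cf; wlog xy : x y / x <= y => [W xab yab|].
  have [xy|/ltW yx] := leP x y; first exact: W.
  by rewrite distrC; exact: W.
move=> /andP[ax xb] /andP[ay yb].
rewrite -abse_EFin -(FTC1D dF cf xy).
apply: le_trans; first apply: le_abse_integral => //.
  by apply/measurable_EFinP; apply: measurable_funTS; exact: continuous_measurable_fun.
apply: ge0_subset_integral => //.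
- apply/measurable_EFinP; apply: measurableT_comp => //.
  by apply: measurable_funTS; exact: continuous_measurable_fun.
- by move=> z /=; rewrite !in_itv /= => /andP[xz zy]; rewrite (le_trans ax xz) (le_trans zy).
Qed.

Lemma compact_csq (c : R * R) (r : R) : compact (csq c r).
Proof. by apply: compact_setX; exact: segment_compact. Qed.

Lemma integrable_csq h (c : R * R) (r : R) : continuous h ->
  mu2.-integrable (csq c r) (EFin \o h).
Proof.
move=> ch; apply: measurable_bounded_integrable.
- exact: measurable_csq.
- have [r0|r0] := leP 0 r; first by rewrite [X in (X < _)%E](leb2_csq c r0) ltry.
  rewrite (_ : csq c r = set0) ?measure0 //.
  apply/seteqP; split=> p // /csqE[h1 _].
  by have := le_trans (normr_ge0 _) h1; rewrite leNgt r0.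
- by apply: measurable_funTS; exact: measurable_continuous2.
- have /compact_bounded : compact (h @` csq c r).
    by apply: continuous_compact; [exact: continuous_subspaceT|exact: compact_csq].
  move=> [M [Mr HM]]; exists M; split => // x Mx y cy; apply: HM Mx _ _.
  by exists y.
Qed.

(** Off a compact set a function and its difference quotients vanish. *)
Lemma partial_off K h x : compact K -> (forall x, ~ K x -> h x = 0) -> ~ K x ->
  partial1 h x = 0 /\ partial2 h x = 0.
Proof.
move=> cK h0 Kx.
have oK : open (~` K).
  by apply: closed_openC; apply: compact_closed => //; exact: norm_hausdorff.
have near0 : \forall y \near x, h y = cst 0 y.
  by have := open_nbhs_nbhs (conj oK Kx); apply: filterS => y /h0.
by split; rewrite /partial1 /partial2 (near_eq_derive _ near0) ?derive_cst //.
Qed.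

Lemma compact_sub_csq K : compact K -> exists2 r : R, 0 < r & K `<=` csq 0 r.
Proof.
move=> /compact_bounded[M [Mr HM]]; exists (`|M| + 1); first by rewrite ltr_wpDl.
move=> x Kx; have := HM (`|M| + 1) _ x Kx.
rewrite (le_lt_trans (ler_norm M)) ?ltrDl // => /(_ isT).
by rewrite /= prod_normE ge_max => /andP[h1 h2]; apply/csqE; rewrite !subr0.
Qed.

Lemma csq_restrict h (r : R) : (forall x, ~ csq 0 r x -> h x = 0) -> h = h \_ (csq 0 r).
Proof.
by move=> h0; apply/funext => x; rewrite patchE; case: ifPn => // /negP; rewrite inE => /h0.
Qed.

Lemma integrable_compact_support K h : compact K -> continuous h ->
  (forall x, ~ K x -> h x = 0) -> mu2.-integrable setT (EFin \o h).
Proof.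
move=> cK ch h0; have [r r0 Kr] := compact_sub_csq cK.
rewrite (@csq_restrict h r) => [|x xr]; last by apply: h0 => /Kr.
rewrite -restrict_EFin.
apply: (proj1 (@integrable_mkcond _ _ _ mu2 _ (EFin \o h) (measurable_csq 0 r))).
exact: integrable_csq.
Qed.

Lemma int_partial1 K h : compact K -> C1 h -> (forall x, ~ K x -> h x = 0) ->
  \int[mu2]_x partial1 h x = 0.
Proof.
move=> cK [ch d1 d2 c1 c2] h0; have [r r0 Kr] := compact_sub_csq cK.
have ip : mu2.-integrable setT (EFin \o partial1 h).
  by apply: (integrable_compact_support cK c1) => x Kx; exact: (partial_off cK h0 Kx).1.
rewrite /Rintegral -(integral21_prod_meas1 ip) integral0_eq // => t _.
rewrite /fubini_G.
have E : (fun s => (EFin \o partial1 h) (s, t)) =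
    ((fun s => (partial1 h (s, t))%:E) \_ `[- r - 1, r + 1]%classic).
  apply/funext => s; rewrite patchE; case: ifPn => // /negP; rewrite inE /= in_itv /= => sr.
  congr EFin; apply: (partial_off cK h0 _).1 => /Kr/csqE[/=]; rewrite subr0 ler_norml => /andP[? ?] _.
  by apply: sr; apply/andP; split; lra.
rewrite [X in integral _ _ X]E -integral_mkcond.
have rr : - r - 1 <= r + 1 by lra.
have := FTC1D (fun s => slice1 (d1 (s, t))) (continuous_slice1 (t := t) c1) rr.
rewrite !h0 ?subrr // => /Kr/csqE[/=]; rewrite subr0 ler_norml => /andP[? ?] _; lra.
Qed.

Lemma int_partial2 K h : compact K -> C1 h -> (forall x, ~ K x -> h x = 0) ->
  \int[mu2]_x partial2 h x = 0.
Proof.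
move=> cK [ch d1 d2 c1 c2] h0; have [r r0 Kr] := compact_sub_csq cK.
have ip : mu2.-integrable setT (EFin \o partial2 h).
  by apply: (integrable_compact_support cK c2) => x Kx; exact: (partial_off cK h0 Kx).2.
rewrite /Rintegral -(integral12_prod_meas1 ip) integral0_eq // => s _.
rewrite /fubini_F.
have E : (fun t => (EFin \o partial2 h) (s, t)) =
    ((fun t => (partial2 h (s, t))%:E) \_ `[- r - 1, r + 1]%classic).
  apply/funext => t; rewrite patchE; case: ifPn => // /negP; rewrite inE /= in_itv /= => sr.
  congr EFin; apply: (partial_off cK h0 _).2 => /Kr/csqE[_ /=]; rewrite subr0 ler_norml => /andP[? ?].
  by apply: sr; apply/andP; split; lra.
rewrite [X in integral _ _ X]E -integral_mkcond.
have rr : - r - 1 <= r + 1 by lra.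
have := FTC1D (fun t => slice2 (d2 (s, t))) (continuous_slice2 (s := s) c2) rr.
rewrite !h0 ?subrr // => /Kr/csqE[_ /=]; rewrite subr0 ler_norml => /andP[? ?]; lra.
Qed.

Lemma partialM h g x : C1 h -> C1 g ->
  partial1 (fun x => h x * g x) x = partial1 h x * g x + h x * partial1 g x /\
  partial2 (fun x => h x * g x) x = partial2 h x * g x + h x * partial2 g x.
Proof.
move=> [_ a1 a2 _ _] [_ b1 b2 _ _]; split.
  rewrite /partial1 (deriveM (a1 x) (b1 x)) addrC /GRing.scale /=.
  by rewrite [g x * _]mulrC.
rewrite /partial2 (deriveM (a2 x) (b2 x)) addrC /GRing.scale /=.
by rewrite [g x * _]mulrC.
Qed.

Lemma C1M h g : C1 h -> C1 g -> C1 (fun x => h x * g x).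
Proof.
move=> Ch Cg; have [ch a1 a2 c1 c2] := Ch; have [cg b1 b2 e1 e2] := Cg.
have CM (u v : R * R -> R) : continuous u -> continuous v -> continuous (fun x => u x * v x).
  by move=> cu cv x; apply: cvgM; [exact: cu|exact: cv].
have CD (u v : R * R -> R) : continuous u -> continuous v -> continuous (fun x => u x + v x).
  by move=> cu cv x; apply: cvgD; [exact: cu|exact: cv].
split.
- exact: CM.
- by move=> x; apply: derivableM.
- by move=> x; apply: derivableM.
- rewrite (_ : partial1 _ = fun x => partial1 h x * g x + h x * partial1 g x).
    by apply: CD; apply: CM.
  by apply/funext => x; exact: (partialM x Ch Cg).1.
- rewrite (_ : partial2 _ = fun x => partial2 h x * g x + h x * partial2 g x).
    by apply: CD; apply: CM.
  by apply/funext => x; exact: (partialM x Ch Cg).2.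
Qed.

(** Integration by parts against a compactly supported function: the
    boundary terms of the fundamental theorem vanish on every line. *)
Lemma parts K h g : compact K -> C1 h -> C1 g -> (forall x, ~ K x -> g x = 0) ->
  \int[mu2]_x (h x * partial1 g x) = - (\int[mu2]_x (partial1 h x * g x)) /\
  \int[mu2]_x (h x * partial2 g x) = - (\int[mu2]_x (partial2 h x * g x)).
Proof.
move=> cK Ch Cg g0.
have hg0 x : ~ K x -> h x * g x = 0 by move=> /g0 ->; rewrite mulr0.
have [ch _ _ c1 c2] := Ch; have [cg _ _ e1 e2] := Cg.
have CM (u v : R * R -> R) : continuous u -> continuous v -> continuous (fun x => u x * v x).
  by move=> cu cv x; apply: cvgM; [exact: cu|exact: cv].
have I (u v : R * R -> R) : continuous u -> continuous v ->
    (forall x, ~ K x -> v x = 0) -> mu2.-integrable setT (EFin \o (fun x => u x * v x)).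
  move=> cu cv v0; apply: (integrable_compact_support cK (CM _ _ cu cv)) => x /v0 ->.
  by rewrite mulr0.
have p0 := fun x Kx => partial_off (x := x) cK g0 Kx.
split; apply/eqP; rewrite -addr_eq0 addrC -RintegralD //; try (by apply: I => // x /p0[]).
  rewrite -(int_partial1 cK (C1M Ch Cg) hg0); apply/eqP; apply: eq_Rintegral => x _.
  by rewrite (partialM x Ch Cg).1.
rewrite -(int_partial2 cK (C1M Ch Cg) hg0); apply/eqP; apply: eq_Rintegral => x _.
by rewrite (partialM x Ch Cg).2.
Qed.
End C1Plane.

(** * Smooth bumps and test functions *)

Section Bump.
Context (R : realType).
Implicit Types (p Q : {poly R}) (c x : R).

(** On the set where [Q] is positive this is [p * Q ^- k * exp (- c / Q)]; this
    family is closed under differentiation, hence consists of smooth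
    functions. *)
Definition bump Q c p (k : nat) x : R :=
  if 0 < Q.[x] then p.[x] * Q.[x] ^- k * expR (- (c / Q.[x])) else 0.

Definition bump_deriv Q c p (k : nat) : {poly R} :=
  p^`() * Q ^+ 2 - (p * Q^`() * Q) *+ k + c *: (Q^`() * p).

(** The only possible points where a bump is not a composition of smooth functions
    are zeros of [Q], and there it is of second order. *)
Lemma quadratic_is_derive0 (F : R -> R) x0 (C d : R) : 0 < d -> F x0 = 0 ->
  (forall x, `|x - x0| < d -> `|F x| <= C * (x - x0) ^+ 2) ->
  is_derive x0 (1 : R) F 0.
Proof.
move=> d0 F0 FC.
suff H : (fun k : R => k^-1 *: (F (k *: (1 : R) + x0) - F x0)) @ 0^' --> (0 : R).
  split; first by apply/cvg_ex; exists 0.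
  by rewrite /derive; apply/cvg_lim.
apply/cvgr0Pnorm_lt => eps eps0.
have CC : 0 < `|C| + 1 by rewrite ltr_wpDl.
near=> h.
have h0 : h != 0 by near: h; exact: nbhs_dnbhs_neq.
have hd : `|h| < d.
  by near: h; exact: dnbhs0_lt.
have he : `|h| < eps / (`|C| + 1).
  by near: h; apply: dnbhs0_lt; rewrite divr_gt0.
rewrite F0 subr0 /GRing.scale /= mulr1 normrM normfV.
rewrite -(ltr_pM2l (x := `|h|)) ?normr_gt0 // mulrA divff ?normr_eq0 // mul1r.
have := FC (h + x0); rewrite addrK => /(_ hd) /le_lt_trans; apply.
rewrite -real_normK ?num_real // expr2 mulrCA ltr_pM2l ?normr_gt0 //.
apply: le_lt_trans (_ : (`|C| + 1) * `|h| < _).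
  by rewrite ler_wpM2r // (le_trans (ler_norm C)) // lerDl.
by rewrite mulrC -ltr_pdivlMr.
Unshelve. all: by end_near.
Qed.

Lemma horner_locally_bounded p x0 : exists2 M : R, 0 < M &
  \forall x \near x0, `|p.[x]| <= M.
Proof.
exists (`|p.[x0]| + 1); first by rewrite ltr_wpDl.
have cp : p.[x] @[x --> x0] --> p.[x0].
  by apply: differentiable_continuous; apply/derivable1_diffP; exact: derivable_horner.
move/cvgrPdist_lt : cp => /(_ 1 ltr01); apply: filterS => x h.
rewrite -[p.[x]](subrK p.[x0]) (le_trans (ler_normD _ _)) // addrC lerD2l.
by rewrite distrC ltW.
Qed.

(** One term of the exponential series of [c / q] already suffices. *)
Lemma exp_beats_power c (k : nat) : 0 < c -> exists2 C : R, 0 < C &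
  forall q, 0 < q -> q ^- k * expR (- (c / q)) <= C * q ^+ 2.
Proof.
move=> c0; exists ((k.+2)`!%:R / c ^+ k.+2).
  by rewrite divr_gt0 ?exprn_gt0 // ltr0n fact_gt0.
move=> q q0; have s0 : 0 < c / q by rewrite divr_gt0.
have f0 : 0 < (k.+2)`!%:R :> R by rewrite ltr0n fact_gt0.
have := expR_ge1Dxn k.+1 (ltW s0).
move=> /(le_trans _) -/(_ ((c / q) ^+ k.+2 / (k.+2)`!%:R)).
rewrite lerDr ler01 => /(_ isT) h.
rewrite expRN mulrC -ler_pdivlMr ?invr_gt0 ?exprn_gt0 // invrK.
have -> : (k.+2)`!%:R / c ^+ k.+2 * q ^+ 2 * q ^+ k = ((c / q) ^+ k.+2 / (k.+2)`!%:R)^-1.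
  rewrite invf_div expr_div_n invf_div -mulrA -exprD addnC addn2 mulrA mulrAC.
  by rewrite -mulrA [q ^+ _ / _]mulrC.
rewrite lef_pV2 ?posrE ?expR_gt0 // divr_gt0 // exprn_gt0 //.
Qed.

(** The derivative is a bump of the same family, so bumps have derivatives of all
    orders. *)
Lemma is_derive_bump Q c p k x0 : 0 < c ->
  is_derive x0 (1 : R) (bump Q c p k) (bump Q c (bump_deriv Q c p k) k.+2 x0).
Proof.
move=> c0; have [q0|q0] := ltP 0 Q.[x0].
  have cQ : Q.[x] @[x --> x0] --> Q.[x0].
    by apply: differentiable_continuous; apply/derivable1_diffP; exact: derivable_horner.
  have nQ : \forall x \near x0, 0 < Q.[x] by move/cvgr_gt : cQ; apply.
  apply: (near_eq_is_derive (f := fun x => p.[x] * (Q.[x])^-1 ^+ k * expR (- (c * (Q.[x])^-1)))).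
    by apply: filterS nQ => x qx; rewrite /bump qx exprVn.
  have Q0 : Q.[x0] != 0 by rewrite gt_eqF.
  have dQ := is_derive_poly Q x0; have dp := is_derive_poly p x0.
  have dV := is_deriveV Q0 dQ.
  have dX := is_deriveX k dV.
  have dE : is_derive x0 (1 : R) (fun x => expR (- (c * (Q.[x])^-1)))
      (expR (- (c * (Q.[x0])^-1)) * (c * (Q.[x0] ^- 2 * Q^`().[x0]))).
    have dN : is_derive x0 (1 : R) (fun x => - (c * (Q.[x])^-1)) (c * (Q.[x0] ^- 2 * Q^`().[x0])).
      have := is_deriveN (is_deriveZ c dV).
      by rewrite /GRing.scale /= mulNr mulrN opprK.
    exact: (is_derive1_comp (is_derive_expR _) dN).
  have -> : (fun x => p.[x] * (Q.[x])^-1 ^+ k * expR (- (c * (Q.[x])^-1))) =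
      (horner p : R -> R) * ((fun x => (Q.[x])^-1) ^+ k) * (fun x => expR (- (c * (Q.[x])^-1))).
    by apply/funext => x; rewrite !fctE.
  apply: (is_derive_eq (is_deriveM (is_deriveM dp dX) dE)).
  rewrite /bump q0 /bump_deriv /GRing.scale /= !fctE !(hornerE, hornerMn) /=.
  rewrite -!exprVn; case: k dX => [|k] _ /=; first by rewrite !mulr0n; field.
  rewrite -mulr_natr !exprS; set E := expR _; set v := (Q.[x0])^-1 ^+ k.
  by field.
have -> : bump Q c (bump_deriv Q c p k) k.+2 x0 = 0 by rewrite /bump ltNge q0.
have [S QS] : exists S : {poly R}, Q - (Q.[x0])%:P = S * ('X - x0%:P).
  by apply/factor_theorem; rewrite /root !hornerE subrr.
have [M M0 HM] := horner_locally_bounded p x0.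
have [L L0 HL] := horner_locally_bounded S x0.
have [C C0 HC] := exp_beats_power k c0.
have /nbhs_ballP[d d0 Hd] : \forall x \near x0, `|p.[x]| <= M /\ `|S.[x]| <= L.
  exact: filterI HM HL.
apply: (quadratic_is_derive0 (C := M * C * L ^+ 2) d0).
  by rewrite /bump ltNge q0.
move=> x xd; have [pM SL] : `|p.[x]| <= M /\ `|S.[x]| <= L.
  by apply: Hd; rewrite /ball /= distrC.
rewrite /bump; case: ifPn => [qx|_]; last first.
  rewrite normr0; apply: mulr_ge0; last exact: sqr_ge0.
  by apply: mulr_ge0; [rewrite mulr_ge0 ?(ltW M0) ?(ltW C0)|exact: sqr_ge0].
rewrite -mulrA normrM -!mulrA; apply: ler_pM; rewrite ?normr_ge0 //.
rewrite ger0_norm ?mulr_ge0 ?expR_ge0 ?invr_ge0 ?exprn_ge0 ?(ltW qx) //.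
apply: le_trans (HC _ qx) _; rewrite ler_wpM2l ?(ltW C0) //.
rewrite mulrA -expr2 -exprMn.
rewrite -[in leRHS]real_normK ?num_real // ler_pXn2r ?nnegrE ?(ltW qx) //.
rewrite normrM (gtr0_norm L0).
have -> : Q.[x] = Q.[x0] + S.[x] * (x - x0).
  have /(congr1 (fun P => P.[x])) := QS; rewrite !hornerE => <-; ring.
apply: le_trans (_ : S.[x] * (x - x0) <= _); first by rewrite gerDr.
by rewrite (le_trans (ler_norm _)) // normrM ler_wpM2r.
Qed.

Lemma slice1_inv (h : R * R -> R) (s t d : R) :
  is_derive s (1 : R) (fun s => h (s, t)) d ->
  derivable h (s, t) ((1, 0) : R * R) /\ partial1 h (s, t) = d.
Proof.
have E : (fun k : R => k^-1 *: (h (k *: ((1, 0) : R * R) + (s, t)) - h (s, t)))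
    = (fun k : R => k^-1 *: (h (k *: (1 : R) + s, t) - h (s, t))).
  apply/funext => k; congr (_ *: (h _ - _)).
  by apply: injective_projections; rewrite /= ?scaler0 ?add0r.
move=> [dh dE]; split; first by rewrite /derivable /= E.
by rewrite -dE /partial1 /derive /= -E.
Qed.

Lemma slice2_inv (h : R * R -> R) (s t d : R) :
  is_derive t (1 : R) (fun t => h (s, t)) d ->
  derivable h (s, t) ((0, 1) : R * R) /\ partial2 h (s, t) = d.
Proof.
have E : (fun k : R => k^-1 *: (h (k *: ((0, 1) : R * R) + (s, t)) - h (s, t)))
    = (fun k : R => k^-1 *: (h (s, k *: (1 : R) + t) - h (s, t))).
  apply/funext => k; congr (_ *: (h _ - _)).
  by apply: injective_projections; rewrite /= ?scaler0 ?add0r.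
move=> [dh dE]; split; first by rewrite /derivable /= E.
by rewrite -dE /partial2 /derive /= -E.
Qed.

Lemma continuous_bump Q c p k : 0 < c -> continuous (bump Q c p k).
Proof.
move=> c0 x; apply: differentiable_continuous; apply/derivable1_diffP.
by have [] := is_derive_bump Q p k x c0.
Qed.

Definition bump2 Q1 Q2 c p1 p2 (k1 k2 : nat) (x : R * R) : R :=
  bump Q1 c p1 k1 x.1 * bump Q2 c p2 k2 x.2.

Lemma continuous_bump2 Q1 Q2 c p1 p2 k1 k2 : 0 < c ->
  continuous (bump2 Q1 Q2 c p1 p2 k1 k2).
Proof.
move=> c0 x; apply: cvgM.
  apply: (@continuous_comp _ _ _ fst (bump Q1 c p1 k1)); first exact: cvg_fst.
  exact: continuous_bump.
apply: (@continuous_comp _ _ _ snd (bump Q2 c p2 k2)); first exact: cvg_snd.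
exact: continuous_bump.
Qed.

Lemma partial_bump2 Q1 Q2 c p1 p2 k1 k2 : 0 < c ->
  let h := bump2 Q1 Q2 c p1 p2 k1 k2 in
  [/\ forall x : R * R, derivable h x ((1, 0) : R * R),
      forall x : R * R, derivable h x ((0, 1) : R * R),
      partial1 h = bump2 Q1 Q2 c (bump_deriv Q1 c p1 k1) p2 k1.+2 k2 &
      partial2 h = bump2 Q1 Q2 c p1 (bump_deriv Q2 c p2 k2) k1 k2.+2].
Proof.
move=> c0 h.
have D1 (x : R * R) : derivable h x ((1, 0) : R * R) /\ partial1 h x =
    bump2 Q1 Q2 c (bump_deriv Q1 c p1 k1) p2 k1.+2 k2 x.
  case: x => s t; apply: slice1_inv.
  have := is_deriveZ (bump Q2 c p2 k2 t) (is_derive_bump Q1 p1 k1 s c0).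
  congr (is_derive _ _ _ _); last by rewrite /GRing.scale /= mulrC.
  by apply/funext => y; rewrite /h /bump2 /GRing.scale /= mulrC.
have D2 (x : R * R) : derivable h x ((0, 1) : R * R) /\ partial2 h x =
    bump2 Q1 Q2 c p1 (bump_deriv Q2 c p2 k2) k1 k2.+2 x.
  case: x => s t; apply: slice2_inv.
  exact: (is_deriveZ (bump Q1 c p1 k1 s) (is_derive_bump Q2 p2 k2 t c0)).
by split=> [x|x||]; [exact: (D1 x).1|exact: (D2 x).1|apply/funext => x;
  exact: (D1 x).2|apply/funext => x; exact: (D2 x).2].
Qed.

Lemma Ck_bump2 Q1 Q2 c p1 p2 k1 k2 (m : nat) : 0 < c ->
  Ck m (bump2 Q1 Q2 c p1 p2 k1 k2).
Proof.
move=> c0; elim: m p1 p2 k1 k2 => [|m IH] p1 p2 k1 k2 /=.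
  exact: continuous_bump2.
by have [d1 d2 -> ->] := partial_bump2 Q1 Q2 p1 p2 k1 k2 c0;
  split; [exact: d1|exact: d2|exact: IH|exact: IH].
Qed.

Definition interval_poly (a b : R) : {poly R} := ('X - a%:P) * (b%:P - 'X).

Lemma interval_polyP (a b x : R) : a < b -> (0 < (interval_poly a b).[x]) = (a < x < b).
Proof.
move=> ab; rewrite /interval_poly !hornerE; apply/idP/andP => [h|[ax xb]]; last first.
  by rewrite mulr_gt0 ?subr_gt0.
have [ax|xa] := ltP a x; first by move: h; rewrite pmulr_rgt0 ?subr_gt0.
have : (x - a) * (b - x) <= 0 by rewrite mulr_le0_ge0 ?subr_le0 // subr_ge0 (le_trans xa) // ltW.
by rewrite leNgt h.
Qed.

Definition orect (a b : R * R) : set (R * R) :=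
  `]a.1, b.1[%classic `*` `]a.2, b.2[%classic.

Definition crect (a b : R * R) : set (R * R) :=
  `[a.1, b.1]%classic `*` `[a.2, b.2]%classic.

Definition rect_bump (c : R) (a b : R * R) : R * R -> R :=
  bump2 (interval_poly a.1 b.1) (interval_poly a.2 b.2) c 1 1 0 0.

Lemma bump01 Q c x : 0 < c -> 0 <= bump Q c 1 0 x <= 1.
Proof.
move=> c0; rewrite /bump; case: ifPn => [q0|_]; last by rewrite lexx ler01.
by rewrite hornerE expr0 invr1 !mul1r expR_ge0 /= -[leRHS]expR0 ler_expR oppr_le0 divr_ge0 // ltW.
Qed.

Lemma rect_bump01 c a b (x : R * R) : 0 < c -> 0 <= rect_bump c a b x <= 1.
Proof.
move=> c0; rewrite /rect_bump /bump2.
set u := bump _ _ _ _ x.1; set v := bump _ _ _ _ x.2.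
have /andP[u0 u1] : 0 <= u <= 1 by exact: bump01.
have /andP[v0 v1] : 0 <= v <= 1 by exact: bump01.
by rewrite mulr_ge0 //= mulr_ile1.
Qed.

Lemma rect_bump_off c (a b x : R * R) : a.1 < b.1 -> a.2 < b.2 ->
  ~ orect a b x -> rect_bump c a b x = 0.
Proof.
move=> ab1 ab2 Hx; rewrite /rect_bump /bump2 /bump !interval_polyP //.
have [h1|_] := boolP (a.1 < x.1 < b.1); last by rewrite mul0r.
have [h2|_] := boolP (a.2 < x.2 < b.2); last by rewrite mulr0.
by case: Hx; split; rewrite /= in_itv.
Qed.

Lemma cvg_bump Q x : 0 < Q.[x] -> (fun n : nat => bump Q n.+1%:R^-1 1 0 x) @ \oo --> (1 : R).
Proof.
move=> q0.
have H : (fun n : nat => expR (- (n.+1%:R^-1 * (Q.[x])^-1))) @ \oo --> expR (- (0 * (Q.[x])^-1)).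
  have H0 : (fun n : nat => - (n.+1%:R^-1 * (Q.[x])^-1)) @ \oo --> - (0 * (Q.[x])^-1).
    by apply: cvgN; apply: cvgMl; exact: cvg_harmonic.
  exact: (cvg_comp _ _ H0 (@continuous_expR R _)).
rewrite mul0r oppr0 expR0 in H; apply: cvg_trans H.
by apply: near_eq_cvg; apply: nearW => n; rewrite /bump q0 hornerE expr0 invr1 !mul1r.
Qed.

Lemma cvg_rect_bump (a b x : R * R) : orect a b x ->
  (fun n : nat => rect_bump n.+1%:R^-1 a b x) @ \oo --> (1 : R).
Proof.
move=> -[]; rewrite /= !in_itv /= => h1 h2; rewrite -[X in _ --> X]mul1r.
have lt (u v w : R) : u < v < w -> u < w by case/andP; exact: lt_trans.
by apply: cvgM; apply: cvg_bump; rewrite interval_polyP //; apply: lt; eassumption.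
Qed.

Lemma test_rect_bump D c (a b : R * R) : 0 < c -> a.1 < b.1 -> a.2 < b.2 ->
  crect a b `<=` D -> test_function D (rect_bump c a b).
Proof.
move=> c0 ab1 ab2 zD; split; first by move=> k; exact: Ck_bump2.
exists (crect a b); split => //.
  by apply: compact_setX; exact: segment_compact.
move=> x Hx; apply: rect_bump_off => // -[h1 h2]; apply: Hx; split.
  exact: subset_itv_oo_cc h1.
exact: subset_itv_oo_cc h2.
Qed.
End Bump.

(** * The fundamental lemma of the calculus of variations *)

Section FundamentalLemma.
Context (R : realType).
Implicit Types (U D : set (R * R)) (g : R * R -> R).
Notation mu2 := (@leb2 R).

Definition quadrants : set (set (R * R)) :=
  [set Q | exists a b : R, Q = `]a, +oo[%classic `*` `]b, +oo[%classic].

Lemma quadrants_setI : setI_closed quadrants.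
Proof.
move=> _ _ [a [b ->]] [a' [b' ->]]; exists (Num.max a a'), (Num.max b b').
apply/seteqP; split=> -[x y]; rewrite /setI /setX /= !in_itv /= !andbT !gt_max.
  by move=> [[-> ->] [-> ->]].
by move=> [/andP[-> ->] /andP[-> ->]].
Qed.

Lemma ray_archi (a : R) : exists k : nat, - k%:R < a.
Proof.
exists (Num.truncn `|a|).+1; rewrite ltrNl (le_lt_trans _ (truncnS_gt _)) //.
by rewrite -normrN ler_norm.
Qed.

(** Open quadrants are closed under intersection, as the Dynkin induction below
    requires. *)
Lemma measurable_quadrants :
  (measurable : set (set (plane R))) = <<s quadrants >>.
Proof.
rewrite eqEsubset; split=> [A|A]; last first.
  apply: smallest_sub; first exact: sigma_algebra_measurable.
  by move=> _ [a [b ->]]; apply: measurableX; exact: measurable_itv.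
have m1 : measurable_fun setT (fst : g_sigma_algebraType quadrants -> R).
  apply: (measurability _ (RGenOInfty.measurableE R)).
  move=> /= _ [_ [a ->]] <-; rewrite setTI.
  rewrite (_ : _ @^-1` _ = \bigcup_k (`]a, +oo[%classic `*` `](- k%:R), +oo[%classic)).
    by apply: bigcup_measurable => k _; apply: sub_sigma_algebra; exists a, (- k%:R).
  apply/seteqP; split=> -[x y]; rewrite /= !in_itv /= !andbT; last by case=> k _ [/=]; rewrite in_itv /= andbT.
  by move=> ax; have [k yk] := ray_archi y; exists k => //; split; rewrite /= in_itv /= andbT.
have m2 : measurable_fun setT (snd : g_sigma_algebraType quadrants -> R).
  apply: (measurability _ (RGenOInfty.measurableE R)).
  move=> /= _ [_ [a ->]] <-; rewrite setTI.
  rewrite (_ : _ @^-1` _ = \bigcup_k (`](- k%:R), +oo[%classic `*` `]a, +oo[%classic)).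
    by apply: bigcup_measurable => k _; apply: sub_sigma_algebra; exists (- k%:R), a.
  apply/seteqP; split=> -[x y]; rewrite /= !in_itv /= !andbT; last by case=> k _ [_ /=]; rewrite in_itv /= andbT.
  by move=> ax; have [k xk] := ray_archi x; exists k => //; split; rewrite /= in_itv /= andbT.
rewrite measurable_prod_measurableType; apply: smallest_sub.
  exact: smallest_sigma_algebra.
move=> _ [B mB [C mC <-]].
have -> : B `*` C = (fst @^-1` B) `&` (snd @^-1` C) by [].
apply: (@measurableI _ (g_sigma_algebraType quadrants)).
  by rewrite -[X in measurable X]setTI; exact: m1.
by rewrite -[X in measurable X]setTI; exact: m2.
Qed.

(** Test functions increasing to the indicator of a rectangle inside [U] show
    that the integral of [g] over that rectangle vanishes. *)
Lemma int_rect_eq0 U g (a b : R * R) : measurable (U : set (plane R)) -> sqint mu2 U g ->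
  (forall phi, test_function U phi -> \int[mu2]_(x in U) (g x * phi x) = 0) ->
  crect a b `<=` U -> \int[mu2]_(x in orect a b) g x = 0.
Proof.
move=> mU gU g0 abU.
have [/andP[ab1 ab2]|] := boolP ((a.1 < b.1) && (a.2 < b.2)); last first.
  move=> h; rewrite (_ : orect a b = set0) ?Rintegral_set0 //.
  apply/seteqP; split=> x // -[]; rewrite /= !in_itv /= => /andP[h1 h2] /andP[h3 h4].
  by move: h; rewrite (lt_trans h1 h2) (lt_trans h3 h4).
have mo : measurable (orect a b : set (plane R)) by apply: measurableX; exact: measurable_itv.
have oU : orect a b `<=` U.
  apply: subset_trans abU => x [h1 h2]; split.
    exact: subset_itv_oo_cc h1.
  exact: subset_itv_oo_cc h2.
have go : sqint mu2 (orect a b) g by exact: sqint_sub gU.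
have fo : (mu2 (orect a b) < +oo)%E.
  rewrite [X in (X < _)%E]product_measure1E ?measurable_itv //.
  by apply: lte_mul_pinfty; rewrite ?ge0_fin_numE //; rewrite [X in (X < _)%E]lebesgue_measure_itv /= ?lte_fin ?ab1 ?ab2 -EFinB ltry.
have one : sqint mu2 (orect a b) (fun=> 1).
  split => //; apply: measurable_bounded_integrable => //.
  by exists 2; split => // x x2 y _; rewrite expr1n normr1 (le_trans _ (ltW x2)) // ler1n.
have ig : mu2.-integrable (orect a b) (EFin \o g).
  have := sqint_mul1 mo go one.
  by under eq_fun do rewrite /= mulr1.
pose f (n : nat) x := g x * rect_bump n.+1%:R^-1 a b x.
have c0 (n : nat) : 0 < n.+1%:R^-1 :> R by rewrite invr_gt0 ltr0n.
have f0 n : (\int[mu2]_(x in orect a b) (f n x)%:E)%E = 0%E.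
  have tn := test_rect_bump (c0 n) ab1 ab2 abU.
  have mb : measurable_fun (setT : set (plane R)) (rect_bump n.+1%:R^-1 a b).
    by apply: measurable_continuous2; exact: (tn.1 0%N).
  have ifn : mu2.-integrable (orect a b) (EFin \o f n).
    apply: (@ae_le_integrable _ _ _ mu2 _ _ g) => //.
      by apply: measurable_funM; [exact: go.1|exact: measurable_funTS].
    apply: aeW => x _; rewrite normrM ler_piMr //.
    by have /andP[h1 h2] := rect_bump01 a b x (c0 n); rewrite ger0_norm.
  rewrite -[LHS]fineK; last exact: integrable_fin_num.
  congr EFin; rewrite -(g0 _ tn); apply: esym.
  rewrite -[LHS]/(fine (\int[mu2]_(x in U) (f n x)%:E)); congr fine.
  rewrite [LHS]integral_mkcond [RHS]integral_mkcond; apply: eq_integral => x _.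
  rewrite !patchE; case: ifPn => xU; case: ifPn => xo //.
    by rewrite /f rect_bump_off ?mulr0 // => h; move: xo; rewrite notin_setE; apply.
  by exfalso; move: xU xo; rewrite notin_setE inE => xU /oU.
have := @dominated_cvg _ _ _ mu2 (orect a b) mo (fun n x => (f n x)%:E)
  (EFin \o g) (abse \o (EFin \o g)).
have mf n : measurable_fun (orect a b) (EFin \o f n).
  apply/measurable_EFinP; apply: measurable_funM; first exact: go.1.
  apply: measurable_funTS; apply: measurable_continuous2.
  exact: ((test_rect_bump (c0 n) ab1 ab2 abU).1 0%N).
move=> /(_ mf); move=> /(_ _ _ _ _)/cvg_lim h.
rewrite /Rintegral -[X in fine X]h //.
- by rewrite (_ : (fun n => _) = cst 0%E) ?lim_cst //; apply/funext => n; exact: f0.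
- move=> x ox; apply/fine_cvgP; split; first exact: nearW.
  rewrite -[X in _ --> X]/(g x) -[X in _ --> X]mulr1.
  by apply: cvgMr; exact: cvg_rect_bump.
- exact: integrable_abse.
- move=> n x _; rewrite /= lee_fin normrM ler_piMr //.
  by have /andP[h1 h2] := rect_bump01 a b x (c0 n); rewrite ger0_norm.
Qed.

(** The Borel sets on which the integral of [g] vanishes form a Dynkin class, and
    it contains the quadrants. *)
Lemma sq_ae_eq0 U g z r : measurable (U : set (plane R)) -> sqint mu2 U g ->
  (forall phi, test_function U phi -> \int[mu2]_(x in U) (g x * phi x) = 0) ->
  csq z r `<=` U -> {ae mu2, forall x, osq z r x -> g x = 0}.
Proof.
move=> mU gU g0 zU; pose Q := osq z r.
have [r0|r0] := ltP 0 r; last first.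
  apply: aeW => x /osqE[h _]; have := le_lt_trans (normr_ge0 _) h.
  by rewrite ltNge r0.
have mQ : measurable (Q : set (plane R)) by exact: measurable_osq.
have QU : Q `<=` U by apply: subset_trans zU; exact: osq_csq.
have gQ : sqint mu2 Q g by exact: sqint_sub gU.
have fQ : (mu2 Q < +oo)%E by rewrite [X in (X < _)%E](leb2_osq z (ltW r0)) ltry.
have one : sqint mu2 Q (fun=> 1).
  split => //; apply: measurable_bounded_integrable => //.
  by exists 2; split => // x x2 y _; rewrite expr1n normr1 (le_trans _ (ltW x2)) // ler1n.
have ig : mu2.-integrable Q (EFin \o g).
  have := sqint_mul1 mQ gQ one.
  by under eq_fun do rewrite /= mulr1.
pose P S := (\int[mu2]_(x in S `&` Q) (g x)%:E = 0)%E.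
have rectP (a b : R * R) : crect a b `<=` U -> orect a b `<=` Q ->
    (\int[mu2]_(x in orect a b) (g x)%:E = 0)%E.
  move=> abU abQ; have mo : measurable (orect a b : set (plane R)).
    by apply: measurableX; exact: measurable_itv.
  rewrite -[LHS]fineK; last by apply: integrable_fin_num => //; exact: integrableS ig.
  by congr EFin; exact: int_rect_eq0 gU g0 abU.
have PT : P setT.
  by rewrite /P setTI; exact: (rectP (z.1 - r, z.2 - r) (z.1 + r, z.2 + r)).
have HP (A : set (plane R)) : measurable A -> P A.
  rewrite measurable_quadrants; apply: (@dynkin_induction _ (plane R)).
  - exact: measurable_quadrants.
  - exact: quadrants_setI.
  - exact: PT.
  - move=> _ [a [b ->]]; rewrite /P.
    rewrite (_ : _ `&` Q = orect (Num.max a (z.1 - r), Num.max b (z.2 - r)) (z.1 + r, z.2 + r)).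
      apply: rectP => [|x []]; last first.
        rewrite /= !in_itv /= !gt_max => /andP[/andP[_ h1] h2] /andP[/andP[_ h3] h4].
        by split; rewrite /= in_itv /= ?h1 ?h2 ?h3 ?h4.
      apply: subset_trans zU => x [/=]; rewrite !in_itv /= !ge_max.
      by move=> /andP[/andP[_ h1] h2] /andP[/andP[_ h3] h4]; split; rewrite /= in_itv /= ?h1 ?h2 ?h3 ?h4.
    apply/seteqP; split=> x; rewrite /Q /orect /osq /setX /setI /= !in_itv /= !gt_max !andbT.
      by move=> [[-> ->] [/andP[-> ->] /andP[-> ->]]].
    by move=> [/andP[/andP[-> ->] ->] /andP[/andP[-> ->] ->]].
  - move=> S mS PS; rewrite /P.
    have SQ : Q = (S `&` Q) `|` (~` S `&` Q) by rewrite -setIUl setUv setTI.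
    have := PT; rewrite /P setTI [in LHS]SQ integral_setU ?PS ?add0e //.
    + exact: measurableI.
    + by apply: measurableI => //; exact: measurableC.
    + by rewrite -SQ; exact: measurable_int ig.
    + by apply/disj_setPS => x [[Sx _] [nSx _]]; exact: nSx.
  - move=> F mF tF PF; rewrite /P setI_bigcupl integral_bigcup.
    + by apply: eseries0 => k _ _; exact: PF.
    + exact: trivIset_setIr.
    + by move=> k; apply: measurableI; [exact: mF|exact: mQ].
    + apply: integrableS ig => //; last by move=> x [k _ []].
      by apply: bigcup_measurable => k _; apply: measurableI; [exact: mF|exact: mQ].
have : ae_eq mu2 Q (EFin \o g) (cst 0%E).
  apply: integral_ae_eq ig _ _ => //.
  by move=> E EQ mE; rewrite integral0; have := HP E mE; rewrite /P setIidl.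
by apply: filterS => x h /h [].
Qed.

(** The open set is a countable union of squares whose closures it contains. *)
Lemma fundamental_lemma U g : open U -> sqint mu2 U g ->
  (forall phi, test_function U phi -> \int[mu2]_(x in U) (g x * phi x) = 0) ->
  {ae mu2, forall x, U x -> g x = 0}.
Proof.
move=> oU gU g0; have [c [r [UE cU]]] := open_bigcup_osq oU.
have H k := sq_ae_eq0 (measurable_open2 oU) gU g0 (cU k).
have := ae_foralln H.
by apply: filterS => x h; rewrite UE => -[k _ /h].
Qed.
End FundamentalLemma.

(** * Weak gradients *)

#[local] Opaque partial1 partial2.

Section WeakGradient.
Context (R : realType).
Implicit Types (D U K : set (R * R)) (v w h : R * R -> R) (g : R * R -> R * R).
Notation mu2 := (@leb2 R).

Lemma L2E D v : open D -> L2 D v <-> sqint mu2 D v.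
Proof. by move=> oD; exact: (sqint_Lfun mu2 v (measurable_open2 oD)). Qed.

Lemma sqint_compact_support D K h : measurable (D : set (plane R)) -> compact K ->
  continuous h -> (forall x, ~ K x -> h x = 0) -> sqint mu2 D h.
Proof.
move=> mD cK ch h0; split.
  by apply: measurable_funTS; exact: measurable_continuous2.
apply: (@integrableS _ _ _ mu2 setT) => //.
apply: (integrable_compact_support cK) => [x|x /h0 ->]; last by rewrite expr0n.
by apply: cvgM; exact: ch.
Qed.

Lemma sqint_test D E h : measurable (D : set (plane R)) -> test_function E h ->
  [/\ sqint mu2 D h, sqint mu2 D (partial1 h) & sqint mu2 D (partial2 h)].
Proof.
move=> mD th; have [_ [K [cK _ h0]]] := th.
have [ch _ _ c1 c2] := test_function_C1 th.
split; apply: (sqint_compact_support mD cK) => // x Kx;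
  by have [] := partial_off cK h0 Kx.
Qed.

Lemma test_sub D U h : U `<=` D -> test_function U h -> test_function D h.
Proof.
move=> UD [hC [K [cK KU h0]]]; split => //; exists K; split => //.
exact: subset_trans UD.
Qed.

Lemma int_off (D U : set (R * R)) (h : R * R -> R) : U `<=` D ->
  (forall x, ~ U x -> h x = 0) -> \int[mu2]_(x in D) h x = \int[mu2]_(x in U) h x.
Proof.
move=> UD h0; rewrite Rintegral_mkcond [RHS]Rintegral_mkcond.
apply: eq_Rintegral => x _; rewrite !patchE.
case: ifPn => xD; case: ifPn => xU //.
  by rewrite h0 // => Ux; move: xU; rewrite notin_setE; apply.
by move: xD xU; rewrite notin_setE inE => nD /UD.
Qed.

Lemma test_off U h x : test_function U h -> ~ U x ->
  [/\ h x = 0, partial1 h x = 0 & partial2 h x = 0].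
Proof.
move=> [_ [K [cK KU h0]]] Ux; have Kx : ~ K x by move=> /KU.
by have [p1 p2] := partial_off cK h0 Kx; rewrite h0.
Qed.

Lemma weak_gradient_sub D U v g : open D -> open U -> U `<=` D ->
  weak_gradient D v g -> weak_gradient U v g.
Proof.
move=> oD oU UD [/(L2E _ oD) g1 /(L2E _ oD) g2 ibp].
have mD := measurable_open2 oD; have mU := measurable_open2 oU.
split; [exact: (proj2 (L2E _ oU) (sqint_sub mD mU UD g1))|
  exact: (proj2 (L2E _ oU) (sqint_sub mD mU UD g2))|].
move=> phi tphi; have [e1 e2] := ibp _ (test_sub UD tphi).
have o x Ux := test_off (x := x) tphi Ux.
have off (q r : R * R -> R) : (forall x, ~ U x -> r x = 0) ->
    \int[mu2]_(x in D) (q x * r x) = \int[mu2]_(x in U) (q x * r x).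
  by move=> r0; apply: int_off => // x /r0 ->; rewrite mulr0.
have o0 x : ~ U x -> phi x = 0 by case/o.
have o1 x : ~ U x -> partial1 phi x = 0 by case/o.
have o2 x : ~ U x -> partial2 phi x = 0 by case/o.
have f1 := off (fun x => (g x).1) phi o0; have f2 := off (fun x => (g x).2) phi o0.
split.
  exact: (etrans (esym (off v _ o1)) (etrans e1 (congr1 -%R f1))).
exact: (etrans (esym (off v _ o2)) (etrans e2 (congr1 -%R f2))).
Qed.

Lemma weak_gradient_lin D (c : R) v w g (h : R * R -> R * R) : open D -> L2 D v -> L2 D w ->
  weak_gradient D v g -> weak_gradient D w h ->
  weak_gradient D (c *: v + w) (fun x => c *: g x + h x).
Proof.
move=> oD /(L2E _ oD) v2 /(L2E _ oD) w2 [/(L2E _ oD) g1 /(L2E _ oD) g2 ig]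
  [/(L2E _ oD) h1 /(L2E _ oD) h2 ih].
have mD := measurable_open2 oD.
split; [exact: (proj2 (L2E _ oD) (sqint_lin c mD g1 h1))|
  exact: (proj2 (L2E _ oD) (sqint_lin c mD g2 h2))|].
move=> phi tphi; have [p0 p1 p2] := sqint_test mD tphi.
have [g1E g2E] := ig _ tphi; have [h1E h2E] := ih _ tphi.
have L (f k q : R * R -> R) : sqint mu2 D f -> sqint mu2 D k -> sqint mu2 D q ->
    \int[mu2]_(x in D) ((c * f x + k x) * q x) =
    c * \int[mu2]_(x in D) (f x * q x) + \int[mu2]_(x in D) (k x * q x).
  move=> hf hk hq; have ifq := sqint_mul1 mD hf hq; have ikq := sqint_mul1 mD hk hq.
  rewrite -[RHS](Rintegral_lin c mD ifq ikq).
  by apply: eq_Rintegral => x _; rewrite mulrDl mulrA.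
have e1' := L (fun x => (g x).1) (fun x => (h x).1) phi g1 h1 p0.
have e2' := L (fun x => (g x).2) (fun x => (h x).2) phi g2 h2 p0.
split.
  rewrite [LHS](L v w (partial1 phi) v2 w2 p1) g1E h1E [X in _ = - X]e1'; ring.
rewrite [LHS](L v w (partial2 phi) v2 w2 p2) g2E h2E [X in _ = - X]e2'; ring.
Qed.

(** The difference of two weak gradients is orthogonal to all test functions. *)
Lemma weak_gradient_unique D v g (h : R * R -> R * R) : open D -> weak_gradient D v g ->
  weak_gradient D v h -> {ae mu2, forall x, D x -> g x = h x}.
Proof.
move=> oD [/(L2E _ oD) g1 /(L2E _ oD) g2 ig] [/(L2E _ oD) h1 /(L2E _ oD) h2 ih].
have mD := measurable_open2 oD.
have L (f k : R * R -> R) : sqint mu2 D f -> sqint mu2 D k ->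
    (forall phi, test_function D phi ->
      \int[mu2]_(x in D) (f x * phi x) = \int[mu2]_(x in D) (k x * phi x)) ->
    {ae mu2, forall x, D x -> f x = k x}.
  move=> hf hk fk; have hkf := sqint_lin (-1) mD hf hk.
  have := fundamental_lemma oD hkf.
  have H phi : test_function D phi ->
      \int[mu2]_(x in D) ((-1 * f x + k x) * phi x) = 0.
    move=> tphi; have [p0 _ _] := sqint_test mD tphi.
    have := fk _ tphi; have i1 := sqint_mul1 mD hf p0; have i2 := sqint_mul1 mD hk p0.
    move=> /eqP; rewrite eq_sym -subr_eq0 -RintegralB // => /eqP <-.
    by apply: eq_Rintegral => x _; ring.
  by move=> /(_ H); apply: aeS => x xD Dx; have := xD Dx; lra.
have H1 := L _ _ g1 h1; have H2 := L _ _ g2 h2.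
have {}H1 := H1 (fun phi tphi => oppr_inj (etrans (esym (ig _ tphi).1) (ih _ tphi).1)).
have {}H2 := H2 (fun phi tphi => oppr_inj (etrans (esym (ig _ tphi).2) (ih _ tphi).2)).
apply: aeS2 H1 H2 => x e1 e2 Dx.
by rewrite [g x]surjective_pairing e1 // e2 // -surjective_pairing.
Qed.

Lemma weak_gradient_C1 D h : open D -> C1 h -> sqint mu2 D (partial1 h) ->
  sqint mu2 D (partial2 h) -> weak_gradient D h (fun x => (partial1 h x, partial2 h x)).
Proof.
move=> oD Ch s1 s2; split; [exact: (proj2 (L2E _ oD) s1)|exact: (proj2 (L2E _ oD) s2)|].
move=> phi tphi; have Cp := test_function_C1 tphi.
have [_ [K [cK KD p0]]] := tphi.
have [e1 e2] := parts cK Ch Cp p0.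
have o x Dx := test_off (x := x) tphi Dx.
have D0 (q r : R * R -> R) : (forall x, ~ D x -> r x = 0) ->
    \int[mu2]_(x in D) (q x * r x) = \int[mu2]_x (q x * r x).
  by move=> r0; rewrite -(@int_off setT) // => x /r0 ->; rewrite mulr0.
have o0 x : ~ D x -> phi x = 0 by case/o.
have o1 x : ~ D x -> partial1 phi x = 0 by case/o.
have o2 x : ~ D x -> partial2 phi x = 0 by case/o.
split.
  exact: (etrans (D0 h _ o1) (etrans e1 (congr1 -%R (esym (D0 (partial1 h) _ o0))))).
exact: (etrans (D0 h _ o2) (etrans e2 (congr1 -%R (esym (D0 (partial2 h) _ o0))))).
Qed.

Lemma test_gradient D E h : open D -> test_function E h ->
  weak_gradient D h (fun x => (partial1 h x, partial2 h x)).
Proof.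
move=> oD th; have [_ s1 s2] := sqint_test (measurable_open2 oD) th.
exact: (weak_gradient_C1 oD (test_function_C1 th) s1 s2).
Qed.

Lemma test_H1 D E h : open D -> test_function E h -> H1 D h.
Proof.
move=> oD th; split; last by eexists; exact: test_gradient th.
by apply/(L2E _ oD); have [] := sqint_test (measurable_open2 oD) th.
Qed.

Lemma gradP D v : H1 D v -> weak_gradient D v (grad D v).
Proof. by move=> [_ ex]; exact: (xgetPex (fun=> 0) ex). Qed.

Lemma grad_sqint D v : open D -> H1 D v ->
  [/\ sqint mu2 D v, sqint mu2 D (fun x => (grad D v x).1) &
      sqint mu2 D (fun x => (grad D v x).2)].
Proof.
move=> oD Hv; have [/(L2E _ oD) ? _] := Hv.
by have [/(L2E _ oD) ? /(L2E _ oD) ? _] := gradP Hv.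
Qed.

Lemma subspace_H1 D : open D -> subspace (H1 D).
Proof.
move=> oD; have mD := measurable_open2 oD; split.
  have l0 : L2 D (fun=> 0) by apply/(L2E _ oD); exact: sqint0.
  split; first exact: l0.
  exists (fun=> 0); split; [exact: l0|exact: l0|].
  move=> phi _; have Z (q : R * R -> R) : \int[mu2]_(x in D) (0 * q x) = 0.
    by rewrite /Rintegral integral0_eq // => x _; rewrite mul0r.
  have Z' : 0 = - (\int[mu2]_(x in D) (0 * phi x)) by rewrite Z oppr0.
  by split; [exact: (etrans (Z (partial1 phi)) Z')|exact: (etrans (Z (partial2 phi)) Z')].
move=> c v w Hv Hw; split.
  have [sv _ _] := grad_sqint oD Hv; have [sw _ _] := grad_sqint oD Hw.
  by apply/(L2E _ oD); exact: sqint_lin.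
eexists; exact: (weak_gradient_lin c oD Hv.1 Hw.1 (gradP Hv) (gradP Hw)).
Qed.

Lemma grad_lin D (c : R) v w : open D -> H1 D v -> H1 D w ->
  {ae mu2, forall x, D x -> grad D (c *: v + w) x = c *: grad D v x + grad D w x}.
Proof.
move=> oD Hv Hw; apply: (weak_gradient_unique (v := c *: v + w)) => //.
  by apply: gradP; apply: (subspace_H1 oD).2.
exact: (weak_gradient_lin c oD Hv.1 Hw.1 (gradP Hv) (gradP Hw)).
Qed.

Definition affine (c : R) (b : R * R) (x : R * R) : R := c + edot b x.

Lemma C1_affine c b : [/\ C1 (affine c b), partial1 (affine c b) = fun=> b.1 &
  partial2 (affine c b) = fun=> b.2].
Proof.
have D1 x : derivable (affine c b) x ((1, 0) : R * R) /\ partial1 (affine c b) x = b.1.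
  case: x => s t; apply: slice1_inv.
  rewrite (_ : (fun s : R => _) = horner ((c + b.2 * t)%:P + b.1 *: 'X)); last first.
    apply/funext => y; rewrite hornerD hornerC hornerZ hornerX /affine /edot /=; ring.
  by apply: is_derive_eq; rewrite derivD derivC derivZ derivX add0r hornerZ hornerE mulr1.
have D2 x : derivable (affine c b) x ((0, 1) : R * R) /\ partial2 (affine c b) x = b.2.
  case: x => s t; apply: slice2_inv.
  rewrite (_ : (fun s : R => _) = horner ((c + b.1 * s)%:P + b.2 *: 'X)); last first.
    apply/funext => y; rewrite hornerD hornerC hornerZ hornerX /affine /edot /=; ring.
  by apply: is_derive_eq; rewrite derivD derivC derivZ derivX add0r hornerZ hornerE mulr1.
have E1 : partial1 (affine c b) = fun=> b.1 by apply/funext => x; exact: (D1 x).2.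
have E2 : partial2 (affine c b) = fun=> b.2 by apply/funext => x; exact: (D2 x).2.
split => //; split.
- move=> x; apply: cvgD; first exact: cvg_cst.
  by apply: cvgD; apply: cvgMr; [exact: cvg_fst|exact: cvg_snd].
- by move=> x; exact: (D1 x).1.
- by move=> x; exact: (D2 x).1.
- by rewrite E1 => x; exact: cvg_cst.
- by rewrite E2 => x; exact: cvg_cst.
Qed.

Lemma sqint_cst D (c : R) : measurable (D : set (plane R)) -> (mu2 D < +oo)%E ->
  sqint mu2 D (fun=> c).
Proof.
move=> mD fD; split => //; apply: measurable_bounded_integrable => //.
by exists (c ^+ 2); split => [|x cx y _]; rewrite ?num_real // ger0_norm ?sqr_ge0 // ltW.
Qed.

(** Restricted to [U], the function has the classical gradient [b] as a weak
    gradient, and weak gradients are unique. *)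
Lemma grad_affine D U v c b : open D -> (mu2 D < +oo)%E -> open U -> U `<=` D ->
  H1 D v -> (forall x, U x -> v x = affine c b x) ->
  {ae mu2, forall x, U x -> grad D v x = b}.
Proof.
move=> oD fD oU UD Hv vE; have mU := measurable_open2 oU.
have fU : (mu2 U < +oo)%E.
  apply: le_lt_trans fD; apply: le_measure => //; rewrite inE //.
  exact: measurable_open2.
have [Ca E1 E2] := C1_affine c b.
have wg : weak_gradient U v (fun=> b).
  have : weak_gradient U (affine c b) (fun x => (partial1 (affine c b) x, partial2 (affine c b) x)).
    by apply: weak_gradient_C1 => //; rewrite ?E1 ?E2; exact: sqint_cst.
  rewrite E1 E2 => -[l1 l2 ibp]; split => // phi tphi.
  have [e1 e2] := ibp _ tphi; rewrite -e1 -e2.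
  by split; apply: eq_Rintegral => x; rewrite inE => /vE ->.
exact: weak_gradient_unique oU (weak_gradient_sub oD oU UD (gradP Hv)) wg.
Qed.
End WeakGradient.

(** * The energy forms on the Sobolev space *)

#[local] Opaque partial1 partial2 grad.

Section FormsMore.
Context (R : realType) (U : lmodType R) (S : set U).
Hypothesis hS : subspace S.

Lemma sym_bilinear_lin (c : R) (p q : U -> U -> R) : sym_bilinear_on S p ->
  sym_bilinear_on S q -> sym_bilinear_on S (fun u v => c * p u v + q u v).
Proof.
move=> [ps pl] [qs ql]; split=> [u v Su Sv|u Su k v w Sv Sw].
  by rewrite ps // qs.
by rewrite pl // ql //; ring.
Qed.

(** Cauchy-Schwarz for the two nonnegative forms [p + q] and [p - q]. *)
Lemma form_dominated (p q : U -> U -> R) : sym_bilinear_on S p ->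
  sym_bilinear_on S q -> (forall u, S u -> `|q u u| <= p u u) ->
  forall u v, S u -> S v -> `|q u v| <= 2 * (Num.sqrt (p u u) * Num.sqrt (p v v)).
Proof.
move=> hp hq qp u v Su Sv.
have hqp := sym_bilinear_lin 1 hq hp; have hpq := sym_bilinear_lin (-1) hq hp.
have P1 : psd_on S (fun u v => 1 * q u v + p u v).
  by move=> x Sx; have := qp x Sx; rewrite ler_norml => /andP[? ?]; lra.
have P2 : psd_on S (fun u v => -1 * q u v + p u v).
  by move=> x Sx; have := qp x Sx; rewrite ler_norml => /andP[? ?]; lra.
have p0 x : S x -> 0 <= p x x by move=> Sx; apply: le_trans (qp x Sx).
set X := Num.sqrt (p u u) * Num.sqrt (p v v).
have X0 : 0 <= X by rewrite mulr_ge0 ?sqrtr_ge0.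
have XX : X ^+ 2 = p u u * p v v by rewrite exprMn !sqr_sqrtr ?p0.
have H t : t ^+ 2 <= (2 * p u u) * (2 * p v v) -> `|t| <= 2 * X.
  move=> h; rewrite -(@ler_pXn2r _ 2) ?nnegrE ?mulr_ge0 //.
  by rewrite real_normK ?num_real // (le_trans h) // exprMn XX; lra.
have h1 : `|1 * q u v + p u v| <= 2 * X.
  apply: H; apply: le_trans (form_cauchy_schwarz hS hqp P1 Su Sv) _.
  have := qp u Su; have := qp v Sv; rewrite !ler_norml => /andP[? ?] /andP[? ?].
  by apply: ler_pM; rewrite ?(P1 u Su) ?(P1 v Sv) //; lra.
have h2 : `|-1 * q u v + p u v| <= 2 * X.
  apply: H; apply: le_trans (form_cauchy_schwarz hS hpq P2 Su Sv) _.
  have := qp u Su; have := qp v Sv; rewrite !ler_norml => /andP[? ?] /andP[? ?].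
  by apply: ler_pM; rewrite ?(P2 u Su) ?(P2 v Sv) //; lra.
by move: h1 h2; rewrite !ler_norml => /andP[? ?] /andP[? ?]; apply/andP; split; lra.
Qed.
End FormsMore.

Section EnergyForms.
Context (R : realType).
Implicit Types (D : set (R * R)) (a v w : R * R -> R).
Notation mu2 := (@leb2 R).

Definition l2form D v w : R := \int[mu2]_(x in D) (v x * w x).

Definition eform D a v w : R :=
  \int[mu2]_(x in D) (a x * edot (grad D v x) (grad D w x)).

Definition hform D v w : R := l2form D v w + eform D (fun=> 1) v w.

Lemma eform_integrable D a v w : open D -> ess_bounded mu2 D a -> H1 D v -> H1 D w ->
  mu2.-integrable D (EFin \o (fun x => a x * edot (grad D v x) (grad D w x))).
Proof.
move=> oD ba Hv Hw; have mD := measurable_open2 oD.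
have [_ v1 v2] := grad_sqint oD Hv; have [_ w1 w2] := grad_sqint oD Hw.
have i1 := sqint_mul mD ba v1 w1; have i2 := sqint_mul mD ba v2 w2.
have := integrableD mD i1 i2; apply: eq_integrable => // x _.
by rewrite /= -EFinD /edot mulrDr.
Qed.

Lemma l2form_integrable D v w : open D -> H1 D v -> H1 D w ->
  mu2.-integrable D (EFin \o (fun x => v x * w x)).
Proof.
move=> oD Hv Hw; have mD := measurable_open2 oD.
have [sv _ _] := grad_sqint oD Hv; have [sw _ _] := grad_sqint oD Hw.
exact: sqint_mul1.
Qed.

Lemma edotC (p q : R * R) : edot p q = edot q p.
Proof. by rewrite /edot ![p.1 * _]mulrC ![p.2 * _]mulrC. Qed.

Lemma edot_lin (c : R) (p q r : R * R) : edot p (c *: q + r) = c * edot p q + edot p r.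
Proof.
case: p => p1 p2; case: q => q1 q2; case: r => r1 r2.
by rewrite /edot /= /GRing.scale /=; ring.
Qed.

Lemma edot_ge0 (p : R * R) : 0 <= edot p p.
Proof. by rewrite /edot addr_ge0 // -expr2 sqr_ge0. Qed.

Lemma eform_bilinear D a : open D -> ess_bounded mu2 D a ->
  sym_bilinear_on (H1 D) (eform D a).
Proof.
move=> oD ba; have mD := measurable_open2 oD; split=> [v w Hv Hw|v Hv c w z Hw Hz].
  by apply: eq_Rintegral => x _; rewrite edotC.
have iw := eform_integrable oD ba Hv Hw; have iz := eform_integrable oD ba Hv Hz.
have Hwz := (subspace_H1 oD).2 c w z Hw Hz.
rewrite -[RHS](Rintegral_lin c mD iw iz).
apply: ae_eq_Rintegral => //.
- have := measurable_int _ (eform_integrable oD ba Hv Hwz).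
  by move/measurable_EFinP.
- apply: measurable_funD.
    by apply: measurable_funM => //; have := measurable_int _ iw; move/measurable_EFinP.
  by have := measurable_int _ iz; move/measurable_EFinP.
- apply: aeS (grad_lin c oD Hw Hz) => x gx Dx.
  by rewrite (gx Dx) edot_lin mulrDr mulrCA.
Qed.

Lemma l2form_bilinear D : open D -> sym_bilinear_on (H1 D) (l2form D).
Proof.
move=> oD; have mD := measurable_open2 oD; split=> [v w Hv Hw|v Hv c w z Hw Hz].
  by apply: eq_Rintegral => x _; rewrite mulrC.
have iw := l2form_integrable oD Hv Hw; have iz := l2form_integrable oD Hv Hz.
rewrite -[RHS](Rintegral_lin c mD iw iz).
apply: eq_Rintegral => x _.
by change (v x * (c * w x + z x) = c * (v x * w x) + v x * z x); rewrite mulrDr mulrCA.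
Qed.

Lemma ess_bounded1 D : open D -> ess_bounded mu2 D (fun=> 1).
Proof. by move=> oD; exact: (@ess_bounded_cst _ _ _ mu2 _ 1 (measurable_open2 oD)). Qed.

Lemma hform_bilinear D : open D -> sym_bilinear_on (H1 D) (hform D).
Proof.
move=> oD; have := sym_bilinear_lin 1 (l2form_bilinear oD) (eform_bilinear oD (ess_bounded1 oD)).
by congr sym_bilinear_on; apply/funext => v; apply/funext => w; rewrite mul1r.
Qed.

Lemma eform_le D a b v : open D -> ess_bounded mu2 D a -> ess_bounded mu2 D b ->
  {ae mu2, forall x, D x -> a x <= b x} -> H1 D v -> eform D a v v <= eform D b v v.
Proof.
move=> oD ba bb ab Hv; have mD := measurable_open2 oD.
have ia := eform_integrable oD ba Hv Hv; have ib := eform_integrable oD bb Hv Hv.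
rewrite -subr_ge0 /eform -RintegralB //.
pose h x := (b x - a x) * edot (grad D v x) (grad D v x).
have ih : mu2.-integrable D (EFin \o h).
  have := integrableB mD ib ia; apply: eq_integrable => // x _.
  by rewrite /= -EFinB /h mulrBl.
rewrite (@ae_eq_Rintegral _ _ _ mu2 D _ (fun x => `|h x|)) //.
- by apply: Rintegral_ge0 => x _.
- by have := measurable_int _ (integrableB mD ib ia); move/measurable_EFinP.
- by apply: measurableT_comp => //; have := measurable_int _ ih; move/measurable_EFinP.
- apply: aeS ab => x abx Dx; rewrite ger0_norm /h ?mulrBl //.
  by rewrite -mulrBl mulr_ge0 ?edot_ge0 // subr_ge0 abx.
Qed.

Lemma eform_cst D (c : R) v : open D -> H1 D v ->
  eform D (fun=> c) v v = c * eform D (fun=> 1) v v.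
Proof.
move=> oD Hv; rewrite /eform -RintegralZl //.
- by apply: eq_Rintegral => x _; rewrite mul1r.
- exact: measurable_open2.
- exact: (eform_integrable oD (ess_bounded1 oD) Hv Hv).
Qed.

Lemma eform1_ge0 D v : 0 <= eform D (fun=> 1) v v.
Proof. by apply: Rintegral_ge0 => x _; rewrite mul1r edot_ge0. Qed.

Lemma l2form_ge0 D v : 0 <= l2form D v v.
Proof. by apply: Rintegral_ge0 => x _; rewrite -expr2 sqr_ge0. Qed.

Lemma hform_psd D : psd_on (H1 D) (hform D).
Proof. by move=> v _; rewrite addr_ge0 ?l2form_ge0 ?eform1_ge0. Qed.

Lemma eform_abs_le D a (M : R) v : open D -> ess_bounded mu2 D a ->
  {ae mu2, forall x, D x -> `|a x| <= M} -> H1 D v ->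
  `|eform D a v v| <= M * eform D (fun=> 1) v v.
Proof.
move=> oD ba aM Hv; have mD := measurable_open2 oD.
rewrite -(eform_cst M) // ler_norml; apply/andP; split; last first.
  apply: eform_le => //; first exact: ess_bounded_cst.
  by apply: aeS aM => x h Dx; rewrite (le_trans (ler_norm _)) ?h.
rewrite [X in - X]eform_cst // -mulNr -eform_cst //.
apply: eform_le => //; first exact: ess_bounded_cst.
by apply: aeS aM => x h Dx; move: (h Dx); rewrite ler_norml => /andP[].
Qed.

Lemma H1norm_sq D v : open D -> H1 D v -> H1norm D v ^+ 2 = hform D v v.
Proof.
move=> oD Hv; rewrite /H1norm sqr_sqrtr; last first.
  by apply: Rintegral_ge0 => x _; rewrite addr_ge0 ?sqr_ge0 ?edot_ge0.
rewrite /hform /l2form /eform -RintegralD //.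
- by apply: eq_Rintegral => x _; rewrite mul1r expr2.
- exact: measurable_open2.
- exact: l2form_integrable.
- exact: (eform_integrable oD (ess_bounded1 oD)).
Qed.

Lemma H1norm_ge0 D v : 0 <= H1norm D v.
Proof. exact: sqrtr_ge0. Qed.

Lemma H1normE D v : open D -> H1 D v -> H1norm D v = Num.sqrt (hform D v v).
Proof. by move=> oD Hv; rewrite -H1norm_sq // sqrtr_sqr ger0_norm ?H1norm_ge0. Qed.

Lemma H1normD D v w : open D -> H1 D v -> H1 D w ->
  H1norm D (v + w) <= H1norm D v + H1norm D w.
Proof.
move=> oD Hv Hw; rewrite !H1normE //; last exact: (subspaceD (subspace_H1 oD)).
exact: (form_sqrtD (subspace_H1 oD) (hform_bilinear oD) (@hform_psd D)).
Qed.

Lemma H1normZ D (c : R) v : open D -> H1 D v -> H1norm D (c *: v) = `|c| * H1norm D v.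
Proof.
move=> oD Hv; rewrite !H1normE //; last exact: (subspaceZ (subspace_H1 oD)).
exact: (form_sqrtZ (subspace_H1 oD) (hform_bilinear oD)).
Qed.

Lemma Ck_lin (c : R) (k : nat) v w : Ck k v -> Ck k w -> Ck k (c *: v + w).
Proof.
elim: k v w => [|k IH] v w /=.
  by move=> cv cw x; apply: cvgD; [apply: cvgMr|]; [exact: cv|exact: cw].
move=> [v1 v2 Cv1 Cv2] [w1 w2 Cw1 Cw2]; split.
- by move=> x; apply: derivableD => //; exact: derivableZ.
- by move=> x; apply: derivableD => //; exact: derivableZ.
- rewrite (_ : partial1 _ = c *: partial1 v + partial1 w); first exact: IH.
  apply/funext => x; rewrite fctE [LHS]deriveD ?deriveZ //.
  exact: derivableZ.
- rewrite (_ : partial2 _ = c *: partial2 v + partial2 w); first exact: IH.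
  apply/funext => x; rewrite fctE [LHS]deriveD ?deriveZ //.
  exact: derivableZ.
Qed.

Lemma test_lin D (c : R) v w : test_function D v -> test_function D w ->
  test_function D (c *: v + w).
Proof.
move=> [Cv [K [cK KD v0]]] [Cw [L [cL LD w0]]]; split.
  by move=> k; exact: Ck_lin.
exists (K `|` L); split; first exact: compactU.
  by move=> x [/KD|/LD].
by move=> x /not_orP[/v0 vx /w0 wx]; change (c * v x + w x = 0); rewrite vx wx mulr0 addr0.
Qed.

Lemma test0 D : test_function D 0.
Proof.
split; last by exists set0; split => //; exact: compact0.
elim=> [|k IH] /=; first by move=> x; exact: cvg_cst.
have d0 (e x : R * R) : derivable (0 : R * R -> R) x e by exact: derivable_cst.
split => //; rewrite (_ : _ 0 = 0) //; apply/funext => x; exact: derive_cst.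
Qed.

Lemma subspace_H10 D : open D -> subspace (H10 D).
Proof.
move=> oD; have hS := subspace_H1 oD; split.
  split; first exact: (subspace0 hS).
  move=> eps eps0; exists 0; first exact: test0.
  rewrite (_ : _ \- _ = 0 *: (0 : R * R -> R)); last first.
    by apply/funext => x; change (0 - 0 = 0 * 0 :> R); rewrite mulr0 subrr.
  by rewrite H1normZ ?normr0 ?mul0r //; exact: (subspace0 hS).
move=> c v w [Hv av] [Hw aw]; split; first exact: hS.2.
move=> eps eps0; have cc : 0 < `|c| + 1 by rewrite ltr_wpDl.
have e1 : 0 < eps / 2 / (`|c| + 1) by rewrite !divr_gt0.
have e2 : 0 < eps / 2 by rewrite divr_gt0.
have [p tp hp] := av _ e1; have [q tq hq] := aw _ e2.
exists (c *: p + q); first exact: test_lin.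
have Hp := test_H1 oD tp; have Hq := test_H1 oD tq.
have Hvp : H1 D (v - p) by exact: (subspaceB hS).
have Hwq : H1 D (w - q) by exact: (subspaceB hS).
rewrite (_ : _ \- _ = c *: (v - p) + (w - q)); last first.
  by apply/funext => x; change (c * v x + w x - (c * p x + q x) = c * (v x - p x) + (w x - q x)); ring.
apply: le_lt_trans (H1normD oD (subspaceZ hS c Hvp) Hwq) _.
rewrite H1normZ // [eps](splitr eps) ltr_leD //; last exact: ltW.
apply: le_lt_trans (_ : (`|c| + 1) * H1norm D (v - p) < _).
  by rewrite ler_wpM2r ?H1norm_ge0 // lerDl.
by rewrite mulrC -ltr_pdivlMr.
Qed.
End EnergyForms.

(** * Integrating forms over the parameter domain *)

Lemma eform_le_hform (R : realType) (D : set (R * R)) (v : R * R -> R) :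
  eform D (fun=> 1) v v <= hform D v v.
Proof. by rewrite /hform lerDr l2form_ge0. Qed.

Lemma hformE (R : realType) (D : set (R * R)) (v w : R * R -> R) :
  hform D v w = l2form D v w + eform D (fun=> 1) v w.
Proof. by []. Qed.

#[local] Opaque partial1 partial2 grad eform l2form hform H1norm.

Lemma form_dominated_scaled (R : realType) (U : lmodType R) (S : set U)
    (p q : U -> U -> R) (M : R) : subspace S ->
  sym_bilinear_on S p -> sym_bilinear_on S q -> psd_on S p -> 0 <= M ->
  (forall u, S u -> `|q u u| <= M * p u u) ->
  forall u v, S u -> S v -> `|q u v| <= 2 * M * (Num.sqrt (p u u) * Num.sqrt (p v v)).
Proof.
move=> hS [ps pl] hq p0 M0 qM u v Su Sv.
have hM : sym_bilinear_on S (fun u v => M * p u v).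
  split=> [x y Sx Sy|x Sx c y z Sy Sz]; first by rewrite ps.
  by rewrite pl // mulrDr mulrCA.
apply: le_trans (form_dominated hS hM hq qM Su Sv) _.
rewrite !sqrtrM // le_eqVlt; apply/orP; left; apply/eqP.
rewrite -[X in _ = 2 * X * _](sqr_sqrtr M0); ring.
Qed.

Lemma cvg_dominated (R : realType) (u : nat -> R) (l : R) (e : nat -> R) :
  (forall k, `|l - u k| <= e k) -> e @ \oo --> (0 : R) -> u @ \oo --> l.
Proof.
move=> ue e0; apply: (@squeeze_cvgr _ _ _ _ (fun k => l - e k) (fun k => l + e k)).
- by apply: nearW => k; have := ue k; rewrite ler_distlC.
- by rewrite -[X in _ --> X]subr0; apply: cvgB => //; exact: cvg_cst.
- by rewrite -[X in _ --> X]addr0; apply: cvgD => //; exact: cvg_cst.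
Qed.

Lemma cvg_scaled_error (R : realType) (p : nat -> R) (c : R) :
  p @ \oo --> (0 : R) -> (fun k => c * p k) @ \oo --> (0 : R).
Proof. by move=> p0; rewrite -[X in _ --> X](mulr0 c); exact: cvgMr. Qed.

Lemma cvg_product_error (R : realType) (p q : nat -> R) (a b c : R) :
  p @ \oo --> (0 : R) -> q @ \oo --> (0 : R) ->
  (fun k => c * (p k * a + (b + p k) * q k)) @ \oo --> (0 : R).
Proof.
move=> p0 q0; apply: cvg_scaled_error.
have E : 0 * a + (b + 0) * 0 = 0 :> R by ring.
rewrite -[X in _ --> X]E; apply: cvgD; first exact: cvgMl.
by apply: cvgM => //; apply: cvgD => //; exact: cvg_cst.
Qed.

Lemma form_bound_real (R : realType) (c b p q C : R) : `|c| <= 1 ->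
  `|b| <= C * (p * q) -> 0 <= p -> 0 <= q ->
  `|c * b| <= `| `|C| * (1 * p ^+ 2 + q ^+ 2)|.
Proof.
move=> c1 bC p0 q0; rewrite mul1r [leRHS]ger0_norm ?mulr_ge0 ?addr_ge0 ?sqr_ge0 //.
rewrite normrM; apply: le_trans (_ : 1 * `|b| <= _); first by rewrite ler_wpM2r.
rewrite mul1r (le_trans bC) //.
apply: le_trans (_ : `|C| * (p * q) <= _); first by rewrite ler_wpM2r ?mulr_ge0 ?ler_norm.
by rewrite ler_wpM2l //; nra.
Qed.

Lemma functional_bound_real (R : realType) (b p C : R) :
  `|b| <= C * p -> 0 <= p -> `|b| <= `| `|C| * (1 * p ^+ 2 + 1)|.
Proof.
move=> bC p0; rewrite mul1r [leRHS]ger0_norm ?mulr_ge0 ?addr_ge0 ?sqr_ge0 //.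
rewrite (le_trans bC) //.
apply: le_trans (_ : `|C| * p <= _); first by rewrite ler_wpM2r ?ler_norm.
by rewrite ler_wpM2l //; nra.
Qed.

Section Bochner.
Context (R : realType) (D : set (R * R)) (pi : probability (param R) R).
Hypothesis oD : open D.
Notation fn := (R * R -> R).
Notation Gam := (@Gamma R).
Implicit Types (v w z : param R -> fn) (b : fn -> fn -> R).

Lemma measurable_coord (m : nat) : measurable_fun (setT : set (param R)) (fun y => y m : R).
Proof.
move=> _ B mB; rewrite setTI; apply: sub_sigma_algebra.
by exists m, B.
Qed.

Lemma measurable_Gamma : measurable Gam.
Proof.
rewrite (_ : Gam = \bigcap_m (fun y : param R => y m) @^-1` `[-1, 1]%classic).
  apply: bigcapT_measurable => m; rewrite -[X in measurable X]setTI.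
  by apply: measurable_coord => //; exact: measurable_itv.
by apply/seteqP; split=> y h m; [move=> _ /=; rewrite in_itv /=|have := h m I; rewrite /= in_itv /=].
Qed.

Definition bounded_form b : Prop := sym_bilinear_on (H10 D) b /\
  exists C : R, forall v w : fn, H10 D v -> H10 D w -> `|b v w| <= C * (H1norm D v * H1norm D w).

Definition bounded_functional (f : fn -> R) : Prop := linear_on (H10 D) f /\
  exists C : R, forall v : fn, H10 D v -> `|f v| <= C * H1norm D v.

Lemma H10_H1 (v : fn) : H10 D v -> H1 D v.
Proof. by case. Qed.

Lemma H10_subspace : subspace (H10 D).
Proof. exact: subspace_H10. Qed.

Lemma sym_bilinear_H10 b : sym_bilinear_on (H1 D) b -> sym_bilinear_on (H10 D) b.
Proof.
move=> [bs bl]; split=> [v w Hv Hw|v Hv c w z Hw Hz].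
  by apply: bs; exact: H10_H1.
by apply: bl; exact: H10_H1.
Qed.

Lemma bounded_form_diag b (M : R) : sym_bilinear_on (H1 D) b -> 0 <= M ->
  (forall v : fn, H1 D v -> `|b v v| <= M * hform D v v) -> bounded_form b.
Proof.
move=> hb M0 bM; split; first exact: sym_bilinear_H10.
exists (2 * M) => v w /H10_H1 Hv /H10_H1 Hw.
rewrite (H1normE oD Hv) (H1normE oD Hw).
exact: (form_dominated_scaled (subspace_H1 oD) (hform_bilinear oD) hb (@hform_psd R D) M0 bM Hv Hw).
Qed.

Lemma eform_bounded (a : fn) : ess_bounded (@leb2 R) D a -> bounded_form (eform D a).
Proof.
move=> ba; have [_ [M aM]] := ba.
apply: (@bounded_form_diag _ `|M|); [exact: eform_bilinear|exact: normr_ge0|].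
move=> v Hv; apply: le_trans (_ : `|M| * eform D (fun=> 1) v v <= _).
  apply: (eform_abs_le oD ba _ Hv); apply: aeS aM => x h Dx.
  exact: le_trans (h Dx) (ler_norm M).
apply: ler_wpM2l (normr_ge0 M) _ _ _; exact: eform_le_hform.
Qed.

Lemma hform_bounded : bounded_form (hform D).
Proof.
apply: (@bounded_form_diag _ 1); [exact: hform_bilinear|exact: ler01|].
by move=> v Hv; rewrite mul1r (ger0_norm (hform_psd Hv)).
Qed.

Lemma simple_H10E (s : param R -> fn) : simple_H10 D s ->
  exists (n : nat) (A : 'I_n -> set (param R)) (h : 'I_n -> fn),
    [/\ forall i, measurable (A i), forall i, H10 D (h i) &
      forall y, s y = \sum_(i < n) (\1_(A i) y : R) *: h i].
Proof.
move=> [n [A [h [mA Hh sE]]]]; exists n, A, h; split => // y.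
by apply/funext => x; rewrite sE fct_sumE.
Qed.

Lemma simple_in (s : param R -> fn) y : simple_H10 D s -> H10 D (s y).
Proof.
move=> /simple_H10E[n [A [h [mA Hh ->]]]].
exact: (subspace_sum H10_subspace _ (fun i _ => Hh i)).
Qed.

Lemma measurable_form_simple b (s t : param R -> fn) : bounded_form b ->
  simple_H10 D s -> simple_H10 D t ->
  measurable_fun setT (fun y : param R => b (s y) (t y)).
Proof.
move=> [[bs bl] _] /simple_H10E[n [A [h [mA Hh sE]]]] /simple_H10E[m [B [k [mB Hk tE]]]].
have E y : b (s y) (t y) =
    \sum_(i < n) \sum_(j < m) (\1_(A i) y * (\1_(B j) y * b (h i) (k j))).
  have Hs : H10 D (s y) by rewrite sE; exact: (subspace_sum H10_subspace _ (fun i _ => Hh i)).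
  have Ht : H10 D (t y) by rewrite tE; exact: (subspace_sum H10_subspace _ (fun i _ => Hk i)).
  rewrite (bs _ _ Hs Ht) [in LHS]sE (linear_on_sum H10_subspace (bl _ Ht) _ (fun i _ => Hh i)).
  apply: eq_bigr => i _; rewrite (bs _ _ Ht (Hh i)) tE.
  by rewrite (linear_on_sum H10_subspace (bl _ (Hh i)) _ (fun i _ => Hk i)) mulr_sumr.
rewrite (funext E); apply: measurable_sum => i; apply: measurable_sum => j.
have mk : measurable_fun setT (fun y : param R => \1_(B j) y * b (h i) (k j)).
  exact: (@measurable_funM _ _ _ setT (\1_(B j)) (cst (b (h i) (k j))) (measurable_indic (mB j)) (measurable_cst _)).
exact: (@measurable_funM _ _ _ setT (\1_(A i)) _ (measurable_indic (mA i)) mk).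
Qed.

Lemma measurable_functional_simple (f : fn -> R) (s : param R -> fn) :
  bounded_functional f -> simple_H10 D s ->
  measurable_fun setT (fun y : param R => f (s y)).
Proof.
move=> [fl _] /simple_H10E[n [A [h [mA Hh sE]]]].
have E y : f (s y) = \sum_(i < n) (\1_(A i) y * f (h i)).
  by rewrite sE (linear_on_sum H10_subspace fl _ (fun i _ => Hh i)).
rewrite (funext E); apply: measurable_sum => i.
exact: (@measurable_funM _ _ _ setT (\1_(A i)) (cst (f (h i))) (measurable_indic (mA i)) (measurable_cst _)).
Qed.

(** A bounded functional is continuous for the norm, so that simple approximations
    of [v] give approximations of [f \o v] by simple functions. *)
Lemma measurable_functional f v : bounded_functional f -> V D pi v ->
  measurable_fun Gam (fun y => f (v y)).
Proof.
move=> bf [Hv [s [ss sv]] _].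
apply: (@measurable_fun_cvg _ _ _ _ (fun k y => f (s k y))).
  by move=> k; apply: measurable_funTS; exact: measurable_functional_simple.
move=> y Gy; have [fl [C fC]] := bf.
apply: (cvg_dominated (e := fun k => C * H1norm D (v y \- s k y))).
  move=> k; have Hs := simple_in y (ss k).
  rewrite -(linear_onB H10_subspace fl (Hv y Gy) Hs); apply: fC.
  exact: (subspaceB H10_subspace (Hv y Gy) Hs).
exact: cvg_scaled_error (sv y Gy).
Qed.

Lemma measurable_form b v w : bounded_form b -> V D pi v -> V D pi w ->
  measurable_fun Gam (fun y => b (v y) (w y)).
Proof.
move=> bb [Hv [s [ss sv]] _] [Hw [t [st tw]] _].
apply: (@measurable_fun_cvg _ _ _ _ (fun k y => b (s k y) (t k y))).
  by move=> k; apply: measurable_funTS; exact: measurable_form_simple.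
move=> y Gy; have [[bs bl] [C bC]] := bb.
pose N := H1norm D; pose p k := N (v y \- s k y); pose q k := N (w y \- t k y).
have [p0 q0] : p @ \oo --> (0 : R) /\ q @ \oo --> (0 : R) by split; [exact: sv|exact: tw].
apply: (cvg_dominated (e := fun k => `|C| * (p k * N (w y) + (N (v y) + p k) * q k))).
  move=> k; have Hs := simple_in y (ss k); have Ht := simple_in y (st k).
  have Hvy := Hv y Gy; have Hwy := Hw y Gy.
  have Hvs : H10 D (v y - s k y) by exact: (subspaceB H10_subspace Hvy Hs).
  have Hwt : H10 D (w y - t k y) by exact: (subspaceB H10_subspace Hwy Ht).
  have -> : b (v y) (w y) - b (s k y) (t k y) =
      b (v y - s k y) (w y) + b (s k y) (w y - t k y).
    rewrite (linear_onB H10_subspace (bl _ Hs) Hwy Ht) (bs _ _ Hvs Hwy).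
    rewrite (linear_onB H10_subspace (bl _ Hwy) Hvy Hs) (bs _ _ Hwy Hvy) (bs _ _ Hwy Hs).
    by rewrite addrA subrK.
  have Nn (z : fn) : 0 <= N z by exact: H1norm_ge0.
  have bC' (z1 z2 : fn) : H10 D z1 -> H10 D z2 -> `|b z1 z2| <= `|C| * (N z1 * N z2).
    by move=> H1' H2'; apply: le_trans (bC _ _ H1' H2') _; rewrite ler_wpM2r ?mulr_ge0 ?ler_norm.
  apply: le_trans (ler_normD _ _) _; rewrite mulrDr; apply: lerD; first exact: (bC' _ _ Hvs Hwy).
  apply: le_trans (bC' _ _ Hs Hwt) _; rewrite ler_wpM2l // ler_wpM2r ?Nn //.
  have -> : s k y = v y + (-1) *: (v y - s k y).
    by apply/funext => x; change (s k y x = v y x + -1 * (v y x - s k y x)); ring.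
  have Hm : H1 D (-1 *: (v y - s k y)).
    exact: (subspaceZ (subspace_H1 oD) (-1) (H10_H1 Hvs)).
  apply: le_trans (H1normD oD (H10_H1 Hvy) Hm) _.
  by rewrite lerD2l (H1normZ _ oD (H10_H1 Hvs)) normrN1 mul1r.
exact: cvg_product_error p0 q0.
Qed.

Lemma V_norm_integrable v : V D pi v ->
  pi.-integrable Gam (EFin \o (fun y => H1norm D (v y) ^+ 2)).
Proof.
move=> Vv; have [Hv _ fin] := Vv; apply/integrableP; split.
  apply/measurable_EFinP.
  apply: eq_measurable_fun (measurable_form hform_bounded Vv Vv) => y /set_mem Gy.
  by rewrite /= H1norm_sq //; exact/H10_H1/Hv.
apply: le_lt_trans fin; rewrite le_eqVlt; apply/orP; left; apply/eqP.
by apply: eq_integral => y _; rewrite /= ger0_norm ?sqr_ge0.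
Qed.

Lemma form_integrable b v w (c : param R -> R) : bounded_form b -> V D pi v -> V D pi w ->
  measurable_fun Gam c -> (forall y, Gam y -> `|c y| <= 1) ->
  pi.-integrable Gam (EFin \o (fun y => c y * b (v y) (w y))).
Proof.
move=> bb Vv Vw mc c1; have [_ [C bC]] := bb.
have i := integrable_lin 1 measurable_Gamma (V_norm_integrable Vv) (V_norm_integrable Vw).
have := integrableZl measurable_Gamma `|C| i.
apply: le_integrable; first exact: measurable_Gamma.
  by apply/measurable_EFinP; apply: measurable_funM => //; exact: measurable_form.
move=> y Gy; rewrite -EFinM !abse_EFin lee_fin.
have Hv : H10 D (v y) by have [h _ _] := Vv; exact: h.
have Hw : H10 D (w y) by have [h _ _] := Vw; exact: h.
exact: (form_bound_real (c1 y Gy) (bC _ _ Hv Hw) (H1norm_ge0 D (v y)) (H1norm_ge0 D (w y))).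
Qed.

Lemma form_integrable1 b v w : bounded_form b -> V D pi v -> V D pi w ->
  pi.-integrable Gam (EFin \o (fun y => b (v y) (w y))).
Proof.
move=> bb Vv Vw.
have c1 y : Gam y -> `|1 : R| <= 1 by rewrite normr1.
have := form_integrable (c := fun=> 1) bb Vv Vw (@measurable_cst _ _ _ _ _ (1 : R)) c1.
by apply: eq_integrable; [exact: measurable_Gamma|move=> y _; rewrite /= mul1r].
Qed.

Lemma functional_integrable f v : bounded_functional f -> V D pi v ->
  pi.-integrable Gam (EFin \o (fun y => f (v y))).
Proof.
move=> bf Vv; have [_ [C fC]] := bf.
have i1 : pi.-integrable Gam (EFin \o (fun=> 1 : R)).
  apply: measurable_bounded_integrable; first exact: measurable_Gamma.
  - by apply: le_lt_trans (probability_le1 pi measurable_Gamma) _; exact: ltry.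
  - exact: measurable_cst.
  - by exists 1; split => // x x1 y _; rewrite normr1 ltW.
have i := integrable_lin 1 measurable_Gamma (V_norm_integrable Vv) i1.
have := integrableZl measurable_Gamma `|C| i.
apply: le_integrable; first exact: measurable_Gamma.
  by apply/measurable_EFinP; exact: measurable_functional.
move=> y Gy; rewrite -EFinM !abse_EFin lee_fin.
have Hv : H10 D (v y) by have [h _ _] := Vv; exact: h.
exact: (functional_bound_real (fC _ Hv) (H1norm_ge0 D (v y))).
Qed.
End Bochner.

(** * The Bochner space *)

Import HBSimple.

Section BochnerSpace.
Context (R : realType) (D : set (R * R)) (pi : probability (param R) R).
Hypothesis oD : open D.
Notation fn := (R * R -> R).
Notation Gam := (@Gamma R).
Implicit Types (v w : param R -> fn) (b : fn -> fn -> R).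

Lemma V_H10 v y : V D pi v -> Gam y -> H10 D (v y).
Proof. by move=> [h _ _]; exact: h. Qed.

Lemma V_H1 v y : V D pi v -> Gam y -> H1 D (v y).
Proof. by move=> Vv Gy; exact: H10_H1 (V_H10 Vv Gy). Qed.

Lemma simple_H10_lin (c : R) (s t : param R -> fn) :
  simple_H10 D s -> simple_H10 D t -> simple_H10 D (c *: s + t).
Proof.
move=> [n [A [h [mA Hh sE]]]] [m [B [k [mB Hk tE]]]].
exists (n + m)%N, (fun i => match fintype.split i with inl j => A j | inr j => B j end),
  (fun i => match fintype.split i with inl j => c *: h j | inr j => k j end); split.
- by move=> i; case: fintype.split.
- move=> i; case: fintype.split => j; last exact: Hk.
  exact: (subspaceZ (H10_subspace oD) c (Hh j)).
- move=> y x; change (c * s y x + t y x = \sum_(i < n + m)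
    \1_(match fintype.split i with inl j => A j | inr j => B j end) y *
    (match fintype.split i with inl j => c *: h j | inr j => k j end) x).
  rewrite big_split_ord sE tE mulr_sumr; congr (_ + _); apply: eq_bigr => i _.
    rewrite (unsplitK (inl i)); change (c * (\1_(A i) y * h i x) = \1_(A i) y * (c * h i x)).
    by rewrite mulrCA.
  by rewrite (unsplitK (inr i)).
Qed.

Lemma cvg_sum_error (u : nat -> R) (c : R) (p q : nat -> R) :
  (forall k, 0 <= u k <= c * p k + q k) ->
  p @ \oo --> (0 : R) -> q @ \oo --> (0 : R) -> u @ \oo --> (0 : R).
Proof.
move=> ue p0 q0; apply: (cvg_dominated (e := fun k => c * p k + q k)).
  by move=> k; have /andP[u0 ul] := ue k; rewrite sub0r normrN ger0_norm.
by rewrite -[X in _ --> X]addr0; apply: cvgD => //; exact: cvg_scaled_error.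
Qed.

Lemma V_lin (c : R) v w : V D pi v -> V D pi w -> V D pi (c *: v + w).
Proof.
move=> Vv Vw; have [Hv [s [ss sv]] _] := Vv; have [Hw [t [st tw]] _] := Vw.
have [hs hl] := hform_bilinear oD.
split.
- by move=> y Gy; exact: (H10_subspace oD).2 c _ _ (Hv y Gy) (Hw y Gy).
- exists (fun k => c *: s k + t k); split.
    by move=> k; exact: simple_H10_lin.
  move=> y Gy; apply: (cvg_sum_error (c := `|c|) _ (sv y Gy) (tw y Gy)) => k.
  rewrite H1norm_ge0 /=.
  have H1 : H1 D (v y \- s k y).
    exact: (subspaceB (subspace_H1 oD) (H10_H1 (Hv y Gy)) (H10_H1 (simple_in oD y (ss k)))).
  have H2 : Defs.H1 D (w y \- t k y).
    exact: (subspaceB (subspace_H1 oD) (H10_H1 (Hw y Gy)) (H10_H1 (simple_in oD y (st k)))).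
  have -> : (c *: v + w) y \- (c *: s k + t k) y = c *: (v y \- s k y) + (w y \- t k y).
    apply/funext => x; change (c * v y x + w y x - (c * s k y x + t k y x) =
      c * (v y x - s k y x) + (w y x - t k y x)); ring.
  apply: le_trans (H1normD oD (subspaceZ (subspace_H1 oD) c H1) H2) _.
  by rewrite (H1normZ c oD H1).
- have hb := hform_bounded oD.
  have i1 := form_integrable1 oD hb Vv Vv; have i2 := form_integrable1 oD hb Vw Vw.
  have i3 := form_integrable1 oD hb Vv Vw.
  have mG := @measurable_Gamma R.
  have := integrable_lin (c ^+ 2) mG i1 (integrable_lin (2 * c) mG i3 i2).
  move=> /integrableP[_]; apply: le_lt_trans.
  rewrite le_eqVlt; apply/orP; left; apply/eqP; apply: eq_integral => y /set_mem Gy.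
  have Hvy := V_H1 Vv Gy; have Hwy := V_H1 Vw Gy.
  have Hcv := subspaceZ (subspace_H1 oD) c Hvy.
  rewrite (H1norm_sq oD ((subspace_H1 oD).2 c _ _ Hvy Hwy)).
  have E : hform D (c *: v y + w y) (c *: v y + w y) = c ^+ 2 * hform D (v y) (v y)
      + (2 * c * hform D (v y) (w y) + hform D (w y) (w y)).
    rewrite (form_sqD (subspace_H1 oD) (conj hs hl) Hcv Hwy).
    rewrite (form_sqZ (subspace_H1 oD) (conj hs hl) c Hvy).
    rewrite (hs _ _ Hcv Hwy) (linear_onZ (subspace_H1 oD) (hl _ Hwy) c Hvy) (hs _ _ Hwy Hvy).
    by rewrite -addrA mulrA.
  change ((hform D (c *: v y + w y) (c *: v y + w y))%:E =
    `|(c ^+ 2 * hform D (v y) (v y) + (2 * c * hform D (v y) (w y) + hform D (w y) (w y)))%:E|%E).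
  have P := hform_psd ((subspace_H1 oD).2 c _ _ Hvy Hwy).
  by rewrite -E abse_EFin (ger0_norm P).
Qed.

(** Simple approximations of the bounded function [g], multiplied by [z]. *)
Lemma V_scalar (g : param R -> R) (z : fn) (M : R) : H10 D z ->
  measurable_fun Gam g -> (forall y, Gam y -> `|g y| <= M) ->
  V D pi (fun y => g y *: z).
Proof.
move=> Hz mg gM; have hS := H10_subspace oD; have H1z := H10_H1 Hz.
split.
- by move=> y Gy; exact: (subspaceZ hS).
- have [u uE] := approximation_sfun (@measurable_Gamma R) (proj2 (measurable_EFinP _ _) mg).
  exists (fun k y => u k y *: z); split.
    move=> k; pose r := finmap.enum_fset (fset_set (range (u k))).
    exists (size r), (fun i => u k @^-1` [set tnth (in_tuple r) i]),
      (fun i => tnth (in_tuple r) i *: z); split.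
    + move=> i; exact: measurable_funPTI.
    + move=> i; exact: (subspaceZ hS).
    + move=> y x; change (u k y * z x = \sum_(i < size r)
        \1_(u k @^-1` [set tnth (in_tuple r) i]) y * (tnth (in_tuple r) i * z x)).
      rewrite (fimfunE (u k) y) fsbig_finite //= -/r big_tnth mulr_suml.
      by apply: eq_bigr => i _; rewrite mulrA [tnth _ _ * _]mulrC.
  move=> y Gy; have /fine_cvgP[_ cu] := uE y Gy.
  apply: (cvg_sum_error (c := H1norm D z) (p := fun k => `|g y - u k y|) (q := fun=> 0)).
  + move=> k; rewrite H1norm_ge0 /= addr0.
    have -> : g y *: z \- u k y *: z = (g y - u k y) *: z.
      by apply/funext => x; change (g y * z x - u k y * z x = (g y - u k y) * z x); rewrite mulrBl.
    by rewrite (H1normZ _ oD H1z) mulrC.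
  + have : (fun k => `|g y - u k y|) @ \oo --> (`|g y - g y| : R).
      by apply: cvg_norm; apply: cvgB; [exact: cvg_cst|exact: cu].
    by rewrite subrr normr0.
  + exact: cvg_cst.
- apply: le_lt_trans (_ : (\int[pi]_(y in Gam) (`|M| ^+ 2 * H1norm D z ^+ 2)%:E < +oo)%E).
    apply: ge0_le_integral.
    + exact: measurable_Gamma.
    + by move=> y _; rewrite lee_fin sqr_ge0.
    + apply/measurable_EFinP.
      apply: (@eq_measurable_fun _ _ _ _ _ (fun y => g y ^+ 2 * H1norm D z ^+ 2)).
        move=> y /set_mem Gy; rewrite (H1normZ _ oD H1z) exprMn real_normK //.
        exact: num_real.
      apply: measurable_funM; last exact: measurable_cst.
      exact: measurable_funX.
    + exact: measurable_cst.
    + move=> y Gy; rewrite lee_fin (H1normZ _ oD H1z) exprMn ler_wpM2r ?sqr_ge0 //.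
      rewrite ler_pXn2r ?nnegrE //.
      by rewrite (le_trans (gM y Gy)) // ler_norm.
  rewrite integral_cst; last exact: measurable_Gamma.
  apply: lte_mul_pinfty; [by rewrite lee_fin mulr_ge0 ?sqr_ge0|by []|].
  by apply: le_lt_trans (probability_le1 pi (@measurable_Gamma R)) _; exact: ltry.
Qed.

Lemma subspace_V : subspace (V D pi).
Proof.
split; last exact: V_lin.
rewrite (_ : 0 = fun y => (fun=> 0 : R) y *: (0 : fn)); last first.
  by apply/funext => y; rewrite scaler0.
apply: (@V_scalar _ _ 0) => [||y _]; last by rewrite normr0.
  exact: (subspace0 (H10_subspace oD)).
exact: measurable_cst.
Qed.

Definition vform b v w : R := \int[pi]_(y in Gam) b (v y) (w y).

Lemma vform_bilinear b : bounded_form D b -> sym_bilinear_on (V D pi) (vform b).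
Proof.
move=> bb; have [[bs bl] _] := bb; split=> [v w Vv Vw|v Vv c w z Vw Vz].
  by apply: eq_Rintegral => y /set_mem Gy; exact: (bs _ _ (V_H10 Vv Gy) (V_H10 Vw Gy)).
have i1 := form_integrable1 oD bb Vv Vw; have i2 := form_integrable1 oD bb Vv Vz.
rewrite /vform -[RHS](Rintegral_lin c (@measurable_Gamma R) i1 i2).
apply: eq_Rintegral => y /set_mem Gy.
exact: (bl _ (V_H10 Vv Gy) c _ _ (V_H10 Vw Gy) (V_H10 Vz Gy)).
Qed.

Lemma vform_psd b : psd_on (H10 D) b -> psd_on (V D pi) (vform b).
Proof.
by move=> b0 v Vv; apply: Rintegral_ge0 => y Gy; exact: (b0 _ (V_H10 Vv Gy)).
Qed.

Lemma F_linear (f : fn -> R) : bounded_functional D f -> linear_on (V D pi) (F pi f).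
Proof.
move=> bf; have [fl _] := bf; move=> c v w Vv Vw.
have i1 := functional_integrable oD bf Vv; have i2 := functional_integrable oD bf Vw.
rewrite /F -[RHS](Rintegral_lin c (@measurable_Gamma R) i1 i2).
by apply: eq_Rintegral => y /set_mem Gy; exact: (fl c _ _ (V_H10 Vv Gy) (V_H10 Vw Gy)).
Qed.

(** Equality of classes in the Bochner space. *)
Definition same_class v w : Prop :=
  {ae pi, forall y, Gam y -> {ae @leb2 R, forall x, D x -> v y x = w y x}}.

Lemma H1norm_ae0 (z : fn) : H1 D z -> {ae @leb2 R, forall x, D x -> z x = 0} ->
  H1norm D z = 0.
Proof.
move=> Hz z0; have mD := measurable_open2 oD; have [sz _ _] := grad_sqint oD Hz.
have wg0 : weak_gradient D z (fun=> 0).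
  have l0 : L2 D (fun=> 0) by exact: (proj2 (L2E _ oD) (sqint0 _ mD)).
  split; [exact: l0|exact: l0|] => phi tphi.
  have [_ s1 s2] := sqint_test mD tphi.
  have Z (q : fn) : \int[@leb2 R]_(x in D) (0 * q x) = 0.
    by rewrite /Rintegral integral0_eq // => x _; rewrite mul0r.
  have Z' (q : fn) : sqint (@leb2 R) D q -> \int[@leb2 R]_(x in D) (z x * q x) = 0.
    move=> sq; apply: etrans (Z q); apply: (ae_eq_Rintegral mD).
    - exact: measurable_funM sz.1 sq.1.
    - exact: measurable_funM (@measurable_cst _ _ _ _ _ (0 : R)) sq.1.
    - by apply: aeS z0 => x zx Dx; rewrite zx.
  have Z0 : 0 = - (\int[@leb2 R]_(x in D) (0 * phi x)) by rewrite Z oppr0.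
  split; [exact: (etrans (Z' _ s1) Z0)|exact: (etrans (Z' _ s2) Z0)].
have gE := weak_gradient_unique oD (gradP Hz) wg0.
rewrite (H1normE oD Hz) (_ : hform D z z = 0) ?sqrtr0 //.
have Z : \int[@leb2 R]_(x in D) (0 : R) = 0 by rewrite /Rintegral integral0.
have E1 : l2form D z z = 0.
  apply: etrans Z; apply: (ae_eq_Rintegral mD).
  - exact: measurable_funM sz.1 sz.1.
  - exact: measurable_cst.
  - by apply: aeS z0 => x zx Dx; rewrite zx // mulr0.
have E2 : eform D (fun=> 1) z z = 0.
  apply: etrans Z; apply: (ae_eq_Rintegral mD).
  - exact: (proj1 (measurable_EFinP _ _) (measurable_int _ (eform_integrable oD (ess_bounded1 oD) Hz Hz))).
  - exact: measurable_cst.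
  - by apply: aeS gE => x gx Dx; rewrite gx // /edot /= mulr0 addr0 mulr0.
by rewrite hformE E1 E2 addr0.
Qed.

Lemma H1norm_same (p q : fn) : H1 D p -> H1 D q ->
  {ae @leb2 R, forall x, D x -> p x = q x} -> H1norm D (p - q) = 0.
Proof.
move=> Hp Hq pq; apply: H1norm_ae0; first exact: (subspaceB (subspace_H1 oD) Hp Hq).
by apply: aeS pq => x e Dx; change (p x - q x = 0); rewrite e // subrr.
Qed.

Lemma vform_same b v v' w : bounded_form D b -> V D pi v -> V D pi v' -> V D pi w ->
  same_class v v' -> vform b v w = vform b v' w.
Proof.
move=> bb Vv Vv' Vw vv'; have [[bs bl] [C bC]] := bb.
apply: (ae_eq_Rintegral (@measurable_Gamma R)).
- exact: (measurable_form oD bb Vv Vw).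
- exact: (measurable_form oD bb Vv' Vw).
apply: aeS vv' => y e Gy; have {}e := e Gy.
have N0 := H1norm_same (V_H1 Vv Gy) (V_H1 Vv' Gy) e.
have Hd := subspaceB (H10_subspace oD) (V_H10 Vv Gy) (V_H10 Vv' Gy).
have := bC _ _ Hd (V_H10 Vw Gy); rewrite N0 mul0r mulr0 normr_le0 => /eqP.
rewrite (bs _ _ Hd (V_H10 Vw Gy)).
rewrite (linear_onB (H10_subspace oD) (bl _ (V_H10 Vw Gy)) (V_H10 Vv Gy) (V_H10 Vv' Gy)).
rewrite (bs _ _ (V_H10 Vw Gy) (V_H10 Vv Gy)) (bs _ _ (V_H10 Vw Gy) (V_H10 Vv' Gy)).
by move/eqP; rewrite subr_eq0 => /eqP.
Qed.

End BochnerSpace.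

(** * The parametric bilinear form *)

Lemma series_dominated (R : realType) (u A : nat -> R) (c : R) :
  (forall m, `|u m| <= c * A m) -> 0 <= c -> (forall m, 0 <= A m) ->
  cvgn (series A) -> cvgn [normed series u] /\
  `|limn (series u)| <= c * limn (series A).
Proof.
move=> uA c0 A0 cA.
have cZ : cvgn (series (c *: A)) by exact: is_cvg_seriesZ.
have cu : cvgn [normed series u].
  apply: series_le_cvg cZ => [m|m|m]; first exact: normr_ge0.
    by change (0 <= c * A m); rewrite mulr_ge0.
  exact: uA.
split => //; apply: le_trans (lim_series_norm cu) _.
by have := lim_series_le cu cZ uA; rewrite lim_seriesZ.
Qed.

Section ParametricForm.
Context (R : realType) (D : set (R * R)) (pi : probability (param R) R).
Hypothesis oD : open D.
Notation fn := (R * R -> R).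
Notation Gam := (@Gamma R).
Notation mu2 := (@leb2 R).
Implicit Types (v w : param R -> fn).

Lemma Linfty_bounded (a : fn) : Linfty D a ->
  [/\ ess_bounded mu2 D a, Linfty_norm D a \is a fin_num, 0 <= fine (Linfty_norm D a) &
   {ae mu2, forall x, D x -> `|a x| <= fine (Linfty_norm D a)}].
Proof.
move=> La; have mD := measurable_open2 oD.
have [ma fa] : measurable_fun D a /\ (Linfty_norm D a < +oo)%E.
  move: La; rewrite /Linfty inE => /andP[]; rewrite inE => h; rewrite inE => f; split => //.
  by have /(measurable_restrict _ mD measurableT) := h; rewrite setTI.
have n0 : (0 <= Linfty_norm D a)%E by exact: Lnorm_ge0.
have fin : Linfty_norm D a \is a fin_num by rewrite ge0_fin_numE.
have ae : {ae mu2, forall x, D x -> `|a x| <= fine (Linfty_norm D a)}.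
  have m0 : (0 < mu2 setT)%E.
    apply: (@lt_le_trans _ _ (mu2 (osq 0 1))).
      by rewrite [X in (_ < X)%E](leb2_osq 0 ler01) lte_fin mulr1 exprn_gt0.
    by apply: le_measure; rewrite ?inE //; exact: measurable_osq.
  have E : Linfty_norm D a = ess_sup mu2 (abse \o (EFin \o (a \_ D))).
    by rewrite /Linfty_norm unlock m0.
  have := ess_sup_ge mu2 (abse \o (EFin \o (a \_ D))).
  rewrite -E; apply: aeS => x h Dx; move: h.
  by rewrite /= patchE mem_set // -{1}(fineK fin) lee_fin.
split => //; last by rewrite fine_ge0.
by split => //; exists (fine (Linfty_norm D a)).
Qed.

Definition cform (m : nat) (b : fn -> fn -> R) v w : R :=
  \int[pi]_(y in Gam) (y m * b (v y) (w y)).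

Lemma coord_le1 (m : nat) (y : param R) : Gam y -> `|y m : R| <= 1.
Proof. by move=> Gy; rewrite ler_norml; exact: Gy. Qed.

Lemma cform_integrable m b v w : bounded_form D b -> V D pi v -> V D pi w ->
  pi.-integrable Gam (EFin \o (fun y => y m * b (v y) (w y))).
Proof.
move=> bb Vv Vw; apply: (form_integrable oD bb Vv Vw); last exact: coord_le1.
by apply: measurable_funTS; exact: measurable_coord.
Qed.

Lemma cform_bilinear m b : bounded_form D b -> sym_bilinear_on (V D pi) (cform m b).
Proof.
move=> bb; have [[bs bl] _] := bb; split=> [v w Vv Vw|v Vv c w z Vw Vz].
  apply: eq_Rintegral => y /set_mem Gy.
  exact: (congr1 (fun t => y m * t) (bs _ _ (V_H10 Vv Gy) (V_H10 Vw Gy))).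
have i1 := cform_integrable m bb Vv Vw; have i2 := cform_integrable m bb Vv Vz.
rewrite /cform -[RHS](Rintegral_lin c (@measurable_Gamma R) i1 i2).
apply: eq_Rintegral => y /set_mem Gy.
have := congr1 (fun t => y m * t) (bl _ (V_H10 Vv Gy) c _ _ (V_H10 Vw Gy) (V_H10 Vz Gy)).
by move=> e; apply: etrans e _; rewrite mulrDr mulrCA.
Qed.

Lemma cform_le m b (p : fn -> fn -> R) (M : R) v : bounded_form D b -> bounded_form D p ->
  (forall z, H10 D z -> `|b z z| <= M * p z z) -> V D pi v ->
  `|cform m b v v| <= M * vform pi p v v.
Proof.
move=> bb bp bM Vv; have mG := @measurable_Gamma R.
have i := cform_integrable m bb Vv Vv; have ip := form_integrable1 oD bp Vv Vv.
apply: le_trans (le_normr_Rintegral mG i) _.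
rewrite -RintegralZl //; apply: le_Rintegral => //.
- exact: (integrable_norm i).
- by have := integrableZl mG M ip; apply: eq_integrable => // y _; rewrite /= EFinM.
- move=> y Gy; rewrite normrM; apply: le_trans (_ : 1 * `|b (v y) (v y)| <= _).
    by rewrite ler_wpM2r ?coord_le1.
  by rewrite mul1r; apply: bM; exact: V_H10 Vv Gy.
Qed.

Lemma eformE (b z1 z2 : fn) :
  eform D b z1 z2 = \int[mu2]_(x in D) (b x * edot (grad D z1 x) (grad D z2 x)).
Proof. by []. Qed.

Section Fixed.
Context (a0 : fn) (a : nat -> fn) (a0min a0max tau : R).
Hypothesis a0min0 : 0 < a0min.
Hypothesis La0 : Linfty D a0.
Hypothesis a0b : {ae mu2, forall x, D x -> a0min <= a0 x <= a0max}.
Hypothesis La : forall m, Linfty D (a m).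
Hypothesis tauE : (tau%:E = a0min^-1%:E * \sum_(0 <= m <oo) Linfty_norm D (a m))%E.

Let A m := fine (Linfty_norm D (a m)).

Lemma A_ge0 m : 0 <= A m.
Proof. by have [_ _ h _] := Linfty_bounded (La m). Qed.

Lemma A_series : series A @ \oo --> tau * a0min.
Proof.
have H0 m : (0 <= Linfty_norm D (a m))%E by exact: Lnorm_ge0.
have E : (\sum_(0 <= m <oo) Linfty_norm D (a m) = (tau * a0min)%:E)%E.
  rewrite EFinM tauE -muleA [X in (_ * X)%E]muleC muleA -EFinM mulVf ?gt_eqF //.
  by rewrite mul1e.
have E2 : (fun n => \sum_(0 <= i < n) Linfty_norm D (a i))%E = EFin \o series A.
  apply/funext => n; rewrite /series /= -sumEFin; apply: eq_bigr => m _.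
  by have [_ h _ _] := Linfty_bounded (La m); rewrite fineK.
have : (fun n => \sum_(0 <= i < n) Linfty_norm D (a i))%E @ \oo --> (tau * a0min)%:E.
  by rewrite -E; apply: is_cvg_nneseries => m _ _.
by rewrite E2 => /fine_cvg.
Qed.

Lemma tau_ge0 : 0 <= tau.
Proof.
have : (0 <= tau%:E)%E.
  rewrite tauE mule_ge0 ?lee_fin ?invr_ge0 ?(ltW a0min0) //.
  by apply: nneseries_ge0 => m _ _; exact: Lnorm_ge0.
by rewrite lee_fin.
Qed.

Let G v w := vform pi (eform D (fun=> 1)) v w.
Let ba1 := eform_bounded oD (ess_bounded1 oD).

Lemma B0E : B0 D pi a0 = vform pi (eform D a0).
Proof. by []. Qed.

Lemma a0_bounded : ess_bounded mu2 D a0.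
Proof. by have [h _ _ _] := Linfty_bounded La0. Qed.

Lemma B0_bilinear : sym_bilinear_on (V D pi) (B0 D pi a0).
Proof. by rewrite B0E; exact: (vform_bilinear pi oD (eform_bounded oD a0_bounded)). Qed.

Lemma eform_a0_ge (z : fn) : H1 D z -> a0min * eform D (fun=> 1) z z <= eform D a0 z z.
Proof.
move=> Hz; rewrite -(eform_cst a0min oD Hz).
apply: (eform_le oD (ess_bounded_cst _ _ (measurable_open2 oD)) a0_bounded _ Hz).
by apply: aeS a0b => x h Dx; have /andP[] := h Dx.
Qed.

Lemma eform_a0_le (z : fn) : H1 D z -> eform D a0 z z <= a0max * eform D (fun=> 1) z z.
Proof.
move=> Hz; rewrite -(eform_cst a0max oD Hz).
apply: (eform_le oD a0_bounded (ess_bounded_cst _ _ (measurable_open2 oD)) _ Hz).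
by apply: aeS a0b => x h Dx; have /andP[] := h Dx.
Qed.

Lemma eform_a0_ge0 (z : fn) : H1 D z -> 0 <= eform D a0 z z.
Proof.
by move=> Hz; apply: le_trans (eform_a0_ge Hz); rewrite mulr_ge0 ?eform1_ge0 ?(ltW a0min0).
Qed.

Lemma B0_psd : psd_on (V D pi) (B0 D pi a0).
Proof. by rewrite B0E; apply: vform_psd => z /H10_H1; exact: eform_a0_ge0. Qed.

Lemma G_le_B0 v : V D pi v -> a0min * G v v <= B0 D pi a0 v v.
Proof.
move=> Vv; have mG := @measurable_Gamma R.
have i1 := form_integrable1 oD ba1 Vv Vv.
have i0 := form_integrable1 oD (eform_bounded oD a0_bounded) Vv Vv.
rewrite B0E /G /vform -RintegralZl //; apply: le_Rintegral => //.
- by have := integrableZl mG a0min i1; apply: eq_integrable => // y _; rewrite /= EFinM.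
- by move=> y Gy; apply: eform_a0_ge; exact: V_H1 Vv Gy.
Qed.

Lemma G_psd : psd_on (V D pi) G.
Proof. by apply: vform_psd => z _; exact: eform1_ge0. Qed.

Let Bm m := cform m (eform D (a m)).

Lemma Bm_bounded m : bounded_form D (eform D (a m)).
Proof. by have [h _ _ _] := Linfty_bounded (La m); exact: eform_bounded. Qed.

Lemma Bm_diag m v : V D pi v -> `|Bm m v v| <= A m * G v v.
Proof.
move=> Vv; apply: (cform_le m (Bm_bounded m) ba1 _ Vv) => z /H10_H1 Hz.
have [h _ _ aA] := Linfty_bounded (La m); exact: (eform_abs_le oD h aA Hz).
Qed.

Lemma Bm_le m v w : V D pi v -> V D pi w ->
  `|Bm m v w| <= 2 * (Num.sqrt (G v v) * Num.sqrt (G w w)) * A m.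
Proof.
move=> Vv Vw.
have := form_dominated_scaled (subspace_V pi oD) (vform_bilinear pi oD ba1)
  (cform_bilinear m (Bm_bounded m)) G_psd (A_ge0 m) (@Bm_diag m) Vv Vw.
by move=> h; apply: le_trans h _; rewrite -/(G v v) -/(G w w) mulrAC.
Qed.

Lemma cvg_Bm v w : V D pi v -> V D pi w -> cvgn (series (fun m => Bm m v w)).
Proof.
move=> Vv Vw; have cA : cvgn (series A) by apply/cvg_ex; eexists; exact: A_series.
have c0 : 0 <= 2 * (Num.sqrt (G v v) * Num.sqrt (G w w)) by rewrite !mulr_ge0 ?sqrtr_ge0.
by have [/normed_cvg] := series_dominated (fun m => Bm_le m Vv Vw) c0 A_ge0 cA.
Qed.

Lemma BE v w : V D pi v -> V D pi w ->
  B D pi a0 a v w = B0 D pi a0 v w + limn (series (fun m => Bm m v w)).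
Proof.
move=> Vv Vw; rewrite /B; congr (_ + limn (series _)); apply/funext => m.
apply: eq_Rintegral => y /set_mem Gy; rewrite eformE -RintegralZl.
- by apply: eq_Rintegral => x _; rewrite mulrA.
- exact: measurable_open2.
- have [h _ _ _] := Linfty_bounded (La m).
  exact: (eform_integrable oD h (V_H1 Vv Gy) (V_H1 Vw Gy)).
Qed.

Lemma B_bilinear : sym_bilinear_on (V D pi) (B D pi a0 a).
Proof.
have [s0 l0] := B0_bilinear; split=> [v w Vv Vw|v Vv c w z Vw Vz].
  have E : (fun m => Bm m v w) = (fun m => Bm m w v).
    by apply/funext => m; exact: ((cform_bilinear m (Bm_bounded m)).1 _ _ Vv Vw).
  exact: (etrans (BE Vv Vw) (etrans (congr2 +%R (s0 _ _ Vv Vw)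
    (congr1 (fun u => limn (series u)) E)) (esym (BE Vw Vv)))).
have Vcw := V_lin oD c Vw Vz.
have E : (fun m => Bm m v (c *: w + z)) = c *: (fun m => Bm m v w) + (fun m => Bm m v z).
  by apply/funext => m; exact: ((cform_bilinear m (Bm_bounded m)).2 _ Vv c _ _ Vw Vz).
have c1 := cvg_Bm Vv Vw; have c2 := cvg_Bm Vv Vz.
have EL : limn (series (fun m => Bm m v (c *: w + z))) =
    c * limn (series (fun m => Bm m v w)) + limn (series (fun m => Bm m v z)).
  apply: etrans (congr1 (fun u => limn (series u)) E) _.
  apply: etrans (lim_seriesD (is_cvg_seriesZ c1) c2) _.
  exact: (congr1 (fun t => t + limn (series (fun m => Bm m v z))) (lim_seriesZ c c1)).
apply: etrans (BE Vv Vcw) _.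
apply: etrans (congr2 +%R (l0 _ Vv c _ _ Vw Vz) EL) _.
apply: esym; apply: etrans (congr2 (fun s t => c * s + t) (BE Vv Vw) (BE Vv Vz)) _.
by rewrite mulrDr addrACA.
Qed.

Lemma B_near_B0 v : V D pi v ->
  `|B D pi a0 a v v - B0 D pi a0 v v| <= tau * B0 D pi a0 v v.
Proof.
move=> Vv; rewrite (BE Vv Vv) addrAC subrr add0r.
have cA : cvgn (series A) by apply/cvg_ex; eexists; exact: A_series.
have Bd m : `|Bm m v v| <= G v v * A m by rewrite mulrC; exact: Bm_diag.
have [_] := series_dominated Bd (G_psd Vv) A_ge0 cA.
move=> /le_trans; apply; rewrite (cvg_lim _ A_series) // mulrCA.
by apply: ler_wpM2l; [exact: tau_ge0|rewrite mulrC; exact: G_le_B0].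
Qed.

(** Each coefficient of the series is bounded by [norm (a m)] times the form of
    the constant 1, hence by [norm (a m) / a0min] times [B0]; these bounds add up
    to [tau]. *)
Lemma B_bounds v : V D pi v ->
  (1 - tau) * B0 D pi a0 v v <= B D pi a0 a v v <= (1 + tau) * B0 D pi a0 v v.
Proof.
move=> Vv; have := B_near_B0 Vv; rewrite ler_norml => /andP[h1 h2].
by apply/andP; split; lra.
Qed.

Lemma B_psd : tau < 1 -> psd_on (V D pi) (B D pi a0 a).
Proof.
move=> t1 v Vv; have /andP[h _] := B_bounds Vv; apply: le_trans h.
by rewrite mulr_ge0 ?(B0_psd Vv) // subr_ge0 ltW.
Qed.

Lemma B0_same v v' w : V D pi v -> V D pi v' -> V D pi w -> same_class D pi v v' ->
  B0 D pi a0 v w = B0 D pi a0 v' w.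
Proof. by rewrite B0E => Vv Vv' Vw; exact: (vform_same oD (eform_bounded oD a0_bounded)). Qed.

Lemma B0_diff_same v v' : V D pi v -> V D pi v' -> same_class D pi v v' ->
  B0 D pi a0 (v - v') (v - v') = 0.
Proof.
move=> Vv Vv' vv'; have hV := subspace_V pi oD; have Vd := subspaceB hV Vv Vv'.
have [s0 l0] := B0_bilinear.
rewrite (linear_onB hV (l0 _ Vd) Vv Vv') (s0 _ _ Vd Vv) (s0 _ _ Vd Vv').
by rewrite (B0_same Vv Vv' Vd vv') subrr.
Qed.

Lemma B_same v v' w : tau < 1 -> V D pi v -> V D pi v' -> V D pi w -> same_class D pi v v' ->
  B D pi a0 a v w = B D pi a0 a v' w.
Proof.
move=> t1 Vv Vv' Vw vv'; have hV := subspace_V pi oD; have Vd := subspaceB hV Vv Vv'.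
have z0 : B D pi a0 a (v - v') (v - v') = 0.
  have := B_bounds Vd; rewrite (B0_diff_same Vv Vv' vv') !mulr0 => h.
  by apply/eqP; rewrite eq_le andbC.
have [s0 l0] := B_bilinear.
have := form_null hV B_bilinear (B_psd t1) Vd Vw z0.
rewrite (s0 _ _ Vd Vw) (linear_onB hV (l0 _ Vw) Vv Vv') (s0 _ _ Vw Vv) (s0 _ _ Vw Vv').
by move/eqP; rewrite subr_eq0 => /eqP.
Qed.
End Fixed.
End ParametricForm.

(** * Orthonormality of the tensorised polynomials *)

Section Factorisation.
Context d (T : measurableType d) (R : realType) (P : {measure set T -> \bar R})
  (nu : {measure set (measurableTypeR R) -> \bar R}) (X : T -> R) (h : T -> R) (C : R).
Hypothesis mX : measurable_fun setT X.
Hypothesis mh : measurable_fun setT h.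
Hypothesis h0 : forall y, 0 <= h y.
Hypothesis HA : forall A : set (measurableTypeR R), measurable A ->
  (\int[P]_y (h y * \1_A (X y))%:E = C%:E * nu A)%E.

Import HBNNSimple.

Lemma factor_nnsfun (s : {nnsfun (measurableTypeR R) >-> R}) :
  (\int[P]_y (h y * s (X y))%:E = C%:E * \int[nu]_x (s x)%:E)%E.
Proof.
pose r := finmap.enum_fset (fset_set (range s)).
have r0 v : v \in r -> `|v| = v.
  move=> vr; have : v \in fset_set (range s) by [].
  rewrite in_fset_set // inE => -[x _ <-]; by rewrite ger0_norm.
have sE x : s x = \sum_(v <- r) `|v| * \1_(s @^-1` [set v]) x.
  rewrite (fimfunE s x) fsbig_finite //= -/r.
  by apply: eq_big_seq => v /r0 ->.
have mA (v : R) : measurable (s @^-1` [set v]) by exact: measurable_funPTI.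
have m1 (v : R) : measurable_fun setT (fun x => \1_(s @^-1` [set v]) x : R).
  exact: measurable_indic.
have LE : (\int[P]_y (h y * s (X y))%:E =
    \int[P]_y \sum_(v <- r) (`|v|%:E * (h y * \1_(s @^-1` [set v]) (X y))%:E))%E.
  apply: eq_integral => y _; rewrite sE mulr_sumr -sumEFin; apply: eq_bigr => v _.
  by rewrite -EFinM mulrCA.
have m2 v : measurable_fun setT (fun y => (h y * \1_(s @^-1` [set v]) (X y))%:E).
  by apply/measurable_EFinP; exact: (measurable_funM mh (measurableT_comp (m1 v) mX)).
have mt v : measurable_fun setT (fun y => (`|v|%:E * (h y * \1_(s @^-1` [set v]) (X y))%:E)%E).
  exact: measurable_funeM.
have t0 (v : R) y : setT y -> (0 <= `|v|%:E * (h y * \1_(s @^-1` [set v]) (X y))%:E)%E.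
  by move=> _; rewrite mule_ge0 // lee_fin mulr_ge0.
rewrite LE (ge0_integral_sum P measurableT mt t0).
have RE : (\int[nu]_x (s x)%:E = \sum_(v <- r) `|v|%:E * nu (s @^-1` [set v]))%E.
  under eq_integral do rewrite sE -sumEFin.
  have mu v : measurable_fun setT (fun x => (`|v| * \1_(s @^-1` [set v]) x : R)%:E).
    by apply/measurable_EFinP; apply: measurable_funM.
  have u0 (v : R) x : setT x -> (0 <= (`|v| * \1_(s @^-1` [set v]) x : R)%:E)%E.
    by move=> _; rewrite lee_fin mulr_ge0.
  rewrite (ge0_integral_sum nu measurableT mu u0).
  apply: eq_bigr => v _; under eq_integral do rewrite EFinM.
  rewrite ge0_integralZl_EFin //; last by apply/measurable_EFinP.
  by rewrite integral_indic // setIT.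
rewrite RE ge0_sume_distrr; last by move=> v _; rewrite mule_ge0.
apply: eq_bigr => v _; rewrite ge0_integralZl_EFin //; last first.
  by move=> y _; rewrite lee_fin mulr_ge0.
by rewrite HA // muleCA.
Qed.

(** Monotone approximation by simple functions. *)
Lemma factor_ge0 (phi : measurableTypeR R -> R) : measurable_fun setT phi -> (forall x, 0 <= phi x) ->
  (\int[P]_y (h y * phi (X y))%:E = C%:E * \int[nu]_x (phi x)%:E)%E.
Proof.
move=> mphi phi0.
have mE : measurable_fun setT (EFin \o phi) by exact/measurable_EFinP.
pose s n := nnsfun_approx measurableT mE n.
have nd x n m : (n <= m)%N -> s n x <= s m x.
  by move=> nm; have /lefP/(_ x) := nd_nnsfun_approx measurableT mE nm.
have cs x : (EFin \o (fun n => s n x)) @ \oo --> (phi x)%:E.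
  by apply: (cvg_nnsfun_approx measurableT mE) => // z _; rewrite lee_fin.
have L1 : (fun n => \int[P]_y (h y * s n (X y))%:E)%E @ \oo --> (\int[P]_y (h y * phi (X y))%:E)%E.
  rewrite [X in _ --> X](_ : _ = \int[P]_y limn (fun n => (h y * s n (X y))%:E))%E.
    apply: cvg_monotone_convergence => //.
    - move=> n; apply/measurable_EFinP.
      exact: (measurable_funM mh (measurableT_comp (@measurable_funPT _ _ _ _ (s n)) mX)).
    - by move=> n y _; rewrite lee_fin mulr_ge0.
    - by move=> y _ n m nm; rewrite lee_fin ler_wpM2l // nd.
  apply: eq_integral => y _; apply/esym/cvg_lim => //.
  apply/fine_cvgP; split; first exact: nearW.
  by apply: cvgMr; have /fine_cvgP[_] := cs (X y).
have L2 : (fun n => C%:E * \int[nu]_x (s n x)%:E)%E @ \oo --> (C%:E * \int[nu]_x (phi x)%:E)%E.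
  apply: cvgeZl => //.
  rewrite [X in _ --> X](_ : _ = \int[nu]_x limn (fun n => (s n x)%:E))%E.
    apply: cvg_monotone_convergence => //.
    - by move=> n; exact/measurable_EFinP.
    - by move=> n x _; rewrite lee_fin.
    - by move=> x _ n m nm; rewrite lee_fin nd.
  by apply: eq_integral => x _; apply/esym/cvg_lim => //; exact: cs.
have E : (fun n => \int[P]_y (h y * s n (X y))%:E)%E = (fun n => C%:E * \int[nu]_x (s n x)%:E)%E.
  by apply/funext => n; exact: factor_nnsfun.
by rewrite -(cvg_lim _ L1) // E (cvg_lim _ L2).
Qed.
End Factorisation.

Section Orthonormal.
Context (R : realType) (pi_ : nat -> probability (measurableTypeR R) R)
  (pi : probability (param R) R).
Hypothesis hpi : product_measure pi_ pi.
Notation Gam := (@Gamma R).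
Implicit Types (g : nat -> measurableTypeR R -> R) (A : nat -> set (measurableTypeR R)).

Lemma measurable_coordT (m : nat) (phi : measurableTypeR R -> R) : measurable_fun setT phi ->
  measurable_fun setT (fun y : param R => phi (y m)).
Proof. by move=> mphi; exact: (measurableT_comp mphi (@measurable_coord R m)). Qed.

Lemma measurable_prod_seq (r : seq nat) (G : nat -> param R -> R) :
  (forall m, measurable_fun setT (G m)) ->
  measurable_fun setT (fun y : param R => \prod_(m <- r) G m y).
Proof.
move=> mG; elim: r => [|m r IH].
  rewrite (_ : (fun y : param R => _) = cst 1); first exact: measurable_cst.
  by apply/funext => y; rewrite big_nil.
rewrite (_ : (fun y : param R => _) = (fun y => G m y * \prod_(m <- r) G m y)).
  exact: (measurable_funM (mG m) IH).
by apply/funext => y; rewrite big_cons.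
Qed.

Lemma int_cylinder A (N : nat) : (forall m, measurable (A m)) ->
  (\int[pi]_y (\prod_(0 <= m < N) (\1_(A m) (y m) : R))%:E =
    (\prod_(0 <= m < N) fine (pi_ m (A m)))%:E)%E.
Proof.
move=> mA; pose S := [set y : param R | forall m, (m < N)%N -> A m (y m)].
have E (y : param R) : \prod_(0 <= m < N) (\1_(A m) (y m) : R) = \1_S y.
  rewrite [RHS]indicE; have [/set_mem yS|yS] := boolP (y \in S).
    rewrite big_nat big1 // => m /andP[_ mN].
    by rewrite indicE mem_set //; exact: yS.
  move: yS; rewrite notin_setE => yS.
  have [m [mN Am]] : exists m, (m < N)%N /\ ~ A m (y m).
    by apply: contrapT => h; apply: yS => m mN; apply: contrapT => nA; apply: h; exists m.
  rewrite (bigD1_seq m) ?mem_index_iota ?iota_uniq //= indicE memNset // mul0r //.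
have mS : measurable S.
  rewrite (_ : S = \bigcap_m [set y | (m < N)%N -> A m (y m)]).
    apply: bigcapT_measurable => m; have [mN|mN] := boolP (m < N)%N.
      rewrite (_ : [set y | _] = (fun y : param R => y m) @^-1` A m); last first.
        by apply/seteqP; split=> y /=; [exact|move=> h _].
      by rewrite -[X in measurable X]setTI; exact: (@measurable_coord R m measurableT _ (mA m)).
    by rewrite (_ : [set y | _] = setT) //; apply/seteqP; split.
  by apply/seteqP; split=> y h m; [move=> _; exact: h|exact: (h m I)].
under eq_integral do rewrite E.
rewrite integral_indic // setIT -[LHS]/(pi S) (hpi _ mA) big_mkord.
elim: N {S E mS} => [|N IH]; first by rewrite !big_ord0.
by rewrite !big_ord_recr /= IH EFinM fineK ?fin_num_measure.
Qed.

(** Replacing the indicators by nonnegative functions one coordinate at a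
    time. *)
Lemma int_prod_ge0 g (c : nat -> R) (N : nat) :
  (forall m, measurable_fun setT (g m)) -> (forall m x, 0 <= g m x) ->
  (forall m, 0 <= c m) ->
  (forall m, \int[pi_ m]_x (g m x)%:E = (c m)%:E)%E ->
  (\int[pi]_y (\prod_(0 <= m < N) g m (y m))%:E = (\prod_(0 <= m < N) c m)%:E)%E.
Proof.
move=> mg g0 c0 gc.
suff H k A : (k <= N)%N -> (forall m, measurable (A m)) ->
    (\int[pi]_y (\prod_(0 <= m < N) (if (m < k)%N then g m (y m) else \1_(A m) (y m)))%:E =
      (\prod_(0 <= m < N) (if (m < k)%N then c m else fine (pi_ m (A m))))%:E)%E.
  have := H N (fun=> setT) (leqnn N) (fun=> measurableT).
  have E (F G : nat -> R) : \prod_(0 <= m < N) (if (m < N)%N then F m else G m) = \prod_(0 <= m < N) F m.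
    by apply: eq_big_nat => m /andP[_ ->].
  by rewrite E; under eq_integral do rewrite E.
elim: k A => [|k IH] A kN mA; first exact: int_cylinder.
pose G m (y : param R) : R := if (m < k)%N then g m (y m) else \1_(A m) (y m).
pose h (y : param R) := \prod_(m <- [seq m <- index_iota 0 N | m != k]) G m y.
pose W := \prod_(m <- [seq m <- index_iota 0 N | m != k])
  (if (m < k)%N then c m else fine (pi_ m (A m))).
have kin : k \in index_iota 0 N by rewrite mem_index_iota.
have split (F : nat -> R) : \prod_(0 <= m < N) F m =
    \prod_(m <- [seq m <- index_iota 0 N | m != k]) F m * F k.
  by rewrite (bigD1_seq k) ?iota_uniq //= mulrC big_filter.
have mG m : measurable_fun setT (G m).
  rewrite /G; case: (m < k)%N; first exact: measurable_coordT.
  by apply: measurable_coordT; exact: measurable_indic.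
have mh : measurable_fun setT h by exact: measurable_prod_seq.
have h0 y : 0 <= h y.
  by apply: prodr_ge0 => m _; rewrite /G; case: ifP => _ //; rewrite indicE.
have HA (B : set (measurableTypeR R)) : measurable B ->
    (\int[pi]_y (h y * \1_B (y k))%:E = W%:E * pi_ k B)%E.
  move=> mB; pose A' m := if m == k then B else A m.
  have mA' m : measurable (A' m) by rewrite /A'; case: ifP.
  have := IH A' (ltnW kN) mA'.
  have -> : \prod_(0 <= m < N) (if (m < k)%N then c m else fine (pi_ m (A' m))) =
      W * fine (pi_ k B).
    rewrite split ltnn /A' eqxx; congr (_ * _); apply: eq_big_seq => m.
    by rewrite mem_filter => /andP[/negbTE -> _].
  rewrite EFinM fineK ?fin_num_measure // => <-; apply: eq_integral => y _.
  rewrite split ltnn /A' eqxx; congr ((_ * _)%:E); apply: eq_big_seq => m.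
  by rewrite mem_filter /G => /andP[/negbTE -> _].
have := @factor_ge0 _ _ _ pi (pi_ k) (fun y => y k) h W (@measurable_coord R k) mh h0 HA (g k) (mg k) (g0 k).
rewrite gc -EFinM => e.
have hE y : \prod_(0 <= m < N) (if (m < k.+1)%N then g m (y m) else \1_(A m) (y m)) =
    h y * g k (y k).
  rewrite split ltnSn; congr (_ * _); apply: eq_big_seq => m.
  by rewrite mem_filter /G ltnS leq_eqVlt => /andP[/negbTE -> _].
under eq_integral do rewrite hE.
rewrite e split ltnSn; congr ((_ * _)%:E); apply: eq_big_seq => m.
by rewrite mem_filter [(m < k.+1)%N]ltnS [(m <= k)%N]leq_eqVlt => /andP[/negbTE -> _].
Qed.

Definition bounded_mfun (phi : measurableTypeR R -> R) : Prop :=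
  measurable_fun setT phi /\ exists2 M : R, 0 <= M & forall x, `|phi x| <= M.

Lemma bounded_mfun_integrable (mu : probability (measurableTypeR R) R) phi :
  bounded_mfun phi -> mu.-integrable setT (EFin \o phi).
Proof.
move=> [mphi [M M0 phiM]]; apply: measurable_bounded_integrable => //.
  by apply: le_lt_trans (probability_le1 mu measurableT) _; exact: ltry.
by exists M; split; rewrite ?num_real // => x Mx y _; exact: le_trans (phiM y) (ltW Mx).
Qed.

Lemma prod_bounded g (r : seq nat) : (forall m, bounded_mfun (g m)) ->
  exists M : R, forall y : param R, `|\prod_(m <- r) g m (y m)| <= M.
Proof.
move=> bg; elim: r => [|m r [M HM]].
  by exists 1 => y; rewrite big_nil normr1.
have [_ [K K0 HK]] := bg m; exists (K * M) => y.
by rewrite big_cons normrM ler_pM.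
Qed.

Lemma prod_integrable g (r : seq nat) : (forall m, bounded_mfun (g m)) ->
  pi.-integrable setT (EFin \o (fun y : param R => \prod_(m <- r) g m (y m))).
Proof.
move=> bg; have [M HM] := prod_bounded r bg.
apply: measurable_bounded_integrable => //.
- by apply: le_lt_trans (probability_le1 pi measurableT) _; exact: ltry.
- by apply: measurable_prod_seq => m; apply: measurable_coordT; have [] := bg m.
- by exists M; split; rewrite ?num_real // => x Mx y _; exact: le_trans (HM y) (ltW Mx).
Qed.

(** Independence of the coordinates: signed factors are shifted by a constant
    one at a time. *)
Lemma int_prod g (N : nat) : (forall m, bounded_mfun (g m)) ->
  \int[pi]_y (\prod_(0 <= m < N) g m (y m)) = \prod_(0 <= m < N) \int[pi_ m]_x g m x.
Proof.
move=> bg0; suff H j g' : (j <= N)%N -> (forall m, bounded_mfun (g' m)) ->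
    (forall m, (j <= m)%N -> forall x, 0 <= g' m x) ->
    \int[pi]_y (\prod_(0 <= m < N) g' m (y m)) = \prod_(0 <= m < N) \int[pi_ m]_x g' m x.
  pose g1 m := if (m < N)%N then g m else (fun=> 1).
  have E (F : (measurableTypeR R -> R) -> nat -> R) :
      \prod_(0 <= m < N) F (g m) m = \prod_(0 <= m < N) F (g1 m) m.
    by apply: eq_big_nat => m /andP[_ mN]; rewrite /g1 mN.
  rewrite (E (fun f m => \int[pi_ m]_x f x)) -(H N g1) //.
  - by apply: eq_Rintegral => y _; rewrite (E (fun f m => f (y m))).
  - move=> m; rewrite /g1; case: ifP => // _; split => //.
    by exists 1 => // x; rewrite normr1.
  - by move=> m; rewrite /g1 ltnNge => -> x.
elim: j g' => [|j IH] g' jN bg g0.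
  have c0 m : 0 <= \int[pi_ m]_x g' m x by apply: Rintegral_ge0 => x _; exact: g0.
  rewrite {1}/Rintegral (int_prod_ge0 N (c := fun m => \int[pi_ m]_x g' m x)) //.
  - by move=> m; have [] := bg m.
  - by move=> m x; exact: g0.
  - by move=> m; rewrite /Rintegral fineK //; apply: integrable_fin_num => //; exact: bounded_mfun_integrable.
have [mj [M M0 HM]] := bg j.
pose gp m := if m == j then (fun x => 1 * g' j x + M) else g' m.
pose gc m := if m == j then (fun=> M) else g' m.
have bc : bounded_mfun (fun=> M) by split => //; exists M => // x; rewrite ger0_norm.
have bgp m : bounded_mfun (gp m).
  rewrite /gp; case: ifP => // _; split; first by apply: measurable_funD => //; exact: measurable_funM.
  by exists (M + M) => [|x]; rewrite ?addr_ge0 // (le_trans (ler_normD _ _)) // mul1r lerD // ger0_norm.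
have bgc m : bounded_mfun (gc m) by rewrite /gc; case: ifP.
have gp0 m : (j <= m)%N -> forall x, 0 <= gp m x.
  move=> jm x; rewrite /gp; case: eqP => [_|/eqP mj'].
    by have := HM x; rewrite ler_norml mul1r => /andP[? _]; lra.
  by apply: g0; rewrite ltn_neqAle eq_sym mj'.
have gc0 m : (j <= m)%N -> forall x, 0 <= gc m x.
  move=> jm x; rewrite /gc; case: eqP => [//|/eqP mj'].
  by apply: g0; rewrite ltn_neqAle eq_sym mj'.
have Hp := IH gp (ltnW jN) bgp gp0; have Hc := IH gc (ltnW jN) bgc gc0.
have jin : j \in index_iota 0 N by rewrite mem_index_iota.
have split (F : nat -> R) : \prod_(0 <= m < N) F m =
    \prod_(m <- [seq m <- index_iota 0 N | m != j]) F m * F j.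
  by rewrite (bigD1_seq j) ?iota_uniq //= mulrC big_filter.
have rest (F G : nat -> R) : (forall m, m != j -> F m = G m) ->
    \prod_(m <- [seq m <- index_iota 0 N | m != j]) F m =
    \prod_(m <- [seq m <- index_iota 0 N | m != j]) G m.
  by move=> FG; apply: eq_big_seq => m; rewrite mem_filter => /andP[/FG].
have L : \int[pi]_y (\prod_(0 <= m < N) g' m (y m)) =
    \int[pi]_y (\prod_(0 <= m < N) gp m (y m)) - \int[pi]_y (\prod_(0 <= m < N) gc m (y m)).
  rewrite -RintegralB //; [|exact: prod_integrable|exact: prod_integrable].
  apply: eq_Rintegral => y _; rewrite !split.
  rewrite (rest (fun m => gp m (y m)) (fun m => g' m (y m))) => [|m mj']; last by rewrite /gp (negbTE mj').
  rewrite (rest (fun m => gc m (y m)) (fun m => g' m (y m))) => [|m mj']; last by rewrite /gc (negbTE mj').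
  by rewrite /gp /gc eqxx; ring.
rewrite L Hp Hc !split.
rewrite (rest (fun m => \int[pi_ m]_x gp m x) (fun m => \int[pi_ m]_x g' m x)) => [|m mj']; last by rewrite /gp (negbTE mj').
rewrite (rest (fun m => \int[pi_ m]_x gc m x) (fun m => \int[pi_ m]_x g' m x)) => [|m mj']; last by rewrite /gc (negbTE mj').
rewrite /gp /gc eqxx Rintegral_lin //; try exact: bounded_mfun_integrable.
ring.
Qed.

Hypothesis adm : forall m, pi_ m `[-1, 1]%classic = 1%E.

Lemma Gamma_full : pi (~` Gam) = 0%E.
Proof.
pose Z m := ~` [set y : param R | `[-1, 1]%classic (y m)].
have mZ m : measurable (Z m).
  apply: measurableC; rewrite -[X in measurable X]setTI.
  by apply: (@measurable_coord R m) => //; exact: measurable_itv.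
have Z0 m : pi (Z m) = 0%E.
  pose A k : set R := if k == m then `[-1, 1]%classic else setT.
  have mA k : measurable (A k : set (measurableTypeR R)) by rewrite /A; case: ifP.
  have E : [set y : param R | `[-1, 1]%classic (y m)] =
      [set y | forall k, (k < m.+1)%N -> A k (y k)].
    apply/seteqP; split=> y.
      by move=> ym k _; rewrite /A; case: eqP => [->|].
    by move=> /(_ m (ltnSn m)); rewrite /A eqxx.
  rewrite /Z probability_setC; last first.
    by rewrite -[X in measurable X]setCK; exact: measurableC (mZ m).
  rewrite E (hpi _ mA) (_ : (\prod_(k < m.+1) _)%E = 1%E) ?subee //.
  rewrite big1 // => k _; rewrite /A; case: eqP => [->|_]; first exact: adm.
  exact: probability_setT.
have -> : ~` Gam = \bigcup_m Z m.
  apply/seteqP; split=> y.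
    move=> nG; apply: contrapT => nZ; apply: nG => m.
    have : ~ Z m y by move=> zy; apply: nZ; exists m.
    by rewrite /Z /= => /contrapT; rewrite in_itv.
  by move=> [m _ zy] Gy; apply: zy; rewrite /= in_itv /=; exact: Gy.
have /negligibleP : pi.-negligible (\bigcup_m Z m).
  by apply: negligible_bigcup => m; apply/negligibleP; [exact: mZ|exact: Z0].
by apply; apply: bigcup_measurable => m _; exact: mZ.
Qed.

Lemma horner_bounded (p : {poly R}) : exists2 M : R, 0 <= M &
  forall t, -1 <= t <= 1 -> `|p.[t]| <= M.
Proof.
exists (\sum_(i < size p) `|p`_i|) => [|t t1]; first by rewrite sumr_ge0.
rewrite horner_coef (le_trans (ler_norm_sum _ _ _)) // ler_sum // => i _.
by rewrite normrM ler_piMr // normrX exprn_ile1 // ler_norml.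
Qed.

Lemma measurable_horner (p : {poly R}) : measurable_fun setT (fun t : measurableTypeR R => p.[t]).
Proof.
apply: continuous_measurable_fun => t.
by apply: differentiable_continuous; apply/derivable1_diffP; exact: derivable_horner.
Qed.

Definition cut_poly (p : {poly R}) : measurableTypeR R -> R :=
  (fun t => p.[t]) \_ `[-1, 1]%classic.

Lemma cut_poly_bounded p : bounded_mfun (cut_poly p).
Proof.
have [M M0 HM] := horner_bounded p; split.
  apply/(measurable_restrict (fun t : measurableTypeR R => p.[t]) (measurable_itv `[-1, 1]) measurableT).
  by apply: measurable_funTS; exact: measurable_horner.
exists M => // x; rewrite /cut_poly patchE; case: ifPn => [/set_mem|_]; last by rewrite normr0.
by rewrite /= in_itv /=; exact: HM.
Qed.

Lemma int_prod_poly (q : nat -> {poly R}) (N : nat) :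
  \int[pi]_(y in Gam) (\prod_(0 <= m < N) (q m).[y m]) =
  \prod_(0 <= m < N) \int[pi_ m]_(t in `[-1, 1]) (q m).[t].
Proof.
have mG := @measurable_Gamma R.
transitivity (\int[pi]_y (\prod_(0 <= m < N) cut_poly (q m) (y m))).
  have ip := prod_integrable (index_iota 0 N) (fun m => cut_poly_bounded (q m)).
  rewrite -(setvU Gam) Rintegral_setU //.
  - rewrite [X in _ = X + _](_ : _ = 0) ?add0r.
      apply: eq_Rintegral => y /set_mem Gy; apply: eq_big_nat => m _.
      by rewrite /cut_poly patchE mem_set //= in_itv /=; exact: Gy.
    rewrite /Rintegral (negligible_integral (N := ~` Gam)) //; last exact: Gamma_full.
    - by rewrite setDv integral_set0.
    - exact: measurableC.
    - exact: measurableC.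
    - by apply: integrableS ip => //; exact: measurableC.
  - exact: measurableC.
  - by rewrite setvU.
  - by apply/disj_setPS => y [].
apply: etrans (int_prod (g := fun m => cut_poly (q m)) N (fun m => cut_poly_bounded (q m))) _.
by apply: eq_bigr => m _; rewrite [RHS]Rintegral_mkcond.
Qed.

Context (P : nat -> nat -> {poly R}).
Hypothesis orth : forall m, orthonormal_polynomials (pi_ m) (P m).

Lemma Ppoly_nat (nu : midx) (N : nat) (y : param R) :
  (forall m, m \in finsupp nu -> (m < N)%N) ->
  Ppoly P nu y = \prod_(0 <= m < N) (P m (nu m)).[y m].
Proof.
move=> HN; rewrite /Ppoly.
rewrite (perm_big [seq m <- index_iota 0 N | m \in finsupp nu]) /=; last first.
  apply: uniq_perm; first exact: fset_uniq.
    by rewrite filter_uniq ?iota_uniq.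
  move=> m; rewrite mem_filter mem_index_iota /=.
  by have [/HN ->|//] := boolP (m \in finsupp nu).
rewrite big_filter big_mkcond /=; apply: eq_bigr => m _.
case: ifPn => // mnu; rewrite fsfun_dflt //.
by have [_ -> _ _] := orth m; rewrite hornerC.
Qed.

Lemma support_bound (I : seq midx) : exists N, forall nu, nu \in I ->
  forall m, m \in finsupp nu -> (m < N)%N.
Proof.
elim: I => [|nu I [N HN]]; first by exists 0%N.
exists (maxn (\max_(m <- finsupp nu) m.+1)%N N) => mu; rewrite inE => /orP[/eqP ->|/HN h] m mm.
  by rewrite leq_max (big_rem m mm) /= leq_max leqnn.
by rewrite leq_max h ?orbT.
Qed.

(** Independence of the coordinates factors the integral into one-dimensional
    ones; the coordinates outside both supports contribute the factor 1. *)
Lemma Ppoly_orthonormal (nu mu : midx) :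
  \int[pi]_(y in Gam) (Ppoly P nu y * Ppoly P mu y) = (nu == mu)%:R.
Proof.
have [N HN] := support_bound [:: nu; mu].
have Hn : forall m, m \in finsupp nu -> (m < N)%N by apply: HN; rewrite !inE eqxx.
have Hm : forall m, m \in finsupp mu -> (m < N)%N by apply: HN; rewrite !inE eqxx orbT.
transitivity (\int[pi]_(y in Gam) (\prod_(0 <= m < N) (P m (nu m) * P m (mu m)).[y m])).
  apply: eq_Rintegral => y _; rewrite (Ppoly_nat y Hn) (Ppoly_nat y Hm) -big_split /=.
  by apply: eq_bigr => m _; rewrite hornerM.
rewrite int_prod_poly.
transitivity (\prod_(0 <= m < N) ((nu m == mu m)%:R : R)).
  apply: eq_bigr => m _; have [_ _ _ <-] := orth m.
  by apply: eq_Rintegral => t _; rewrite hornerM.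
have [->|ne] := eqVneq nu mu; first by rewrite big1 // => m _; rewrite eqxx.
have [m nm] : exists m, nu m != mu m.
  apply: contrapT => h; case/eqP: ne; apply/fsfunP => m; apply/eqP.
  by apply: contrapT => hm; apply: h; exists m; exact/negP.
have mN : (m < N)%N.
  have [m1|m1] := boolP (m \in finsupp nu); first exact: Hn.
  have [m2|m2] := boolP (m \in finsupp mu); first exact: Hm.
  by move: nm; rewrite (fsfun_dflt m1) (fsfun_dflt m2) eqxx.
by rewrite (bigD1_seq m) ?mem_index_iota ?iota_uniq //= (negbTE nm) mul0r.
Qed.

Lemma Ppoly_bounded (nu : midx) : exists M : R, forall y, Gam y -> `|Ppoly P nu y| <= M.
Proof.
have [M HM] := prod_bounded (finsupp nu) (fun m => cut_poly_bounded (P m (nu m))).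
exists M => y Gy; apply: le_trans (HM y); rewrite le_eqVlt; apply/orP; left; apply/eqP.
congr `|_|; apply: eq_bigr => m _; rewrite /cut_poly patchE mem_set //= in_itv /=.
exact: Gy.
Qed.

Lemma measurable_Ppoly (nu : midx) : measurable_fun setT (Ppoly P nu).
Proof.
apply: (measurable_prod_seq (finsupp nu) (G := fun m y => (P m (nu m)).[y m])) => m.
by apply: measurable_coordT; exact: measurable_horner.
Qed.
End Orthonormal.

(** * Convex hulls, triangles and refinements *)

Section EuclideanNorm.
Context (R : realType).
Implicit Types (p q : R * R).

Lemma enorm_ge0 p : 0 <= enorm p. Proof. exact: sqrtr_ge0. Qed.

Lemma enorm_sq p : enorm p ^+ 2 = edot p p.
Proof. by rewrite /enorm sqr_sqrtr ?edot_ge0. Qed.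

Lemma enormZ (c : R) p : enorm (c *: p) = `|c| * enorm p.
Proof.
rewrite /enorm (_ : edot (c *: p) (c *: p) = c ^+ 2 * edot p p).
  by rewrite sqrtrM ?sqr_ge0 // sqrtr_sqr.
by case: p => x y; rewrite /edot /= /GRing.scale /=; ring.
Qed.

Lemma enorm_le p (r : R) : 0 <= r -> edot p p <= r ^+ 2 -> enorm p <= r.
Proof.
move=> r0 h; rewrite -(@ler_pXn2r _ 2) ?nnegrE ?enorm_ge0 //.
by rewrite enorm_sq.
Qed.

Lemma edot_cauchy p q : `|edot p q| <= enorm p * enorm q.
Proof.
rewrite -(@ler_pXn2r _ 2) ?nnegrE ?mulr_ge0 ?enorm_ge0 // exprMn !enorm_sq.
rewrite real_normK ?num_real //; case: p => a b; case: q => c d; rewrite /edot /=.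
by rewrite -subr_ge0 (_ : _ - _ = (a * d - b * c) ^+ 2) ?sqr_ge0 //; ring.
Qed.

Lemma coord_le_enorm p : `|p.1| <= enorm p /\ `|p.2| <= enorm p.
Proof.
split; rewrite -(@ler_pXn2r _ 2) ?nnegrE ?enorm_ge0 // enorm_sq real_normK ?num_real //.
  by rewrite /edot -expr2 lerDl -expr2 sqr_ge0.
by rewrite /edot -[p.2 * _]expr2 lerDr -expr2 sqr_ge0.
Qed.

Lemma enorm_le_coord p (r : R) : `|p.1| <= r -> `|p.2| <= r -> enorm p <= 2 * r.
Proof.
move=> h1 h2; have r0 : 0 <= r by apply: le_trans h1.
apply: enorm_le; first by rewrite mulr_ge0.
have {}h1 : p.1 ^+ 2 <= r ^+ 2 by rewrite -real_normK ?num_real // ler_pXn2r ?nnegrE.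
have {}h2 : p.2 ^+ 2 <= r ^+ 2 by rewrite -real_normK ?num_real // ler_pXn2r ?nnegrE.
by rewrite /edot -!expr2 exprMn; have := sqr_ge0 r; lra.
Qed.
End EuclideanNorm.

Section Hull.
Context (R : realType).
Implicit Types (S T : {fset (R * R)}) (p q x : R * R) (k : R) (b : R * R).

Lemma edotDr p q x : edot p (q + x) = edot p q + edot p x.
Proof. by rewrite -[q]scale1r edot_lin mul1r scale1r. Qed.

Lemma edotZr p c q : edot p (c *: q) = c * edot p q.
Proof.
rewrite -[c *: q]addr0 edot_lin (_ : edot p 0 = 0) ?addr0 //.
by rewrite /edot /= !mulr0 addr0.
Qed.

Lemma affine_sum (I : Type) (r : seq I) (w : I -> R) (z : I -> R * R) k b :
  \sum_(i <- r) w i = 1 ->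
  affine k b (\sum_(i <- r) w i *: z i) = \sum_(i <- r) w i * affine k b (z i).
Proof.
move=> w1; rewrite /affine.
have -> : \sum_(i <- r) w i * (k + edot b (z i)) =
    \sum_(i <- r) w i * k + \sum_(i <- r) w i * edot b (z i).
  by rewrite -big_split; apply: eq_bigr => i _; rewrite mulrDr.
rewrite -mulr_suml w1 mul1r; congr (_ + _).
elim: r {w1} => [|i r IH]; first by rewrite !big_nil /edot /= !mulr0 addr0.
by rewrite !big_cons edot_lin IH.
Qed.

(** Weights of points with the same image under [g] add up. *)
Lemma hull_comb S S' (w : R * R -> R) (g : R * R -> R * R) :
  (forall x, x \in S -> 0 <= w x) -> \sum_(x <- S) w x = 1 ->
  (forall x, x \in S -> g x \in S') -> hull S' (\sum_(x <- S) w x *: g x).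
Proof.
move=> w0 w1 gS.
have pick (V : nmodType) (F : R * R -> V) x : x \in S ->
    \sum_(z <- S') (if g x == z then F z else 0) = F (g x).
  move=> xS; rewrite (bigD1_seq (g x)) ?gS ?fset_uniq //= eqxx big1 ?addr0 //.
  by move=> z; rewrite eq_sym => /negbTE ->.
exists (fun z => \sum_(x <- S) if g x == z then w x else 0); split.
- by move=> z _; rewrite big_seq; apply: sumr_ge0 => x xS; case: ifP => // _; exact: w0.
- rewrite exchange_big -w1 big_seq [RHS]big_seq; apply: eq_bigr => x xS.
  exact: (pick _ (fun=> w x)).
- under [RHS]eq_bigr do rewrite scaler_suml.
  rewrite exchange_big big_seq [RHS]big_seq; apply: eq_bigr => x xS.
  rewrite -(pick _ (fun z => w x *: z) x xS); apply: eq_bigr => z _.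
  by case: ifP => // _; rewrite scale0r.
Qed.

Lemma hull_vertex S x : x \in S -> hull S x.
Proof.
move=> xS; exists (fun z => (z == x)%:R); split.
- by move=> z _; rewrite ler0n.
- rewrite (bigD1_seq x) ?fset_uniq //= eqxx big1 ?addr0 // => z /negbTE ->.
  by [].
- rewrite (bigD1_seq x) ?fset_uniq //= eqxx scale1r big1 ?addr0 // => z /negbTE ->.
  by rewrite scale0r.
Qed.

Lemma hull_segment S p q t : hull S p -> hull S q -> 0 <= t <= 1 ->
  hull S (p + t *: (q - p)).
Proof.
move=> [u [u0 u1 ->]] [v [v0 v1 ->]] /andP[t0 t1].
exists (fun x => (1 - t) * u x + t * v x); split.
- by move=> x xS; rewrite addr_ge0 // mulr_ge0 ?subr_ge0 ?u0 ?v0.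
- by rewrite big_split /= -!mulr_sumr u1 v1 !mulr1 subrK.
- rewrite -sumrB scaler_sumr -big_split; apply: eq_bigr => x _ /=.
  rewrite scalerBr !scalerDl !scalerA mulrBl mul1r scalerBl.
  by rewrite addrAC -addrA.
Qed.

Lemma hull_affine_ge S k b x : (forall z, z \in S -> 0 <= affine k b z) ->
  hull S x -> 0 <= affine k b x.
Proof.
move=> H [w [w0 w1 ->]]; rewrite affine_sum // big_seq; apply: sumr_ge0 => z zS.
by rewrite mulr_ge0 ?w0 ?H.
Qed.

Lemma affineN k b x : affine (- k) (- b) x = - affine k b x.
Proof. by rewrite /affine /edot /=; ring. Qed.

Lemma hull_affine_eq0 S k b x : (forall z, z \in S -> affine k b z = 0) ->
  hull S x -> affine k b x = 0.
Proof.
move=> H Sx; apply/eqP; rewrite eq_le.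
rewrite (hull_affine_ge _ Sx) ?andbT => [|z zS]; last by rewrite H.
rewrite -oppr_ge0 -affineN (hull_affine_ge _ Sx) // => z zS.
by rewrite affineN H ?oppr0.
Qed.

Lemma hull_bounded S : exists M : R, forall x, hull S x -> `|x.1| <= M /\ `|x.2| <= M.
Proof.
exists (\sum_(z <- S) (`|z.1| + `|z.2|)) => x Sx; pose M := \sum_(z <- S) (`|z.1| + `|z.2|).
have zM z : z \in S -> `|z.1| + `|z.2| <= M.
  move=> zS; rewrite /M (bigD1_seq z) ?fset_uniq //= lerDl.
  by apply: sumr_ge0 => y _; rewrite addr_ge0.
have H (b : R * R) : (forall z, z \in S -> `|edot b z| <= M) -> edot b x <= M.
  move=> h; rewrite -subr_ge0.
  have E y : M - edot b y = affine M (- b) y by rewrite /affine /edot /=; ring.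
  rewrite E; apply: (hull_affine_ge _ Sx) => z /h; rewrite -E ler_norml => /andP[_].
  by rewrite subr_ge0.
have e (s1 s2 : R) : `|s1| + `|s2| <= 1 -> `|s1| * `|s2| = 0 -> edot (s1, s2) x <= M.
  move=> h h0; apply: H => z zS; apply: le_trans (zM z zS); rewrite /edot /=.
  rewrite (le_trans (ler_normD _ _)) // !normrM lerD // ler_piMl //.
    by have := normr_ge0 s2; lra.
  by have := normr_ge0 s1; lra.
have z0 : `|0 : R| = 0 by rewrite normr0.
have o1 : `|1 : R| = 1 by rewrite normr1.
have o2 : `|-1 : R| = 1 by rewrite normrN1.
have := e 1 0; have := e (-1) 0; have := e 0 1; have := e 0 (-1).
rewrite z0 o1 o2 !mulr0 !mul0r !addr0 !add0r lexx /edot /= !mul1r !mul0r !mulN1r ?addr0 ?add0r.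
move=> /(_ isT erefl) h1 /(_ isT erefl) h2 /(_ isT erefl) h3 /(_ isT erefl) h4.
by rewrite !ler_norml -/M; split; apply/andP; split; lra.
Qed.

(** A point of [A] moved a little along the normal [b] leaves the line. *)
Lemma line_no_interior (A : set (R * R)) k b : b != 0 ->
  (forall x, A x -> affine k b x = 0) -> interior A = set0.
Proof.
move=> b0 H; apply/seteqP; split=> // x /interior_osq[r r0 rA].
have bb : 0 < edot b b.
  rewrite lt0r edot_ge0 andbT; apply: contraNneq b0 => e.
  have h1 := sqr_ge0 b.1; have h2 := sqr_ge0 b.2.
  have e1 : b.1 ^+ 2 = 0 by move: e; rewrite /edot -!expr2; lra.
  have e2 : b.2 ^+ 2 = 0 by move: e; rewrite /edot -!expr2; lra.
  move/eqP : e1; move/eqP : e2; rewrite !sqrf_eq0 => /eqP e2 /eqP e1.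
  by rewrite [b]surjective_pairing e1 e2.
have nb := enorm_ge0 b.
pose e : R := r / 2 / (enorm b + 1).
have e0 : 0 < e by rewrite /e !divr_gt0 // ltr_wpDl.
have eb : e * enorm b < r.
  apply: lt_trans (_ : r / 2 < r); last lra.
  by rewrite /e mulrAC ltr_pdivrMr ?ltr_wpDl // ltr_pM2l ?divr_gt0 // ltrDl.
have [c1 c2] := coord_le_enorm b; clearbody e.
have Ax : A x by apply: rA; apply/osqE; rewrite !subrr normr0.
have Ay : A (x + e *: b).
  apply: rA; apply/osqE; rewrite /= ![x.1 + _ - _]addrAC ![x.2 + _ - _]addrAC !subrr !add0r.
  change (`|e * b.1| < r /\ `|e * b.2| < r).
  by rewrite !normrM (gtr0_norm e0); split; apply: le_lt_trans eb; rewrite ler_pM2l.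
have := H _ Ay; rewrite /affine edotDr edotZr addrA; have := H _ Ax; rewrite /affine => ->.
by rewrite add0r => /eqP; rewrite mulf_eq0 !gt_eqF.
Qed.

Definition perp (p : R * R) : R * R := (- p.2, p.1).

Lemma perp_neq0 p : p != 0 -> perp p != 0.
Proof.
apply: contraNneq => /(congr1 (fun z => (z.2, - z.1))) /=.
by rewrite opprK oppr0 -surjective_pairing => ->.
Qed.

Lemma hull_small S : (#|` S| <= 2)%N -> interior (hull S) = set0.
Proof.
case E : (enum_fset S) => [|a [|b [|c s]]]; rewrite ?E.
- move=> _; apply/seteqP; split=> // x /interior_subset[w [_]].
  by rewrite E big_nil => /eqP; rewrite eq_sym oner_eq0.
- move=> _; apply: (@line_no_interior _ (- a.1) (1, 0)).
    by apply/eqP => -[/eqP]; rewrite oner_eq0.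
  move=> x; apply: hull_affine_eq0 => z; rewrite [_ \in S](_ : _ = (z \in enum_fset S)) // E inE => /eqP ->.
  by rewrite /affine /edot /=; ring.
- move=> _; have ab : a != b.
    by have := fset_uniq S; rewrite E /= inE andbT.
  apply: (@line_no_interior _ (- edot (perp (b - a)) a) (perp (b - a))).
    by apply: perp_neq0; rewrite subr_eq0 eq_sym.
  move=> x; apply: hull_affine_eq0 => z; rewrite [_ \in S](_ : _ = (z \in enum_fset S)) // E !inE.
  by move=> /orP[] /eqP ->; rewrite /affine /edot /perp /=; ring.
- by move=> /=; rewrite ltnS.
Qed.
End Hull.

Lemma ae_all_seq (R : realType) (I : eqType) (s : seq I) (P : I -> R * R -> Prop) :
  (forall i, i \in s -> {ae @leb2 R, forall x, P i x}) ->
  {ae @leb2 R, forall x, forall i, i \in s -> P i x}.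
Proof.
elim: s => [|i s IH] N; first by apply: aeW => x i; rewrite in_nil.
have Ns j : j \in s -> {ae @leb2 R, forall x, P j x}.
  by move=> js; apply: N; rewrite inE js orbT.
by apply: aeS2 (N i (mem_head _ _)) (IH Ns) => x x1 x2 j; rewrite inE => /orP[/eqP ->|/x2].
Qed.

Section Triangle.
Context (R : realType).
Implicit Types (S T t : {fset (R * R)}) (p q x c : R * R) (k : R) (b : R * R)
  (M : {fset {fset (R * R)}}).
Notation mu2 := (@leb2 R).

Lemma affine_hull_eq0 S k b : interior (hull S) !=set0 ->
  (forall x, hull S x -> affine k b x = 0) -> b = 0.
Proof.
move=> [x Sx] H; apply/eqP/negPn/negP => b0.
by move: Sx; rewrite (line_no_interior b0 H).
Qed.

Lemma hull_triangle_ind S a b c k e : enum_fset S = [:: a; b; c] ->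
  0 <= affine k e a -> 0 <= affine k e b -> 0 <= affine k e c ->
  forall x, hull S x -> 0 <= affine k e x.
Proof.
move=> E ha hb hc x; apply: hull_affine_ge => z.
rewrite [_ \in S](_ : _ = (z \in enum_fset S)) // E !inE.
by move=> /or3P[] /eqP ->.
Qed.

(** The half-planes come from the barycentric coordinates, which are affine
    because the vertices are affinely independent. *)
Lemma triangle_halfplanes T : is_triangle T ->
  exists s : seq (R * (R * R)), (forall h, h \in s -> h.2 != 0) /\
    forall p, hull T p <-> forall h, h \in s -> 0 <= affine h.1 h.2 p.
Proof.
move=> [T3 [x0 Tx0]].
have [a [b [c E]]] : exists a b c, enum_fset T = [:: a; b; c].
  move: T3; rewrite /=; case: (enum_fset T) => [|a [|b [|c [|d s]]]] // _.
  by exists a, b, c.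
have := fset_uniq T; rewrite E /= !inE !negb_or andbT => /andP[/andP[ab ac] bc].
pose d : R := (b.1 - a.1) * (c.2 - a.2) - (b.2 - a.2) * (c.1 - a.1).
have d0 : d != 0.
  apply/eqP => d0; move: Tx0.
  rewrite (@line_no_interior _ _ (- edot (perp (b - a)) a) (perp (b - a))) //.
    by apply: perp_neq0; rewrite subr_eq0 eq_sym.
  move=> x; apply: hull_affine_eq0 => z; rewrite [_ \in T](_ : _ = (z \in enum_fset T)) // E !inE.
  move=> /or3P[] /eqP ->; rewrite /affine /edot /perp /=; try ring.
  by rewrite -[RHS]d0 /d; ring.
pose h (q r : R * R) : R * (R * R) := (- edot (perp (r - q)) q / d, d^-1 *: perp (r - q)).
have hE q r p : affine (h q r).1 (h q r).2 p =
    ((r.1 - q.1) * (p.2 - q.2) - (r.2 - q.2) * (p.1 - q.1)) / d.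
  by rewrite /affine /h /= [edot (_ *: _) p]edotC edotZr /edot /perp /=; ring.
have h0 q r : q != r -> (h q r).2 != 0.
  move=> qr; rewrite /h /= scaler_eq0 invr_eq0 negb_or d0 /=.
  by apply: perp_neq0; rewrite subr_eq0 eq_sym.
exists [:: h a b; h b c; h c a]; split.
  by move=> z; rewrite !inE => /or3P[] /eqP ->; apply: h0 => //; rewrite eq_sym.
move=> p; split.
  have h1 (u : R) : u = d -> 0 <= u / d by move=> ->; rewrite divff.
  have h2 (u : R) : u = 0 -> 0 <= u / d by move=> ->; rewrite mul0r.
  move=> Tp z; rewrite !inE => /or3P[] /eqP ->; apply: (hull_triangle_ind E) Tp;
    rewrite hE; first [by apply: h1; rewrite /d; ring | by apply: h2; ring].
move=> H.
have Ha := H _ (mem_head _ _).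
have Hb : 0 <= affine (h b c).1 (h b c).2 p by apply: H; rewrite !inE eqxx orbT.
have Hc : 0 <= affine (h c a).1 (h c a).2 p by apply: H; rewrite !inE eqxx !orbT.
exists (fun z => if z == a then affine (h b c).1 (h b c).2 p else
   if z == b then affine (h c a).1 (h c a).2 p else affine (h a b).1 (h a b).2 p).
have ba : (b == a) = false by apply/negbTE; rewrite eq_sym.
have ca : (c == a) = false by apply/negbTE; rewrite eq_sym.
have cb : (c == b) = false by apply/negbTE; rewrite eq_sym.
split.
- by move=> z _; do 2! case: ifP => // _.
- rewrite E !big_cons big_nil eqxx ba eqxx ca cb !hE addr0 -!mulrDl.
  by apply: (mulIf d0); rewrite divfK // mul1r /d; ring.
- rewrite E !big_cons big_nil eqxx ba eqxx ca cb !hE addr0.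
  have X (u v : R * R) : u.1 = v.1 -> u.2 = v.2 -> u = v by case: u v => [? ?] [? ?] /= -> ->.
  have dK (u v : R) : u / d * v * d = u * v by rewrite -mulrA [v * d]mulrC mulrA divfK.
  set na := (_ - _); set nb := (_ - _); set nc := (_ - _).
  apply: X.
    change (p.1 = na / d * a.1 + (nb / d * b.1 + nc / d * c.1)).
    by apply: (mulIf d0); rewrite !mulrDl !dK /na /nb /nc /d; ring.
  change (p.2 = na / d * a.2 + (nb / d * b.2 + nc / d * c.2)).
  by apply: (mulIf d0); rewrite !mulrDl !dK /na /nb /nc /d; ring.
Qed.

Lemma continuous_affine k b : continuous (affine k b).
Proof. by case: (C1_affine k b) => -[]. Qed.

Lemma closed_hull T : is_triangle T -> closed (hull T).
Proof.
move=> /triangle_halfplanes[s [_ H]].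
rewrite (_ : hull T = \bigcap_(h in [set` s]) [set p | 0 <= affine h.1 h.2 p]).
  apply: closed_bigI => h _.
  rewrite (_ : [set _ | _] = affine h.1 h.2 @^-1` [set r : R | 0 <= r]) //.
  by move/continuous_closedP: (@continuous_affine h.1 h.2); apply; exact: closed_ge.
by apply/seteqP; split => p; rewrite H => h z /h.
Qed.

Lemma hull_interior_ae T : is_triangle T ->
  {ae mu2, forall x, hull T x -> interior (hull T) x}.
Proof.
move=> /triangle_halfplanes[s [s0 H]].
have N h : h \in s -> {ae mu2, forall x, affine h.1 h.2 x <> 0}.
  move=> /s0 h0; exists [set p | h.1 + h.2.1 * p.1 + h.2.2 * p.2 = 0]; split.
  - rewrite (_ : [set _ | _] = affine h.1 h.2 @^-1` [set r : R | r = 0]).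
      apply: measurable_closed2.
      by move/continuous_closedP: (@continuous_affine h.1 h.2); apply; exact: closed_eq.
    by apply/seteqP; split=> p /=; rewrite /affine /edot addrA.
  - by rewrite leb2_line // -surjective_pairing.
  - by move=> x /= /contrapT; rewrite /affine /edot addrA.
apply: aeS (ae_all_seq N) => x x0 /H Hx.
have -> : hull T = \bigcap_(h in [set` s]) [set p | 0 <= affine h.1 h.2 p].
  by apply/seteqP; split => p; rewrite H => h z /h.
have : nbhs x (\bigcap_(h in [set` s]) [set p | 0 < affine h.1 h.2 p]).
  rewrite bigcap_seq; apply: open_nbhs_nbhs; split; last first.
    rewrite -bigcap_seq => h hs; rewrite /= lt0r Hx // andbT.
    by apply/eqP; exact: x0.
  elim/big_ind: _ => [||h _]; [exact: openT|exact: openI|].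
  rewrite (_ : [set _ | _] = affine h.1 h.2 @^-1` [set r : R | 0 < r]) //.
  by move/continuousP: (@continuous_affine h.1 h.2); apply; exact: open_gt.
by apply: filterS => y hy h hs; exact/ltW/hy.
Qed.

(** Interiors of distinct elements are disjoint: two elements meet in the hull
    of their common vertices, which has an interior point only if it has three
    of them. *)
Lemma triangulation_overlap A M S T : triangulation A M -> S \in M -> T \in M ->
  interior (hull S `&` hull T) !=set0 -> S = T.
Proof.
move=> [tM _ IM] SM TM; rewrite (IM _ _ SM TM) => -[x].
have [h|] := leqP #|` (S `&` T)%fset| 2; first by rewrite hull_small.
move=> c3 _; have [[S3 _] [T3 _]] := (tM _ SM, tM _ TM).
have /fsubset_leqif_cards/leqifP : (S `&` T `<=` S)%fset by exact: fsubsetIl.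
have /fsubset_leqif_cards/leqifP : (S `&` T `<=` T)%fset by exact: fsubsetIr.
rewrite S3 T3; case: eqP => [e1 _|_]; last by rewrite ltnNge c3.
case: eqP => [e2 _|_]; last by rewrite ltnNge c3.
by rewrite -e2 e1.
Qed.

Lemma diam_ge A p q : (exists M : R, forall x, A x -> `|x.1| <= M /\ `|x.2| <= M) ->
  A p -> A q -> enorm (p - q) <= @diam R A.
Proof.
move=> [M HM] Ap Aq; apply: ub_le_sup; last by exists p, q.
exists (4 * M) => _ [x [y [/HM[x1 x2] /HM[y1 y2] ->]]].
have -> : 4 * M = 2 * (2 * M) by ring.
apply: enorm_le_coord => /=; rewrite (le_trans (ler_normB _ _)) //; lra.
Qed.

(** The disc of at least half the inradius that is used to compare lengths. *)
Lemma fat_triangle T (sigma : R) : is_triangle T ->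
  diam (hull T) / inradius (hull T) <= sigma ->
  exists c (r : R), [/\ 0 < r, forall x, enorm (x - c) <= r -> hull T x &
    forall p q, hull T p -> hull T q -> enorm (p - q) <= 2 * sigma * r].
Proof.
move=> [_ [x0 /interior_osq[r0 r00 r0T]]] hs.
set E := [set r : R | 0 <= r /\ exists c, [set x | enorm (x - c) <= r] `<=` hull T].
have [M HM] := hull_bounded T.
have nE0 : E (r0 / 2).
  split; first by rewrite divr_ge0 // ltW.
  exists x0 => x /= hx; apply: r0T; apply/osqE; have [h1 h2] := coord_le_enorm (x - x0).
  by split; (apply: le_lt_trans (_ : enorm (x - x0) < r0) => //; lra).
have uE : has_ubound E.
  exists M => r [rge0 [c hc]].
  have e1 : enorm ((1, 0) : R * R) = 1 by rewrite /enorm /edot /= mulr1 mulr0 addr0 sqrtr1.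
  have hr (s : R) : `|s| <= r -> `|c.1 + s| <= M.
    move=> sr; rewrite -[s]mulr1; apply: (HM (c + s *: ((1, 0) : R * R)) _).1.
    by apply: hc; rewrite /= addrAC subrr add0r enormZ e1 mulr1.
  have := hr r; have := hr (- r); rewrite normrN ger0_norm // => /(_ (lexx _)).
  by rewrite !ler_norml => /andP[h1 h2] /(_ (lexx _)) /andP[h3 h4]; lra.
have sE : has_sup E by split=> //; exists (r0 / 2).
have i0 : 0 < inradius (hull T).
  by apply: lt_le_trans (ub_le_sup uE nE0); rewrite divr_gt0.
(* The supremum that defines the inradius need not be known to be attained. *)
have [r [rge0 [c hc]] hr] := sup_adherent (divr_gt0 i0 (ltr0n R 2)) sE.
have i2 : inradius (hull T) < 2 * r by move: hr; rewrite -/(inradius (hull T)); lra.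
exists c, r; split => [|x hx|p q Tp Tq]; first by lra.
  exact: hc.
have s0 : 0 <= sigma.
  apply: le_trans hs; apply: divr_ge0; last exact: ltW.
  by apply: le_trans (enorm_ge0 (p - p)) _; apply: diam_ge => //; exists M.
apply: (le_trans (diam_ge _ Tp Tq)); first by exists M.
move: hs; rewrite ler_pdivrMr // => /le_trans; apply.
by rewrite [2 * _]mulrC -mulrA ler_wpM2l // ltW.
Qed.

Lemma fat_triangulation A M (sigma : R) T : triangulation A M ->
  shape_regularity M <= sigma -> T \in M ->
  exists c (r : R), [/\ 0 < r, forall x, enorm (x - c) <= r -> hull T x &
    forall p q, hull T p -> hull T q -> enorm (p - q) <= 2 * sigma * r].
Proof.
move=> [tM _ _] hs TM; apply: fat_triangle (tM _ TM) _; apply: le_trans hs.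
rewrite /shape_regularity; apply: (@le_bigmax_seq _ R _ (enum_fset M) 0 T xpredT (fun T => diam (hull T) / inradius (hull T)) TM isT).
Qed.
End Triangle.

Section Refinement.
Context (R : realType).
Implicit Types (S T t : {fset (R * R)}) (p q x c u v : R * R)
  (M : {fset {fset (R * R)}}) (rule : seq {fset {fset (R * R)}}).

Lemma affine_map_sum c u v (I : Type) (r : seq I) (w : I -> R) (z : I -> R * R) :
  \sum_(i <- r) w i = 1 ->
  affine_map c u v (\sum_(i <- r) w i *: z i) =
    \sum_(i <- r) w i *: affine_map c u v (z i).
Proof.
move=> w1; rewrite /affine_map.
have L (f : R * R -> R * R) : f 0 = 0 ->
    (forall a p q, f (a *: p + q) = a *: f p + f q) ->
    f (\sum_(i <- r) w i *: z i) = \sum_(i <- r) w i *: f (z i).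
  move=> f0 fD; elim: r {w1} => [|i r IH]; first by rewrite !big_nil.
  by rewrite !big_cons fD IH.
have -> : \sum_(i <- r) w i *: (c + (z i).1 *: u + (z i).2 *: v) =
    \sum_(i <- r) (w i *: c) + \sum_(i <- r) w i *: ((z i).1 *: u) +
    \sum_(i <- r) w i *: ((z i).2 *: v).
  by rewrite -!big_split; apply: eq_bigr => i _ /=; rewrite !scalerDr.
rewrite -scaler_suml w1 scale1r; congr (_ + _ + _).
  apply: (L (fun x => x.1 *: u)); first by rewrite scale0r.
  by move=> a p q; rewrite scalerA -scalerDl.
apply: (L (fun x => x.2 *: v)); first by rewrite scale0r.
by move=> a p q; rewrite scalerA -scalerDl.
Qed.

Lemma affine_map_diff c u v p q p' q' (s : R) : p - q = s *: (p' - q') ->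
  affine_map c u v p - affine_map c u v q =
    s *: (affine_map c u v p' - affine_map c u v q').
Proof.
have E x y : affine_map c u v x - affine_map c u v y =
    (x - y).1 *: u + (x - y).2 *: v.
  by rewrite /affine_map -!(addrA c (_ *: u)) opprD addrACA subrr add0r opprD addrACA -!scalerBl.
by move=> e; rewrite !E e; move: (p' - q') => d; rewrite scalerDr !scalerA.
Qed.

Lemma hull_affine_map T S c u v x : T = [fset affine_map c u v z | z in S]%fset ->
  hull S x -> hull T (affine_map c u v x).
Proof.
move=> -> [w [w0 w1 ->]]; rewrite affine_map_sum //; apply: hull_comb => // z zS.
exact: in_imfset.
Qed.

Lemma hull_affine_map_inv T S c u v y : T = [fset affine_map c u v z | z in S]%fset ->
  hull T y -> exists2 x, hull S x & y = affine_map c u v x.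
Proof.
move=> TE [w [w0 w1 ->]].
pose g (y : R * R) : R * R := xget 0 [set x | x \in S /\ affine_map c u v x = y].
have Hg (a : R * R) : a \in T -> g a \in S /\ affine_map c u v (g a) = a.
  move=> aT; apply: (@xgetPex _ 0 [set x | x \in S /\ affine_map c u v x = a]).
  by move: (aT); rewrite TE => /imfsetP[x /= xS yE]; exists x.
exists (\sum_(z <- T) w z *: g z); first by apply: hull_comb => // z /Hg[].
rewrite affine_map_sum // big_seq [RHS]big_seq; apply: eq_bigr => z /Hg[_ ->].
by [].
Qed.

Lemma hull_ref x : hull (ref_triangle R) x -> [/\ 0 <= x.1, 0 <= x.2 & x.1 + x.2 <= 1].
Proof.
have H k e : (forall z, z \in ref_triangle R -> 0 <= affine k e z) ->
    hull (ref_triangle R) x -> 0 <= affine k e x by exact: hull_affine_ge.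
have V (z : R * R) : z \in ref_triangle R -> [\/ z = (0, 0), z = (1, 0) | z = (0, 1)].
  by rewrite !inE => /orP[/orP[]|] /eqP ->; [constructor 1|constructor 2|constructor 3].
move=> Hx; split.
- rewrite (_ : x.1 = affine 0 (1, 0) x); last by rewrite /affine /edot /=; ring.
  by apply: H Hx => z /V[] ->; rewrite /affine /edot /=; lra.
- rewrite (_ : x.2 = affine 0 (0, 1) x); last by rewrite /affine /edot /=; ring.
  by apply: H Hx => z /V[] ->; rewrite /affine /edot /=; lra.
- rewrite -subr_ge0 (_ : 1 - _ = affine 1 (-1, -1) x); last by rewrite /affine /edot /=; ring.
  by apply: H Hx => z /V[] ->; rewrite /affine /edot /=; lra.
Qed.

(** The vertices of the reference triangle are extreme points of it. *)
Lemma ref_vertex t x : hull t `<=` hull (ref_triangle R) -> hull t x ->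
  x \in ref_triangle R -> x \in t.
Proof.
move=> tr [w [w0 w1 xE]] xr.
have [k [e [lx lge lv]]] : exists k e, [/\ affine k e x = 0,
    forall z, hull (ref_triangle R) z -> 0 <= affine k e z &
    forall z, hull (ref_triangle R) z -> affine k e z = 0 -> z = x].
  have X (p q : R * R) : p.1 = q.1 -> p.2 = q.2 -> p = q by case: p q => [? ?] [? ?] /= -> ->.
  move: xr; rewrite !inE => /orP[/orP[]|] /eqP ->.
  - exists 0, (1, 1); split => [|z /hull_ref[h1 h2 h3]|z /hull_ref[h1 h2 h3]];
      rewrite /affine /edot /=; [lra|lra|move=> h].
    by apply: X => /=; lra.
  - exists 1, (-1, 0); split => [|z /hull_ref[h1 h2 h3]|z /hull_ref[h1 h2 h3]];
      rewrite /affine /edot /=; [lra|lra|move=> h].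
    by apply: X => /=; lra.
  - exists 1, (0, -1); split => [|z /hull_ref[h1 h2 h3]|z /hull_ref[h1 h2 h3]];
      rewrite /affine /edot /=; [lra|lra|move=> h].
    by apply: X => /=; lra.
have [z zt wz] : exists2 z, z \in t & w z != 0.
  apply: contrapT => H; move/eqP: w1; rewrite big_seq big1 ?(eq_sym 0) ?oner_eq0 // => z zt.
  by apply/eqP/negPn/negP => wz; apply: H; exists z.
have : \sum_(z <- t) w z * affine k e z = 0 by rewrite -affine_sum // -xE.
rewrite big_seq => /eqP; rewrite psumr_eq0 => [|y yt]; last first.
  by rewrite mulr_ge0 ?w0 // lge //; apply: tr; exact: hull_vertex.
move=> /allP/(_ z zt); rewrite zt /= mulf_eq0 (negbTE wz) /= => /eqP lz.
by rewrite -(lv z _ lz) //; apply: tr; exact: hull_vertex.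
Qed.

Lemma max_seq (I : eqType) (s : seq I) (Q : I -> R -> Prop) :
  (forall i k k', k <= k' -> Q i k -> Q i k') ->
  (forall i, i \in s -> exists k, Q i k) ->
  exists2 k : R, 0 <= k & forall i, i \in s -> Q i k.
Proof.
move=> Qm; elim: s => [|i s IH] H; first by exists 0 => // i; rewrite in_nil.
have [k Qk] := H i (mem_head _ _).
have [k' k0 Qk'] : exists2 k : R, 0 <= k & forall i, i \in s -> Q i k.
  by apply: IH => j js; apply: H; rewrite inE js orbT.
exists (Num.max k k'); first by rewrite le_max k0 orbT.
move=> j; rewrite inE => /orP[/eqP ->|/Qk' Qj].
  by apply: Qm Qk; rewrite le_max lexx.
by apply: Qm Qj; rewrite le_max lexx orbT.
Qed.

Definition pieces M T : {fset {fset (R * R)}} :=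
  [fset T' in M | `[< (hull T' `<=` hull T)%classic >]]%fset.

Lemma in_pieces M T T' : (T' \in pieces M T) = (T' \in M) && `[< hull T' `<=` hull T >].
Proof. by rewrite !inE. Qed.

(** Every refinement of an element is an affine copy of one of finitely many
    patterns: this bounds the number of pieces and, since each piece of the
    reference triangle contains a disc, the ratio of the lengths. *)
Lemma refinement_constants rule : refinement_rule rule ->
  exists (N : nat) (k : R), 0 <= k /\ forall M M', uniform_refinement rule M M' ->
    forall T, T \in M ->
    [/\ (#|` pieces M' T| <= N)%N,
        forall x, hull T x -> exists2 T', T' \in M' & hull T' `<=` hull T /\ hull T' x,
        forall T', T' \in M' -> hull T' `<=` hull T -> forall p q, hull T p -> hull T q ->
          exists p' q', [/\ hull T' p', hull T' q' & enorm (p - q) <= k * enorm (p' - q')] &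
        forall x, x \in T -> exists2 T', T' \in M' & x \in T'].
Proof.
move=> rok.
pose Q t (k : R) := forall p q, hull (ref_triangle R) p -> hull (ref_triangle R) q ->
  exists (p' q' : R * R) (s : R), [/\ hull t p', hull t q', 0 <= s <= k & p - q = s *: (p' - q')].
have [|t|k k0 Qk] := @max_seq _ (flatten [seq enum_fset A | A : {fset {fset (R * R)}} <- rule]) Q.
- move=> t k k' kk Qt p q hp hq; have [p' [q' [s [h1 h2 /andP[h3 h4] h5]]]] := Qt _ _ hp hq.
  by exists p', q', s; split => //; rewrite h3 (le_trans h4).
- move=> /flattenP[_ /mapP[p pr ->] tp]; have [[tr _ _] _] := rok _ pr.
  have [_ [c /interior_osq[r r0 rt]]] := tr _ tp.
  exists (2 / r) => x y /hull_ref[x1 x2 x3] /hull_ref[y1 y2 y3].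
  exists (c + (r / 2) *: (x - y)), c, (2 / r).
  have r2 : 0 < r / 2 by rewrite divr_gt0.
  split.
  + apply: rt; apply/osqE.
    change (`|c.1 + (r / 2) * (x.1 - y.1) - c.1| < r /\ `|c.2 + (r / 2) * (x.2 - y.2) - c.2| < r).
    rewrite ![c.1 + _]addrC ![c.2 + _]addrC !addrK !(normrM (r / 2)) (gtr0_norm r2).
    have B (s : R) : `|s| <= 1 -> r / 2 * `|s| < r.
      by move=> s1; apply: le_lt_trans (_ : r / 2 < r); [rewrite ler_piMr // ltW|lra].
    by split; apply: B; rewrite ler_norml; apply/andP; split; lra.
  + by apply: rt; apply/osqE; rewrite !subrr normr0.
  + by rewrite lexx divr_ge0 // ltW.
  + rewrite [c + _]addrC addrK scalerA mulrA divfK ?gt_eqF // divff ?scale1r //.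
exists (\sum_(A <- rule) #|` A|)%N, k; split => // M M' [_ uM] T TM.
have [p pr [c [u [v [TE tE]]]]] := uM _ TM; have [[_ pU _] _] := rok _ pr.
have memt t : t \in p -> [fset affine_map c u v x | x in t]%fset \in M' /\
    hull [fset affine_map c u v x | x in t]%fset `<=` hull T.
  by move=> tp; apply/tE; exists t.
split.
- rewrite (big_rem p) //=.
  apply: leq_trans (leq_addr _ _).
  pose GT (t : {fset (R * R)}) : {fset (R * R)} := [fset affine_map c u v x | x in t]%fset.
  have sub : (pieces M' T `<=` [fset GT t | t in p])%fset.
    apply/fsubsetP => T'; rewrite in_pieces => /andP[T'M /asboolP T'T].
    by have [t tp ->] := (tE T').1 (conj T'M T'T); apply/imfsetP; exists t.
  apply: leq_trans (fsubset_leq_card sub) _; exact: leq_imfset_card.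
- move=> y /(hull_affine_map_inv TE)[x xr ->].
  move: (xr); rewrite -pU => -[t /= tp tx].
  have [h1 h2] := memt _ tp; exists [fset affine_map c u v x | x in t]%fset => //; split => //.
  exact: hull_affine_map tx.
- move=> T' T'M T'T y z /(hull_affine_map_inv TE)[p1 hp1 ->] /(hull_affine_map_inv TE)[q1 hq1 ->].
  have [t tp T'E] := (tE T').1 (conj T'M T'T).
  have tf : t \in flatten [seq enum_fset A | A : {fset {fset (R * R)}} <- rule].
    by apply/flattenP; exists (enum_fset p) => //; apply/mapP; exists p.
  have [p' [q' [s [hp' hq' /andP[s0 sk] pq]]]] := Qk _ tf _ _ hp1 hq1.
  exists (affine_map c u v p'), (affine_map c u v q'); split.
  + exact: (hull_affine_map T'E).
  + exact: (hull_affine_map T'E).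
  + by rewrite (affine_map_diff c u v pq) enormZ ger0_norm // ler_wpM2r ?enorm_ge0.
- move=> y; rewrite {1}TE => /imfsetP[x /= xr ->].
  have : hull (ref_triangle R) x by exact: hull_vertex.
  rewrite -pU => -[t /= tp tx]; have [h1 _] := memt _ tp.
  exists [fset affine_map c u v x | x in t]%fset => //.
  apply: in_imfset; apply: ref_vertex tx xr => z tz.
  by rewrite -pU; exists t.
Qed.
End Refinement.

(** * The domain and its triangulations *)

Section Domain.
Context (R : realType).
Implicit Types (D U : set (R * R)) (T : {fset (R * R)}) (x e c b : R * R)
  (M : {fset {fset (R * R)}}) (w : R * R -> R).
Notation mu2 := (@leb2 R).

Lemma bounded_finite D : bounded_set D -> open D -> (mu2 D < +oo)%E.
Proof.
move=> [M [Mr HM]] oD; have r0 : 0 <= `|M| + 1 by rewrite addr_ge0.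
apply: (@le_lt_trans _ _ (mu2 (csq 0 (`|M| + 1)))); last first.
  by rewrite [X in (X < _)%E](leb2_csq 0 r0) ltry.
apply: le_measure; rewrite ?inE; [exact: measurable_open2|exact: measurable_csq|].
move=> x Dx; have := HM (`|M| + 1) _ x Dx.
rewrite (le_lt_trans (ler_norm M)) ?ltrDl // => /(_ isT).
by rewrite /= prod_normE ge_max => /andP[h1 h2]; apply/csqE; rewrite !subr0.
Qed.

(** Near a boundary point the domain lies above the graph of a Lipschitz
    function through that point: it contains a cone of squares on one side and
    misses the opposite cone. *)
Lemma boundary_cone D x : open D -> lipschitz_boundary D -> closure D x -> ~ D x ->
  exists e (k r0 : R), [/\ enorm e = 1, 0 < k <= 1, 0 < r0 & forall r, 0 < r < r0 ->
    csq (x + r *: e) (k * r) `<=` D /\ forall z, csq (x - r *: e) (k * r) z -> ~ D z].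
Proof.
move=> oD LD cx nx; have bx : boundary D x.
  by split => // /interior_subset.
have [e [r [h [L [g]]]]] := LD x bx; set e' := (- e.2, e.1) => -[e1 r0 h0 gL DE].
have L0 : 0 <= L.
  have := gL (1, 0) (conj I I); rewrite /= subr0 normr1 mulr1.
  exact: le_trans.
have gE s t : `|g s - g t| <= L * `|s - t| by exact: (gL (s, t) (conj I I)).
have ee : edot e e = 1 by rewrite -enorm_sq e1 expr1n.
have ee' : edot e' e = 0 by rewrite /edot /= ; ring.
have e'e' : edot e' e' = 1 by rewrite -ee /edot /=; ring.
have e'1 : enorm e' = 1 by rewrite /enorm e'e' sqrtr1.
pose S (d : R * R) := edot d e; pose T d := edot d e'.
have dE d : d = S d *: e + T d *: e'.
  have X (p q : R * R) : p.1 = q.1 -> p.2 = q.2 -> p = q by case: p q => [? ?] [? ?] /= -> ->.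
  move: ee; rewrite /S /T /edot /e' /= => ee; apply: X.
    change (d.1 = (d.1 * e.1 + d.2 * e.2) * e.1 + (d.1 * - e.2 + d.2 * e.1) * - e.2).
    by rewrite -[LHS]mulr1 -ee; ring.
  change (d.2 = (d.1 * e.1 + d.2 * e.2) * e.2 + (d.1 * - e.2 + d.2 * e.1) * e.1).
  by rewrite -[LHS]mulr1 -ee; ring.
have DE' d : `|S d| < r -> `|T d| < h -> D (x + d) <-> g (S d) < T d.
  by move=> h1 h2; rewrite {1}[d]dE addrA; exact: DE.
have Sle d : `|S d| <= enorm d by have := edot_cauchy d e; rewrite e1 mulr1.
have Tle d : `|T d| <= enorm d by have := edot_cauchy d e'; rewrite e'1 mulr1.
have g0 : g 0 = 0.
  apply/eqP; rewrite eq_le; apply/andP; split.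
    rewrite leNgt; apply/negP => g0.
    pose m := Num.min (Num.min r h) (g 0 / (L + 1)).
    have m0 : 0 < m by rewrite !lt_min r0 h0 /= divr_gt0 // ltr_wpDl.
    have : nbhs x (osq x (m / 2)) by rewrite osq_ball; apply: nbhsx_ballx; rewrite divr_gt0.
    move=> /cx[z [Dz /osqE[z1 z2]]].
    have zx : enorm (z - x) < m.
      have -> : m = 2 * (m / 2) by rewrite mulrC divfK.
      have X : Num.max `|(z - x).1| `|(z - x).2| < m / 2 by rewrite gt_max z1 z2.
      apply: le_lt_trans (_ : 2 * Num.max `|(z - x).1| `|(z - x).2| < _); last by rewrite ltr_pM2l.
      by apply: enorm_le_coord; rewrite le_max lexx ?orbT.
    have [mr mh mg] : [/\ m <= r, m <= h & m * (L + 1) <= g 0].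
      rewrite /m; split; rewrite ?ge_min ?lexx ?orbT //.
      by rewrite -ler_pdivlMr ?ltr_wpDl // ge_min lexx orbT.
    move: Dz; rewrite -[z](subrK x) [_ + x]addrC.
    move=> /DE' -/(_ (lt_le_trans (le_lt_trans (Sle _) zx) mr))
      /(_ (lt_le_trans (le_lt_trans (Tle _) zx) mh)).
    have := gE (S (z - x)) 0; rewrite subr0 => h1.
    have h2 : L * `|S (z - x)| <= L * enorm (z - x) by rewrite ler_wpM2l.
    have h3 : L * enorm (z - x) <= L * m by rewrite ler_wpM2l // ltW.
    have h4 := le_trans (ler_norm _) (Tle (z - x)).
    move: (le_trans h1 (le_trans h2 h3)); rewrite ler_norml => /andP[h5 h6].
    by apply/negP; rewrite -leNgt; lra.
  rewrite leNgt; apply/negP => g0; apply: nx.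
  have S0 : S 0 = 0 by rewrite /S /edot /= !mul0r addr0.
  have T0 : T 0 = 0 by rewrite /T /edot /= !mul0r addr0.
  by rewrite -[x]addr0; apply/DE'; rewrite ?S0 ?T0 ?normr0.
have gs s : `|g s| <= L * `|s| by have := gE s 0; rewrite g0 !subr0.
(* On squares of relative size [k] the graph varies by less than its distance
   to their centres. *)
pose k := (4 * (L + 1))^-1.
have k0 : 0 < k by rewrite invr_gt0 mulr_gt0 // ltr_wpDl.
have kE : 4 * k * (L + 1) = 1.
  by rewrite mulrAC mulfV // gt_eqF // mulr_gt0 // ltr_wpDl.
have kL : 0 <= k * L by rewrite mulr_ge0 // ltW.
have k4 : 4 * k <= 1 by move: kE; rewrite mulrDr mulr1; lra.
exists e', k, (Num.min r h / 2); split=> //.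
- by rewrite k0 /=; lra.
- by rewrite divr_gt0 // lt_min r0.
move=> rho /andP[rho0 rhom].
have [rr rh] : 2 * rho < r /\ 2 * rho < h.
  have : 2 * rho < Num.min r h by move: rhom; lra.
  by rewrite lt_min => /andP[].
have KL : 0 <= k * L * rho by rewrite mulr_ge0 // ltW.
have KR : 4 * (k * rho) <= rho by rewrite mulrA ler_piMl // ltW.
have KE : 4 * (k * rho) + 4 * (k * L * rho) = rho by rewrite -[RHS]mul1r -[X in X * rho]kE; ring.
have main (sg : R) z : `|sg| = 1 -> csq (x + (sg * rho) *: e') (k * rho) z ->
    [/\ `|S (z - x)| <= 2 * (k * rho), `|T (z - x) - sg * rho| <= 2 * (k * rho) &
     `|g (S (z - x))| <= 2 * (k * L * rho)].
  move=> sg1 /csqE[z1 z2].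
  have dl : enorm (z - (x + (sg * rho) *: e')) <= 2 * (k * rho) by exact: enorm_le_coord.
  have dE1 : z - x = (sg * rho) *: e' + (z - (x + (sg * rho) *: e')).
    by rewrite [RHS]addrC opprD addrA subrK.
  have S1 : S (z - x) = S (z - (x + (sg * rho) *: e')).
    by rewrite {1}dE1 /S [LHS]edotC edot_lin [edot e e']edotC ee' mulr0 add0r edotC.
  have T1 : T (z - x) = sg * rho + T (z - (x + (sg * rho) *: e')).
    by rewrite {1}dE1 /T [LHS]edotC edot_lin e'e' mulr1 [in LHS]edotC.
  split.
  - by rewrite S1; exact: le_trans (Sle _) dl.
  - by rewrite T1 addrC addKr; exact: le_trans (Tle _) dl.
  - apply: le_trans (gs _) _; rewrite (_ : 2 * (k * L * rho) = L * (2 * (k * rho))); last by ring.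
    by rewrite ler_wpM2l // S1; exact: le_trans (Sle _) dl.
split => z.
  rewrite -[X in x + X *: _]mul1r => /main-/(_ (normr1 _))[].
  rewrite mul1r !ler_norml => /andP[a1 a2] /andP[a3 a4] /andP[a5 a6].
  rewrite -[z](subrK x) [_ + x]addrC; apply/DE'.
  - by rewrite ltr_norml; apply/andP; split; lra.
  - by rewrite ltr_norml; apply/andP; split; lra.
  - by lra.
rewrite -scaleNr -mulN1r => /main-/(_ (normrN1 _))[].
rewrite mulN1r !ler_norml => /andP[a1 a2] /andP[a3 a4] /andP[a5 a6].
rewrite -[z](subrK x) [_ + x]addrC => /DE' H.
have : g (S (z - x)) < T (z - x).
  by apply: H; rewrite ltr_norml; apply/andP; split; lra.
by apply/negP; rewrite -leNgt; lra.
Qed.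

(** A boundary point has arbitrarily close points in the exterior of [D], which
    an interior point of an element cannot have. *)
Lemma interior_hull_domain D M T : open D -> lipschitz_boundary D ->
  triangulation (closure D) M -> T \in M -> interior (hull T) `<=` D.
Proof.
move=> oD LD [_ cov _] TM x xT; apply: contrapT => nx.
have hc : hull T `<=` closure D by rewrite -cov => z zT; exists T.
have [e [k [r0 [e1 /andP[k0 k1] r00 H]]]] := boundary_cone oD LD (hc _ (interior_subset xT)) nx.
move/interior_osq : xT => [d d0 dT].
pose r := Num.min r0 d / 2.
have r1 : 0 < r by rewrite divr_gt0 // lt_min r00 d0.
have [rr rd] : r < r0 /\ r < d.
  have h1 : Num.min r0 d <= r0 by rewrite ge_min lexx.
  have h2 : Num.min r0 d <= d by rewrite ge_min lexx orbT.
  by move: r1; rewrite /r; split; lra.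
have r1r : 0 < r < r0 by rewrite r1 rr.
have [_ H2] := H r r1r.
have : hull T (x - r *: e).
  have [c1 c2] := coord_le_enorm (r *: e).
  have ne : enorm (r *: e) = r by rewrite enormZ e1 mulr1 gtr0_norm.
  have N (a b : R) : a - b - a = - b by ring.
  apply: dT; apply/osqE => /=; rewrite !N !normrN.
  by rewrite ne in c1 c2; split; [exact: le_lt_trans c1 rd|exact: le_lt_trans c2 rd].
move=> /hc cz; have : nbhs (x - r *: e) (osq (x - r *: e) (k * r)).
  by rewrite osq_ball; apply: nbhsx_ballx; rewrite mulr_gt0.
by move=> /cz[z [Dz /osq_csq/H2]].
Qed.

Lemma domain_interior_ae D M : triangulation (closure D) M ->
  {ae mu2, forall x, D x -> exists2 T, T \in M & interior (hull T) x}.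
Proof.
move=> [tM cov _].
have := @ae_all_seq _ _ (enum_fset M) (fun T x => hull T x -> interior (hull T) x).
move=> /(_ (fun T TM => hull_interior_ae (tM T TM))); apply: aeS => x H Dx.
have : closure D x by exact: subset_closure.
by rewrite -cov => -[T TM Tx]; exists T => //; exact: H.
Qed.

(** The affine pieces of a finite element function, which determine its weak
    gradient almost everywhere. *)
Lemma S10_pieces D M w : open D -> (mu2 D < +oo)%E -> lipschitz_boundary D ->
  triangulation (closure D) M -> S10 D M w ->
  exists (c : {fset (R * R)} -> R) (b : {fset (R * R)} -> R * R),
    (forall T, T \in M -> forall x, hull T x -> w x = affine (c T) (b T) x) /\
    {ae mu2, forall x, forall T, T \in M -> interior (hull T) x -> grad D w x = b T}.
Proof.
move=> oD fD LD tM [Hw wT].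
pose g (T : {fset (R * R)}) : R * (R * R) :=
  xget (0, 0) [set h | forall x, hull T x -> w x = affine h.1 h.2 x].
have gP T : T \in M -> forall x, hull T x -> w x = affine (g T).1 (g T).2 x.
  move=> /wT[c [b cb]].
  by apply: (@xgetPex _ (0, 0) [set h | forall x, hull T x -> w x = affine h.1 h.2 x]); exists (c, b).
exists (fun T => (g T).1), (fun T => (g T).2); split => //.
apply: (@ae_all_seq _ _ (enum_fset M) (fun T x => interior (hull T) x -> grad D w x = (g T).2)) => T TM.
apply: (grad_affine oD fD (open_interior _) _ Hw.1).
  exact: (interior_hull_domain oD LD tM TM).
by move=> x /interior_subset; exact: gP.
Qed.
End Domain.

(** * Finite element functions vanish on the boundary *)

Section RectangleEstimate.
Context (R : realType).
Implicit Types (g h : R * R -> R) (c p q : R * R) (r d : R).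
Notation mu1 := (@lebesgue_measure R).
Notation mu2 := (@leb2 R).

Definition clip g c r : R * R -> \bar R := (EFin \o g) \_ (csq c r).

Lemma clip_ge0 g c r x : (forall x, 0 <= g x) -> (0 <= clip g c r x)%E.
Proof. by move=> g0; rewrite /clip patchE; case: ifP => // _; rewrite lee_fin. Qed.

Lemma measurable_clip g c r : continuous g ->
  measurable_fun (setT : set (plane R)) (clip g c r).
Proof.
move=> cg; apply/(measurable_restrict _ (measurable_csq c r) measurableT).
rewrite setTI; apply: measurable_funTS; apply/measurable_EFinP.
exact: measurable_continuous2.
Qed.

Lemma int_clip g c r : (\int[mu2]_(x in csq c r) (g x)%:E = \int[mu2]_x clip g c r x)%E.
Proof. by rewrite integral_mkcond. Qed.

Lemma clip_slice1 g c r (t : R) : `|t - c.2| <= r ->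
  (\int[mu1]_s clip g c r (s, t) = \int[mu1]_(s in `[(c.1 - r)%R, (c.1 + r)%R]) (g (s, t))%:E)%E.
Proof.
move=> tr; rewrite [RHS]integral_mkcond; apply: eq_integral => s _.
rewrite /clip !patchE; congr (if _ then _ else _).
apply/idP/idP; rewrite !inE /= in_itv /= -ler_distl.
  by move=> /csqE[].
by move=> h; apply/csqE.
Qed.

Lemma clip_slice2 g c r (s : R) : `|s - c.1| <= r ->
  (\int[mu1]_t clip g c r (s, t) = \int[mu1]_(t in `[(c.2 - r)%R, (c.2 + r)%R]) (g (s, t))%:E)%E.
Proof.
move=> tr; rewrite [RHS]integral_mkcond; apply: eq_integral => t _.
rewrite /clip !patchE; congr (if _ then _ else _).
apply/idP/idP; rewrite !inE /= in_itv /= -ler_distl.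
  by move=> /csqE[].
by move=> h; apply/csqE.
Qed.

Lemma clip_measurable2 g c r : continuous g -> (forall x, 0 <= g x) ->
  measurable_fun setT (fun s : measurableTypeR R => \int[mu1]_t clip g c r (s, t))%E /\
  measurable_fun setT (fun t : measurableTypeR R => \int[mu1]_s clip g c r (s, t))%E.
Proof.
move=> cg g0; split.
  exact: (measurable_fun_fubini_tonelli_F _ (measurable_clip c r cg) (fun x => clip_ge0 c r x g0)).
exact: (measurable_fun_fubini_tonelli_G _ (measurable_clip c r cg) (fun x => clip_ge0 c r x g0)).
Qed.

Lemma clip_tonelli g c r : continuous g -> (forall x, 0 <= g x) ->
  (\int[mu2]_x clip g c r x = \int[mu1]_s \int[mu1]_t clip g c r (s, t) /\
  \int[mu2]_x clip g c r x = \int[mu1]_t \int[mu1]_s clip g c r (s, t))%E.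
Proof.
move=> cg g0; split.
  exact: (fubini_tonelli1 _ (measurable_clip c r cg) (fun x => clip_ge0 c r x g0)).
exact: (fubini_tonelli2 _ (measurable_clip c r cg) (fun x => clip_ge0 c r x g0)).
Qed.

(** Integrate the pointwise bound over [P] in [t], then over [Q] in [z]; both
    sets have length [l]. *)
Lemma average_estimate (M N G : R -> \bar R) (P Q : set (measurableTypeR R)) (l : R) : 0 < l ->
  measurable P -> measurable Q -> mu1 P = l%:E -> mu1 Q = l%:E ->
  measurable_fun setT M -> measurable_fun setT N -> measurable_fun setT G ->
  (forall t, 0 <= M t)%E -> (forall t, 0 <= N t)%E -> (forall t, 0 <= G t)%E ->
  (forall z t, Q z -> G t <= ((fun t => l%:E * (M t + N z)) \_ P) t)%E ->
  (\int[mu1]_t G t <= l%:E * (\int[mu1]_t M t + \int[mu1]_t N t))%E.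
Proof.
move=> l0 mP mQ lP lQ mM mN mG M0 N0 G0 H.
have l0' := ltW l0; have l0E : (0 <= l%:E)%E by rewrite lee_fin.
have A0 (g : R -> \bar R) : (forall t, 0 <= g t)%E -> (0 <= \int[mu1]_t g t)%E by move=> g0; exact: integral_ge0.
have sub (D : set (measurableTypeR R)) (g : R -> \bar R) : measurable D -> measurable_fun setT g -> (forall t, 0 <= g t)%E ->
    (\int[mu1]_(t in D) g t <= \int[mu1]_t g t)%E.
  by move=> mD mg g0; apply: ge0_subset_integral.
have mMN z : measurable_fun P (fun t => M t + N z)%E.
  exact: (emeasurable_funD (measurable_funTS mM) (measurable_cst (N z))).
have mMN2 z : measurable_fun P (fun t => l%:E * (M t + N z))%E by exact: (measurable_funeM l%:E (mMN z)).
have mNQ : measurable_fun Q N by exact: measurable_funTS.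
have mN1 : measurable_fun Q (fun z => l%:E * N z)%E by exact: (measurable_funeM l%:E mNQ).
have mN2 : measurable_fun Q (fun z => l%:E * (l%:E * N z))%E by exact: (measurable_funeM l%:E mN1).
have cI (D : set (measurableTypeR R)) (C : \bar R) : measurable D -> mu1 D = l%:E ->
    (\int[mu1]_(t in D) (fun=> C) t = l%:E * C)%E.
  by move=> mD lD; rewrite integral_cst // muleC; congr (_ * _)%E; exact: lD.
have ZI (D : set (measurableTypeR R)) (g : R -> \bar R) : measurable D -> measurable_fun D g ->
    (forall t, 0 <= g t)%E ->
    (\int[mu1]_(t in D) (l%:E * g t) = l%:E * \int[mu1]_(t in D) g t)%E.
  by move=> mD mg g0; exact: (ge0_integralZl_EFin mu1 mD (fun t _ => g0 t) mg l0').
have DI (D : set (measurableTypeR R)) (g g' : R -> \bar R) : measurable D -> measurable_fun D g ->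
    measurable_fun D g' -> (forall t, 0 <= g t)%E -> (forall t, 0 <= g' t)%E ->
    (\int[mu1]_(t in D) (g t + g' t) = \int[mu1]_(t in D) g t + \int[mu1]_(t in D) g' t)%E.
  by move=> mD mg mg' g0 g'0; exact: (ge0_integralD mu1 mD (fun t _ => g0 t) mg (fun t _ => g'0 t) mg').
have IP (D : set (measurableTypeR R)) (g : R -> \bar R) : (forall t, 0 <= g t)%E ->
    (0 <= \int[mu1]_(t in D) g t)%E by move=> g0; apply: integral_ge0 => t _; exact: g0.
set I := (\int[mu1]_t G t)%E.
have Iz z : Q z -> (I <= l%:E * \int[mu1]_t M t + l%:E * (l%:E * N z))%E.
  move=> Qz; apply: (@le_trans _ _ (\int[mu1]_(t in P) (l%:E * (M t + N z)))%E).
    rewrite [leRHS]integral_mkcond; apply: ge0_le_integral => //.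
    - apply/(measurable_restrict _ mP measurableT); rewrite setTI; exact: mMN2.
    - by move=> t _; exact: H.
  rewrite (ZI P _ mP (mMN z)); last by move=> t; exact: adde_ge0.
  rewrite (DI P M (fun=> N z) mP (measurable_funTS mM) (measurable_cst _) M0 (fun=> N0 z)).
  rewrite (cI P _ mP lP) ge0_muleDr; [|exact: IP|exact: mule_ge0].
  by rewrite leeD2r // lee_wpmul2l // sub.
have : (l%:E * I <= l%:E * (l%:E * (\int[mu1]_t M t + \int[mu1]_t N t)))%E.
  rewrite -(cI Q I mQ lQ); apply: (@le_trans _ _ (\int[mu1]_(z in Q) (l%:E * \int[mu1]_t M t + l%:E * (l%:E * N z)))%E).
    apply: ge0_le_integral => //.
    - by move=> z _; exact: A0.
    - by exact: (emeasurable_funD (measurable_cst _) mN2).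
  have a0 t : (0 <= l%:E * N t)%E by exact: mule_ge0.
  have b0 t : (0 <= l%:E * (l%:E * N t))%E by exact: mule_ge0.
  have c0 : (0 <= l%:E * \int[mu1]_t M t)%E by apply: mule_ge0 => //; exact: IP.
  rewrite (DI Q (fun=> l%:E * \int[mu1]_t M t)%E (fun z => l%:E * (l%:E * N z))%E mQ (measurable_cst _) mN2 (fun=> c0) b0).
  rewrite (cI Q _ mQ lQ) (ZI Q _ mQ mN1 a0) (ZI Q _ mQ mNQ N0).
  rewrite -ge0_muleDr; [|by []|by apply: mule_ge0 => //; exact: IP].
  apply: lee_wpmul2l => //; rewrite [leRHS]ge0_muleDr; [|exact: IP|exact: IP].
  by rewrite leeD2l // lee_wpmul2l // sub.
by rewrite lee_pmul2l // lte_fin.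
Qed.

(** Joining a point of the first square to a point of the second one by a
    horizontal and a vertical segment, and averaging over the pairs of points. *)
Lemma rect_estimate h c r p q d : C1 h -> 0 < d ->
  csq p d `<=` csq c r -> csq q d `<=` csq c r -> (forall z, csq q d z -> h z = 0) ->
  (\int[mu2]_(x in csq p d) `|h x|%:E <= (2 * d)%:E *
    (\int[mu2]_(x in csq c r) `|partial1 h x|%:E + \int[mu2]_(x in csq c r) `|partial2 h x|%:E))%E.
Proof.
move=> [ch d1 d2 c1 c2] d0 pc qc hq.
have cn (g : R * R -> R) : continuous g -> continuous (fun x => `|g x|).
  by move=> cg x; apply: (@continuous_comp _ _ _ g (fun y : R => `|y|)); [exact: cg|exact: norm_continuous].
have nn (g : R * R -> R) x : 0 <= `|g x| by exact: normr_ge0.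
rewrite (int_clip (fun x => `|h x|)) (int_clip (fun x => `|partial1 h x|)) (int_clip (fun x => `|partial2 h x|)).
set g0 := fun x => `|h x|; set g1 := fun x => `|partial1 h x|; set g2 := fun x => `|partial2 h x|.
have [mN _] := clip_measurable2 c r (cn _ c2) (nn _); have [_ mM] := clip_measurable2 c r (cn _ c1) (nn _).
have [_ mG] := clip_measurable2 p d (cn _ ch) (nn _).
rewrite -/g0 -/g1 -/g2 in mN mM mG.
have [_ E0] := clip_tonelli p d (cn _ ch) (nn _); have [_ E1] := clip_tonelli c r (cn _ c1) (nn _).
have [E2 _] := clip_tonelli c r (cn _ c2) (nn _).
rewrite -/g0 -/g1 -/g2 in E0 E1 E2.
pose N (s : R) := (\int[mu1]_t clip g2 c r (s, t))%E.
pose M (t : R) := (\int[mu1]_s clip g1 c r (s, t))%E.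
have N0 s : (0 <= N s)%E by apply: integral_ge0 => t _; exact: (clip_ge0 c r _ (nn _)).
have M0 t : (0 <= M t)%E by apply: integral_ge0 => s _; exact: (clip_ge0 c r _ (nn _)).
pose P1 := `[p.1 - d, p.1 + d]%classic; pose P2 := `[p.2 - d, p.2 + d]%classic.
pose Q1 := `[q.1 - d, q.1 + d]%classic.
have len (a : R) : mu1 (`[a - d, a + d]%classic : set R) = (2 * d)%:E.
  rewrite lebesgue_measure_itv /= lte_fin ifT; last by lra.
  by rewrite -EFinB; congr EFin; ring.
have cstI (a : R) (C : \bar R) :
    (\int[mu1]_(s in `[(a - d)%R, (a + d)%R]) (cst C : R -> \bar R) s = (2 * d)%:E * C)%E.
  by rewrite integral_cst ?measurable_itv // muleC; congr (_ * _)%E; exact: len.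
have pt s t z : csq p d (s, t) -> z \in Q1 -> (`|h (s, t)|%:E <= M t + N z)%E.
  move=> pst; rewrite inE /Q1 /= in_itv /= -ler_distl => zq.
  have qz : csq q d (z, q.2) by apply/csqE; rewrite /= subrr normr0; split => //; exact: ltW.
  have /pc/csqE[/= sc tc] := pst; have /qc/csqE[/= zc qc2] := qz.
  have i1 : (`|h (s, t) - h (z, t)|%:E <= M t)%E.
    rewrite /M clip_slice1 //; apply: (increment_le (F := fun s => h (s, t))).
    - by move=> y; exact: slice1.
    - exact: continuous_slice1.
    - by rewrite -ler_distl.
    - by rewrite -ler_distl.
  have i2 : (`|h (z, t) - h (z, q.2)|%:E <= N z)%E.
    rewrite /N clip_slice2 //; apply: (increment_le (F := fun t => h (z, t))).
    - by move=> y; exact: slice2.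
    - exact: continuous_slice2.
    - by rewrite -ler_distl.
    - by rewrite -ler_distl.
  apply: le_trans (leeD i1 i2); rewrite -EFinD lee_fin (hq _ qz) subr0.
  by apply: le_trans (ler_normD _ _); rewrite subrK.
have slice z t : z \in Q1 ->
    (\int[mu1]_s clip g0 p d (s, t) <= ((fun t => (2 * d)%:E * (M t + N z)) \_ P2) t)%E.
  move=> zQ; rewrite patchE; case: ifPn => tP; last first.
    rewrite integral0_eq // => s _; rewrite /clip patchE ifF //; apply/negbTE.
    move: tP; apply: contra; rewrite !inE => /csqE[_ /= h2].
    by rewrite /P2 /= in_itv /= -ler_distl.
  have tp : `|t - p.2| <= d by move: tP; rewrite inE /P2 /= in_itv /= -ler_distl.
  rewrite clip_slice1 //.
  apply: (@le_trans _ _ (\int[mu1]_(s in P1) (cst (M t + N z)) s)%E); last first.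
    by rewrite [leLHS](cstI p.1).
  apply: ge0_le_integral => //.
  - by move=> s _; rewrite lee_fin; exact: nn.
  - apply/measurable_EFinP; apply: measurable_funTS; apply: continuous_measurable_fun.
    by apply: continuous_slice1; exact: cn.
  - move=> s; rewrite /= in_itv /= -ler_distl => sp; apply: pt => //.
    exact/csqE.
have G0 t : (0 <= \int[mu1]_s clip g0 p d (s, t))%E.
  by apply: integral_ge0 => s _; exact: (clip_ge0 p d _ (nn _)).
have dd : 0 < 2 * d by rewrite mulr_gt0.
have mP : measurable (P2 : set (measurableTypeR R)) by exact: measurable_itv.
have mQ : measurable (Q1 : set (measurableTypeR R)) by exact: measurable_itv.
have sl (z t : R) : Q1 z -> (\int[mu1]_s clip g0 p d (s, t) <= ((fun t => (2 * d)%:E * (M t + N z)) \_ P2) t)%E.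
  by move=> zQ; apply: slice; rewrite inE.
rewrite E0 E1 E2.
exact: (average_estimate dd mP mQ (len p.2) (len q.1) mM mN mG M0 N0 G0 sl).
Qed.
End RectangleEstimate.

Lemma near_in_seq (X : topologicalType) (I : eqType) (s : seq I) (x : X) (P : I -> X -> Prop) :
  (forall i, i \in s -> \forall z \near x, P i z) ->
  \forall z \near x, forall i, i \in s -> P i z.
Proof.
elim: s => [|i s IH] H; first by apply: filterS filterT => z _ i; rewrite in_nil.
have Hs j : j \in s -> \forall z \near x, P j z.
  by move=> js; apply: H; rewrite inE js orbT.
have A := H i (mem_head _ _); have B := IH Hs; move: A B.
by apply: filterS2 => z z1 z2 j; rewrite inE => /orP[/eqP ->|/z2].
Qed.

Section Trace.
Context (R : realType).
Implicit Types (D E U : set (R * R)) (T : {fset (R * R)}) (x e c b : R * R)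
  (M : {fset {fset (R * R)}}) (w v f g h : R * R -> R).
Notation mu2 := (@leb2 R).

Lemma int_sub D E f : measurable (D : set (plane R)) -> measurable (E : set (plane R)) ->
  E `<=` D -> mu2.-integrable D (EFin \o f) -> (forall x, 0 <= f x) ->
  \int[mu2]_(x in E) f x <= \int[mu2]_(x in D) f x.
Proof.
move=> mD mE ED fD f0; have fE := integrableS mD mE ED fD.
apply: fine_le; [exact: (integrable_fin_num mE fE)|exact: (integrable_fin_num mD fD)|].
apply: (@ge0_subset_integral _ _ _ mu2 E D mE mD) => //.
  exact: measurable_int fD.
by move=> x _; rewrite lee_fin.
Qed.

(** A bounded part plus a part controlled in [L^2]; [eta] balances the two
    contributions of the latter. *)
Lemma int_abs_le D E f g (B eta m : R) : measurable (D : set (plane R)) ->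
  measurable (E : set (plane R)) -> E `<=` D -> (mu2 E <= m%:E)%E -> 0 < eta -> 0 <= B ->
  sqint mu2 D g -> measurable_fun E f ->
  {ae mu2, forall x, E x -> `|f x| <= B + `|g x|} ->
  \int[mu2]_(x in E) `|f x| <= (B + eta) * m + eta^-1 * \int[mu2]_(x in D) (g x ^+ 2).
Proof.
move=> mD mE ED Em eta0 B0 gD mf fg.
have fE : mu2 E \is a fin_num by rewrite ge0_fin_numE ?(le_lt_trans Em) ?ltry.
have sE := sqint_sub mD mE ED gD.
have mg : measurable_fun E (fun x => `|g x|) by apply: measurableT_comp => //; exact: sE.1.
have ig : mu2.-integrable E (EFin \o (fun x => `|g x|)).
  have i3 : mu2.-integrable E (EFin \o (fun x => 1 + g x ^+ 2)).
    have i1 : mu2.-integrable E (EFin \o (fun=> 1)).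
      apply: measurable_bounded_integrable => //; first by rewrite ltey_eq fE.
      by exists 1; split => // z zM y _ /=; rewrite normr1 ltW.
    under [X in _.-integrable _ X]eq_fun do rewrite /= EFinD.
    exact: (integrableD mE i1 sE.2).
  apply: (ae_le_integrable mE mg _ i3); apply: aeW => x _; rewrite normr_id.
  apply: le_trans (ler_norm _); have := sqr_ge0 (`|g x| - 1).
  by rewrite sqrrB expr1n mulr1 real_normK ?num_real //; have := normr_ge0 (g x); lra.
have iB : mu2.-integrable E (EFin \o (fun=> B)).
  apply: measurable_bounded_integrable => //; first by rewrite ltey_eq fE.
  by exists `|B|; split => // z zM y _; exact: ltW.
have iBg : mu2.-integrable E (EFin \o (fun x => B + `|g x|)).
  under [X in _.-integrable _ X]eq_fun do rewrite /= EFinD.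
  exact: (integrableD mE iB ig).
have mnf : measurable_fun E (fun x => `|f x|) by apply: measurableT_comp.
have i_f : mu2.-integrable E (EFin \o (fun x => `|f x|)).
  apply: (ae_le_integrable mE mnf _ iBg); apply: aeS fg => x h /h{}h.
  by rewrite normr_id; apply: le_trans h (ler_norm _).
apply: (@le_trans _ _ (\int[mu2]_(x in E) (B + `|g x|))).
  apply: fine_le; [exact: (integrable_fin_num mE i_f)|exact: (integrable_fin_num mE iBg)|].
  apply: ae_ge0_le_integral => //.
  - exact: measurable_int i_f.
  - by move=> x _; rewrite lee_fin addr_ge0.
  - exact: measurable_int iBg.
rewrite (@RintegralD _ _ _ mu2 E _ _ mE iB ig) (@Rintegral_cst _ _ _ mu2 E mE).
have mE' : fine (mu2 E) <= m by rewrite -lee_fin fineK.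
have H1 := int_norm_le mE fE eta0 sE.
have H2 := int_sub mD mE ED gD.2 (fun x => sqr_ge0 (g x)).
have H3 : eta^-1 * \int[mu2]_(x in E) (g x ^+ 2) <= eta^-1 * \int[mu2]_(x in D) (g x ^+ 2).
  by rewrite ler_wpM2l // invr_ge0 ltW.
have H4 : B * fine (mu2 E) <= B * m by rewrite ler_wpM2l.
have H5 : eta * fine (mu2 E) <= eta * m by rewrite ler_pM2l.
rewrite mulrDl; lra.
Qed.

#[local] Transparent H1norm.
Lemma H1norm_parts D v : open D -> H1 D v ->
  [/\ \int[mu2]_(x in D) (v x ^+ 2) <= H1norm D v ^+ 2,
      \int[mu2]_(x in D) ((grad D v x).1 ^+ 2) <= H1norm D v ^+ 2 &
      \int[mu2]_(x in D) ((grad D v x).2 ^+ 2) <= H1norm D v ^+ 2].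
Proof.
move=> oD Hv; have mD := measurable_open2 oD; have [s0 s1 s2] := grad_sqint oD Hv.
have -> : H1norm D v ^+ 2 = \int[mu2]_(x in D) (v x ^+ 2 + edot (grad D v x) (grad D v x)).
  rewrite /H1norm sqr_sqrtr //; apply: Rintegral_ge0 => x _.
  by rewrite addr_ge0 ?sqr_ge0 ?edot_ge0.
have i0 : mu2.-integrable D (EFin \o (fun x => v x ^+ 2 + edot (grad D v x) (grad D v x))).
  have i12 := integrableD mD s0.2 (integrableD mD s1.2 s2.2).
  by apply: eq_integrable i12 => // x _; rewrite /= -!EFinD /edot -!expr2.
have P (f : R * R -> R) : mu2.-integrable D (EFin \o f) ->
    (forall x, f x <= v x ^+ 2 + edot (grad D v x) (grad D v x)) ->
    \int[mu2]_(x in D) f x <= \int[mu2]_(x in D) (v x ^+ 2 + edot (grad D v x) (grad D v x)).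
  by move=> fi fl; apply: (le_Rintegral mD fi i0) => x _; exact: fl.
split; [apply: P; first exact: s0.2|apply: P; first exact: s1.2|apply: P; first exact: s2.2] => x.
- by rewrite lerDl edot_ge0.
- by rewrite /edot -!expr2; have := sqr_ge0 (v x); have := sqr_ge0 (grad D v x).2; lra.
- by rewrite /edot -!expr2; have := sqr_ge0 (v x); have := sqr_ge0 (grad D v x).1; lra.
Qed.

#[local] Opaque H1norm.

Lemma int_off_in D E f : (forall x, E x -> ~ D x -> f x = 0) ->
  \int[mu2]_(x in E) f x = \int[mu2]_(x in E `&` D) f x.
Proof.
move=> H; rewrite Rintegral_mkcond [RHS]Rintegral_mkcond.
apply: eq_Rintegral => x _; rewrite !patchE.
case: ifPn => xE; case: ifPn => xI //.
  by apply: H; [exact: set_mem|move=> Dx; move: xI; rewrite notin_setE; apply; split=> //; exact: set_mem].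
by move: xE xI; rewrite notin_setE inE => nE [].
Qed.

Lemma integrable_norm_csq g (u : R * R) (s : R) : continuous g ->
  mu2.-integrable (csq u s) (EFin \o (fun z => `|g z|)).
Proof.
move=> cg; apply: (@integrable_csq _ (fun z => `|g z|)) => z.
by apply: (@continuous_comp _ _ _ g (fun y : R => `|y|)); [exact: cg|exact: norm_continuous].
Qed.

Lemma Rint_csq g (u : R * R) (s : R) : continuous g ->
  (\int[mu2]_(z in csq u s) `|g z|)%:E = (\int[mu2]_(z in csq u s) `|g z|%:E)%E.
Proof.
move=> cg; apply: fineK.
exact: (integrable_fin_num (measurable_csq u s) (integrable_norm_csq u s cg)).
Qed.

Lemma rect_estimate_real h (c p q : R * R) (r d : R) : C1 h -> 0 < d ->
  csq p d `<=` csq c r -> csq q d `<=` csq c r -> (forall z, csq q d z -> h z = 0) ->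
  \int[mu2]_(x in csq p d) `|h x| <= 2 * d *
    (\int[mu2]_(x in csq c r) `|partial1 h x| + \int[mu2]_(x in csq c r) `|partial2 h x|).
Proof.
move=> Ch d0 pc qc hq; have [ch _ _ c1 c2] := Ch.
have X (A B C : \bar R) (a b e l : R) : a%:E = A -> b%:E = B -> e%:E = C ->
    (A <= l%:E * (B + C))%E -> a <= l * (b + e).
  by move=> <- <- <-; rewrite -EFinD -EFinM lee_fin.
exact: (X _ _ _ _ _ _ _ (Rint_csq p d ch) (Rint_csq c r c1) (Rint_csq c r c2)
  (rect_estimate Ch d0 pc qc hq)).
Qed.

Lemma cst_le_csq (a : R) g (u : R * R) (s : R) : 0 <= s -> continuous g ->
  `|a| * (2 * s) ^+ 2 <= \int[mu2]_(z in csq u s) `|a - g z| + \int[mu2]_(z in csq u s) `|g z|.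
Proof.
move=> s0 cg; have mP := measurable_csq u s.
have c1 : continuous (fun z => a - g z) by move=> z; apply: cvgB; [exact: cvg_cst|exact: cg].
have i1 := integrable_norm_csq u s c1; have i2 := integrable_norm_csq u s cg.
have i3 : mu2.-integrable (csq u s) (EFin \o (fun=> `|a|)).
  by apply: (integrable_norm_csq u s (g := fun=> a)) => z; exact: cvg_cst.
have i4 : mu2.-integrable (csq u s) (EFin \o (fun z => `|a - g z| + `|g z|)).
  by apply: eq_integrable (integrableD mP i1 i2).
rewrite -(@RintegralD _ _ _ mu2 _ _ _ mP i1 i2).
have <- : \int[mu2]_(z in csq u s) `|a| = `|a| * (2 * s) ^+ 2.
  by rewrite (@Rintegral_cst _ _ _ mu2 _ mP) [X in fine X](leb2_csq u s0).
have H := @le_Rintegral _ _ _ mu2 _ _ _ mP i3 i4; apply: H => z _.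
by rewrite -[X in `|X| <= _](subrK (g z)); exact: ler_normD.
Qed.

Lemma trace_arith (B r k a A1 A2 I1 I2 : R) :
  let d := k * r in let m := (2 * (2 * r)) ^+ 2 in let m' := (2 * d) ^+ 2 in
  0 <= B -> 0 < r -> r <= 1 -> 0 < k -> k <= 1 ->
  A1 <= (B + r) * m + r ^+ 3 -> A2 <= (B + r) * m + r ^+ 3 ->
  I1 <= 2 * d * (A1 + A2) -> I2 <= (4 * r * B + r) * m' + r ^+ 3 ->
  a * m' <= I2 + I1 -> a * (4 * k ^+ 2) <= r * (80 * B + 80).
Proof.
move=> d m m' B0 rp r1 k0 k1 h1 h2 E1 E3 E4.
have r2 : 0 < r ^+ 2 by rewrite exprn_gt0.
have d_gt0 : 0 < d by rewrite mulr_gt0.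
have dr : d <= r by rewrite /d ler_piMl // ltW.
  set X := (B + r) * m + r ^+ 3 in h1 h2.
  have r3 : r ^+ 3 <= r ^+ 2 by rewrite exprS ler_piMl // ltW.
  have X0 : 0 <= X.
    by rewrite /X addr_ge0 ?exprn_ge0 ?(ltW rp) // mulr_ge0 ?sqr_ge0 // addr_ge0 // ltW.
  have XB : X <= (B + 1) * (16 * r ^+ 2) + r ^+ 2.
    rewrite /X; apply: lerD => //; rewrite /m (_ : _ ^+ 2 = 16 * r ^+ 2); last by ring.
    by apply: ler_wpM2r; [rewrite mulr_ge0 // sqr_ge0|rewrite lerD2l].
  have k2 : k ^+ 2 <= 1 by rewrite expr_le1 // ltW.
  have m'E : m' = 4 * k ^+ 2 * r ^+ 2 by rewrite /m' /d; ring.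
  have m'r : m' <= 4 * r ^+ 2.
    by rewrite m'E ler_wpM2r ?sqr_ge0 //; lra.
  have H3 : (4 * r * B + r) * m' <= (4 * r * B + r) * (4 * r ^+ 2).
    by rewrite ler_wpM2l // addr_ge0 ?mulr_ge0 ?(ltW rp).
  have H1 : 2 * d * (X + X) <= 4 * (r * ((B + 1) * (16 * r ^+ 2) + r ^+ 2)).
    rewrite (_ : 2 * d * _ = 4 * (d * X)); last by ring.
    by rewrite ler_pM2l // ler_pM // ltW.
  have H1' : 2 * d * (A1 + A2) <=
      2 * d * (X + X) by rewrite ler_wpM2l ?lerD // mulr_ge0 // ltW.
  rewrite -(ler_pM2r r2) (_ : a * _ * _ = a * m'); last by rewrite m'E; ring.
  have F := le_trans E4 (lerD E3 (le_trans E1 (le_trans H1' H1))).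
  apply: le_trans F _.
  have -> : r * (80 * B + 80) * r ^+ 2 = (4 * r * B + r) * (4 * r ^+ 2) + r ^+ 3 +
      4 * (r * ((B + 1) * (16 * r ^+ 2) + r ^+ 2)) + 7 * r ^+ 3 by ring.
  have r30 : 0 <= r ^+ 3 by rewrite exprn_ge0 // ltW.
  by move: H3 r30; move: (_ * m') (r * _) (_ * (4 * _)) (r ^+ 3) => *; lra.
Qed.

(** On squares of side comparable to [r] around the axis of the boundary cone,
    a test function close to [w] is the integral of its gradient from a square
    where it vanishes, so its mean is of order [r]; so is the oscillation
    of [w], hence [w x] is of order [r]. *)
Lemma trace_zero D M w x : open D -> bounded_set D -> lipschitz_boundary D ->
  triangulation (closure D) M -> S10 D M w -> closure D x -> ~ D x -> w x = 0.
Proof.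
move=> oD bD LD tM Sw cx nx; have fD := bounded_finite bD oD; have mD := measurable_open2 oD.
have [c [b [wE gE]]] := S10_pieces oD fD LD tM Sw; have [tri cov _] := tM.
have Hw : H1 D w := Sw.1.1.
pose B := \sum_(T <- M) enorm (b T).
have B0 : 0 <= B by apply: sumr_ge0 => T _; exact: enorm_ge0.
have bB T : T \in M -> enorm (b T) <= B.
  move=> TM; rewrite /B (bigD1_seq T) ?fset_uniq //= lerDl.
  by apply: sumr_ge0 => S _; exact: enorm_ge0.
have [d0 d00 near] : exists2 d0 : R, 0 < d0 & forall z, osq x d0 z -> closure D z ->
    `|w x - w z| <= B * enorm (x - z).
  have H : \forall z \near x, forall T, T \in enum_fset M -> hull T z -> hull T x.
    apply: (@near_in_seq _ _ (enum_fset M) x (fun T z => hull T z -> hull T x)) => T TM.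
    have [Tx|nTx] := pselect (hull T x); first by apply: filterS filterT.
    have o : open (~` hull T) by apply: closed_openC; exact: (closed_hull (tri _ TM)).
    by have := open_nbhs_nbhs (conj o nTx); apply: filterS => z nz /nz.
  move: H => /nbhs_ballP[d0 d00 H]; exists d0 => // z; rewrite osq_ball => /H{}H.
  rewrite -cov => -[T TM Tz]; have Tx := H T TM Tz.
  rewrite (wE T TM x Tx) (wE T TM z Tz).
  have -> : affine (c T) (b T) x - affine (c T) (b T) z = edot (b T) (x - z).
    by rewrite /affine /edot /=; ring.
  by apply: le_trans (edot_cauchy _ _) _; rewrite ler_wpM2r ?enorm_ge0 ?bB.
have [e [k [r0 [e1 /andP[k0 k1] r00 cone]]]] := boundary_cone oD LD cx nx.
have gB : {ae mu2, forall z, D z -> enorm (grad D w z) <= B}.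
  apply: aeS2 gE (domain_interior_ae tM) => z gz Dz /Dz[T TM Tz].
  by rewrite (gz T TM Tz) bB.
pose C := 80 * B + 80.
have main (r : R) : 0 < r -> r <= 1 -> r < r0 -> 2 * r < d0 -> `|w x| * (4 * k ^+ 2) <= r * C.
  move=> rp r1 rr rd; have rr0 : 0 < r < r0 by rewrite rp rr.
  have [PD Qn] := cone r rr0.
  pose p := x + r *: e; pose q := x - r *: e; pose d := k * r.
  have d_gt0 : 0 < d by rewrite mulr_gt0.
  have dr : d <= r by rewrite /d ler_piMl // ltW.
  pose S := csq x (2 * r); pose P := csq p d.
  have ne : enorm (r *: e) = r by rewrite enormZ e1 mulr1 gtr0_norm.
  have [ne1 ne2] := coord_le_enorm (r *: e); rewrite ne in ne1 ne2.
  have sh (v : R * R) : `|v.1| <= r -> `|v.2| <= r -> csq (x + v) d `<=` S.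
    move=> v1 v2 z /csqE[/= z1 z2]; apply/csqE.
    have X (a a' a'' : R) : `|a - (a' + a'')| <= d -> `|a''| <= r -> `|a - a'| <= 2 * r.
      by rewrite !ler_norml => /andP[h1 h2] /andP[h3 h4]; apply/andP; split; lra.
    by split; [exact: X z1 v1|exact: X z2 v2].
  have PS : P `<=` S by exact: sh.
  have QS : csq q d `<=` S by apply: sh => /=; rewrite normrN.
  have r2 : 0 < r ^+ 2 by rewrite exprn_gt0.
  (* With the accuracy [r ^+ 2] the error of the approximation is of order
     [r ^+ 3], which is the area of the squares times [r]. *)
  have [phi tphi Hphi] := Sw.1.2 _ r2.
  have C1phi := test_function_C1 tphi; have [cphi _ _ cp1 cp2] := C1phi.
  have [_ [Kc [cK KD phi0]]] := tphi.
  have q0 z : csq q d z -> phi z = 0 by move=> /Qn nz; apply: phi0 => /KD.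
  have Hd : H1 D (w - phi) by apply: (subspaceB (subspace_H1 oD) Hw); exact: (test_H1 oD tphi).
  have {}Hphi : H1norm D (w - phi) ^+ 2 <= r ^+ 4.
    rewrite (exprM r 2 2) ler_pXn2r ?nnegrE ?H1norm_ge0 // ltW //.
  have [n0 n1 n2] := H1norm_parts oD Hd; have [s0 s1 s2] := grad_sqint oD Hd.
  have mS := measurable_csq x (2 * r); have mP := measurable_csq p d.
  have ii := @integrable_norm_csq.
  have E1 : \int[mu2]_(z in P) `|phi z| <=
      2 * d * (\int[mu2]_(z in S) `|partial1 phi z| + \int[mu2]_(z in S) `|partial2 phi z|).
    exact: (rect_estimate_real C1phi d_gt0 PS QS q0).
  have gd : {ae mu2, forall z, D z -> [/\ `|partial1 phi z| <= B + `|(grad D (w - phi) z).1| &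
      `|partial2 phi z| <= B + `|(grad D (w - phi) z).2|]}.
    have Hphi1 := test_H1 oD tphi.
    have g1 := weak_gradient_unique oD (gradP Hphi1) (test_gradient oD tphi).
    have := grad_lin 1 oD Hd Hphi1; rewrite scale1r subrK => g2.
    apply: (aeS2 _ g1 (aeS2 _ g2 gB)); last by move=> z a1 a2; exact: (conj a1 a2).
    move=> z h1 [h2 h3] Dz; have {}h1 := h1 Dz; have {}h2 := h2 Dz; have {}h3 := h3 Dz; rewrite scale1r in h2.
    have [k1' k2'] := coord_le_enorm (grad D w z).
    have F1 : partial1 phi z = (grad D w z).1 - (grad D (w - phi) z).1.
      by rewrite h2 h1 /= addrAC subrr add0r.
    have F2 : partial2 phi z = (grad D w z).2 - (grad D (w - phi) z).2.
      by rewrite h2 h1 /= addrAC subrr add0r.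
    rewrite F1 F2; split.
      by apply: le_trans (ler_normB _ _) _; rewrite lerD2r (le_trans k1').
    by apply: le_trans (ler_normB _ _) _; rewrite lerD2r (le_trans k2').
  pose m := (2 * (2 * r)) ^+ 2.
  have mSD : measurable (S `&` D : set (plane R)) by exact: measurableI.
  have SDm : (mu2 (S `&` D) <= m%:E)%E.
    have r20 : 0 <= 2 * r by rewrite mulr_ge0 // ltW.
    rewrite /m -(leb2_csq x r20); apply: le_measure; rewrite ?inE //; exact: subIsetl.
  have E2 (f g : R * R -> R) : continuous f -> (forall z, ~ D z -> f z = 0) ->
      sqint mu2 D g -> \int[mu2]_(z in D) (g z ^+ 2) <= H1norm D (w - phi) ^+ 2 ->
      {ae mu2, forall z, D z -> `|f z| <= B + `|g z|} ->
      \int[mu2]_(z in S) `|f z| <= (B + r) * m + r ^+ 3.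
    move=> cf f0 sg ng fg; rewrite (@int_off_in D S (fun z => `|f z|)) => [|z _ /f0 ->]; last by rewrite normr0.
    apply: le_trans (int_abs_le mD mSD (@subIsetr _ S D) SDm rp B0 sg _ _) _.
    - by apply: measurable_funTS; exact: measurable_continuous2.
    - by apply: aeS fg => z h [_ /h].
    - rewrite lerD2l; apply: (@le_trans _ _ (r^-1 * r ^+ 4)).
        by rewrite ler_wpM2l ?invr_ge0 ?(ltW rp) // (le_trans ng).
      by rewrite exprS mulKf // gt_eqF.
  have A1 : \int[mu2]_(z in S) `|partial1 phi z| <= (B + r) * m + r ^+ 3.
    apply: E2 cp1 _ s1 n1 _; last by apply: aeS gd => z h /h[].
    by move=> z nz; apply: (partial_off cK phi0 _).1 => /KD.
  have A2 : \int[mu2]_(z in S) `|partial2 phi z| <= (B + r) * m + r ^+ 3.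
    apply: E2 cp2 _ s2 n2 _; last by apply: aeS gd => z h /h[].
    by move=> z nz; apply: (partial_off cK phi0 _).2 => /KD.
  pose m' := (2 * d) ^+ 2.
  have Pm : mu2 P = m'%:E by exact: (leb2_csq p (ltW d_gt0)).
  have E3 : \int[mu2]_(z in P) `|w x - phi z| <= (4 * r * B + r) * m' + r ^+ 3.
    have Pm' : (mu2 P <= m'%:E)%E by rewrite Pm.
    have B4 : 0 <= 4 * r * B by rewrite !mulr_ge0 // ltW.
    apply: le_trans (int_abs_le mD mP PD Pm' rp B4 s0 _ _) _.
    - apply: measurable_funTS; apply: measurable_continuous2 => z.
      by apply: cvgB; [exact: cvg_cst|exact: cphi].
    - apply: aeW => z Pz; have Sz := PS z Pz; have /csqE[z1 z2] := Sz.
      have Dz := PD z Pz.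
      have oz : osq x d0 z by apply/osqE; split; apply: le_lt_trans rd.
      have exz : enorm (x - z) <= 2 * (2 * r).
        by apply: enorm_le_coord => /=; rewrite distrC.
      have h := le_trans (near z oz (subset_closure Dz)) (ler_wpM2l B0 exz).
      rewrite (_ : w x - phi z = (w x - w z) + (w z - phi z)); last by ring.
      apply: le_trans (ler_normD _ _) _; rewrite lerD2r (le_trans h) // le_eqVlt.
      by apply/orP; left; apply/eqP; ring.
    - rewrite lerD2l; apply: (@le_trans _ _ (r^-1 * r ^+ 4)).
        by rewrite ler_wpM2l ?invr_ge0 ?(ltW rp) // (le_trans n0).
      by rewrite exprS mulKf // gt_eqF.
  have E4 : `|w x| * m' <= \int[mu2]_(z in P) `|w x - phi z| + \int[mu2]_(z in P) `|phi z|.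
    exact: (cst_le_csq (w x) p (ltW d_gt0) cphi).
  exact: (trace_arith B0 rp r1 k0 k1 A1 A2 E1 E3 E4).
apply/eqP; rewrite -normr_eq0; apply/negPn/negP => wx0.
have wx : 0 < `|w x| * (4 * k ^+ 2).
  by rewrite !mulr_gt0 ?exprn_gt0 // lt0r wx0 normr_ge0.
have C0 : 0 < C by rewrite /C; lra.
set a := `|w x| * _ in main wx.
pose r := Num.min (Num.min 1 (r0 / 2)) (Num.min (d0 / 4) (a / (2 * C))).
have r_gt0 : 0 < r by rewrite /r !lt_min ltr01 !divr_gt0 // mulr_gt0.
have [h1 h2 h3 h4] : [/\ r <= 1, r <= r0 / 2, r <= d0 / 4 & r <= a / (2 * C)].
  by rewrite /r; split; rewrite !ge_min lexx ?orbT.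
have : a <= r * C by apply: main => //; [move: r_gt0; lra|lra].
rewrite leNgt => /negP; apply.
have : r * C <= a / (2 * C) * C by rewrite ler_pM2r.
have -> : a / (2 * C) * C = a / 2 by rewrite invfM mulrA mulfVK // gt_eqF.
by move/le_lt_trans; apply; lra.
Qed.
End Trace.

(** * Local finite element estimates *)

(** A function that is Lipschitz on each set of a finite closed cover of an
    interval is so between its ends: one travels in one set of the cover up to
    its last point, which lies in another set, and then discards the first. *)
Lemma lipschitz_cover (R : realType) (I : eqType) (A : I -> set R) (g : R -> R) (L b : R)
    (n : nat) (s : seq I) (a : R) : (size s <= n)%N ->
  (forall i, i \in s -> closed (A i)) ->
  (forall i x y, i \in s -> A i x -> A i y -> `|g x - g y| <= L * `|x - y|) ->
  (forall x, a <= x <= b -> exists2 i, i \in s & A i x) -> a <= b ->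
  `|g a - g b| <= L * (b - a).
Proof.
elim: n s a => [|n IH] s a sn cA gA cov ab.
  have [|i] := cov a; first by rewrite lexx ab.
  by move: sn; rewrite leqn0 size_eq0 => /eqP ->.
have [|i is_ Aa] := cov a; first by rewrite lexx ab.
pose E := A i `&` `[a, b]%classic.
have Ea : E a by split => //; rewrite /= in_itv /= lexx ab.
have uE : has_ubound E by exists b => x [_]; rewrite /= in_itv /= => /andP[].
pose c := sup E.
have cE : closed E by apply: closedI; [exact: cA|exact: interval_closed].
have Ec : E c.
  rewrite [E](_ : E = closure E); last by exact/closure_id.
  by apply: closure_sup => //; exists a.
have [Ac] := Ec; rewrite /= in_itv /= => /andP[ac cb].
have h1 : `|g a - g c| <= L * (c - a).
  by apply: le_trans (gA i a c is_ Aa Ac) _; rewrite distrC ger0_norm // subr_ge0.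
move: cb; rewrite le_eqVlt => /orP[/eqP cb|cb]; first by rewrite -cb.
pose s' := [seq j <- s | j != i].
have ins' j : j \in s' = (j != i) && (j \in s) by rewrite mem_filter.
have cov1 x : c < x <= b -> exists2 j, j \in s' & A j x.
  move=> /andP[cx xb]; have [|j js Ajx] := cov x; first by rewrite xb (le_trans ac (ltW cx)).
  exists j => //; rewrite ins' js andbT; apply/eqP => ji; rewrite ji in Ajx.
  have : x <= c.
    by apply: ub_le_sup => //; split=> //; rewrite /= in_itv /= xb (le_trans ac (ltW cx)).
  by rewrite leNgt cx.
have cov' x : c <= x <= b -> exists2 j, j \in s' & A j x.
  rewrite le_eqVlt => /andP[/orP[/eqP <-|cx] xb]; last by apply: cov1; rewrite cx.
  apply: contrapT => nA.
  have : \forall z \near c, forall j, j \in s' -> ~ A j z.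
    apply: (@near_in_seq R I s' c (fun j z => ~ A j z)) => j js.
    have o : open (~` A j) by apply: closed_openC; apply: cA; move: js; rewrite ins' => /andP[].
    by apply: (open_nbhs_nbhs (conj o _)) => Ajc; apply: nA; exists j.
  move=> /nbhs_ballP[d d0 H].
  (* A point right of [c] that is not in the first set but close to [c]. *)
  pose z := Num.min b (c + d / 2).
  have cz : c < z by rewrite lt_min cb ltrDl divr_gt0.
  have [|j js Ajz] := cov1 z; first by rewrite cz ge_min lexx.
  apply: (H z _ j js Ajz); rewrite /ball /= ltr_norml.
  have h2 : z <= c + d / 2 by rewrite ge_min lexx orbT.
  by have d0' : 0 < d by []; apply/andP; split; lra.
have h2 : `|g c - g b| <= L * (b - c).
  apply: (IH s') => //.
  - have : (size s' < size s)%N.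
      by rewrite size_filter -(count_predC (fun j => j != i) s) -[ltnLHS]addn0 ltn_add2l -has_count;
        apply/hasP; exists i => //=; rewrite eqxx.
    by move=> h; rewrite -ltnS (leq_trans h).
  - by move=> j; rewrite ins' => /andP[_ js]; exact: cA.
  - by move=> j x y; rewrite ins' => /andP[_ js]; exact: gA.
  - exact: ltW.
have -> : g a - g b = (g a - g c) + (g c - g b) by ring.
by apply: le_trans (ler_normD _ _) (le_trans (lerD h1 h2) _); rewrite -mulrDr addrC subrKA.
Qed.

Section FiniteElements.
Context (R : realType).
Implicit Types (D : set (R * R)) (T S : {fset (R * R)}) (x p q c b : R * R)
  (M : {fset {fset (R * R)}}) (w v : R * R -> R).
Notation mu2 := (@leb2 R).

Lemma subspace_S10 D M : open D -> subspace (S10 D M).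
Proof.
move=> oD; have [h0 hl] := subspace_H10 oD; split.
  split=> // T _; exists 0, 0 => x _.
  by rewrite /edot /= !mul0r !addr0.
move=> k u v [Hu uT] [Hv vT]; split; first exact: hl.
move=> T TM; have [c1 [b1 e1]] := uT T TM; have [c2 [b2 e2]] := vT T TM.
exists (k * c1 + c2), (k *: b1 + b2) => x Tx.
change (k * u x + v x = k * c1 + c2 + ((k * b1.1 + b2.1) * x.1 + (k * b1.2 + b2.2) * x.2)).
by rewrite e1 // e2 // /edot; ring.
Qed.

Lemma S10_refine D (rule : seq {fset {fset (R * R)}}) M M' w :
  uniform_refinement rule M M' -> S10 D M w -> S10 D M' w.
Proof.
move=> [sub _] [Hw wT]; split=> // T' /sub[T TM T'T]; have [c [b e]] := wT T TM.
by exists c, b => x /T'T; exact: e.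
Qed.

Lemma affine_hull_le S k b x (m : R) : (forall z, z \in S -> affine k b z <= m) ->
  hull S x -> affine k b x <= m.
Proof.
move=> H Sx; rewrite -subr_ge0.
have E y : m - affine k b y = affine (m - k) (- b) y by rewrite /affine /edot /=; ring.
by rewrite E; apply: hull_affine_ge Sx => z /H; rewrite -E subr_ge0.
Qed.

(** An affine function with values in [[0, 1]] varies by at most 1 along the
    diameter of a disc in the direction of its gradient. *)
Lemma slope_le S k b c (r : R) : (forall x, enorm (x - c) <= r -> hull S x) -> 0 < r ->
  (forall x, hull S x -> 0 <= affine k b x <= 1) -> 2 * r * enorm b <= 1.
Proof.
move=> cS r0 H; have [b0|b0] := eqVneq (enorm b) 0; first by rewrite b0 mulr0 ler01.
have nb : 0 < enorm b by rewrite lt0r b0 enorm_ge0.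
pose t := r / enorm b.
have tE : t * enorm b = r by rewrite divfK.
have t0 : 0 < t by rewrite divr_gt0.
have P (s : R) : `|s| = t -> hull S (c + s *: b).
  by move=> st; apply: cS; rewrite addrAC subrr add0r enormZ st tE.
have := H _ (P t (gtr0_norm t0)); have := H _ (P (- t) _).
rewrite normrN gtr0_norm // => /(_ erefl) /andP[h1 _] /andP[_ h2].
have E (s : R) : affine k b (c + s *: b) = affine k b c + s * enorm b ^+ 2.
  by rewrite enorm_sq /affine edotDr edotZr addrA.
have : t * enorm b ^+ 2 = r * enorm b by rewrite expr2 mulrA tE.
move: h1 h2; rewrite !E mulNr; lra.
Qed.

Section Fixed.
Context (D : set (R * R)).
Hypothesis oD : open D.
Hypothesis bD : bounded_set D.
Hypothesis LD : lipschitz_boundary D.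

Let fD := bounded_finite bD oD.
Let mD := measurable_open2 oD.

(** Values at the vertices determine a finite element function, and those at
    the boundary vertices are zero. *)
Lemma S10_vertex M w T x : triangulation (closure D) M -> S10 D M w -> T \in M -> x \in T ->
  (interior_vertices D M x -> w x = 0) -> w x = 0.
Proof.
move=> tM Sw TM xT H; have [Dx|nDx] := pselect (D x); first by apply: H; split=> //; exists T.
apply: (trace_zero oD bD LD tM Sw) nDx; have [_ <- _] := tM.
by exists T => //; exact: hull_vertex.
Qed.

(** Interior vertices are handled by hypothesis and boundary vertices by the
    vanishing trace; in between the function is affine. *)
Lemma S10_zero M w x : triangulation (closure D) M -> S10 D M w ->
  (forall z, interior_vertices D M z -> w z = 0) -> closure D x -> w x = 0.
Proof.
move=> tM Sw H; have [_ <- _] := tM => -[T TM Tx].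
have [c [b e]] := Sw.2 T TM; rewrite e //.
apply: (hull_affine_eq0 (S := T)) Tx => z zT.
rewrite [LHS](_ : _ = w z); last by rewrite e //; exact: hull_vertex.
by apply: (S10_vertex tM Sw TM zT) => /H.
Qed.

Lemma Rintegral_sum (I : Type) (s : seq I) (k : I -> R) (f : I -> R * R -> R) :
  (forall i, mu2.-integrable D (EFin \o f i)) ->
  mu2.-integrable D (EFin \o (fun x => \sum_(i <- s) k i * f i x)) /\
  \int[mu2]_(x in D) (\sum_(i <- s) k i * f i x) = \sum_(i <- s) k i * \int[mu2]_(x in D) f i x.
Proof.
move=> fi; elim: s => [|i s [IH1 IH2]].
  split; first by under eq_fun do rewrite big_nil; exact: integrable0.
  under eq_Rintegral do rewrite big_nil; rewrite big_nil.
  by rewrite (@Rintegral_cst _ _ _ mu2 _ mD) mul0r.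
have E : (fun x => \sum_(j <- i :: s) k j * f j x) =
    (fun x => k i * f i x + \sum_(j <- s) k j * f j x).
  by apply/funext => x; rewrite big_cons.
rewrite E; split; first exact: (integrable_lin (k i) mD (fi i) IH1).
by rewrite big_cons -IH2; exact: (@Rintegral_lin _ _ _ mu2 _ (k i) _ _ mD (fi i) IH1).
Qed.

Definition area T : R := fine (mu2 (interior (hull T))).

(** Almost every point lies in the interior of exactly one element, where the
    gradient is constant. *)
Lemma eform_S10 M w (b : {fset (R * R)} -> R * R) :
  triangulation (closure D) M -> H1 D w ->
  {ae mu2, forall x, forall T, T \in M -> interior (hull T) x -> grad D w x = b T} ->
  eform D (fun=> 1) w w = \sum_(T <- M) edot (b T) (b T) * area T.
Proof.
move=> tM Hw gE.
have mI T : measurable (interior (hull T) : set (plane R)).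
  by apply: measurable_open2; exact: open_interior.
have iI T : mu2.-integrable D (EFin \o \1_(interior (hull T))).
  apply: measurable_bounded_integrable => //.
  exists 1; split => // m m1 x _ /=; rewrite indicE.
  by case: (_ \in _); rewrite ?normr1 ?normr0 ltW // (lt_trans ltr01).
pose g x := \sum_(T <- M) edot (b T) (b T) * \1_(interior (hull T)) x.
have [ig gI] := Rintegral_sum (enum_fset M) (fun T => edot (b T) (b T)) iI.
have aE T : T \in M -> \int[mu2]_(x in D) \1_(interior (hull T)) x = area T.
  move=> TM; rewrite /Rintegral /area integral_indic // setIidl //.
  exact: (interior_hull_domain oD LD tM TM).
have -> : \sum_(T <- M) edot (b T) (b T) * area T = \int[mu2]_(x in D) g x.
  by rewrite gI big_seq [RHS]big_seq; apply: eq_bigr => T /aE ->.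
have ie := eform_integrable oD (ess_bounded1 oD) Hw Hw.
have me := (measurable_EFinP _ _).1 (measurable_int _ ie).
have mg := (measurable_EFinP _ _).1 (measurable_int _ ig).
rewrite [LHS]eformE; apply: (ae_eq_Rintegral mD me mg).
apply: aeS2 gE (domain_interior_ae tM) => x gx Dx Dx'.
have [T TM Tx] := Dx Dx'; rewrite (gx T TM Tx) mul1r /g (bigD1_seq T) ?fset_uniq //=.
rewrite big_seq_cond big1 ?addr0 => [|S /andP[SM ST]]; first by rewrite indicE mem_set // mulr1.
rewrite indicE memNset ?mulr0 // => Sx; move/eqP: ST; apply.
apply: (triangulation_overlap tM SM TM); exists x; rewrite interiorI; split=> //.
Qed.

Lemma area_ge M T c (r : R) : triangulation (closure D) M -> T \in M -> 0 < r ->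
  (forall x, enorm (x - c) <= r -> hull T x) -> r ^+ 2 <= area T.
Proof.
move=> tM TM r0 cT; have UD := interior_hull_domain oD LD tM TM.
have mU : measurable (interior (hull T) : set (plane R)).
  by apply: measurable_open2; exact: open_interior.
have r2 : 0 <= r / 2 by rewrite divr_ge0 // ltW.
have -> : r ^+ 2 = fine (mu2 (osq c (r / 2))).
  by rewrite [X in fine X](leb2_osq c r2) /= mulrC divfK.
apply: fine_le.
- by rewrite ge0_fin_numE // [X in (X < _)%E](leb2_osq c r2) ltry.
- rewrite ge0_fin_numE // (le_lt_trans _ fD) //; apply: le_measure; rewrite ?inE //.
apply: le_measure; rewrite ?inE //; first exact: measurable_osq.
rewrite -[X in X `<=` _](interior_id _).1; last exact: open_osq.
apply: interiorS => x /osqE[x1 x2]; apply: cT.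
have -> : r = 2 * (r / 2) by rewrite mulrC divfK.
by apply: enorm_le_coord; exact: ltW.
Qed.

Lemma area_le T c (d : R) : 0 <= d -> (forall x, hull T x -> enorm (x - c) <= d) ->
  area T <= (2 * d) ^+ 2.
Proof.
move=> d0 H.
have mU : measurable (interior (hull T) : set (plane R)).
  by apply: measurable_open2; exact: open_interior.
have le : (mu2 (interior (hull T)) <= ((2 * d) ^+ 2)%:E)%E.
  rewrite -(leb2_csq c d0); apply: le_measure; rewrite ?inE //; first exact: measurable_csq.
  move=> x /interior_subset/H h; have [h1 h2] := coord_le_enorm (x - c).
  by apply/csqE; split; [exact: le_trans h1 h|exact: le_trans h2 h].
by rewrite /area -lee_fin fineK // ge0_fin_numE // (le_lt_trans le) ?ltry.
Qed.

(** On an element a hat function interpolates values 0 and 1, and only 0 if its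
    node is not a vertex of the element. *)
Lemma hat_slope M w x T (k : R) b : triangulation (closure D) M -> S10 D M w ->
  w x = 1 -> (forall z, interior_vertices D M z -> z <> x -> w z = 0) -> T \in M ->
  (forall z, hull T z -> w z = affine k b z) ->
  (x \notin T -> b = 0) /\
  forall c (r : R), 0 < r -> (forall z, enorm (z - c) <= r -> hull T z) -> 2 * r * enorm b <= 1.
Proof.
move=> tM Sw wx w0 TM wE.
have V z : z \in T -> z <> x -> affine k b z = 0.
  move=> zT zx; rewrite -wE; last exact: hull_vertex.
  by apply: (S10_vertex tM Sw TM zT) => iz; exact: w0.
split=> [xT|c r r0 cT].
  have [tri _ _] := tM; apply: (affine_hull_eq0 (tri T TM).2) => z.
  by apply: hull_affine_eq0 => y yT; apply: V => // yx; rewrite -yx yT in xT.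
apply: (slope_le (k := k) cT r0) => z Tz; have V01 y : y \in T -> 0 <= affine k b y <= 1.
  move=> yT; have [yx|yx] := eqVneq y x; last by rewrite V ?lexx ?ler01 //; exact/eqP.
  by rewrite -wE ?yx ?wx ?lexx ?ler01 // -yx; exact: hull_vertex.
apply/andP; split.
  by apply: (hull_affine_ge _ Tz) => y /V01/andP[].
by apply: (affine_hull_le _ Tz) => y /V01/andP[].
Qed.

Section OneElement.
Context (M' : {fset {fset (R * R)}}) (T : {fset (R * R)}) (z : R * R -> R)
  (c : {fset (R * R)} -> R) (b : {fset (R * R)} -> R * R) (L : R).
Hypothesis tM' : triangulation (closure D) M'.
Hypothesis zE : forall S, S \in M' -> forall x, hull S x -> z x = affine (c S) (b S) x.
Hypothesis cov : forall x, hull T x ->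
  exists2 S, S \in M' & hull S `<=` hull T /\ hull S x.
Hypothesis bL : forall S, S \in pieces M' T -> enorm (b S) <= L.

(** The segment from [p] to [q] is covered by the finitely many closed pieces. *)
Lemma piecewise_lipschitz p q : hull T p -> hull T q -> `|z p - z q| <= L * enorm (q - p).
Proof.
move=> Tp Tq; pose path (t : R) := p + t *: (q - p).
have cpath : continuous path.
  by move=> t; apply: cvgD; [exact: cvg_cst|apply: cvgZr_tmp; exact: cvg_id].
have [tri _ _] := tM'.
pose A S : set R := path @^-1` hull S.
have := @lipschitz_cover R _ A (z \o path) (L * enorm (q - p)) 1 _ (enum_fset (pieces M' T)) 0 (leqnn _).
rewrite /= /path scale0r addr0 scale1r [p + _]addrC subrK subr0 mulr1; apply => //.
- move=> S; rewrite [_ \in _](_ : _ = (S \in pieces M' T)) // in_pieces => /andP[SM _].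
  by move/continuous_closedP: cpath; apply; exact: closed_hull (tri S SM).
- move=> S s t SP; have := bL SP.
  move: (SP); rewrite [_ \in _](_ : _ = (S \in pieces M' T)) // in_pieces => /andP[SM _] bS.
  rewrite /A /path /= => As At; rewrite (zE SM As) (zE SM At).
  have -> : affine (c S) (b S) (p + s *: (q - p)) - affine (c S) (b S) (p + t *: (q - p)) =
      edot (b S) ((s - t) *: (q - p)).
    by rewrite /affine !edotDr !edotZr; ring.
  apply: le_trans (edot_cauchy _ _) _; rewrite enormZ mulrCA [leRHS]mulrC.
  by rewrite ler_wpM2l // ler_wpM2r ?enorm_ge0.
- move=> t t01; have [S SM [ST Sx]] := cov (hull_segment Tp Tq t01).
  by exists S => //; rewrite [_ \in _](_ : _ = (S \in pieces M' T)) // in_pieces SM; exact/asboolP.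
Qed.

(** On a coarse element, a coarse function that agrees with [z] at the vertices
    is a mean of vertex values of [z]. *)
Lemma interpolation_error x (k d : R) e : (forall a : R * R, a \in T -> z a = affine k e a) ->
  0 <= L -> (forall p q, hull T p -> hull T q -> enorm (p - q) <= d) ->
  hull T x -> `|z x - affine k e x| <= L * d.
Proof.
move=> za L0 hd Tx; have [w [w0 w1 xE]] := Tx.
have -> : z x - affine k e x = \sum_(a <- T) w a * (z x - z a).
  rewrite [in affine k e x]xE affine_sum //.
  under [RHS]eq_bigr do rewrite mulrBr.
  rewrite sumrB -mulr_suml w1 mul1r; congr (_ - _).
  by rewrite big_seq [RHS]big_seq; apply: eq_bigr => a aT; rewrite za.
apply: le_trans (ler_norm_sum _ _ _) _.
rewrite -[leRHS]mul1r -w1 mulr_suml big_seq [leRHS]big_seq; apply: ler_sum => a aT.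
have Ta : hull T a by exact: hull_vertex.
rewrite normrM (ger0_norm (w0 a aT)) ler_wpM2l ?w0 //.
by apply: le_trans (piecewise_lipschitz Tx Ta) _; rewrite ler_wpM2l // hd.
Qed.
End OneElement.
End Fixed.
End FiniteElements.

Lemma enorm0 (R : realType) : enorm (0 : R * R) = 0.
Proof. by rewrite /enorm /edot /= !mulr0 addr0 sqrtr0. Qed.

Section Estimate.
Context (R : realType) (D : set (R * R)).
Implicit Types (T S : {fset (R * R)}) (x p q c b : R * R)
  (M : {fset {fset (R * R)}}) (w v : R * R -> R).
Hypothesis oD : open D.
Hypothesis bD : bounded_set D.
Hypothesis LD : lipschitz_boundary D.
Notation mu2 := (@leb2 R).

Let fD := bounded_finite bD oD.

(** Each element of the refinement lies in exactly one coarse element. *)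
Lemma pieces_sum rule M M' (f : {fset (R * R)} -> R) : triangulation (closure D) M ->
  triangulation (closure D) M' -> uniform_refinement rule M M' ->
  \sum_(T <- M) \sum_(S <- pieces M' T) f S = \sum_(S <- M') f S.
Proof.
move=> tM [tri' _ _] [par _].
have E T : \sum_(S <- pieces M' T) f S =
    \sum_(S <- M') if `[< hull S `<=` hull T >] then f S else 0.
  rewrite -big_mkcond -big_filter; apply: perm_big; apply: uniq_perm.
  - exact: fset_uniq.
  - by rewrite filter_uniq // fset_uniq.
  - by move=> S; rewrite mem_filter andbC; exact: in_pieces.
under eq_bigr do rewrite E.
rewrite exchange_big big_seq [RHS]big_seq; apply: eq_bigr => S SM /=.
have [T TM ST] := par S SM.
rewrite (bigD1_seq T) ?fset_uniq //= asboolT // big_seq_cond big1 ?addr0 // => T2 /andP[T2M T2T].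
rewrite asboolF // => ST2; move/eqP: T2T; apply.
apply: (triangulation_overlap tM T2M TM).
have [_ [x Sx]] := tri' S SM; exists x.
by apply: (interiorS _ Sx) => y Sy; split; [exact: ST2|exact: ST].
Qed.

Section Setting.
Context (rule : seq {fset {fset (R * R)}}) (N : nat) (kk sigma : R)
  (M M' : {fset {fset (R * R)}}).
Hypothesis tM : triangulation (closure D) M.
Hypothesis tM' : triangulation (closure D) M'.
Hypothesis uM : uniform_refinement rule M M'.
Hypothesis sM' : shape_regularity M' <= sigma.
Hypothesis kk0 : 0 <= kk.
Hypothesis ref : forall T, T \in M ->
  [/\ (#|` pieces M' T| <= N)%N,
      forall x, hull T x -> exists2 S, S \in M' & hull S `<=` hull T /\ hull S x,
      forall S, S \in M' -> hull S `<=` hull T -> forall p q, hull T p -> hull T q ->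
        exists p' q', [/\ hull S p', hull S q' & enorm (p - q) <= kk * enorm (p' - q')] &
      forall x, x \in T -> exists2 S, S \in M' & x \in S].

Section Element.
Context (n : nat) (xi : 'I_n -> R * R) (z x : R * R -> R)
  (c : {fset (R * R)} -> R) (b : {fset (R * R)} -> R * R)
  (bp : 'I_n -> {fset (R * R)} -> R * R).
Hypothesis xi_inj : injective xi.
Hypothesis Sz : S10 D M' z.
Hypothesis Sx : S10 D M x.
Hypothesis zx : forall a, interior_vertices D M a -> z a = x a.
Hypothesis zE : forall S, S \in M' -> forall x, hull S x -> z x = affine (c S) (b S) x.
Hypothesis bp0 : forall S j, S \in M' -> xi j \notin S -> bp j S = 0.
Hypothesis bp1 : forall S j, S \in M' -> forall c (r : R), 0 < r ->
  (forall z, enorm (z - c) <= r -> hull S z) -> 2 * r * enorm (bp j S) <= 1.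

(** With [L2] the sum of the squared slopes of [z] and [d] the diameter of [T],
    each coefficient is at most [L * d], each hat function has slope at most the
    inverse of the width of [S], at most three of them are active on [S], and
    shape regularity makes the areas comparable to the squared lengths. *)
Lemma element_estimate T S : T \in M -> S \in pieces M' T ->
  (\sum_j (z (xi j) - x (xi j)) ^+ 2 * edot (bp j S) (bp j S)) * area S <=
  48 * sigma ^+ 4 * kk ^+ 2 * \sum_(U <- pieces M' T) edot (b U) (b U) * area U.
Proof.
move=> TM SP; have [_ cov scale vert] := ref TM.
move: (SP); rewrite in_pieces => /andP[SM /asboolP ST].
have [p [r [r0 pS rS]]] := fat_triangulation tM' sM' SM.
have Sp : hull S p by apply: pS; rewrite subrr enorm0 ltW.
have s0 : 0 <= 2 * sigma * r by apply: le_trans (enorm_ge0 (p - p)) (rS p p Sp Sp).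
have sg0 : 0 <= sigma by move: s0; rewrite -mulrA pmulr_rge0 // pmulr_lge0.
pose L2 := \sum_(U <- pieces M' T) edot (b U) (b U).
have L20 : 0 <= L2 by apply: sumr_ge0 => U _; exact: edot_ge0.
pose L := Num.sqrt L2.
have L0 : 0 <= L by exact: sqrtr_ge0.
have LE : L ^+ 2 = L2 by rewrite sqr_sqrtr.
have bL U : U \in pieces M' T -> enorm (b U) <= L.
  move=> UP; apply: ler_wsqrtr; rewrite /L2 (bigD1_seq U) ?fset_uniq //= lerDl.
  by apply: sumr_ge0 => V _; exact: edot_ge0.
pose d := diam (hull T).
have hd q q' : hull T q -> hull T q' -> enorm (q - q') <= d.
  by move=> Tq Tq'; apply: diam_ge => //; exact: hull_bounded.
have Tp : hull T p.
  exact: ST.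
have d0 : 0 <= d by apply: le_trans (enorm_ge0 _) (hd p p Tp Tp).
have dU U : U \in pieces M' T -> d ^+ 2 <= 4 * sigma ^+ 2 * kk ^+ 2 * area U.
  rewrite in_pieces => /andP[UM /asboolP UT].
  have [c' [r' [r'0 c'U r'U]]] := fat_triangulation tM' sM' UM.
  have dr : d <= kk * (2 * sigma * r').
    apply: ge_sup; first by exists (enorm (p - p)), p, p.
    move=> _ [q [q' [Tq Tq' ->]]]; have [y [y' [Uy Uy' h]]] := scale U UM UT q q' Tq Tq'.
    by apply: le_trans h _; rewrite ler_wpM2l // r'U.
  apply: (@le_trans _ _ ((kk * (2 * sigma * r')) ^+ 2)).
    by rewrite ler_pXn2r ?nnegrE // (le_trans d0).
  rewrite (_ : _ ^+ 2 = 4 * sigma ^+ 2 * kk ^+ 2 * r' ^+ 2); last by ring.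
  rewrite ler_wpM2l ?mulr_ge0 ?sqr_ge0 //.
  exact: (area_ge oD bD LD tM' UM r'0 c'U).
have LdG : L2 * d ^+ 2 <= 4 * sigma ^+ 2 * kk ^+ 2 * \sum_(U <- pieces M' T) edot (b U) (b U) * area U.
  rewrite mulr_suml mulr_sumr big_seq [leRHS]big_seq; apply: ler_sum => U UP.
  by rewrite [leRHS]mulrCA ler_wpM2l ?edot_ge0 // dU.
have [k [e xE]] := Sx.2 T TM.
have vE (a : R * R) : a \in T -> z a = affine k e a.
  move=> aT; rewrite -[RHS]xE; last exact: hull_vertex.
  apply/eqP; rewrite -subr_eq0; apply/eqP.
  have [U UM aU] := vert a aT.
  have Sd : S10 D M' (z - x).
    exact: (subspaceB (subspace_S10 M' oD) Sz (S10_refine uM Sx)).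
  apply: (S10_vertex oD bD LD tM' Sd UM aU) => -[Da _].
  by change (z a - x a = 0); rewrite zx ?subrr //; split => //; exists T.
have yj j : xi j \in S -> (z (xi j) - x (xi j)) ^+ 2 <= L2 * d ^+ 2.
  move=> jS; have Tj : hull T (xi j) by apply: ST; exact: hull_vertex.
  have := interpolation_error tM' zE cov bL vE L0 hd Tj.
  rewrite -[X in _ - X]xE // => h.
  by rewrite -LE -exprMn -[leLHS]real_normK ?num_real // ler_pXn2r ?nnegrE // mulr_ge0.
have aS : area S <= 16 * sigma ^+ 2 * r ^+ 2.
  have := area_le s0 (fun q Sq => rS q p Sq Sp).
  by rewrite (_ : _ ^+ 2 = 16 * sigma ^+ 2 * r ^+ 2) //; ring.
have a0 : 0 <= area S by rewrite /area fine_ge0.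
have ej j : edot (bp j S) (bp j S) * area S <= 4 * sigma ^+ 2.
  have h := bp1 j SM r0 pS.
  have h2 : (2 * r * enorm (bp j S)) ^+ 2 <= 1.
    by rewrite expr_le1 // !mulr_ge0 ?enorm_ge0 // ltW.
  move: h2; rewrite exprMn enorm_sq => h2.
  apply: (@le_trans _ _ (edot (bp j S) (bp j S) * (16 * sigma ^+ 2 * r ^+ 2))).
    by rewrite ler_wpM2l ?edot_ge0.
  rewrite (_ : _ * _ = 4 * sigma ^+ 2 * ((2 * r) ^+ 2 * edot (bp j S) (bp j S))); last by ring.
  by rewrite -[leRHS]mulr1 ler_wpM2l // mulr_ge0 ?sqr_ge0.
have term j : (z (xi j) - x (xi j)) ^+ 2 * edot (bp j S) (bp j S) * area S <=
    4 * sigma ^+ 2 * (L2 * d ^+ 2) * (xi j \in S)%:R.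
  have [jS|jS] := boolP (xi j \in S); last first.
    by rewrite (bp0 SM jS) /edot /= !mul0r addr0 mulr0 mul0r mulr0.
  rewrite mulr1 -mulrA [leRHS]mulrC; apply: ler_pM; rewrite ?sqr_ge0 ?yj //.
  by rewrite mulr_ge0 ?edot_ge0.
have cnt : \sum_j ((xi j \in S)%:R : R) <= 3.
  rewrite -natr_sum ler_nat; have [[S3 _] _] := ((let: And3 t _ _ := tM' in t) S SM, tt).
  rewrite -S3 (_ : (\sum_j (xi j \in S))%N = size [seq xi j | j <- enum 'I_n & xi j \in S]).
    apply: uniq_leq_size; first by rewrite map_inj_uniq // filter_uniq // enum_uniq.
    by move=> y /mapP[j]; rewrite mem_filter => /andP[jS _] ->.
  rewrite size_map size_filter -sum1_count big_enum_cond [RHS]big_mkcond /=.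
  by apply: eq_bigr => j _; case: (_ \in _).
rewrite mulr_suml; apply: le_trans (ler_sum _ (fun j _ => term j)) _.
rewrite -mulr_sumr; apply: (@le_trans _ _ (4 * sigma ^+ 2 * (L2 * d ^+ 2) * 3)).
  by rewrite ler_wpM2l // !mulr_ge0 ?sqr_ge0.
rewrite (_ : _ * 3 = 12 * sigma ^+ 2 * (L2 * d ^+ 2)); last by ring.
rewrite (_ : 48 * _ * _ * _ = 12 * sigma ^+ 2 * (4 * sigma ^+ 2 * kk ^+ 2 * \sum_(U <- pieces M' T) edot (b U) (b U) * area U)); last by ring.
by rewrite ler_wpM2l // mulr_ge0 ?sqr_ge0.
Qed.
End Element.

(** The hierarchical coefficients at the new vertices are controlled by the
    energy of the whole function, one coarse element at a time. *)
Lemma detail_estimate n (xi : 'I_n -> R * R) (phi : 'I_n -> R * R -> R) (z x : R * R -> R) :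
  hat_functions D M M' xi phi -> S10 D M' z -> S10 D M x ->
  (forall a, interior_vertices D M a -> z a = x a) ->
  \sum_j (z (xi j) - x (xi j)) ^+ 2 * eform D (fun=> 1) (phi j) (phi j) <=
  48 * sigma ^+ 4 * kk ^+ 2 * N%:R * eform D (fun=> 1) z z.
Proof.
move=> [xi_inj _ Sphi phiE] Sz Sx zx.
have [c [b [zE gz]]] := S10_pieces oD fD LD tM' Sz.
have ex (j : 'I_n) : exists cb : ({fset (R * R)} -> R) * ({fset (R * R)} -> R * R),
    (forall T, T \in M' -> forall x, hull T x -> phi j x = affine (cb.1 T) (cb.2 T) x) /\
    {ae mu2, forall x, forall T, T \in M' -> interior (hull T) x -> grad D (phi j) x = cb.2 T}.
  by have [c' [b' h]] := S10_pieces oD fD LD tM' (Sphi j); exists (c', b').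
have [cb cbP] := choice ex.
pose bp j S := (cb j).2 S.
have slopes S j (SM : S \in M') := hat_slope oD bD LD tM' (Sphi j) (phiE j).1 (phiE j).2 SM ((cbP j).1 S SM).
have bp0 S j : S \in M' -> xi j \notin S -> bp j S = 0 by move=> SM; exact: (slopes S j SM).1.
have bp1 S j : S \in M' -> forall c (r : R), 0 < r ->
    (forall z, enorm (z - c) <= r -> hull S z) -> 2 * r * enorm (bp j S) <= 1.
  by move=> SM; exact: (slopes S j SM).2.
pose G U := edot (b U) (b U) * area U.
have G0 U : 0 <= G U by rewrite mulr_ge0 ?edot_ge0 // /area fine_ge0.
pose E S := (\sum_j (z (xi j) - x (xi j)) ^+ 2 * edot (bp j S) (bp j S)) * area S.
have -> : \sum_j (z (xi j) - x (xi j)) ^+ 2 * eform D (fun=> 1) (phi j) (phi j) =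
    \sum_(S <- M') E S.
  under eq_bigr => j _ do rewrite (eform_S10 oD bD LD tM' (Sphi j).1.1 (cbP j).2) mulr_sumr.
  rewrite exchange_big; apply: eq_bigr => S _; rewrite /E mulr_suml.
  by apply: eq_bigr => j _; rewrite mulrA.
rewrite (eform_S10 oD bD LD tM' Sz.1.1 gz) -(pieces_sum E tM tM' uM) -(pieces_sum G tM tM' uM).
rewrite mulr_sumr big_seq [leRHS]big_seq; apply: ler_sum => T TM.
set C := 48 * _ * _; set SG := \sum_(U <- _) G U.
have C0 : 0 <= C.
  rewrite /C; apply: mulr_ge0; [apply: mulr_ge0|exact: sqr_ge0]; first by [].
  by rewrite (_ : sigma ^+ 4 = (sigma ^+ 2) ^+ 2) ?sqr_ge0 // -exprM.
have SG0 : 0 <= SG by apply: sumr_ge0 => U _; exact: G0.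
apply: (@le_trans _ _ (\sum_(S <- pieces M' T) C * SG)).
  rewrite big_seq [leRHS]big_seq; apply: ler_sum => S SP.
  exact: (element_estimate xi_inj Sz Sx zx zE bp0 bp1 TM SP).
rewrite (_ : \sum_(S <- pieces M' T) C * SG = C * (#|` pieces M' T|)%:R * SG); last first.
  move: (C) (SG) => C' SG'; rewrite big_const_seq count_predT iter_addr addr0.
  by rewrite -[LHS]mulr_natr mulrAC.
apply: (ler_wpM2r SG0); apply: (ler_wpM2l C0); rewrite ler_nat.
by have [] := ref TM.
Qed.
End Setting.
End Estimate.

(** * Expansion and overlap of the hat functions *)

Section Overlap.
Context (R : realType).
Implicit Types (T S : {fset (R * R)}) (M : {fset {fset (R * R)}}) (D : set (R * R)).
Notation mu2 := (@leb2 R).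

Lemma sum_sq_le n (P : {set 'I_n}) (s : 'I_n -> R) :
  (\sum_(i in P) s i) ^+ 2 <= #|P|%:R * \sum_(i in P) s i ^+ 2.
Proof.
rewrite expr2 mulr_suml.
apply: (@le_trans _ _ (\sum_(i in P) \sum_(j in P) (s i ^+ 2 / 2 + s j ^+ 2 / 2))).
  apply: ler_sum => i _; rewrite mulr_sumr; apply: ler_sum => j _.
  by have := sqr_ge0 (s i - s j); rewrite sqrrB; lra.
under eq_bigr do rewrite big_split /= sumr_const.
rewrite big_split /= sumr_const sumrMnl -!mulr_suml -mulrnDl mulr_natl.
by rewrite -splitr.
Qed.

Lemma edot_sum_le n (P : {set 'I_n}) (v : 'I_n -> R * R) : (forall j, j \notin P -> v j = 0) ->
  edot (\sum_j v j) (\sum_j v j) <= #|P|%:R * \sum_j edot (v j) (v j).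
Proof.
move=> v0.
have E (V : nmodType) (f : R * R -> V) : f 0 = 0 -> \sum_j f (v j) = \sum_(j in P) f (v j).
  by move=> f0; rewrite [RHS]big_mkcond; apply: eq_bigr => j _; case: ifPn => // /v0 ->.
have L (f : R * R -> R) : f 0 = 0 -> (forall p q, f (p + q) = f p + f q) ->
    f (\sum_j v j) = \sum_(j in P) f (v j).
  by move=> f0 fD; rewrite -E //; apply: big_morph.
rewrite (E _ (fun p => edot p p)); last by rewrite /edot /= mulr0 addr0.
rewrite {1}/edot (L fst) // (L snd) // -!expr2.
have -> : \sum_(j in P) edot (v j) (v j) =
    \sum_(j in P) (v j).1 ^+ 2 + \sum_(j in P) (v j).2 ^+ 2 by rewrite -big_split.
by rewrite mulrDr lerD // sum_sq_le.
Qed.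

(** The function [g - |g - f|] lies below [g] everywhere and equals [f] almost
    everywhere. *)
Lemma ae_le_Rintegral D (f g : R * R -> R) : measurable (D : set (plane R)) ->
  mu2.-integrable D (EFin \o f) -> mu2.-integrable D (EFin \o g) ->
  {ae mu2, forall x, D x -> f x <= g x} ->
  \int[mu2]_(x in D) f x <= \int[mu2]_(x in D) g x.
Proof.
move=> mD fi gi fg; pose h x := g x - `|g x - f x|.
have mf := (measurable_EFinP _ _).1 (measurable_int _ fi).
have mg := (measurable_EFinP _ _).1 (measurable_int _ gi).
have mh : measurable_fun D h.
  by apply: measurable_funB => //; apply: measurableT_comp => //; exact: measurable_funB.
have fh : {ae mu2, forall x, D x -> f x = h x}.
  apply: aeS fg => x h1 /h1{}h1.
  by rewrite /h ger0_norm ?subr_ge0 // opprB addrCA subrr addr0.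
rewrite (ae_eq_Rintegral mD mf mh fh); apply: le_Rintegral => //.
  apply: (ae_le_integrable mD mh _ fi); apply: aeS fh => x h1 /h1 ->.
  by [].
by move=> x _; rewrite /h gerBl.
Qed.

Lemma grad_sum D (I : Type) (s : seq I) (c : I -> R) (f : I -> R * R -> R) : open D ->
  (forall i, H1 D (f i)) -> H1 D (\sum_(i <- s) c i *: f i) /\
  {ae mu2, forall x, D x -> grad D (\sum_(i <- s) c i *: f i) x = \sum_(i <- s) c i *: grad D (f i) x}.
Proof.
move=> oD Hf; elim: s => [|i s [IH1 IH2]].
  have H0 := subspace0 (subspace_H1 oD); rewrite big_nil; split=> //.
  have := grad_lin (-1) oD H0 H0; rewrite scaler0 addr0; apply: aeS => x h /h ->.
  by rewrite big_nil scaleN1r addNr.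
rewrite big_cons; split; first exact: ((subspace_H1 oD).2 (c i) _ _ (Hf i) IH1).
apply: aeS2 (grad_lin (c i) oD (Hf i) IH1) IH2 => x h1 h2 Dx.
by rewrite big_cons (h1 Dx) (h2 Dx).
Qed.

Lemma sum_scaleE (I : Type) (s : seq I) (c : I -> R) (f : I -> R * R -> R) z :
  (\sum_(i <- s) c i *: f i) z = \sum_(i <- s) c i * f i z.
Proof.
elim: s => [|i s IH]; first by rewrite !big_nil.
by rewrite !big_cons -IH.
Qed.

Section Fixed.
Context (D : set (R * R)).
Hypothesis oD : open D.
Hypothesis bD : bounded_set D.
Hypothesis LD : lipschitz_boundary D.
Context (rule : seq {fset {fset (R * R)}}) (M M' : {fset {fset (R * R)}})
  (n : nat) (xi : 'I_n -> R * R) (phi : 'I_n -> R * R -> R).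
Hypothesis tM : triangulation (closure D) M.
Hypothesis tM' : triangulation (closure D) M'.
Hypothesis uM : uniform_refinement rule M M'.
Hypothesis vert : forall T, T \in M -> forall x, x \in T -> exists2 S, S \in M' & x \in S.
Hypothesis hat : hat_functions D M M' xi phi.

Let fD := bounded_finite bD oD.
Let mD := measurable_open2 oD.

Lemma interior_vertices_sub x : interior_vertices D M x -> interior_vertices D M' x.
Proof. by move=> [Dx [T TM xT]]; split=> //; exact: vert xT. Qed.

Lemma hat_detail j : detail_space D M M' (phi j).
Proof.
have [_ xiE Sphi phiE] := hat; split=> // x ix; apply: (phiE j).2; first exact: interior_vertices_sub.
move=> xj; have : range xi (xi j) by exists j.
by rewrite xiE -xj => -[].
Qed.

(** Both sides are finite element functions with the same values at the interior
    vertices of the refinement. *)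
Lemma detail_expansion y x : detail_space D M M' y -> closure D x ->
  y x = \sum_j y (xi j) * phi j x.
Proof.
move=> [Sy y0] cx; have [xi_inj xiE Sphi phiE] := hat.
have hS := subspace_S10 M' oD.
pose w := y - \sum_j y (xi j) *: phi j.
have wE z : w z = y z - \sum_j y (xi j) * phi j z.
  by rewrite -sum_scaleE.
have Sw : S10 D M' w.
  apply: (subspaceB hS Sy); apply: (subspace_sum hS) => j _; exact: Sphi.
suff : w x = 0 by rewrite wE => /eqP; rewrite subr_eq0 => /eqP.
apply: (S10_zero oD bD LD tM' Sw _ cx) => z iz; rewrite wE.
have [iMz|niMz] := pselect (interior_vertices D M z).
  rewrite (y0 z iMz) big1 ?subrr // => j _.
  by rewrite (hat_detail j).2 // mulr0.
have : range xi z by rewrite xiE.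
move=> [i _ <-]; rewrite (bigD1 i) //= (phiE i).1 mulr1 big1 ?addr0 ?subrr // => j ji.
rewrite (phiE j).2 ?mulr0 //; last by move=> /xi_inj /esym /eqP; apply/negP.
have : range xi (xi i) by exists i.
by rewrite xiE => -[].
Qed.

(** Where the affine function is nonzero it contributes an open set to the
    support, which the hypothesis excludes. *)
Lemma hat_uncounted T S j (k : R) b : T \in M -> S \in M' -> hull S `<=` hull T ->
  (forall x, hull S x -> phi j x = affine k b x) ->
  ~ (interior (fsupp D (phi j) `&` hull T) !=set0) -> b = 0.
Proof.
move=> TM SM ST pE H; have [tri' _ _] := tM'.
have UD := interior_hull_domain oD LD tM' SM.
have Z x : interior (hull S) x -> affine k b x = 0.
  move=> Sx; apply: contrapT => nz; apply: H; exists x.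
  have o : open (interior (hull S) `&` [set z | affine k b z <> 0]).
    apply: openI; first exact: open_interior.
    have cl : closed (affine k b @^-1` [set r : R | r = 0]).
      by move/continuous_closedP: (@continuous_affine R k b); apply; exact: closed_eq.
    by have := closed_openC cl.
  have := open_nbhs_nbhs (conj o (conj Sx nz)); apply: filterS => z [Sz z0]; split.
    apply: subset_closure; split; first exact: UD.
    by rewrite pE //; exact: interior_subset.
  by apply: ST; exact: interior_subset.
apply/eqP/negPn/negP => b0; have [_ [x Sx]] := tri' S SM.
have := line_no_interior b0 Z; rewrite (interior_id _).1; last exact: open_interior.
by move=> h; move: Sx; rewrite h.
Qed.

(** On each element at most [K] of the gradients are nonzero, so the square of
    their sum is at most [K] times the sum of their squares. *)
Lemma overlap_energy a0 (K : R) (c : 'I_n -> R) : ess_bounded mu2 D a0 ->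
  {ae mu2, forall x, D x -> 0 <= a0 x} -> overlap_bound D M phi K ->
  eform D a0 (\sum_j c j *: phi j) (\sum_j c j *: phi j) <=
    K * \sum_j c j ^+ 2 * eform D a0 (phi j) (phi j).
Proof.
move=> ba a0p hK; have [xi_inj xiE Sphi phiE] := hat.
have Hphi j : H1 D (phi j) := (Sphi j).1.1.
have [Hs gs] := grad_sum (index_enum 'I_n) c oD Hphi.
have ij j := eform_integrable oD ba (Hphi j) (Hphi j).
have [iS IS] := Rintegral_sum oD (index_enum 'I_n) (fun j => K * c j ^+ 2) ij.
have -> : K * \sum_j c j ^+ 2 * eform D a0 (phi j) (phi j) =
    \sum_j (K * c j ^+ 2) * \int[mu2]_(x in D) (a0 x * edot (grad D (phi j) x) (grad D (phi j) x)).
  by rewrite mulr_sumr; apply: eq_bigr => j _; rewrite mulrA eformE.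
rewrite -IS eformE; apply: (ae_le_Rintegral mD (eform_integrable oD ba Hs Hs) iS).
have ex (j : 'I_n) : exists cb : ({fset (R * R)} -> R) * ({fset (R * R)} -> R * R),
    (forall T, T \in M' -> forall x, hull T x -> phi j x = affine (cb.1 T) (cb.2 T) x) /\
    {ae mu2, forall x, forall T, T \in M' -> interior (hull T) x -> grad D (phi j) x = cb.2 T}.
  by have [c' [b' h]] := S10_pieces oD fD LD tM' (Sphi j); exists (c', b').
have [cb cbP] := choice ex.
have gE := @ae_all_seq _ _ (enum 'I_n) (fun j x => forall T, T \in M' ->
  interior (hull T) x -> grad D (phi j) x = (cb j).2 T) (fun j _ => (cbP j).2).
apply: (aeS2 _ (domain_interior_ae tM') (aeS2 _ gs (aeS2 _ gE a0p)));
  [|move=> x h1 h2; exact: (conj h1 h2)|move=> x h1 h2; exact: (conj h1 h2)].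
move=> x h1 [h2 [h3 h4]] Dx; have [S SM Sx] := h1 Dx; rewrite (h2 Dx).
have gj j : grad D (phi j) x = (cb j).2 S by apply: (h3 j) => //; rewrite mem_enum.
under [X in edot X _]eq_bigr do rewrite gj; under [X in edot _ X]eq_bigr do rewrite gj.
under [leRHS]eq_bigr do rewrite gj.
have [T TM ST] := uM.1 S SM.
pose P := [set j : 'I_n | `[< interior (fsupp D (phi j) `&` hull T) !=set0 >]]%SET.
have PK : #|P|%:R <= K by exact: (hK T TM).
have b0 j : j \notin P -> c j *: (cb j).2 S = 0.
  rewrite inE => /asboolPn nj; rewrite (hat_uncounted TM SM ST ((cbP j).1 S SM) nj) scaler0 //.
have h := edot_sum_le b0; have a0x := h4 Dx.
apply: (@le_trans _ _ (a0 x * (K * \sum_j edot (c j *: (cb j).2 S) (c j *: (cb j).2 S)))).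
  rewrite ler_wpM2l //; apply: le_trans h _; rewrite ler_wpM2r //.
  by apply: sumr_ge0 => j _; exact: edot_ge0.
rewrite mulr_sumr mulr_sumr le_eqVlt; apply/orP; left; apply/eqP.
apply: eq_bigr => j _; rewrite edotZr edotC edotZr; ring.
Qed.
End Fixed.
End Overlap.

(** * The residual and the error estimate *)

Lemma subspace_sum1 (R : realType) (U : lmodType R) (S : set U) (hS : subspace S)
    (I : eqType) (r : seq I) (u : I -> U) :
  (forall i, i \in r -> S (u i)) -> S (\sum_(i <- r) u i).
Proof.
by move=> /(@subspace_sum _ _ _ hS _ r (fun=> 1) u); under eq_bigr do rewrite scale1r.
Qed.

Lemma linear_on_sum1 (R : realType) (U : lmodType R) (S : set U) (hS : subspace S) (f : U -> R)
    (hf : linear_on S f) (I : eqType) (r : seq I) (u : I -> U) :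
  (forall i, i \in r -> S (u i)) -> f (\sum_(i <- r) u i) = \sum_(i <- r) f (u i).
Proof.
move=> /(@linear_on_sum _ _ _ hS _ hf _ r (fun=> 1) u); under eq_bigr do rewrite scale1r.
by move=> ->; under eq_bigr do rewrite mul1r.
Qed.

Section Tensors.
Context (R : realType) (D : set (R * R)) (pi : probability (param R) R)
  (pi_ : nat -> probability (measurableTypeR R) R) (P : nat -> nat -> {poly R}).
Hypothesis oD : open D.
Hypothesis piE : product_measure pi_ pi.
Hypothesis pi1 : forall m, pi_ m `[(-1)%R, 1%R]%classic = 1%E.
Hypothesis PE : forall m, orthonormal_polynomials (pi_ m) (P m).
Notation fn := (R * R -> R).
Notation fn2 := (param R -> R * R -> R).
Implicit Types (I J : {fset midx}) (Z : set fn) (nu : midx) (z : fn).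

Definition ptensor z nu : fn2 := fun y => Ppoly P nu y *: z.

Lemma elem_tensorE z nu : elem_tensor P z nu = ptensor z nu.
Proof. by apply/funext => y; apply/funext => x; exact: mulrC. Qed.

Lemma ptensor_V z nu : H10 D z -> V D pi (ptensor z nu).
Proof.
move=> Hz; have [M hM] := Ppoly_bounded P nu.
by apply: (V_scalar pi oD Hz _ hM); apply: measurable_funTS; exact: measurable_Ppoly.
Qed.

Lemma ptensor_sum (I : Type) (s : seq I) (c : I -> R) (f : I -> fn) nu :
  ptensor (\sum_(i <- s) c i *: f i) nu = \sum_(i <- s) c i *: ptensor (f i) nu.
Proof.
elim: s => [|i s IH].
  by rewrite !big_nil; apply/funext => y; rewrite /ptensor scaler0.
rewrite !big_cons -IH; apply/funext => y.
change (Ppoly P nu y *: (c i *: f i + \sum_(j <- s) c j *: f j) =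
  c i *: (Ppoly P nu y *: f i) + Ppoly P nu y *: \sum_(j <- s) c j *: f j).
by rewrite scalerDr !scalerA mulrC.
Qed.

Lemma ptensorD z z' nu : ptensor (z + z') nu = ptensor z nu + ptensor z' nu.
Proof. by apply/funext => y; exact: scalerDr. Qed.

Lemma ptensor0 nu : ptensor 0 nu = 0.
Proof. by apply/funext => y; exact: scaler0. Qed.

Lemma sum_apply (I : Type) (s : seq I) (f : I -> fn2) y x :
  (\sum_(i <- s) f i) y x = \sum_(i <- s) f i y x.
Proof.
elim: s => [|i s IH]; first by rewrite !big_nil.
by rewrite !big_cons -IH.
Qed.

Lemma vform_ptensor b z z' nu nu' : bounded_form D b -> H10 D z -> H10 D z' ->
  vform pi b (ptensor z nu) (ptensor z' nu') = (nu == nu')%:R * b z z'.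
Proof.
move=> [[bs bl] _] Hz Hz'; have hS := subspace_H10 oD.
rewrite -(Ppoly_orthonormal piE pi1 PE nu nu') mulrC.
rewrite /vform (_ : (fun y => b (ptensor z nu y) (ptensor z' nu' y)) =
    (fun y => b z z' * (Ppoly P nu y * Ppoly P nu' y))).
  have [M hM] := Ppoly_bounded P nu; have [M' hM'] := Ppoly_bounded P nu'.
  rewrite RintegralZl //; first exact: measurable_Gamma.
  apply: measurable_bounded_integrable.
  - exact: measurable_Gamma.
  - by rewrite (le_lt_trans (probability_le1 _ (@measurable_Gamma R))) ?ltry.
  - by apply: measurable_funTS; apply: measurable_funM; exact: measurable_Ppoly.
  - exists (M * M'); split => [|m mM y Gy]; first exact: num_real.
    rewrite /= normrM; apply: le_trans (ltW mM).
    by rewrite ler_pM // ?hM ?hM'.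
apply/funext => y; rewrite /ptensor.
rewrite (linear_onZ hS (bl _ (subspaceZ hS _ Hz)) _ Hz') (bs _ _ (subspaceZ hS _ Hz) Hz').
by rewrite (linear_onZ hS (bl _ Hz') _ Hz) (bs _ _ Hz' Hz); ring.
Qed.

(** Different multi-indices are orthogonal, so only the diagonal terms remain. *)
Lemma vform_ptensor_sum b (s : seq midx) (g : midx -> fn) : bounded_form D b -> uniq s ->
  (forall nu, H10 D (g nu)) ->
  vform pi b (\sum_(nu <- s) ptensor (g nu) nu) (\sum_(nu <- s) ptensor (g nu) nu) =
  \sum_(nu <- s) b (g nu) (g nu).
Proof.
move=> bb us Hg; have [qs ql] := vform_bilinear pi oD bb; have hV := subspace_V pi oD.
have Vt nu : V D pi (ptensor (g nu) nu) by exact: ptensor_V.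
have S1 (r : seq midx) : V D pi (\sum_(nu <- r) ptensor (g nu) nu).
  exact: (subspace_sum1 hV (fun nu _ => Vt nu)).
have L u (r : seq midx) : V D pi u ->
    vform pi b u (\sum_(nu <- r) ptensor (g nu) nu) = \sum_(nu <- r) vform pi b u (ptensor (g nu) nu).
  by move=> Vu; exact: (linear_on_sum1 hV (ql u Vu) (fun nu _ => Vt nu)).
rewrite (L _ s (S1 s)) big_seq [RHS]big_seq; apply: eq_bigr => nu nus.
rewrite (qs _ _ (S1 s) (Vt nu)) (L _ s (Vt nu)) (bigD1_seq nu) //=.
rewrite (vform_ptensor nu nu bb (Hg nu) (Hg nu)) eqxx mul1r big1 ?addr0 // => nu' nn.
by rewrite (vform_ptensor nu nu' bb (Hg nu) (Hg nu')) eq_sym (negbTE nn) mul0r.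
Qed.

Lemma ptensor_tensor Z I z nu : (forall z, Z z -> H10 D z) -> Z 0 -> nu \in I -> Z z ->
  tensor D pi P Z I (ptensor z nu).
Proof.
move=> ZH Z0 nuI Zz; split; first exact/ptensor_V/ZH.
exists (fun k => if k == nu then z else 0); split; first by move=> k _; case: ifP.
apply: aeW => y _; apply: aeW => x _.
rewrite (bigD1_seq nu) ?fset_uniq //= eqxx big1 ?addr0.
  by rewrite -elem_tensorE.
by move=> k /negbTE ->; rewrite elem_tensorE ptensor0.
Qed.

Lemma tensor0 Z I : Z 0 -> tensor D pi P Z I 0.
Proof.
move=> Z0; split; first exact: (subspace0 (subspace_V pi oD)).
exists (fun=> 0); split=> //; apply: aeW => y _; apply: aeW => x _.
by rewrite big1 // => k _; rewrite elem_tensorE ptensor0.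
Qed.

Lemma tensor_same Z I v : (forall z, Z z -> H10 D z) -> Z 0 -> tensor D pi P Z I v ->
  exists g : midx -> fn, (forall nu, Z (g nu)) /\
    same_class D pi v (\sum_(nu <- I) ptensor (g nu) nu).
Proof.
move=> ZH Z0 [Vv [z [Zz vE]]]; exists (fun nu => if nu \in I then z nu else 0); split.
  by move=> nu; case: ifP => // /Zz.
apply: aeS vE => y h Gy; apply: aeS (h Gy) => x h' Dx; rewrite (h' Dx) sum_apply.
by rewrite big_seq [RHS]big_seq; apply: eq_bigr => nu nuI; rewrite nuI elem_tensorE.
Qed.
End Tensors.

Section Residual.
Context (R : realType).
Notation fn := (R * R -> R).
Notation fn2 := (param R -> R * R -> R).
Notation mu2 := (@leb2 R).

(** The square root vanishes where [a0] is negative, which happens on a null set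
    only. *)
Lemma L2norm_energy (D : set (R * R)) (a0 z : fn) : open D -> ess_bounded mu2 D a0 ->
  {ae mu2, forall x, D x -> 0 <= a0 x} -> H1 D z ->
  L2norm D (fun x => Num.sqrt (a0 x) *: grad D z x) ^+ 2 = eform D a0 z z.
Proof.
move=> oD ba a0p Hz; rewrite /L2norm sqr_sqrtr; last first.
  by apply: Rintegral_ge0 => x _; exact: edot_ge0.
pose h x := (a0 x + `|a0 x|) / 2 * edot (grad D z x) (grad D z x).
have -> : \int[mu2]_(x in D) edot (Num.sqrt (a0 x) *: grad D z x) (Num.sqrt (a0 x) *: grad D z x) =
    \int[mu2]_(x in D) h x.
  apply: eq_Rintegral => x _; rewrite edotZr edotC edotZr mulrA -expr2 /h.
  congr (_ * _); have [h0|h0] := leP 0 (a0 x).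
    by rewrite sqr_sqrtr // ger0_norm //; lra.
  by rewrite ler0_sqrtr ?ltW // ltr0_norm // subrr expr0n mul0r.
have ie := eform_integrable oD ba Hz Hz; have mD := measurable_open2 oD.
have me := (measurable_EFinP _ _).1 (measurable_int _ ie).
have ma : measurable_fun D (fun x => (a0 x + `|a0 x|) / 2).
  apply: measurable_funM => //; apply: measurable_funD; first exact: ba.1.
  by apply: measurableT_comp => //; exact: ba.1.
have i1 := (eform_integrable oD (ess_bounded1 oD) Hz Hz).
have m1 := (measurable_EFinP _ _).1 (measurable_int _ i1).
have mh : measurable_fun D h.
  have := measurable_funM ma m1; apply: eq_measurable_fun => x _.
  by rewrite /= mul1r.
rewrite eformE; apply: (ae_eq_Rintegral mD mh me); apply: aeS a0p => x hx /hx h0.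
rewrite /h ger0_norm //; congr (_ * _); lra.
Qed.

(** Divide by [m] in the bound of its square. *)
Lemma lower_arith (m q K tau lam : R) : 0 <= m -> 0 <= q -> 1 <= K -> 0 <= tau ->
  0 <= lam -> lam * (1 + tau) <= 1 -> m ^+ 2 <= q * ((1 + tau) * (K * m)) ->
  lam / K * m <= q.
Proof.
move=> m0 q0 K1 t0 l0 l1 h; have K0 : 0 < K by lra.
have [->|mn] := eqVneq m 0; first by rewrite mulr0.
have mp : 0 < m by rewrite lt0r mn.
have h1 : m <= q * ((1 + tau) * K).
  by rewrite -(ler_pM2r mp) -expr2 -mulrA -(mulrA _ K).
rewrite mulrAC ler_pdivrMr //.
apply: le_trans (ler_wpM2l l0 h1) _.
rewrite (_ : lam * _ = (lam * (1 + tau)) * (q * K)); last by ring.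
by rewrite ler_piMl // mulr_ge0 // ltW.
Qed.

Lemma equivalence_arith (amin amax tau K C m p q r : R) :
  0 < amin -> amin <= amax -> 0 <= tau -> tau < 1 -> 1 <= K -> 1 <= C -> 0 <= m ->
  0 <= p -> 0 <= q -> 0 <= r -> m ^+ 2 <= q ^+ 2 * ((1 + tau) * (K * m)) ->
  q ^+ 2 <= C / (1 - tau) * m -> r ^+ 2 = p ^+ 2 + q ^+ 2 ->
  let lambda := amin / (amax * (1 + tau)) in let Lambda := amax / (amin * (1 - tau)) in
  (lambda / K * m <= q ^+ 2 /\ q ^+ 2 <= Lambda * C * m) /\
  (forall beta : R, 0 <= beta < 1 -> p <= beta * r ->
    lambda / K * m <= r ^+ 2 /\ r ^+ 2 <= Lambda * C / (1 - beta ^+ 2) * m).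
Proof.
move=> a0 aM t0 t1 K1 C1 m0 p0 q0 r0 lower upper pyth lambda Lambda.
have aM0 : 0 < amax := lt_le_trans a0 aM.
have t2 : 0 < 1 + tau by lra.
have t3 : 0 < 1 - tau by lra.
have C0 : 0 < C := lt_le_trans ltr01 C1.
have lt : lambda * (1 + tau) = amin / amax.
  by rewrite /lambda invfM mulrA divfK // gt_eqF.
have low : lambda / K * m <= q ^+ 2.
  apply: (lower_arith m0 (sqr_ge0 q) K1 t0 _ _ lower).
    by rewrite divr_ge0 ?mulr_ge0 // ltW.
  by rewrite lt ler_pdivrMr // mul1r.
have LE : (1 - tau)^-1 <= Lambda.
  rewrite /Lambda invfM mulrA -[leLHS]mul1r ler_wpM2r ?invr_ge0 ?(ltW t3) //.
  by rewrite ler_pdivlMr // mul1r.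
have up : q ^+ 2 <= Lambda * C * m.
  apply: le_trans upper _; apply: (ler_wpM2r m0); rewrite mulrC.
  exact: (ler_wpM2r (ltW C0) LE).
split=> [//|beta /andP[b0 b1] hp].
have b2 : 0 < 1 - beta ^+ 2 by rewrite subr_gt0 expr_lt1.
have hp2 : p ^+ 2 <= beta ^+ 2 * r ^+ 2.
  by rewrite -exprMn ler_pXn2r ?nnegrE // mulr_ge0.
split; first by rewrite pyth (le_trans low) // lerDr sqr_ge0.
rewrite mulrAC ler_pdivlMr //; apply: le_trans up.
by rewrite mulrBr mulr1 mulrC lerBlDr; move: hp2; rewrite pyth; lra.
Qed.

(** The choice [s = c^-1] lets half of [q] absorb the term in [A]. *)
Lemma upper_arith (m q A c : R) : 0 < c -> A <= c * q ->
  (forall s, 0 < s -> 2 * q <= s * A + s^-1 * m) -> q <= c * m.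
Proof.
move=> c0 Aq /(_ c^-1); rewrite invr_gt0 invrK => /(_ c0) h.
have : c^-1 * A <= q by rewrite mulrC ler_pdivrMr // mulrC.
lra.
Qed.

(** Young's inequality with weight [s * E]. If [E = 0] then [b = 0] and the
    quotient is zero by the convention on division. *)
Lemma amgm (a b s E : R) : 0 < s -> 0 <= E -> (E = 0 -> b = 0) ->
  2 * (a * b) <= s * (a ^+ 2 * E) + s^-1 * (b ^+ 2 / E).
Proof.
move=> s0 E0 Eb; have [E1|E1] := eqVneq E 0; first by rewrite (Eb E1) E1 invr0 !mulr0 addr0.
have Ep : 0 < E by rewrite lt0r E1.
have sE : 0 < s * E by rewrite mulr_gt0.
have -> : s * (a ^+ 2 * E) + s^-1 * (b ^+ 2 / E) = (s * E) * a ^+ 2 + b ^+ 2 / (s * E).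
  by field; rewrite gt_eqF // gt_eqF.
rewrite -subr_ge0 (_ : _ - _ = (s * E * a - b) ^+ 2 / (s * E)).
  by rewrite divr_ge0 ?sqr_ge0 // ltW.
by field; rewrite gt_eqF // gt_eqF.
Qed.

Lemma scale_div (c t p q : R) : 0 < c -> 0 < t -> t * p <= q -> c * p <= c / t * q.
Proof. by move=> c0 t0 h; rewrite mulrAC ler_pdivlMr // -mulrA ler_pM2l // mulrC. Qed.

Lemma le_scale (c p : R) : 1 <= c -> 0 <= p -> p <= c * p.
Proof. by move=> c1 p0; rewrite ler_peMl. Qed.

Lemma weighted_add (s t a b a' b' a'' b'' : R) : 2 * a <= s * a' + t * a'' ->
  2 * b <= s * b' + t * b'' -> 2 * (a + b) <= s * (a' + b') + t * (a'' + b'').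
Proof. by move=> h h'; have := lerD h h'; rewrite !mulrDr; lra. Qed.

Lemma weighted_sum (I : eqType) (r : seq I) (s t : R) (a a' a'' : I -> R) :
  (forall i, i \in r -> 2 * a i <= s * a' i + t * a'' i) ->
  2 * (\sum_(i <- r) a i) <= s * (\sum_(i <- r) a' i) + t * (\sum_(i <- r) a'' i).
Proof.
move=> h; rewrite !mulr_sumr -big_split [leLHS]big_seq [leRHS]big_seq.
by apply: ler_sum => i /h.
Qed.

Lemma cauchy_amgm (t u v s : R) : 0 < s -> 0 <= u -> 0 <= v -> t ^+ 2 <= u * v ->
  2 * t <= s * v + s^-1 * u.
Proof.
move=> s0 u0 v0 h; have r0 : 0 <= s * v + s^-1 * u.
  by rewrite addr_ge0 // mulr_ge0 // ?invr_ge0 ltW.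
apply: le_trans (ler_norm _) _; rewrite -(@ler_pXn2r _ 2) ?nnegrE //.
rewrite real_normK ?num_real //.
have -> : (s * v + s^-1 * u) ^+ 2 = (s * v - s^-1 * u) ^+ 2 + 4 * (u * v).
  by field; rewrite gt_eqF.
by have := sqr_ge0 (s * v - s^-1 * u); rewrite exprMn; lra.
Qed.

Context (D : set (R * R)) (a0 : fn) (a : nat -> fn) (a0min a0max tau : R)
  (pi_ : nat -> probability (measurableTypeR R) R) (pi : probability (param R) R)
  (P : nat -> nat -> {poly R}) (f : fn -> R).
Hypothesis oD : open D.
Hypothesis bD : bounded_set D.
Hypothesis LD : lipschitz_boundary D.
Hypothesis La0 : Linfty D a0.
Hypothesis a0min0 : 0 < a0min.
Hypothesis a0b : {ae mu2, forall x, D x -> a0min <= a0 x <= a0max}.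
Hypothesis La : forall m, Linfty D (a m).
Hypothesis tauE : (tau%:E = a0min^-1%:E * \sum_(0 <= m <oo) Linfty_norm D (a m))%E.
Hypothesis tau1 : tau < 1.
Hypothesis piE : product_measure pi_ pi.
Hypothesis pi1 : forall m, pi_ m `[(-1)%R, 1%R]%classic = 1%E.
Hypothesis PE : forall m, orthonormal_polynomials (pi_ m) (P m).
Hypothesis bf : bounded_functional D f.

Let En := eform D a0.
Let Bf := B D pi a0 a.
Let hV := subspace_V pi oD.
Let ba0 := a0_bounded oD La0.
Let bEn : bounded_form D En := eform_bounded oD ba0.
Let hB : sym_bilinear_on (V D pi) Bf := @B_bilinear R D pi oD a0 a a0min tau a0min0 La0 La tauE.
Let hBp : psd_on (V D pi) Bf := @B_psd R D pi oD a0 a a0min a0max tau a0min0 La0 a0b La tauE tau1.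
Let pt := ptensor P.
Let Vpt z nu : H10 D z -> V D pi (pt z nu) := fun Hz => ptensor_V pi P oD nu Hz.

Context (rule : seq {fset {fset (R * R)}}) (M M' : {fset {fset (R * R)}})
  (n : nat) (xi : 'I_n -> R * R) (phi : 'I_n -> fn) (K C : R) (I J : {fset midx})
  (uXP uhat : fn2) (e : midx -> fn2).
Hypothesis tM : triangulation (closure D) M.
Hypothesis tM' : triangulation (closure D) M'.
Hypothesis uM : uniform_refinement rule M M'.
Hypothesis vert : forall T, T \in M -> forall x, x \in T -> exists2 S, S \in M' & x \in S.
Hypothesis hat : hat_functions D M M' xi phi.
Hypothesis K1 : 1 <= K.
Hypothesis hK : overlap_bound D M phi K.
Hypothesis C1' : 1 <= C.
Hypothesis hC : forall z x, S10 D M' z -> S10 D M x ->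
  (forall p, interior_vertices D M p -> z p = x p) ->
  \sum_j (z (xi j) - x (xi j)) ^+ 2 * En (phi j) (phi j) <= C * En z z.
Hypothesis JI : forall nu, nu \in J -> nu \notin I.
Hypothesis gX : galerkin D pi a0 a f (tensor D pi P (S10 D M) I) uXP.
Hypothesis gh : galerkin D pi a0 a f (enriched_space D pi P M M' I J) uhat.
Hypothesis he : index_estimators D pi a0 a f P (S10 D M) J uXP e.

Let X := S10 D M.
Let Y := detail_space D M M'.
Let d : fn2 := uhat - uXP.
Let res (v : fn2) : R := F pi f v - Bf uXP v.

Let hX : subspace X := subspace_S10 M oD.
Let XH z : X z -> H10 D z := fun h => h.1.
Let YH z : Y z -> H10 D z := fun h => h.1.1.
Let X0 : X 0 := hX.1.

Let Y0 : Y 0.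
Proof. by split; [exact: (subspace_S10 M' oD).1|]. Qed.

Let VX : V D pi uXP := gX.1.1.

Let enr v1 v2 v3 : tensor D pi P X I v1 -> tensor D pi P Y I v2 -> tensor D pi P X J v3 ->
  enriched_space D pi P M M' I J (v1 + v2 + v3).
Proof. by move=> h1 h2 h3; exists v1, v2, v3. Qed.

Let t0X : tensor D pi P X I 0 := @tensor0 R D pi P oD X I X0.
Let t0Y : tensor D pi P Y I 0 := @tensor0 R D pi P oD Y I Y0.
Let t0J : tensor D pi P X J 0 := @tensor0 R D pi P oD X J X0.

Let enrX v : tensor D pi P X I v -> enriched_space D pi P M M' I J v.
Proof. by move=> h; have := enr h t0Y t0J; rewrite !addr0. Qed.

Let enrY v : tensor D pi P Y I v -> enriched_space D pi P M M' I J v.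
Proof. by move=> h; have := enr t0X h t0J; rewrite add0r addr0. Qed.

Let enrJ v : tensor D pi P X J v -> enriched_space D pi P M M' I J v.
Proof. by move=> h; have := enr t0X t0Y h; rewrite !add0r. Qed.

Let enrV v : enriched_space D pi P M M' I J v -> V D pi v.
Proof.
move=> [v1 [v2 [v3 [[h1 _] [h2 _] [h3 _] ->]]]].
exact: (subspaceD hV (subspaceD hV h1 h2) h3).
Qed.

Let Vh : V D pi uhat := enrV gh.1.
Let Vd : V D pi d := subspaceB hV Vh VX.

Let resE v : enriched_space D pi P M M' I J v -> res v = Bf d v.
Proof.
move=> hv; have Vv := enrV hv; rewrite /res -(gh.2 v hv) /d [RHS](hB.1 _ _ Vd Vv).
by rewrite (linear_onB hV (hB.2 v Vv) Vh VX) (hB.1 _ _ Vv Vh) (hB.1 _ _ Vv VX).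
Qed.

Let res_lin : linear_on (V D pi) res.
Proof.
move=> c v w Vv Vw.
have X1 (p q r s t u : R) : p = c * q + r -> s = c * t + u -> p - s = c * (q - t) + (r - u).
  by move=> -> ->; ring.
exact: (X1 _ _ _ _ _ _ (@F_linear R D pi oD f bf c v w Vv Vw) (hB.2 uXP VX c v w Vv Vw)).
Qed.

(** Galerkin orthogonality. *)
Lemma residual_coarse z nu : X z -> nu \in I -> res (pt z nu) = 0.
Proof.
move=> Xz nuI; have h := ptensor_tensor pi P oD XH X0 nuI Xz.
by rewrite /res -(gX.2 _ h) subrr.
Qed.

(** The elements of [X (x) P_nu] are known up to classes; a representative [g nu]
    of the spatial factor turns the defining equations into equations on the
    domain. *)
Lemma estimators_exist : exists g : midx -> fn, (forall nu, X (g nu)) /\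
  forall nu, nu \in J -> norm0 D pi a0 (e nu) ^+ 2 = En (g nu) (g nu) /\
    forall z, X z -> En (g nu) z = res (pt z nu).
Proof.
have ex nu : exists z, X z /\ (nu \in J -> norm0 D pi a0 (e nu) ^+ 2 = En z z /\
    forall z', X z' -> En z z' = res (pt z' nu)).
  have [nuJ|nJ] := boolP (nu \in J); last by exists 0; split.
  have [te ee] := he nuJ; have [g [Xg se]] := @tensor_same R D pi P X _ _ XH X0 te.
  exists (g nu); split; [exact: Xg|move=> _]; rewrite big_seq_fset1 in se.
  have Ve := te.1; have Vg := Vpt nu (XH (Xg nu)).
  have S0 w : V D pi w -> B0 D pi a0 (e nu) w = B0 D pi a0 (pt (g nu) nu) w.
    by move=> Vw; exact: (B0_same oD La0 Ve Vg Vw se).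
  have B0pt z' : X z' -> B0 D pi a0 (pt (g nu) nu) (pt z' nu) = En (g nu) z'.
    move=> Xz'; rewrite B0E (vform_ptensor oD piE pi1 PE nu nu bEn (XH (Xg nu)) (XH Xz')).
    by rewrite eqxx mul1r.
  split=> [|z' Xz'].
    have [sB0 _] := B0_bilinear pi oD La0.
    rewrite /norm0 sqr_sqrtr; last exact: (B0_psd oD a0min0 La0 a0b Ve).
    by rewrite (S0 _ Ve) (sB0 _ _ Vg Ve) (S0 _ Vg) B0pt.
  have := ee z' Xz'; rewrite elem_tensorE -/pt (S0 _ (Vpt nu (XH Xz'))) (B0pt z' Xz').
  exact.
have [g gP] := choice ex; exists g; split=> [nu|nu nuJ]; first by have [] := gP nu.
by have [_ /(_ nuJ)] := gP nu.
Qed.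

Lemma error_estimate_sq (g : midx -> fn) :
  (forall nu, nu \in J -> norm0 D pi a0 (e nu) ^+ 2 = En (g nu) (g nu)) ->
  error_estimate D pi a0 a f P I J phi uXP e ^+ 2 =
  \sum_(nu <- I) \sum_j res (pt (phi j) nu) ^+ 2 / En (phi j) (phi j) +
  \sum_(nu <- J) En (g nu) (g nu).
Proof.
move=> ge; have [_ _ Sphi _] := hat.
have a0p : {ae mu2, forall x, D x -> 0 <= a0 x}.
  by apply: aeS a0b => x h /h /andP[h1 _]; rewrite (le_trans (ltW a0min0)).
rewrite /error_estimate sqr_sqrtr; last first.
  apply: addr_ge0; apply: sumr_ge0 => nu _; last exact: sqr_ge0.
  by apply: sumr_ge0 => j _; rewrite divr_ge0 ?sqr_ge0.
congr (_ + _).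
  apply: eq_bigr => nu _; apply: eq_bigr => j _.
  rewrite (L2norm_energy oD ba0 a0p (Sphi j).1.1) elem_tensorE real_normK ?num_real //.
by rewrite big_seq [RHS]big_seq; apply: eq_bigr => nu /ge.
Qed.

Lemma norm_bounds v : V D pi v ->
  (1 - tau) * B0 D pi a0 v v <= Bf v v <= (1 + tau) * B0 D pi a0 v v.
Proof. exact: (@B_bounds R D pi oD a0 a a0min a0max tau a0min0 La0 a0b La tauE). Qed.

Let index_seq := (enum_fset I ++ enum_fset J).

Let uniq_seq : uniq index_seq.
Proof.
rewrite cat_uniq !fset_uniq /= andbT; apply/hasPn => nu nuJ; exact: JI.
Qed.

Let glue (g h : midx -> fn) nu := if nu \in I then g nu else h nu.

Let glue_sum (W : nmodType) (F1 : midx -> fn -> W) g h :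
  \sum_(nu <- index_seq) F1 nu (glue g h nu) =
  \sum_(nu <- I) F1 nu (g nu) + \sum_(nu <- J) F1 nu (h nu).
Proof.
rewrite big_cat /=; congr (_ + _); rewrite big_seq [RHS]big_seq; apply: eq_bigr => nu nuI.
  by rewrite /glue (_ : nu \in I).
by rewrite /glue (negbTE (JI nuI)).
Qed.

Let glue_B0 g h : (forall nu, H10 D (g nu)) -> (forall nu, H10 D (h nu)) ->
  let w := \sum_(nu <- I) pt (g nu) nu + \sum_(nu <- J) pt (h nu) nu in
  V D pi w /\ B0 D pi a0 w w = \sum_(nu <- I) En (g nu) (g nu) + \sum_(nu <- J) En (h nu) (h nu).
Proof.
move=> Hg Hh w; have Hgh nu : H10 D (glue g h nu) by rewrite /glue; case: ifP.
have wE : w = \sum_(nu <- index_seq) pt (glue g h nu) nu.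
  by rewrite (glue_sum (fun nu z => pt z nu)).
rewrite wE; split; first by apply: (subspace_sum1 hV) => nu _; exact: Vpt.
rewrite B0E (vform_ptensor_sum oD piE pi1 PE bEn uniq_seq Hgh).
exact: (glue_sum (fun nu z => En z z)).
Qed.

Let res_ptensor_sum (c : 'I_n -> R) nu :
  res (pt (\sum_j c j *: phi j) nu) = \sum_j c j * res (pt (phi j) nu).
Proof.
rewrite /pt ptensor_sum; apply: (linear_on_sum hV res_lin) => j _.
by apply: Vpt; exact: YH (hat_detail vert hat j).
Qed.

(** Testing the residual with the combination of the hat functions and of the
    [e nu] that appears in the estimate reproduces [mu ^+ 2]. *)
Lemma estimate_le : (error_estimate D pi a0 a f P I J phi uXP e ^+ 2) ^+ 2 <=
  Bf d d * ((1 + tau) * (K * error_estimate D pi a0 a f P I J phi uXP e ^+ 2)).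
Proof.
set m := error_estimate D pi a0 a f P I J phi uXP e ^+ 2; have [g [Xg gE]] := estimators_exist.
have mE := error_estimate_sq (fun nu h => (gE nu h).1); rewrite -/m in mE.
have Yphi := hat_detail vert hat; have Hphi j : H10 D (phi j) := YH (Yphi j).
have a0p : {ae mu2, forall x, D x -> 0 <= a0 x}.
  by apply: aeS a0b => x h /h /andP[h1 _]; rewrite (le_trans (ltW a0min0)).
(* For a hat function of zero energy both the coefficient and the corresponding
   term of the estimate are zero. *)
pose c nu j := res (pt (phi j) nu) / En (phi j) (phi j).
pose y nu := \sum_j c nu j *: phi j.
have Yy nu : Y (y nu).
  split; first by apply: (subspace_sum (subspace_S10 M' oD)) => j _; exact: (Yphi j).1.
  by move=> x ix; rewrite /y sum_scaleE big1 // => j _; rewrite (Yphi j).2 // mulr0.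
have [Vw wB0] := glue_B0 (fun nu => YH (Yy nu)) (fun nu => XH (Xg nu)).
set w := _ + _ in Vw wB0.
have VI nu : V D pi (pt (y nu) nu) by exact: Vpt (YH (Yy nu)).
have VJ nu : V D pi (pt (g nu) nu) by exact: Vpt (XH (Xg nu)).
have VsI := subspace_sum1 hV (r := enum_fset I) (fun nu _ => VI nu).
have VsJ := subspace_sum1 hV (r := enum_fset J) (fun nu _ => VJ nu).
have lin (b : fn2 -> R) : linear_on (V D pi) b ->
    b w = \sum_(nu <- I) b (pt (y nu) nu) + \sum_(nu <- J) b (pt (g nu) nu).
  move=> bl; rewrite (linear_onD bl VsI VsJ).
  by rewrite (linear_on_sum1 hV bl (fun nu _ => VI nu)) (linear_on_sum1 hV bl (fun nu _ => VJ nu)).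
have rw : Bf d w = m.
  rewrite (lin _ (hB.2 d Vd)) mE; congr (_ + _).
    rewrite big_seq [RHS]big_seq; apply: eq_bigr => nu nuI.
    rewrite -resE; last exact/enrY/(@ptensor_tensor R D pi P oD Y I _ _ YH Y0 nuI (Yy nu)).
    by rewrite /y res_ptensor_sum; apply: eq_bigr => j _; rewrite /c mulrAC -expr2.
  rewrite big_seq [RHS]big_seq; apply: eq_bigr => nu nuJ.
  rewrite -resE; last exact/enrJ/(@ptensor_tensor R D pi P oD X J _ _ XH X0 nuJ (Xg nu)).
  by rewrite (gE nu nuJ).2.
have wK : B0 D pi a0 w w <= K * m.
  rewrite wB0 mE mulrDr lerD //.
    rewrite mulr_sumr; apply: ler_sum => nu _.
    apply: le_trans (overlap_energy oD bD LD tM' uM hat (c nu) ba0 a0p hK) _.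
    rewrite ler_wpM2l ?(le_trans ler01) // ler_sum // => j _.
    have [E0|E0] := eqVneq (En (phi j) (phi j)) 0; first by rewrite -/En E0 mulr0 invr0 mulr0.
    by rewrite /c expr_div_n -mulrA [X in _ * X](_ : _ = (En (phi j) (phi j))^-1) // expr2 invfM -mulrA mulVf // mulr1.
  rewrite ler_peMl //; apply: sumr_ge0 => nu _.
  exact: (eform_a0_ge0 oD a0min0 La0 a0b (XH (Xg nu)).1).
have tau0 := tau_ge0 a0min0 tauE.
have /andP[_ wB] := norm_bounds Vw.
rewrite -[X in X ^+ 2]rw; apply: le_trans (form_cauchy_schwarz hV hB hBp Vd Vw) _.
rewrite ler_wpM2l ?hBp //; apply: le_trans wB _.
by rewrite ler_wpM2l // addr_ge0.
Qed.

Let same_expansion y nu : Y y ->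
  same_class D pi (pt y nu) (pt (\sum_j y (xi j) *: phi j) nu).
Proof.
move=> Yy; apply: aeW => p _; apply: aeW => x Dx.
change (Ppoly P nu p * y x = Ppoly P nu p * (\sum_j y (xi j) *: phi j) x).
by rewrite sum_scaleE -(detail_expansion oD bD LD tM' vert hat Yy (subset_closure Dx)).
Qed.

Let res_detail y nu : Y y -> nu \in I -> Bf d (pt y nu) = \sum_j y (xi j) * res (pt (phi j) nu).
Proof.
move=> Yy nuI; have Yphi := hat_detail vert hat.
have Ys : Y (\sum_j y (xi j) *: phi j).
  split; first by apply: (subspace_sum (subspace_S10 M' oD)) => j _; exact: (Yphi j).1.
  by move=> x ix; rewrite sum_scaleE big1 // => j _; rewrite (Yphi j).2 // mulr0.
have V1 := Vpt nu (YH Yy); have V2 := Vpt nu (YH Ys).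
have -> : Bf d (pt y nu) = Bf d (pt (\sum_j y (xi j) *: phi j) nu).
  rewrite (hB.1 _ _ Vd V1) (hB.1 _ _ Vd V2).
  exact: (@B_same R D pi oD a0 a a0min a0max tau a0min0 La0 a0b La tauE _ _ d tau1 V1 V2 Vd (same_expansion nu Yy)).
rewrite -resE; last exact/enrY/(@ptensor_tensor R D pi P oD Y I _ _ YH Y0 nuI Ys).
exact: res_ptensor_sum.
Qed.

(** The form [B] is dominated by [B0], so a function of zero energy is in the
    kernel of [B]. This covers the terms of the estimate whose denominator is zero. *)
Let res_null j nu : nu \in I -> En (phi j) (phi j) = 0 -> res (pt (phi j) nu) = 0.
Proof.
move=> nuI E0; have Yj := hat_detail vert hat j; have Vj := Vpt nu (YH Yj).
rewrite resE; last exact/enrY/(@ptensor_tensor R D pi P oD Y I _ _ YH Y0 nuI Yj).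
rewrite (hB.1 _ _ Vd Vj); apply: (form_null hV hB hBp Vj Vd).
have B00 : B0 D pi a0 (pt (phi j) nu) (pt (phi j) nu) = 0.
  by rewrite B0E (vform_ptensor oD piE pi1 PE nu nu bEn (YH Yj) (YH Yj)) -/En E0 mulr0.
have := norm_bounds Vj; rewrite B00 !mulr0 => h.
by apply/eqP; rewrite eq_le andbC.
Qed.

Let error_class : exists x y z : midx -> fn,
  [/\ forall nu, X (x nu), forall nu, Y (y nu), forall nu, X (z nu) &
    same_class D pi d (\sum_(nu <- I) pt (x nu + y nu) nu + \sum_(nu <- J) pt (z nu) nu)].
Proof.
have [v1 [v2 [v3 [t1 t2 t3 uE]]]] := gh.1.
have [z1 [X1 s1]] := @tensor_same R D pi P X _ _ XH X0 t1.
have [z2 [X2 s2]] := @tensor_same R D pi P Y _ _ YH Y0 t2.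
have [z3 [X3 s3]] := @tensor_same R D pi P X _ _ XH X0 t3.
have [z0 [X0' s0]] := @tensor_same R D pi P X _ _ XH X0 gX.1.
exists (fun nu => z1 nu - z0 nu), z2, z3; split; [|exact: X2|exact: X3|].
  by move=> nu; exact: (subspaceB hX (X1 nu) (X0' nu)).
have C3 (p q : param R -> Prop) : {ae pi, forall y, p y} -> {ae pi, forall y, q y} ->
    {ae pi, forall y, p y /\ q y} by apply: aeS2.
apply: aeS (C3 _ _ (C3 _ _ s1 s2) (C3 _ _ s3 s0)) => y [[h1 h2] [h3 h0]] Gy.
have C2 (p q : R * R -> Prop) : {ae mu2, forall x, p x} -> {ae mu2, forall x, q x} ->
    {ae mu2, forall x, p x /\ q x} by apply: aeS2.
apply: aeS (C2 _ _ (C2 _ _ (h1 Gy) (h2 Gy)) (C2 _ _ (h3 Gy) (h0 Gy))) => x [[e1 e2] [e3 e0]] Dx.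
have := e1 Dx; have := e2 Dx; have := e3 Dx; have := e0 Dx.
rewrite !sum_apply => {}e0 {}e3 {}e2 {}e1.
have -> : d y x = v1 y x + v2 y x + v3 y x - uXP y x by rewrite /d uE.
rewrite e1 e2 e3 e0.
change (\sum_(i <- I) pt (z1 i) i y x + \sum_(i <- I) pt (z2 i) i y x + \sum_(i <- J) pt (z3 i) i y x -
  \sum_(i <- I) pt (z0 i) i y x = (\sum_(nu <- I) pt (z1 nu - z0 nu + z2 nu) nu) y x +
  (\sum_(nu <- J) pt (z3 nu) nu) y x).
rewrite !sum_apply [LHS]addrAC; congr (_ + _).
rewrite -big_split -sumrB; apply: eq_bigr => nu _.
change (Ppoly P nu y * z1 nu x + Ppoly P nu y * z2 nu x - Ppoly P nu y * z0 nu x =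
  Ppoly P nu y * (z1 nu x - z0 nu x + z2 nu x)).
by ring.
Qed.

(** Expanding the residual of the error along hat functions and
    detail polynomials pairs the terms of the estimate with coefficients
    that the energy of the error controls. *)
Lemma error_le : Bf d d <= C / (1 - tau) * error_estimate D pi a0 a f P I J phi uXP e ^+ 2.
Proof.
set m := error_estimate D pi a0 a f P I J phi uXP e ^+ 2; have [g [Xg gE]] := estimators_exist.
have mE := error_estimate_sq (fun nu h => (gE nu h).1); rewrite -/m in mE.
have [x [y [z [Xx Yy Xz sd]]]] := error_class.
have Sh nu : S10 D M' (x nu + y nu).
  exact: (subspaceD (subspace_S10 M' oD) (S10_refine uM (Xx nu)) (Yy nu).1).
have Hh nu : H10 D (x nu + y nu) := (Sh nu).1.
have [Vw wB0] := glue_B0 Hh (fun nu => XH (Xz nu)).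
set w := _ + _ in Vw wB0 sd.
have VI nu : V D pi (pt (x nu + y nu) nu) by exact: Vpt (Hh nu).
have VJ nu : V D pi (pt (z nu) nu) by exact: Vpt (XH (Xz nu)).
have VsI := subspace_sum1 hV (r := enum_fset I) (fun nu _ => VI nu).
have VsJ := subspace_sum1 hV (r := enum_fset J) (fun nu _ => VJ nu).
have dd : Bf d d = Bf d w.
  rewrite -(hB.1 _ _ Vw Vd).
  exact: (@B_same R D pi oD a0 a a0min a0max tau a0min0 La0 a0b La tauE d w d tau1 Vd Vw Vd sd).
have d0 : B0 D pi a0 d d = B0 D pi a0 w w.
  have [sB0 _] := B0_bilinear pi oD La0.
  rewrite (B0_same oD La0 Vd Vw Vd sd) (sB0 _ _ Vw Vd).
  exact: (B0_same oD La0 Vd Vw Vw sd).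
pose A := \sum_(nu <- I) \sum_j y nu (xi j) ^+ 2 * En (phi j) (phi j) + \sum_(nu <- J) En (z nu) (z nu).
have Ez0 (v : fn) : H10 D v -> 0 <= En v v.
  by move=> Hv; exact: (eform_a0_ge0 oD a0min0 La0 a0b Hv.1).
have dE : Bf d d = \sum_(nu <- I) \sum_j y nu (xi j) * res (pt (phi j) nu) +
    \sum_(nu <- J) En (g nu) (z nu).
  have bl := hB.2 d Vd; rewrite dd (linear_onD bl VsI VsJ).
  rewrite (linear_on_sum1 hV bl (fun nu _ => VI nu)) (linear_on_sum1 hV bl (fun nu _ => VJ nu)).
  congr (_ + _); rewrite big_seq [RHS]big_seq; apply: eq_bigr => nu nuI.
    have Vx := Vpt nu (XH (Xx nu)); have Vy := Vpt nu (YH (Yy nu)).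
    rewrite /pt ptensorD (linear_onD bl Vx Vy) (res_detail (Yy nu) nuI) -resE.
      by rewrite (residual_coarse (Xx nu) nuI) add0r.
    exact/enrX/(@ptensor_tensor R D pi P oD X I _ _ XH X0 nuI (Xx nu)).
  rewrite -resE; last exact/enrJ/(@ptensor_tensor R D pi P oD X J _ _ XH X0 nuI (Xz nu)).
  by rewrite (gE nu nuI).2.
have t1 : 0 < 1 - tau by rewrite subr_gt0.
have C0 : 0 < C := lt_le_trans ltr01 C1'.
apply: (@upper_arith m (Bf d d) A _ (divr_gt0 C0 t1)).
  apply: (@le_trans _ _ (C * B0 D pi a0 d d)); last first.
    have /andP[h _] := norm_bounds Vd.
    exact: (scale_div C0 t1 h).
  rewrite d0 wB0 mulrDr; apply: lerD; last first.
    by apply: (le_scale C1'); apply: sumr_ge0 => nu _; exact: (Ez0 _ (XH (Xz nu))).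
  rewrite mulr_sumr; apply: ler_sum => nu _.
  have := hC (Sh nu) (Xx nu).
  under eq_bigr => j _.
    have -> : (x nu + y nu) (xi j) - x nu (xi j) = y nu (xi j).
      by change (x nu (xi j) + y nu (xi j) - x nu (xi j) = y nu (xi j)); ring.
    over.
  apply => p ip; change (x nu p + y nu p = x nu p).
  exact: etrans (congr1 (fun t => x nu p + t) ((Yy nu).2 p ip)) (addr0 _).
move=> s s0; rewrite dE mE; apply: weighted_add; apply: weighted_sum => nu nuI.
  apply: weighted_sum => j _.
  exact: (amgm _ s0 (Ez0 _ (YH (hat_detail vert hat j))) (res_null nuI)).
have Hg := XH (Xg nu); have Hz := XH (Xz nu).
apply: (cauchy_amgm s0 (Ez0 _ Hg) (Ez0 _ Hz)).
exact: (form_cauchy_schwarz (subspace_H10 oD) bEn.1 Ez0 Hg Hz).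
Qed.

(** The Galerkin error is orthogonal to both discrete solutions. *)
Lemma galerkin_pythagoras u : galerkin D pi a0 a f (V D pi) u ->
  Bf (u - uXP) (u - uXP) = Bf (u - uhat) (u - uhat) + Bf d d.
Proof.
move=> [Vu gu]; have Vuh := subspaceB hV Vu Vh.
have orth v : enriched_space D pi P M M' I J v -> Bf (u - uhat) v = 0.
  move=> ev; have Vv := enrV ev; rewrite (hB.1 _ _ Vuh Vv).
  rewrite (linear_onB hV (hB.2 v Vv) Vu Vh) (hB.1 _ _ Vv Vu) (hB.1 _ _ Vv Vh).
  by rewrite [Bf u v](gu v Vv) [Bf uhat v](gh.2 v ev) subrr.
have -> : u - uXP = (u - uhat) + d by rewrite /d addrA subrK.
rewrite (form_sqD hV hB Vuh Vd) [Bf (u - uhat) d](linear_onB hV (hB.2 _ Vuh) Vh VX).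
by rewrite (orth _ gh.1) (orth _ (enrX gX.1)) subrr mulr0 addr0.
Qed.

Lemma estimator_equivalence u (mu := error_estimate D pi a0 a f P I J phi uXP e)
    (lambda := a0min / (a0max * (1 + tau))) (Lambda := a0max / (a0min * (1 - tau))) :
  a0min <= a0max -> galerkin D pi a0 a f (V D pi) u ->
  (lambda / K * mu ^+ 2 <= normB D pi a0 a (uhat \- uXP) ^+ 2 /\
   normB D pi a0 a (uhat \- uXP) ^+ 2 <= Lambda * C * mu ^+ 2) /\
  (forall beta : R, 0 <= beta < 1 ->
    normB D pi a0 a (u \- uhat) <= beta * normB D pi a0 a (u \- uXP) ->
    lambda / K * mu ^+ 2 <= normB D pi a0 a (u \- uXP) ^+ 2 /\
    normB D pi a0 a (u \- uXP) ^+ 2 <= Lambda * C / (1 - beta ^+ 2) * mu ^+ 2).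
Proof.
move=> a0mM gu; have tau0 := tau_ge0 a0min0 tauE.
have nE v : V D pi v -> normB D pi a0 a v ^+ 2 = Bf v v.
  by move=> Vv; rewrite /normB sqr_sqrtr //; exact: hBp.
have Vu := gu.1.
have nd : normB D pi a0 a (uhat \- uXP) ^+ 2 = Bf d d := nE _ Vd.
have nu1 : normB D pi a0 a (u \- uXP) ^+ 2 = Bf (u - uXP) (u - uXP) := nE _ (subspaceB hV Vu VX).
have nu2 : normB D pi a0 a (u \- uhat) ^+ 2 = Bf (u - uhat) (u - uhat) := nE _ (subspaceB hV Vu Vh).
have pyth := galerkin_pythagoras gu; rewrite -nu1 -nu2 -nd in pyth.
have lower := estimate_le; rewrite -nd -/mu in lower.
have upper := error_le; rewrite -nd -/mu in upper.
have n0 v : 0 <= normB D pi a0 a v by exact: sqrtr_ge0.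
apply: (equivalence_arith a0min0 a0mM tau0 tau1 K1 C1' (sqr_ge0 mu) (n0 _) (n0 _) (n0 _) lower upper pyth).
Qed.
End Residual.

(** * The constant and the theorem *)

Lemma energy_scale (R : realType) (y E b e : R) : 0 <= y -> 0 <= e -> E <= b * e ->
  y * E <= `|b| * (y * e).
Proof.
move=> y0 e0 h; rewrite mulrCA ler_wpM2l //; apply: le_trans h _.
by rewrite ler_wpM2r // ler_norm.
Qed.

Section Constants.
Context (R : realType) (D : set (R * R)) (a0 : R * R -> R)
  (rule : seq {fset {fset (R * R)}}) (sigma : R).
Hypothesis oD : open D.
Hypothesis bD : bounded_set D.
Hypothesis LD : lipschitz_boundary D.
Hypothesis La0 : Linfty D a0.
Hypothesis rule_ok : refinement_rule rule.

Lemma refined_vertices M M' T x : uniform_refinement rule M M' -> T \in M -> x \in T ->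
  exists2 S : {fset (R * R)}, S \in M' & x \in S.
Proof.
move=> uM TM xT; have [N [k [_ H]]] := refinement_constants rule_ok.
by have [_ _ _ h] := H M M' uM T TM; exact: h.
Qed.

(** The constant uses fixed bounds of the mean field, so that it does not
    depend on the bounds given later. *)
Lemma detail_constant : exists2 C : R, 1 <= C & forall (alpha beta : R) M M' n
    (xi : 'I_n -> R * R) (phi : 'I_n -> R * R -> R) (z x : R * R -> R),
  0 < alpha -> {ae @leb2 R, forall x, D x -> alpha <= a0 x <= beta} ->
  triangulation (closure D) M -> triangulation (closure D) M' ->
  uniform_refinement rule M M' -> shape_regularity M' <= sigma ->
  hat_functions D M M' xi phi -> S10 D M' z -> S10 D M x ->
  (forall p, interior_vertices D M p -> z p = x p) ->
  \sum_j (z (xi j) - x (xi j)) ^+ 2 * eform D a0 (phi j) (phi j) <= C * eform D a0 z z.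
Proof.
have [N [k [k0 ref]]] := refinement_constants rule_ok.
have [[al [be [al0 alb]]]|nab] := pselect (exists al be : R, 0 < al /\
    {ae @leb2 R, forall x, D x -> al <= a0 x <= be}); last first.
  (* Without any bounds of the mean field the claim is void. *)
  exists 1 => // alpha beta M M' n xi phi z x h1 h2.
  by exfalso; apply: nab; exists alpha, beta.
pose C := 48 * sigma ^+ 4 * k ^+ 2 * N%:R.
exists (Num.max 1 (`|be| * C / al)); first by rewrite le_max lexx.
move=> _ _ M M' n xi phi z x _ _ tM tM' uM sM' hat Sz Sx zx.
have Hz : H1 D z := Sz.1.1.
have [_ _ Sphi _] := hat; have E1 := eform_a0_ge oD La0 alb Hz.
have E0 := eform_a0_ge0 oD al0 La0 alb Hz.
have C0 : 0 <= C.
  have s4 : 0 <= sigma ^+ 4 by rewrite (exprM sigma 2 2) sqr_ge0.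
  by rewrite /C (mulr_ge0 (mulr_ge0 (mulr_ge0 _ s4) (sqr_ge0 k))).
apply: (@le_trans _ _ (`|be| * C / al * eform D a0 z z)); last first.
  by rewrite ler_wpM2r // le_max lexx orbT.
apply: (@le_trans _ _ (`|be| * (C * eform D (fun=> 1) z z))); last first.
  rewrite mulrA -[leRHS]mulrA; apply: ler_wpM2l; first by rewrite mulr_ge0.
  by rewrite ler_pdivlMl.
have h := detail_estimate oD bD LD tM tM' uM sM' k0 (ref M M' uM) hat Sz Sx zx.
apply: le_trans (ler_wpM2l (normr_ge0 be) h); rewrite mulr_sumr; apply: ler_sum => j _.
exact: (energy_scale (sqr_ge0 _) (eform1_ge0 D (phi j)) (eform_a0_le oD La0 alb (Sphi j).1.1)).
Qed.
End Constants.

Lemma detail_indices_notin (I : {fset midx}) Mbar nu : nu \in detail_indices I Mbar -> nu \notin I.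
Proof.
rewrite /detail_indices; set S := [set mu | _].
have [fS|nS] := pselect (finite_set S); first by rewrite in_fset_set // inE => -[].
by rewrite /fset_set; case: pselect => // _; rewrite inE.
Qed.

Theorem theorem3p1 (R : realType) (D : set (R * R)) (a0 : R * R -> R)
    (rule : seq {fset {fset (R * R)}}) (sigma : R)
    (D_domain : polygonal_domain D)
    (a0_Linfty : Linfty D a0)
    (rule_ok : refinement_rule rule) :
  exists2 Cthm : R, 1 <= Cthm &
  forall
    (a : nat -> R * R -> R) (a0min a0max tau : R)
    (pi_ : nat -> probability (measurableTypeR R) R)
    (pi : probability (param R) R)
    (P : nat -> nat -> {poly R})
    (f : (R * R -> R) -> R)
    (T T' : {fset {fset (R * R)}})
    (n : nat) (xi : 'I_n -> R * R) (phi : 'I_n -> R * R -> R) (K : R)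
    (I : {fset midx}) (Mbar : nat)
    (u uXP uhat : param R -> R * R -> R)
    (e : midx -> param R -> R * R -> R),
  let J := detail_indices I Mbar in
  let X := S10 D T in
  let lambda := a0min / (a0max * (1 + tau)) in
  let Lambda := a0max / (a0min * (1 - tau)) in
  let mu := error_estimate D pi a0 a f P I J phi uXP e in
  0 < a0min -> a0min <= a0max ->
  {ae @leb2 R, forall x, D x -> a0min <= a0 x <= a0max} ->
  (forall m, Linfty D (a m)) ->
  (tau%:E = a0min^-1%:E * \sum_(0 <= m <oo) Linfty_norm D (a m))%E ->
  tau < 1 ->
  (forall m, admissible_marginal (pi_ m)) ->
  product_measure pi_ pi ->
  (forall m, orthonormal_polynomials (pi_ m) (P m)) ->
  Hm1 D f ->
  triangulation (closure D) T ->
  triangulation (closure D) T' ->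
  uniform_refinement rule T T' ->
  shape_regularity T <= sigma -> shape_regularity T' <= sigma ->
  hat_functions D T T' xi phi ->
  1 <= K -> overlap_bound D T phi K ->
  midx0 \in I -> (0 < Mbar)%N ->
  galerkin D pi a0 a f (V D pi) u ->
  galerkin D pi a0 a f (tensor D pi P X I) uXP ->
  galerkin D pi a0 a f (enriched_space D pi P T T' I J) uhat ->
  index_estimators D pi a0 a f P X J uXP e ->
  (lambda / K * mu ^+ 2 <= normB D pi a0 a (uhat \- uXP) ^+ 2 /\
   normB D pi a0 a (uhat \- uXP) ^+ 2 <= Lambda * Cthm * mu ^+ 2) /\
  (forall beta : R, 0 <= beta < 1 ->
    normB D pi a0 a (u \- uhat) <= beta * normB D pi a0 a (u \- uXP) ->
    lambda / K * mu ^+ 2 <= normB D pi a0 a (u \- uXP) ^+ 2 /\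
    normB D pi a0 a (u \- uXP) ^+ 2
      <= Lambda * Cthm / (1 - beta ^+ 2) * mu ^+ 2).
Proof.
have [oD _ _ bD [LD _]] := D_domain.
have [C C1 hC] := detail_constant sigma oD bD LD a0_Linfty rule_ok.
exists C => // a a0min a0max tau pi_ pi P f T T' n xi phi K I Mbar u uXP uhat e.
move=> J X lambda Lambda mu a0min0 a0mM a0b La tauE tau1 adm piE PE Hf tT tT' uT _ sT'.
move=> hat K1 hK _ _ gu gX gh he.
have bf : bounded_functional D f.
  by case: Hf => fl fb; split; [move=> c v w Hv Hw; exact: fl|exact: fb].
have pi1 m : pi_ m `[(-1)%R, 1%R]%classic = 1%E by have [] := adm m.
have vert S (ST : S \in T) x (xS : x \in S) := refined_vertices rule_ok uT ST xS.
have hC' z x (Sz : S10 D T' z) (Sx : S10 D T x) (zx : forall p, interior_vertices D T p -> z p = x p) :=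
  hC _ _ T T' n xi phi z x a0min0 a0b tT tT' uT sT' hat Sz Sx zx.
exact: (estimator_equivalence oD bD LD a0_Linfty a0min0 a0b La tauE tau1 piE pi1 PE bf
  tT' uT vert hat K1 hK C1 hC' (@detail_indices_notin I Mbar) gX gh he a0mM gu).
Qed.
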